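(* Let $p,q,\tilde p,\tilde q\in\mathbb R_{>0}$, and let $\mathbb F_{p,q},\mathbb F_{\tilde p,\tilde q}\subset\mathbb C\times\mathbb C$ be the generalized Hartogs triangles with $n=m=1$. (a) There exists a proper holomorphic mapping $\mathbb F_{p,q}\to\mathbb F_{\tilde p,\tilde q}$ if and only if there exist $k,l\in\mathbb N$ such that $$\frac{l\tilde q}{\tilde p}-\frac{kq}{p}\in\mathbb Z.$$ (b) A mapping $F:\mathbb F_{p,q}\to\mathbb F_{\tilde p,\tilde q}$ is proper and holomorphic if and only if $$F(z,w)=\begin{cases}\left(\zeta z^kw^{l\tilde q/\tilde p-kq/p},\ \xi w^l\right), & \text{if } q/p\notin\mathbb Q,\\[2mm] \left(\zeta z^{k'}w^{l\tilde q/\tilde p-k'q/p}\,B\!\left(z^{p'}w^{-q'}\right),\ \xi w^l\right), & \text{if } q/p\in\mathbb Q,\end{cases}\qquad (z,w)\in\mathbb F_{p,q},$$ where $\zeta,\xi\in\mathbb T$, $k,l\in\mathbb N$, $k'\in\mathbb N\cup\{0\}$ are such that $l\tilde q/\tilde p-kq/p\in\mathbb Z$ (first case), $l\tilde q/\tilde p-k'q/p\in\mathbb Z$ (second case), and, in the second case, $p',q'\in\mathbb N$ are relatively prime with $p/q=p'/q'$, and $B$ is a finite Blaschke product non-vanishing at $0$ (if $B\equiv1$, then $k'>0$). In particular, there are non-trivial proper holomorphic self-mappings of $\mathbb F_{p,q}$ (i.e. ones that are not automorphisms). (c) $F\in\operatorname{Aut}(\mathbb F_{p,q})$ if and only if $$F(z,w)=\left(w^{q/p}\phi\left(zw^{-q/p}\right),\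 \xi w\right),\qquad (z,w)\in\mathbb F_{p,q},$$ where $\xi\in\mathbb T$ and $\phi\in\operatorname{Aut}(\mathbb D)$ (moreover, $\phi(0)=0$ whenever $q/p\notin\mathbb N$).
   Context: $\mathbb N$ denotes the positive integers, $\mathbb D$ the open unit disc in $\mathbb C$ and $\mathbb T$ the unit circle. For $p\in\mathbb R_{>0}^n$, $q\in\mathbb R_{>0}^m$ the generalized Hartogs triangle is $$\mathbb F_{p,q}:=\Big\{(z,w)\in\mathbb C^n\times\mathbb C^m:\sum_{j=1}^n|z_j|^{2p_j}<\sum_{j=1}^m|w_j|^{2q_j}<1\Big\};$$ for $n=m=1$ this is $\{(z,w)\in\mathbb C^2:|z|^{2p}<|w|^{2q}<1\}$, so $w\neq0$ on it. $\operatorname{Aut}(D)$ is the group of holomorphic automorphisms (biholomorphic self-maps) of $D$. A finite Blaschke product is a finite, possibly empty, product of factors $t\mapsto (t-a)/(1-\bar a t)$ with $a\in\mathbb D$ (the empty product is $\equiv1$; unimodular constants are absorbed in $\zeta$). In (c), if $q/p\notin\mathbb N$, then $\phi(t)=\zeta t$ with $\zeta\in\mathbb T$, and $w^{q/p}\phi(zw^{-q/p})$ means $\zeta z$. *)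

(* Defs.v *)
From Stdlib Require Import Reals Qreals ZArith List.
From Coquelicot Require Import Coquelicot.

(* Maps between subsets are represented by total functions on the ambient
   space; for open subsets, the notions below only depend on the values there. *)

Definition maps_to {S T : Type} (D : S -> Prop) (E : T -> Prop) (F : S -> T) : Prop :=
  forall x, D x -> E (F x).

Definition compact_set {T : UniformSpace} (K : T -> Prop) : Prop :=
  forall cov : (T -> Prop) -> Prop,
    (forall V, cov V -> open V) ->
    (forall x, K x -> exists V, cov V /\ V x) ->
    exists l : list (T -> Prop),
      (forall V, In V l -> cov V) /\
      (forall x, K x -> exists V, In V l /\ V x).

(* Fréchet differentiability over the field C: the differential provided by
   [ex_filterdiff] is C-linear because the scalar ring is [C_AbsRing]. *)
Definition holomorphic_on {U V : NormedModule C_AbsRing} (D : U -> Prop) (F : U -> V) : Prop :=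
  forall x, D x -> ex_filterdiff F (locally x).

Definition proper_map {S T : UniformSpace} (D : S -> Prop) (E : T -> Prop) (F : S -> T) : Prop :=
  forall K : T -> Prop,
    (forall y, K y -> E y) -> compact_set K -> compact_set (fun x => D x /\ K (F x)).

Definition proper_holomorphic {U V : NormedModule C_AbsRing}
    (D : U -> Prop) (E : V -> Prop) (F : U -> V) : Prop :=
  maps_to D E F /\ holomorphic_on D F /\ proper_map D E F.

Definition automorphism {U : NormedModule C_AbsRing} (D : U -> Prop) (F : U -> U) : Prop :=
  maps_to D D F /\ holomorphic_on D F /\
  exists G : U -> U,
    maps_to D D G /\ holomorphic_on D G /\
    (forall x, D x -> G (F x) = x) /\ (forall x, D x -> F (G x) = x).

(* [Rpower 0 s = 1] in the standard library, whereas 0 ^ s = 0 for s > 0. *)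
Definition rpow (x s : R) : R := if Req_EM_T x 0 then 0%R else Rpower x s.

Definition Cpowz (z : C) (m : Z) : C :=
  match m with
  | Z0 => RtoC 1
  | Zpos n => Cpow z (Pos.to_nat n)
  | Zneg n => Cinv (Cpow z (Pos.to_nat n))
  end.

Definition unit_disc (t : C_NormedModule) : Prop := (Cmod t < 1)%R.

Definition unit_circle (t : C) : Prop := Cmod t = 1%R.

Definition C2 : NormedModule C_AbsRing :=
  prod_NormedModule C_AbsRing C_NormedModule C_NormedModule.

Definition hartogs (p q : R) (x : C2) : Prop :=
  (rpow (Cmod (fst x)) (2 * p) < rpow (Cmod (snd x)) (2 * q) < 1)%R.

Definition is_rational (x : R) : Prop := exists r : Q, x = Q2R r.

Definition is_positive_integer (x : R) : Prop := exists N : nat, (0 < N)%nat /\ x = INR N.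

Definition blaschke_factor (a t : C) : C := ((t - a) / (1 - Cconj a * t))%C.

Definition finite_blaschke (B : C -> C) : Prop :=
  exists l : list C,
    (forall a, In a l -> unit_disc a) /\
    (forall t, unit_disc t -> B t = fold_right (fun a b => (blaschke_factor a t * b)%C) (RtoC 1) l).

(* Main.v *)
Require Import Defs.
From Stdlib Require Import Reals Qreals ZArith List Lra Lia Classical ClassicalEpsilon FinFun.
From Stdlib Require Import FunctionalExtensionality PropExtensionality.
From Coquelicot Require Import Coquelicot.
Local Open Scope R_scope.

(* The triangle |z| < |w|^r < 1 is covered by the bidisc-like set { |t| < 1, Re s < 0 } through
   (t, s) |-> (t e^{rs}, e^s).  Lift a proper map to a pair (f, g) on this cover.  Properness gives
   |f| = |g|^{r'} on |t| = 1, and forces g to the boundary or to 0 as Re s tends to 0 or to -oo, so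
   (g f_t - r' f g_t) g_t has boundary value 0 in s and vanishes identically; hence g depends on w
   alone and g = xi w^l.  Then f e^{-l r' s} is unimodular on |t| = 1 and, being near-constant in s,
   does not depend on s: it is an inner function h(t), that is, a finite Blaschke product.
   Single-valuedness on the triangle says h(e^{2 pi i r} t) = e^{2 pi i l r'} h(t), which makes the
   zeros of h invariant under rotation by 2 pi r: they all sit at 0 if r is irrational, and h is
   t^{k'} B(t^{p'}) if r = q'/p'.  Cauchy's theorem is only needed for circles, and is obtained from
   Goursat's lemma on rectangles through the exponential. *)

(** As Re s tends to 0 or -oo with t fixed, the image can leave compact sets in three ways: g -> 0,
    |g| -> 1, or |f| close to |g|^{r'}. In the first case f and g tend to 0 while f_t and g_t stay
    bounded. In the second only g_t is known to become small, by Schwarz-Pick, whence the extra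
    factor g_t. In the third f g^{-r'} is close to the unit circle and Schwarz-Pick makes its
    t-derivative small; since r' is real, f g^{-r'} is replaced there by f^b / g^a with a / b close
    to r'. All estimates are uniform in Im s for fixed t, so the half-plane needs no growth
    condition at infinity. Normal families are never invoked: that a function bounded by 1 with a
    value near the unit circle is nearly constant is a quantitative consequence of Harnack's
    inequality. This serves three times: for the vanishing theorem on the half-plane, for inner
    functions without zeros, and for the independence of s. *)

(** * Modulus and continuity in C *)

Lemma Cmod_minus_sym (a b : C) : Cmod (a - b) = Cmod (b - a).
Proof. rewrite <- Cmod_opp. f_equal. ring. Qed.

Lemma Cmod_minus_le (a b : C) : Cmod (a - b) <= Cmod a + Cmod b.
Proof. unfold Cminus. rewrite <- (Cmod_opp b). apply Cmod_triangle. Qed.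

Lemma Cmod_triangle_inv (a b : C) : Cmod a - Cmod b <= Cmod (a - b).
Proof. generalize (Cmod_triangle (a - b) b). replace (a - b + b)%C with a by ring. lra. Qed.

Lemma Cmod_RtoC_pos (x : R) : 0 <= x -> Cmod (RtoC x) = x.
Proof. intros H. rewrite Cmod_R. now apply Rabs_pos_eq. Qed.

Lemma im_le_Cmod (z : C) : Rabs (Im z) <= Cmod z.
Proof.
  generalize (re_le_Cmod (Ci * z)%C). rewrite Cmod_mult, Cmod_Ci, Rmult_1_l.
  rewrite Cmult_comm, re_mult_Ci, Rabs_Ropp. easy.
Qed.

Lemma Cmod_le_re_im (z : C) : Cmod z <= Rabs (Re z) + Rabs (Im z).
Proof.
  destruct z as [x y]. simpl.
  replace (x, y) with (RtoC x + Ci * RtoC y)%C.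
  - eapply Rle_trans; [apply Cmod_triangle|].
    rewrite Cmod_mult, !Cmod_R, Cmod_Ci. lra.
  - unfold Ci, RtoC, Cplus, Cmult; simpl. f_equal; ring.
Qed.

(** Balls of the product uniform structure are squares, hence the factor, a crude bound for sqrt
    2. *)
Lemma C_ball_Cmod (a z : C) (e : R) : ball a e z -> Cmod (z - a) < 2 * e.
Proof.
  intros [H1 H2]. eapply Rle_lt_trans; [apply Cmod_le_re_im|].
  change (Rabs (fst z - fst a) < e) in H1. change (Rabs (snd z - snd a) < e) in H2.
  destruct z, a; simpl in *. unfold Rminus in *. lra.
Qed.

Lemma Cmod_C_ball (a z : C) (e : R) : Cmod (z - a) < e -> ball a e z.
Proof.
  intros H. split.
  - change (Rabs (fst z - fst a) < e). eapply Rle_lt_trans; [|exact H].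
    generalize (re_le_Cmod (z - a)%C). destruct z, a; simpl; easy.
  - change (Rabs (snd z - snd a) < e). eapply Rle_lt_trans; [|exact H].
    generalize (im_le_Cmod (z - a)%C). destruct z, a; simpl; easy.
Qed.

Lemma continuous_C_iff {T : UniformSpace} (f : T -> C) (x : T) :
  continuous f x <-> forall e, 0 < e -> locally x (fun y => Cmod (f y - f x) < e).
Proof.
  split.
  - intros H e He. assert (He2 : 0 < e / 2) by lra.
    apply filterlim_locally with (eps := mkposreal _ He2) in H.
    revert H. apply filter_imp. intros y Hy. apply C_ball_Cmod in Hy. simpl in Hy. lra.
  - intros H. apply filterlim_locally. intros [e He].
    generalize (H e He). apply filter_imp. intros y. apply Cmod_C_ball.
Qed.

Lemma locally_C_iff (P : C -> Prop) (a : C) :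
  locally a P <-> exists d, 0 < d /\ forall z, Cmod (z - a) < d -> P z.
Proof.
  split.
  - intros [[d Hd] H]. exists d. split; [easy|]. intros z Hz. apply H. now apply Cmod_C_ball.
  - intros (d & Hd & H). assert (Hd2 : 0 < d / 2) by lra. exists (mkposreal _ Hd2).
    intros z Hz. apply H. apply C_ball_Cmod in Hz. simpl in Hz. lra.
Qed.

Lemma continuous_CC_iff (f : C -> C) (a : C) :
  continuous f a <->
  forall e, 0 < e -> exists d, 0 < d /\ forall z, Cmod (z - a) < d -> Cmod (f z - f a) < e.
Proof.
  rewrite continuous_C_iff. split; intros H e He; specialize (H e He).
  - now apply locally_C_iff in H.
  - now apply locally_C_iff.
Qed.

Lemma continuous_RC_iff (f : R -> C) (a : R) :
  continuous f a <->
  forall e, 0 < e -> exists d, 0 < d /\ forall x, Rabs (x - a) < d -> Cmod (f x - f a) < e.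
Proof.
  rewrite continuous_C_iff. split; intros H e He; specialize (H e He).
  - destruct H as [[d Hd] H]. exists d. split; [easy|]. intros x Hx. apply H. exact Hx.
  - destruct H as (d & Hd & H). exists (mkposreal d Hd). intros x Hx. apply H. exact Hx.
Qed.

Section ContinuousC.
Context {T : UniformSpace}.
Implicit Types (f g : T -> C) (x : T).

Lemma continuous_Cpair (f1 f2 : T -> R) x :
  continuous f1 x -> continuous f2 x -> continuous (fun t => (f1 t, f2 t) : C) x.
Proof.
  intros H1 H2. apply filterlim_locally. intros e.
  apply filterlim_locally with (eps := e) in H1.
  apply filterlim_locally with (eps := e) in H2.
  generalize (filter_and _ _ H1 H2). apply filter_imp. intros y [A B]. now split.
Qed.

Lemma continuous_Re f x : continuous f x -> continuous (fun t => Re (f t)) x.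
Proof. intros H. apply (continuous_comp f Re). exact H. apply continuous_fst. Qed.

Lemma continuous_Im f x : continuous f x -> continuous (fun t => Im (f t)) x.
Proof. intros H. apply (continuous_comp f Im). exact H. apply continuous_snd. Qed.

Lemma continuous_Cplus f g x :
  continuous f x -> continuous g x -> continuous (fun t => (f t + g t)%C) x.
Proof. intros Hf Hg. exact (continuous_plus (V := C_R_NormedModule) f g x Hf Hg). Qed.

Lemma continuous_Copp f x : continuous f x -> continuous (fun t => (- f t)%C) x.
Proof. intros Hf. exact (continuous_opp (V := C_R_NormedModule) f x Hf). Qed.

Lemma continuous_Cminus f g x :
  continuous f x -> continuous g x -> continuous (fun t => (f t - g t)%C) x.
Proof. intros Hf Hg. apply continuous_Cplus; [easy|now apply continuous_Copp]. Qed.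

Lemma continuous_Cmult f g x :
  continuous f x -> continuous g x -> continuous (fun t => (f t * g t)%C) x.
Proof.
  intros Hf Hg.
  assert (A := continuous_Re f x Hf). assert (B := continuous_Im f x Hf).
  assert (A' := continuous_Re g x Hg). assert (B' := continuous_Im g x Hg).
  apply continuous_Cpair.
  - apply (continuous_minus (V := R_NormedModule)); apply (continuous_mult (K := R_AbsRing)); assumption.
  - apply (continuous_plus (V := R_NormedModule)); apply (continuous_mult (K := R_AbsRing)); assumption.
Qed.

Lemma continuous_Cconj f x : continuous f x -> continuous (fun t => Cconj (f t)) x.
Proof.
  intros Hf. apply continuous_Cpair.
  - now apply continuous_Re.
  - apply (continuous_opp (V := R_NormedModule)). now apply continuous_Im.
Qed.

Lemma continuous_Cmod f x : continuous f x -> continuous (fun t => Cmod (f t)) x.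
Proof.
  intros H. apply filterlim_locally. intros [e He].
  apply continuous_C_iff with (e := e) in H; [|easy]. revert H. apply filter_imp.
  intros y Hy. change (Rabs (Cmod (f y) - Cmod (f x)) < e).
  apply Rle_lt_trans with (2 := Hy).
  generalize (Cmod_triangle_inv (f y) (f x)) (Cmod_triangle_inv (f x) (f y)).
  rewrite (Cmod_minus_sym (f x)). intros. apply Rabs_le. lra.
Qed.

Lemma continuous_Cinv f x : continuous f x -> f x <> 0 -> continuous (fun t => (/ f t)%C) x.
Proof.
  intros Hf H0.
  assert (A := continuous_Re f x Hf). assert (B := continuous_Im f x Hf).
  assert (N : Re (f x) ^ 2 + Im (f x) ^ 2 <> 0)
    by (rewrite <- Cmod2_alt; apply pow_nonzero; intros E; now apply Cmod_eq_0 in E).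
  assert (S : continuous (fun t => Re (f t) ^ 2 + Im (f t) ^ 2) x).
  { apply (continuous_plus (V := R_NormedModule)); simpl;
    apply (continuous_mult (K := R_AbsRing)); try assumption;
    apply (continuous_mult (K := R_AbsRing)); try assumption; apply continuous_const. }
  assert (S' : continuous (fun t => / (Re (f t) ^ 2 + Im (f t) ^ 2)) x).
  { apply (continuous_comp _ Rinv); [exact S|].
    apply continuity_pt_filterlim. apply (continuity_pt_inv id); [|exact N].
    apply derivable_continuous_pt, derivable_pt_id. }
  apply continuous_Cpair; apply (continuous_mult (K := R_AbsRing)); try assumption.
  apply (continuous_opp (V := R_NormedModule)); assumption.
Qed.

Lemma continuous_Cdiv f g x :
  continuous f x -> continuous g x -> g x <> 0 -> continuous (fun t => (f t / g t)%C) x.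
Proof. intros. apply continuous_Cmult; [easy|now apply continuous_Cinv]. Qed.

End ContinuousC.

(** * Complex differentiation *)

(** The remainder estimate is multiplied out, so the centre z = a needs no exception and the
    calculus rules reduce to the triangle inequality. *)
Definition cderiv (f : C -> C) (a l : C) : Prop :=
  forall e, 0 < e -> exists d, 0 < d /\ forall z, Cmod (z - a) < d ->
    Cmod (f z - f a - l * (z - a)) <= e * Cmod (z - a).

Definition cdiff (f : C -> C) (a : C) : Prop := exists l, cderiv f a l.

Lemma cderiv_continuous f a l : cderiv f a l -> continuous f a.
Proof.
  intros H. apply continuous_CC_iff. intros e He.
  destruct (H 1 Rlt_0_1) as (d & Hd & Hz).
  assert (K : 0 < 1 + Cmod l) by (generalize (Cmod_ge_0 l); lra).
  exists (Rmin d (e / (1 + Cmod l))). split.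
  - apply Rmin_glb_lt; [easy|]. now apply Rdiv_lt_0_compat.
  - intros z Hm. assert (H1 := Rlt_le_trans _ _ _ Hm (Rmin_l _ _)).
    assert (H2 := Rlt_le_trans _ _ _ Hm (Rmin_r _ _)).
    specialize (Hz z H1).
    replace (f z - f a)%C with ((f z - f a - l * (z - a)) + l * (z - a))%C by ring.
    eapply Rle_lt_trans; [apply Cmod_triangle|]. rewrite Cmod_mult.
    apply Rle_lt_trans with ((1 + Cmod l) * Cmod (z - a)); [lra|].
    apply Rlt_le_trans with ((1 + Cmod l) * (e / (1 + Cmod l))).
    + now apply Rmult_lt_compat_l.
    + right. field. lra.
Qed.

Lemma cdiff_continuous f a : cdiff f a -> continuous f a.
Proof. intros [l H]. now apply cderiv_continuous in H. Qed.

Lemma cderiv_ext_loc f g a l :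
  (exists d, 0 < d /\ forall z, Cmod (z - a) < d -> f z = g z) -> cderiv f a l -> cderiv g a l.
Proof.
  intros (d0 & Hd0 & E) H e He. destruct (H e He) as (d & Hd & Hz).
  exists (Rmin d d0). split; [now apply Rmin_glb_lt|]. intros z Hm.
  assert (H1 := Rlt_le_trans _ _ _ Hm (Rmin_l _ _)).
  assert (H2 := Rlt_le_trans _ _ _ Hm (Rmin_r _ _)).
  rewrite <- !E; auto. replace (a - a)%C with (RtoC 0) by ring. now rewrite Cmod_0.
Qed.

Lemma cdiff_ext_loc f g a :
  (exists d, 0 < d /\ forall z, Cmod (z - a) < d -> f z = g z) -> cdiff f a -> cdiff g a.
Proof. intros E [l H]. exists l. now apply (cderiv_ext_loc f). Qed.

Lemma cderiv_const c a : cderiv (fun _ => c) a 0.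
Proof.
  intros e He. exists 1. split; [lra|]. intros z _.
  replace (c - c - 0 * (z - a))%C with (RtoC 0) by ring. rewrite Cmod_0.
  apply Rmult_le_pos; [lra|apply Cmod_ge_0].
Qed.

Lemma cderiv_id a : cderiv (fun z => z) a 1.
Proof.
  intros e He. exists 1. split; [lra|]. intros z _.
  replace (z - a - 1 * (z - a))%C with (RtoC 0) by ring. rewrite Cmod_0.
  apply Rmult_le_pos; [lra|apply Cmod_ge_0].
Qed.

Lemma cderiv_plus f g a lf lg :
  cderiv f a lf -> cderiv g a lg -> cderiv (fun z => f z + g z)%C a (lf + lg).
Proof.
  intros Hf Hg e He. destruct (Hf (e / 2)) as (d & Hd & Hz); [lra|].
  destruct (Hg (e / 2)) as (d' & Hd' & Hz'); [lra|].
  exists (Rmin d d'). split; [now apply Rmin_glb_lt|]. intros z Hm.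
  assert (H1 := Hz z (Rlt_le_trans _ _ _ Hm (Rmin_l _ _))).
  assert (H2 := Hz' z (Rlt_le_trans _ _ _ Hm (Rmin_r _ _))).
  replace (f z + g z - (f a + g a) - (lf + lg) * (z - a))%C
    with ((f z - f a - lf * (z - a)) + (g z - g a - lg * (z - a)))%C by ring.
  eapply Rle_trans; [apply Cmod_triangle|]. lra.
Qed.

Lemma cderiv_comp f g a lf lg :
  cderiv g a lg -> cderiv f (g a) lf -> cderiv (fun z => f (g z)) a (lf * lg).
Proof.
  intros Hg Hf e He.
  assert (P1 := Cmod_ge_0 lf). assert (P2 := Cmod_ge_0 lg).
  (* [e1] pays for the remainder of f, measured against |g z - g a| <= (1 + |lg|) |z - a|; [e2] pays
     for lf times the remainder of g, and its cap at 1 yields that Lipschitz bound. *)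
  set (e1 := e / 2 / (1 + Cmod lg)). set (e2 := Rmin 1 (e / 2 / (1 + Cmod lf))).
  assert (He1 : 0 < e1) by (unfold e1; apply Rdiv_lt_0_compat; lra).
  assert (He2 : 0 < e2) by (unfold e2; apply Rmin_glb_lt; [lra|apply Rdiv_lt_0_compat; lra]).
  destruct (Hf e1 He1) as (d1 & Hd1 & F). destruct (Hg e2 He2) as (d2 & Hd2 & G).
  destruct (proj1 (continuous_CC_iff g a) (cderiv_continuous _ _ _ Hg) d1 Hd1) as (d3 & Hd3 & K).
  exists (Rmin d2 d3). split; [now apply Rmin_glb_lt|]. intros z Hm.
  specialize (G z (Rlt_le_trans _ _ _ Hm (Rmin_l _ _))).
  specialize (K z (Rlt_le_trans _ _ _ Hm (Rmin_r _ _))).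
  specialize (F (g z) K).
  replace (f (g z) - f (g a) - lf * lg * (z - a))%C with
    ((f (g z) - f (g a) - lf * (g z - g a)) + lf * (g z - g a - lg * (z - a)))%C by ring.
  eapply Rle_trans; [apply Cmod_triangle|]. rewrite Cmod_mult.
  assert (Pz := Cmod_ge_0 (z - a)).
  assert (B : Cmod (g z - g a) <= (1 + Cmod lg) * Cmod (z - a)).
  { replace (g z - g a)%C with ((g z - g a - lg * (z - a)) + lg * (z - a))%C by ring.
    eapply Rle_trans; [apply Cmod_triangle|]. rewrite Cmod_mult.
    assert (e2 <= 1) by apply Rmin_l.
    assert (e2 * Cmod (z - a) <= 1 * Cmod (z - a)) by now apply Rmult_le_compat_r. lra. }
  assert (B1 : e1 * Cmod (g z - g a) <= e / 2 * Cmod (z - a)).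
  { apply Rle_trans with (e1 * ((1 + Cmod lg) * Cmod (z - a))).
    - apply Rmult_le_compat_l; lra.
    - right. unfold e1. field. lra. }
  assert (B2 : Cmod lf * Cmod (g z - g a - lg * (z - a)) <= e / 2 * Cmod (z - a)).
  { apply Rle_trans with ((1 + Cmod lf) * (e2 * Cmod (z - a))).
    - apply Rmult_le_compat; try lra. apply Cmod_ge_0.
    - apply Rle_trans with ((1 + Cmod lf) * ((e / 2 / (1 + Cmod lf)) * Cmod (z - a))).
      + apply Rmult_le_compat_l; [lra|]. apply Rmult_le_compat_r; [lra|]. apply Rmin_r.
      + right. field. lra. }
  lra.
Qed.

Lemma cderiv_sqr a : cderiv (fun z => z * z)%C a (2 * a).
Proof.
  intros e He. exists e. split; [easy|]. intros z Hz.
  replace (z * z - a * a - 2 * a * (z - a))%C with ((z - a) * (z - a))%C by ring.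
  rewrite Cmod_mult. apply Rmult_le_compat_r; [apply Cmod_ge_0|lra].
Qed.

Lemma cderiv_scal c f a l : cderiv f a l -> cderiv (fun z => c * f z)%C a (c * l).
Proof.
  intros H. apply (cderiv_comp (fun z => c * z)%C f); [easy|].
  intros e He. exists 1. split; [lra|]. intros z _.
  replace (c * z - c * f a - c * (z - f a))%C with (RtoC 0) by ring. rewrite Cmod_0.
  apply Rmult_le_pos; [lra|apply Cmod_ge_0].
Qed.

(* Polarization: fg = ((f+g)^2 - (f-g)^2)/4. *)
Lemma cderiv_mult f g a lf lg :
  cderiv f a lf -> cderiv g a lg -> cderiv (fun z => f z * g z)%C a (lf * g a + f a * lg).
Proof.
  intros Hf Hg.
  assert (P := cderiv_comp _ _ _ _ _ (cderiv_plus _ _ _ _ _ Hf Hg) (cderiv_sqr _)).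
  assert (M := cderiv_comp _ _ _ _ _ (cderiv_plus _ _ _ _ _ Hf (cderiv_scal (-1)%R _ _ _ Hg)) (cderiv_sqr _)).
  assert (S := cderiv_plus _ _ _ _ _ (cderiv_scal (/4)%C _ _ _ P) (cderiv_scal (-/4)%C _ _ _ M)).
  simpl in S.
  replace (lf * g a + f a * lg)%C with
    (/ 4 * (2 * (f a + g a) * (lf + lg)) + - / 4 * (2 * (f a + (-1)%R * g a) * (lf + (-1)%R * lg)))%C.
  - revert S. apply cderiv_ext_loc. exists 1. split; [lra|]. intros z _.
    replace (RtoC (-1)) with (- (1))%C by (now rewrite <- RtoC_opp). field.
  - replace (RtoC (-1)) with (- (1))%C by (now rewrite <- RtoC_opp). field.
Qed.

Lemma cderiv_inv_id (a : C) : a <> 0 -> cderiv Cinv a (- / (a * a)).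
Proof.
  intros Ha e He. assert (P : 0 < Cmod a) by (apply Cmod_gt_0; exact Ha).
  (* The remainder is (z - a)^2 / (z a^2). The first radius gives |z| > |a| / 2, and the second then
     makes |z - a| at most e |z| |a|^2. *)
  exists (Rmin (Cmod a / 2) (e * (Cmod a) ^ 3 / 2)). split.
  - apply Rmin_glb_lt; [lra|]. assert (0 < Cmod a ^ 3) by now apply pow_lt. nra.
  - intros z Hm. assert (H1 := Rlt_le_trans _ _ _ Hm (Rmin_l _ _)).
    assert (H2 := Rlt_le_trans _ _ _ Hm (Rmin_r _ _)).
    assert (Q : Cmod a / 2 < Cmod z).
    { generalize (Cmod_triangle_inv a z). rewrite Cmod_minus_sym. lra. }
    assert (Hz : z <> 0) by (apply Cmod_gt_0; lra).
    replace (/ z - / a - - / (a * a) * (z - a))%C with ((z - a) * ((z - a) / (z * (a * a))))%C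
      by (field; auto).
    rewrite Cmod_mult, Rmult_comm. apply Rmult_le_compat_r; [apply Cmod_ge_0|].
    rewrite Cmod_div by (repeat apply Cmult_neq_0; auto). rewrite !Cmod_mult.
    apply Rle_div_l.
    { apply Rmult_gt_0_compat; [lra|nra]. }
    apply Rlt_le. apply Rlt_le_trans with (1 := H2).
    replace (e * Cmod a ^ 3 / 2) with (e * (Cmod a / 2 * (Cmod a * Cmod a))) by field.
    apply Rmult_le_compat_l; [lra|]. apply Rmult_le_compat_r; nra.
Qed.

Lemma cdiff_const c a : cdiff (fun _ => c) a.
Proof. eexists; apply cderiv_const. Qed.
Lemma cdiff_id a : cdiff (fun z => z) a.
Proof. eexists; apply cderiv_id. Qed.
Lemma cdiff_comp f g a : cdiff g a -> cdiff f (g a) -> cdiff (fun z => f (g z)) a.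
Proof. intros [lg Hg] [lf Hf]. eexists. now apply (cderiv_comp f g a lf lg). Qed.
Lemma cdiff_plus f g a : cdiff f a -> cdiff g a -> cdiff (fun z => f z + g z)%C a.
Proof. intros [lf Hf] [lg Hg]. eexists. apply cderiv_plus; eassumption. Qed.
Lemma cdiff_mult f g a : cdiff f a -> cdiff g a -> cdiff (fun z => f z * g z)%C a.
Proof. intros [lf Hf] [lg Hg]. eexists. apply cderiv_mult; eassumption. Qed.
Lemma cdiff_opp f a : cdiff f a -> cdiff (fun z => - f z)%C a.
Proof.
  intros Hf. apply (cdiff_ext_loc (fun z => - (1) * f z)%C).
  - exists 1. split; [lra|]. intros; ring.
  - apply cdiff_mult; [apply cdiff_const|easy].
Qed.
Lemma cdiff_minus f g a : cdiff f a -> cdiff g a -> cdiff (fun z => f z - g z)%C a.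
Proof. intros Hf Hg. apply cdiff_plus; [easy|now apply cdiff_opp]. Qed.
Lemma cdiff_inv f a : cdiff f a -> f a <> 0 -> cdiff (fun z => / f z)%C a.
Proof.
  intros Hf H0. apply (cdiff_comp Cinv f); [easy|]. eexists. now apply cderiv_inv_id.
Qed.
Lemma cdiff_div f g a : cdiff f a -> cdiff g a -> g a <> 0 -> cdiff (fun z => f z / g z)%C a.
Proof. intros Hf Hg H0. apply cdiff_mult; [easy|now apply cdiff_inv]. Qed.
Lemma cdiff_pow f n a : cdiff f a -> cdiff (fun z => f z ^ n)%C a.
Proof. intros Hf. induction n; simpl; [apply cdiff_const|now apply cdiff_mult]. Qed.

(** * Integrals of complex functions and Goursat on rectangles *)

Notation CInt f a b := (RInt (V := C_R_CompleteNormedModule) f a b).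
Notation is_CInt f a b l := (is_RInt (V := C_R_CompleteNormedModule) f a b l).

Lemma is_CInt_cont (f : R -> C) (a b : R) :
  (forall x, Rmin a b <= x <= Rmax a b -> continuous f x) -> is_CInt f a b (CInt f a b).
Proof.
  intros H. apply (RInt_correct (V := C_R_CompleteNormedModule)).
  apply (ex_RInt_continuous (V := C_R_CompleteNormedModule)). exact H.
Qed.

Lemma is_CInt_unique (f : R -> C) (a b : R) (l : C) : is_CInt f a b l -> CInt f a b = l.
Proof. apply (is_RInt_unique (V := C_R_CompleteNormedModule)). Qed.

Lemma is_CInt_pair (f : R -> C) (a b : R) (l : C) :
  is_CInt f a b l <->
  is_RInt (fun x => Re (f x)) a b (Re l) /\ is_RInt (fun x => Im (f x)) a b (Im l).
Proof.
  split.
  - intros H. split.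
    + exact (is_RInt_fct_extend_fst (U := R_NormedModule) (V := R_NormedModule) f a b l H).
    + exact (is_RInt_fct_extend_snd (U := R_NormedModule) (V := R_NormedModule) f a b l H).
  - intros [H1 H2]. destruct l as [l1 l2].
    exact (is_RInt_fct_extend_pair (U := R_NormedModule) (V := R_NormedModule) f a b l1 l2 H1 H2).
Qed.

Lemma is_CInt_mult (c : C) (f : R -> C) (a b : R) (l : C) :
  is_CInt f a b l -> is_CInt (fun x => c * f x)%C a b (c * l)%C.
Proof.
  rewrite !is_CInt_pair. intros [H1 H2]. split.
  - exact (is_RInt_minus _ _ _ _ _ _ (is_RInt_scal _ _ _ (Re c) _ H1) (is_RInt_scal _ _ _ (Im c) _ H2)).
  - exact (is_RInt_plus _ _ _ _ _ _ (is_RInt_scal _ _ _ (Re c) _ H2) (is_RInt_scal _ _ _ (Im c) _ H1)).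
Qed.

Lemma is_CInt_plus (f g : R -> C) (a b : R) (l m : C) :
  is_CInt f a b l -> is_CInt g a b m -> is_CInt (fun x => f x + g x)%C a b (l + m)%C.
Proof. intros H1 H2. exact (is_RInt_plus _ _ _ _ _ _ H1 H2). Qed.

Lemma is_CInt_const (c : C) (a b : R) : is_CInt (fun _ => c) a b (RtoC (b - a) * c)%C.
Proof.
  rewrite <- scal_R_Cmult. exact (is_RInt_const (V := C_R_NormedModule) a b c).
Qed.

Lemma CInt_norm_le (f : R -> C) (a b M : R) (l : C) :
  a <= b -> (forall x, a <= x <= b -> Cmod (f x) <= M) -> is_CInt f a b l ->
  Cmod l <= (b - a) * M.
Proof.
  intros Hab HM H. rewrite Cmod_norm.
  apply (norm_RInt_le_const (V := C_R_NormedModule) f a b l M Hab); [|exact H].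
  intros x Hx. rewrite <- Cmod_norm. now apply HM.
Qed.

Lemma CInt_Chasles (f : R -> C) (a b c : R) :
  a <= b <= c -> (forall x, a <= x <= c -> continuous f x) ->
  (CInt f a b + CInt f b c)%C = CInt f a c.
Proof.
  intros [H1 H2] Hf.
  apply (RInt_Chasles (V := C_R_CompleteNormedModule));
    apply (ex_RInt_continuous (V := C_R_CompleteNormedModule)); intros z Hz; apply Hf;
    rewrite Rmin_left, Rmax_right in Hz; lra.
Qed.

(** Transfers an epsilon-delta estimate to the real derivative of C-valued functions, for which the
    fundamental theorem of calculus is at hand. *)
Lemma is_derive_RC (f : R -> C) (x : R) (l : C) :
  (forall e, 0 < e -> exists d, 0 < d /\ forall y, Rabs (y - x) < d ->
     Cmod (f y - f x - l * RtoC (y - x)) <= e * Rabs (y - x)) ->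
  is_derive (V := C_R_NormedModule) f x l.
Proof.
  intros H. split.
  - apply is_linear_scal_l.
  - intros y Hy.
    apply (is_filter_lim_locally_unique (K := R_AbsRing) (V := AbsRing_NormedModule R_AbsRing)) in Hy. subst y. intros [e He].
    destruct (H e He) as (d & Hd & Hz). exists (mkposreal d Hd). intros y Hy. simpl.
    specialize (Hz y Hy).
    replace (norm (minus y x)) with (Rabs (y - x)) by reflexivity.
    eapply Rle_trans; [|exact Hz]. right. rewrite Cmod_norm. f_equal.
    rewrite scal_R_Cmult. rewrite (Cmult_comm l). reflexivity.
Qed.

Lemma is_derive_hor (F : C -> C) (x y : R) (l : C) :
  cderiv F (x, y) l -> is_derive (V := C_R_NormedModule) (fun t => F (t, y)) x l.
Proof.
  intros H. apply is_derive_RC. intros e He. destruct (H e He) as (d & Hd & Hz).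
  exists d. split; [easy|]. intros t Ht.
  assert (E : ((t, y) - (x, y) = RtoC (t - x))%C)
    by (unfold Cminus, Cplus, Copp, RtoC; simpl; f_equal; ring).
  assert (E2 : Cmod ((t, y) - (x, y)) = Rabs (t - x)) by (rewrite E; apply Cmod_R).
  specialize (Hz (t, y)). rewrite E2, E in Hz. now apply Hz.
Qed.

Lemma is_derive_vert (F : C -> C) (x y : R) (l : C) :
  cderiv F (x, y) l -> is_derive (V := C_R_NormedModule) (fun t => F (x, t)) y (l * Ci)%C.
Proof.
  intros H. apply is_derive_RC. intros e He. destruct (H e He) as (d & Hd & Hz).
  exists d. split; [easy|]. intros t Ht.
  assert (E : ((x, t) - (x, y) = Ci * RtoC (t - y))%C)
    by (unfold Ci, Cminus, Cmult, Cplus, Copp, RtoC; simpl; f_equal; ring).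
  assert (E2 : Cmod ((x, t) - (x, y)) = Rabs (t - y))
    by (rewrite E, Cmod_mult, Cmod_Ci, Cmod_R; ring).
  specialize (Hz (x, t)). rewrite E2, E in Hz. rewrite <- Cmult_assoc. now apply Hz.
Qed.

Lemma continuous_hor (F : C -> C) (x y : R) :
  continuous F (x, y) -> continuous (fun t => F (t, y)) x.
Proof.
  intros H. apply (continuous_comp (fun t => (t, y) : C) F); [|exact H].
  apply continuous_Cpair; [apply continuous_id|apply continuous_const].
Qed.

Lemma continuous_vert (F : C -> C) (x y : R) :
  continuous F (x, y) -> continuous (fun t => F (x, t)) y.
Proof.
  intros H. apply (continuous_comp (fun t => (x, t) : C) F); [|exact H].
  apply continuous_Cpair; [apply continuous_const|apply continuous_id].
Qed.

Definition in_rect (a b c d : R) (s : C) : Prop := a <= Re s <= b /\ c <= Im s <= d.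

(** The contour integral over the boundary, counterclockwise: bottom minus top, then right minus
    left with dz = i dy. *)
Definition rect_int (H : C -> C) (a b c d : R) : C :=
  (CInt (fun x => H (x, c)) a b - CInt (fun x => H (x, d)) a b
   + Ci * (CInt (fun y => H (b, y)) c d - CInt (fun y => H (a, y)) c d))%C.

(** The fundamental theorem of calculus on each side leaves values of F at the corners only, and
    these cancel. *)
Lemma rect_int_primitive (F H : C -> C) (a b c d : R) :
  a <= b -> c <= d ->
  (forall s, in_rect a b c d s -> cderiv F s (H s)) ->
  (forall s, in_rect a b c d s -> continuous H s) ->
  rect_int H a b c d = 0.
Proof.
  intros Hab Hcd HF HH.
  assert (Hor : forall y, c <= y <= d -> CInt (fun x => H (x, y)) a b = (F (b, y) - F (a, y))%C).
  { intros y Hy. apply is_CInt_unique.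
    apply (is_RInt_derive (V := C_R_CompleteNormedModule) (fun x => F (x, y)) (fun x => H (x, y)));
      intros x Hx; rewrite Rmin_left, Rmax_right in Hx by lra.
    - apply is_derive_hor. apply HF. now split.
    - apply continuous_hor. apply HH. now split. }
  assert (Vert : forall x, a <= x <= b -> (CInt (fun y => H (x, y)) c d * Ci = F (x, d) - F (x, c))%C).
  { intros x Hx.
    assert (I : is_CInt (fun y => H (x, y) * Ci)%C c d (F (x, d) - F (x, c))%C).
    { apply (is_RInt_derive (V := C_R_CompleteNormedModule) (fun y => F (x, y)) (fun y => H (x, y) * Ci)%C);
      intros y Hy; rewrite Rmin_left, Rmax_right in Hy by lra.
      - apply is_derive_vert. apply HF. now split.
      - apply continuous_Cmult; [|apply continuous_const]. apply continuous_vert. apply HH. now split. }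
    apply is_CInt_unique in I. rewrite <- I. symmetry. apply is_CInt_unique.
    rewrite Cmult_comm.
    apply (is_RInt_ext (V := C_R_NormedModule) (fun y => Ci * H (x, y))%C).
    { intros; apply Cmult_comm. }
    apply is_CInt_mult. apply is_CInt_cont. intros y Hy.
    rewrite Rmin_left, Rmax_right in Hy by lra. apply continuous_vert. apply HH. now split. }
  unfold rect_int. rewrite !Hor by lra.
  replace (Ci * (CInt (fun y => H (b, y)) c d - CInt (fun y => H (a, y)) c d))%C with
    (CInt (fun y => H (b, y)) c d * Ci - CInt (fun y => H (a, y)) c d * Ci)%C by ring.
  rewrite !Vert by lra. ring.
Qed.

Lemma rect_int_minus (H K : C -> C) (a b c d : R) :
  a <= b -> c <= d ->
  (forall s, in_rect a b c d s -> continuous H s) ->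
  (forall s, in_rect a b c d s -> continuous K s) ->
  rect_int (fun s => H s + - (1) * K s)%C a b c d = (rect_int H a b c d - rect_int K a b c d)%C.
Proof.
  intros Hab Hcd HH HK.
  assert (X : forall (f g : R -> C) u v, u <= v ->
    (forall x, u <= x <= v -> continuous f x) -> (forall x, u <= x <= v -> continuous g x) ->
    CInt (fun x => f x + - (1) * g x)%C u v = (CInt f u v + - (1) * CInt g u v)%C).
  { intros f g u v Huv Hf Hg. apply is_CInt_unique. apply is_CInt_plus; [|apply is_CInt_mult];
    apply is_CInt_cont; intros x Hx; rewrite Rmin_left, Rmax_right in Hx by lra; auto. }
  unfold rect_int.
  rewrite (X (fun x => H (x, c)) (fun x => K (x, c))), (X (fun x => H (x, d)) (fun x => K (x, d))),
    (X (fun y => H (b, y)) (fun y => K (b, y))), (X (fun y => H (a, y)) (fun y => K (a, y)));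
  [repeat match goal with |- context [CInt ?f ?u ?v] => generalize (CInt f u v); intro end; ring|..];
  match goal with
  | |- _ <= _ => assumption
  | _ => intros t Ht; first [apply continuous_hor|apply continuous_vert];
         match goal with |- continuous H _ => apply HH | |- _ => apply HK end;
         split; simpl; lra
  end.
Qed.

Lemma rect_int_bound (H : C -> C) (a b c d M : R) :
  a <= b -> c <= d ->
  (forall s, in_rect a b c d s -> continuous H s) ->
  (forall s, in_rect a b c d s -> Cmod (H s) <= M) ->
  Cmod (rect_int H a b c d) <= 2 * ((b - a) + (d - c)) * M.
Proof.
  intros Hab Hcd HH HM.
  assert (X : forall (f : R -> C) u v, u <= v -> (forall x, u <= x <= v -> continuous f x) ->
    (forall x, u <= x <= v -> Cmod (f x) <= M) -> Cmod (CInt f u v) <= (v - u) * M).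
  { intros f u v Huv Hf HfM. apply (CInt_norm_le f); auto. apply is_CInt_cont.
    intros x Hx; rewrite Rmin_left, Rmax_right in Hx by lra; auto. }
  assert (Hor : forall y, c <= y <= d -> Cmod (CInt (fun x => H (x, y)) a b) <= (b - a) * M).
  { intros y Hy. apply X; [easy|intros x Hx; apply continuous_hor, HH|intros x Hx; apply HM]; now split. }
  assert (Vert : forall x, a <= x <= b -> Cmod (CInt (fun y => H (x, y)) c d) <= (d - c) * M).
  { intros x Hx. apply X; [easy|intros y Hy; apply continuous_vert, HH|intros y Hy; apply HM]; now split. }
  unfold rect_int. eapply Rle_trans; [apply Cmod_triangle|]. rewrite Cmod_mult, Cmod_Ci.
  generalize (Cmod_minus_le (CInt (fun x => H (x, c)) a b) (CInt (fun x => H (x, d)) a b)).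
  generalize (Cmod_minus_le (CInt (fun y => H (b, y)) c d) (CInt (fun y => H (a, y)) c d)).
  generalize (Hor c) (Hor d) (Vert a) (Vert b). lra.
Qed.

Lemma rect_int_split (H : C -> C) (a m b c n d : R) :
  a <= m <= b -> c <= n <= d ->
  (forall s, in_rect a b c d s -> continuous H s) ->
  rect_int H a b c d =
  (rect_int H a m c n + rect_int H m b c n + rect_int H a m n d + rect_int H m b n d)%C.
Proof.
  intros Hm Hn HH.
  assert (Hor : forall y, c <= y <= d ->
    CInt (fun x => H (x, y)) a b = (CInt (fun x => H (x, y)) a m + CInt (fun x => H (x, y)) m b)%C).
  { intros y Hy. symmetry. apply CInt_Chasles; [easy|].
    intros x Hx; apply continuous_hor, HH; now split. }
  assert (Vert : forall x, a <= x <= b ->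
    CInt (fun y => H (x, y)) c d = (CInt (fun y => H (x, y)) c n + CInt (fun y => H (x, y)) n d)%C).
  { intros x Hx. symmetry. apply CInt_Chasles; [easy|].
    intros y Hy; apply continuous_vert, HH; now split. }
  unfold rect_int. rewrite (Hor c), (Hor d), (Vert a), (Vert b) by lra. ring.
Qed.

(** The affine part has a primitive and contributes nothing, so only the remainder is felt. The
    factor in front of M is the perimeter. *)
Lemma rect_int_affine_bound (H : C -> C) (A B s0 : C) (a b c d M : R) :
  a <= b -> c <= d ->
  (forall s, in_rect a b c d s -> continuous H s) ->
  (forall s, in_rect a b c d s -> Cmod (H s - A - B * (s - s0)) <= M) ->
  Cmod (rect_int H a b c d) <= 2 * ((b - a) + (d - c)) * M.
Proof.
  intros Hab Hcd HH HM.
  set (L := fun s => (A + B * (s - s0))%C).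
  assert (dL : forall s, cderiv (fun s => A * (s - s0) + B / 2 * ((s - s0) * (s - s0)))%C s (L s)).
  { intros s.
    assert (D : cderiv (fun s => s - s0)%C s (1 + 0)%C)
      by (apply cderiv_plus; [apply cderiv_id|apply cderiv_const]).
    assert (D2 := cderiv_plus _ _ _ _ _ (cderiv_scal A _ _ _ D)
                    (cderiv_scal (B / 2)%C _ _ _ (cderiv_comp _ _ _ _ _ D (cderiv_sqr _)))).
    simpl in D2. unfold L.
    replace (A + B * (s - s0))%C with (A * (1 + 0) + B / 2 * (2 * (s - s0) * (1 + 0)))%C by field.
    exact D2. }
  assert (cL : forall s, continuous L s).
  { intros s. unfold L. apply continuous_Cplus; [apply continuous_const|].
    apply continuous_Cmult; [apply continuous_const|].
    apply continuous_Cminus; [apply continuous_id|apply continuous_const]. }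
  assert (Z : rect_int L a b c d = 0).
  { apply (rect_int_primitive _ L a b c d Hab Hcd (fun s _ => dL s) (fun s _ => cL s)). }
  replace (rect_int H a b c d) with (rect_int (fun s => H s + - (1) * L s)%C a b c d).
  - apply rect_int_bound; auto.
    + intros s Hs. apply continuous_Cplus; [now apply HH|].
      apply continuous_Cmult; [apply continuous_const|apply cL].
    + intros s Hs. replace (H s + - (1) * L s)%C with (H s - A - B * (s - s0))%C; auto.
      unfold L. ring.
  - rewrite rect_int_minus by auto. rewrite Z. ring.
Qed.

Section Goursat.
Variables (H : C -> C) (a b c d : R).
Hypotheses (Hab : a <= b) (Hcd : c <= d).
Hypothesis Hdiff : forall s, in_rect a b c d s -> cdiff H s.

Let rect : Type := (R * R * R * R)%type.
Let RI (r : rect) : R := let '(a, b, c, d) := r in Cmod (rect_int H a b c d).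

(** Goursat's bisection: the first quarter whose boundary integral is at least a fourth of the
    whole. The last quarter is taken by default, rightly so, since the four integrals add up to the
    whole. *)
Let step (r : rect) : rect :=
  let '(a, b, c, d) := r in
  let m := (a + b) / 2 in let n := (c + d) / 2 in
  if Rle_dec (RI r) (4 * RI (a, m, c, n)) then (a, m, c, n)
  else if Rle_dec (RI r) (4 * RI (m, b, c, n)) then (m, b, c, n)
  else if Rle_dec (RI r) (4 * RI (a, m, n, d)) then (a, m, n, d)
  else (m, b, n, d).

Let seqr (k : nat) : rect := Nat.iter k step (a, b, c, d).

Let good (k : nat) (r : rect) : Prop :=
  let '(a', b', c', d') := r in
  a <= a' /\ a' <= b' /\ b' <= b /\ c <= c' /\ c' <= d' /\ d' <= d /\
  b' - a' = (b - a) / 2 ^ k /\ d' - c' = (d - c) / 2 ^ k /\ RI (a, b, c, d) <= 4 ^ k * RI r.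

Let sub (r' r : rect) : Prop :=
  let '(a', b', c', d') := r' in let '(a0, b0, c0, d0) := r in
  a0 <= a' /\ b' <= b0 /\ c0 <= c' /\ d' <= d0.

Let step_good (k : nat) (r : rect) : good k r -> good (S k) (step r) /\ sub (step r) r.
Proof.
  destruct r as [[[a' b'] c'] d']. intros (H1 & H2 & H3 & H4 & H5 & H6 & H7 & H8 & H9).
  assert (P2 : 0 < 2 ^ k) by (apply pow_lt; lra). assert (P4 : 0 < 4 ^ k) by (apply pow_lt; lra).
  assert (S : RI (a', b', c', d') <= RI (a', (a' + b') / 2, c', (c' + d') / 2)
     + RI ((a' + b') / 2, b', c', (c' + d') / 2) + RI (a', (a' + b') / 2, (c' + d') / 2, d')
     + RI ((a' + b') / 2, b', (c' + d') / 2, d')).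
  { unfold RI. rewrite (rect_int_split H a' ((a' + b') / 2) b' c' ((c' + d') / 2) d'); try lra.
    - eapply Rle_trans; [apply Cmod_triangle|]. apply Rplus_le_compat_r.
      eapply Rle_trans; [apply Cmod_triangle|]. apply Rplus_le_compat_r.
      apply Cmod_triangle.
    - intros s [Hs1 Hs2]. apply cdiff_continuous, Hdiff. split; lra. }
  assert (E1 : forall u, u / 2 ^ (Datatypes.S k) = u / 2 ^ k / 2) by (intros u; simpl; field; lra).
  assert (Q : forall x, RI (a', b', c', d') <= 4 * x -> RI (a, b, c, d) <= 4 ^ Datatypes.S k * x).
  { intros x Hx. simpl. apply Rle_trans with (1 := H9).
    rewrite (Rmult_comm 4), Rmult_assoc. apply Rmult_le_compat_l; lra. }
  unfold step. fold RI in S, Q |- *.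
  set (m := (a' + b') / 2) in *. set (n := (c' + d') / 2) in *.
  assert (a' <= m <= b' /\ b' - m = m - a' /\ m - a' = (b' - a') / 2) as (M1 & M2 & M3) by (unfold m; lra).
  assert (c' <= n <= d' /\ d' - n = n - c' /\ n - c' = (d' - c') / 2) as (N1 & N2 & N3) by (unfold n; lra).
  clearbody m n. clear Hdiff.
  destruct (Rle_dec _ _) as [G|G]; [|destruct (Rle_dec _ _) as [G'|G'];
    [|destruct (Rle_dec _ _) as [G''|G'']]]; unfold good, sub; rewrite !E1;
    (split; [repeat split; [..|apply Q; assumption || lra]; lra|repeat split; lra]).
Qed.

Let seqr_good (k : nat) : good k (seqr k).
Proof.
  induction k.
  - simpl. repeat split; try lra; try field. 
  - apply step_good. exact IHk.
Qed.

Let seqr_sub (k : nat) : sub (seqr (S k)) (seqr k).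
Proof. apply (step_good k). apply seqr_good. Qed.

Let lo (r : rect) := let '(a, b, c, d) := r in a.
Let hi (r : rect) := let '(a, b, c, d) := r in b.
Let lo' (r : rect) := let '(a, b, c, d) := r in c.
Let hi' (r : rect) := let '(a, b, c, d) := r in d.

Let nested_point (u v : nat -> R) :
  (forall k, u k <= u (S k)) -> (forall k, v (S k) <= v k) -> (forall k, u k <= v k) ->
  exists x, forall k, u k <= x <= v k.
Proof.
  intros Hu Hv Huv.
  assert (Mu : forall k j, u k <= u (j + k)%nat).
  { intros k j. induction j; simpl; [lra|]. specialize (Hu (j + k)%nat). lra. }
  assert (Mv : forall k j, v (j + k)%nat <= v k).
  { intros k j. induction j; simpl; [lra|]. specialize (Hv (j + k)%nat). lra. }
  assert (UV : forall j k, u j <= v k).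
  { intros j k. generalize (Mu j k) (Mv k j) (Huv (j + k)%nat). rewrite (Nat.add_comm k j). lra. }
  destruct (completeness (fun x => exists k, x = u k)) as [x [X1 X2]].
  - exists (v 0%nat). intros y [k ->]. apply UV.
  - exists (u 0%nat), 0%nat. reflexivity.
  - exists x. intros k. split.
    + apply X1. now exists k.
    + apply X2. intros y [j ->]. apply UV.
Qed.

Lemma goursat_rect : rect_int H a b c d = 0.
Proof.
  destruct (nested_point (fun k => lo (seqr k)) (fun k => hi (seqr k))) as [x0 Hx].
  1,2,3: intros k; generalize (seqr_good k) (seqr_sub k);
    destruct (seqr k) as [[[? ?] ?] ?], (seqr (S k)) as [[[? ?] ?] ?]; simpl; intros; lra.
  destruct (nested_point (fun k => lo' (seqr k)) (fun k => hi' (seqr k))) as [y0 Hy].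
  1,2,3: intros k; generalize (seqr_good k) (seqr_sub k);
    destruct (seqr k) as [[[? ?] ?] ?], (seqr (S k)) as [[[? ?] ?] ?]; simpl; intros; lra.
  set (s0 := (x0, y0) : C).
  assert (Hs0 : in_rect a b c d s0) by (specialize (Hx 0%nat); specialize (Hy 0%nat); now split).
  destruct (Hdiff s0 Hs0) as [l Hl].
  set (L := (b - a) + (d - c)). assert (HL : 0 <= L) by (unfold L; lra).
  (* Differentiability at the limit point bounds the remainder by e |s - s0|. Perimeter and diameter
     of the k-th rectangle are both of order L / 2^k, so their product cancels the factor 4^k lost
     in the bisection. *)
  assert (Key : forall e, 0 < e -> RI (a, b, c, d) <= 2 * e * (L * L)).
  { intros e He. destruct (Hl e He) as (dl & Hdl & Hz).
    assert (exists k, L / 2 ^ k < dl) as [k Hk].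
    { destruct (pow_lt_1_zero (/ 2)) with (y := dl / (1 + L)) as [N HN].
      - rewrite Rabs_pos_eq; lra.
      - apply Rdiv_lt_0_compat; lra.
      - exists N. specialize (HN N (le_n N)). rewrite Rabs_pos_eq in HN by (apply pow_le; lra).
        apply Rle_lt_trans with ((1 + L) * (/ 2) ^ N).
        + rewrite pow_inv. unfold Rdiv. apply Rmult_le_compat_r; [|lra].
          left. apply Rinv_0_lt_compat, pow_lt. lra.
        + apply Rlt_le_trans with ((1 + L) * (dl / (1 + L))).
          * apply Rmult_lt_compat_l; lra.
          * right. field. lra. }
    generalize (seqr_good k) (Hx k) (Hy k).
    destruct (seqr k) as [[[a' b'] c'] d']. simpl.
    intros (H1 & H2 & H3 & H4 & H5 & H6 & H7 & H8 & H9) Hx' Hy'.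
    assert (P2 : 0 < 2 ^ k) by (apply pow_lt; lra). assert (P4 : 0 < 4 ^ k) by (apply pow_lt; lra).
    assert (EL : (b' - a') + (d' - c') = L / 2 ^ k) by (rewrite H7, H8; unfold L; field; lra).
    assert (Bd : Cmod (rect_int H a' b' c' d') <= 2 * (L / 2 ^ k) * (e * (L / 2 ^ k))).
    { rewrite <- EL at 1. apply (rect_int_affine_bound H (H s0) l s0); auto.
      - intros s [Hs1 Hs2]. apply cdiff_continuous, Hdiff. split; lra.
      - intros s [Hs1 Hs2].
        assert (D : Cmod (s - s0) <= L / 2 ^ k).
        { rewrite <- EL. eapply Rle_trans; [apply Cmod_le_re_im|].
          destruct s as [x y]. simpl in *. apply Rplus_le_compat; apply Rabs_le; lra. }
        apply Rle_trans with (e * Cmod (s - s0)); [apply Hz; lra|].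
        apply Rmult_le_compat_l; lra. }
    apply Rle_trans with (1 := H9).
    apply Rle_trans with (4 ^ k * (2 * (L / 2 ^ k) * (e * (L / 2 ^ k)))).
    - apply Rmult_le_compat_l; [lra|exact Bd].
    - right. replace (4 ^ k) with (2 ^ k * 2 ^ k); [field; lra|].
      rewrite <- Rpow_mult_distr. f_equal; lra. }
  apply Cmod_eq_0. apply Rle_antisym; [|apply Cmod_ge_0].
  apply le_epsilon. intros e He.
  assert (P : 0 < 2 * (L * L) + 1) by nra.
  specialize (Key (e / (2 * (L * L) + 1)) (Rdiv_lt_0_compat _ _ He P)).
  apply Rle_trans with (1 := Key). rewrite Rplus_0_l.
  replace (2 * (e / (2 * (L * L) + 1)) * (L * L)) with (e * (2 * (L * L) / (2 * (L * L) + 1))) by (field; lra).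
  rewrite <- (Rmult_1_r e) at 2. apply Rmult_le_compat_l; [lra|].
  apply Rle_div_l; lra.
Qed.
End Goursat.

(** * Circular means and Cauchy's formula *)

Definition cis (t : R) : C := (cos t, sin t).
Definition cexp (s : C) : C := (RtoC (exp (Re s)) * cis (Im s))%C.

Lemma Cmod_cis (t : R) : Cmod (cis t) = 1.
Proof.
  unfold cis, Cmod; simpl. replace (_ + _) with 1; [apply sqrt_1|].
  generalize (sin2_cos2 t). unfold Rsqr. lra.
Qed.

Lemma cis_plus (s t : R) : cis (s + t) = (cis s * cis t)%C.
Proof. unfold cis, Cmult; simpl. rewrite cos_plus, sin_plus. f_equal; ring. Qed.

Lemma cis_0 : cis 0 = 1.
Proof. unfold cis. rewrite cos_0, sin_0. reflexivity. Qed.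

Lemma cis_2PI : cis (2 * PI) = 1.
Proof. unfold cis. rewrite cos_2PI, sin_2PI. reflexivity. Qed.

Lemma cis_neq_0 (t : R) : cis t <> 0.
Proof. intros E. generalize (Cmod_cis t). rewrite E, Cmod_0. lra. Qed.

Lemma cexp_plus (a b : C) : cexp (a + b)%C = (cexp a * cexp b)%C.
Proof.
  unfold cexp. destruct a, b; simpl. rewrite exp_plus, cis_plus, RtoC_mult. ring.
Qed.

Lemma Cmod_cexp (a : C) : Cmod (cexp a) = exp (Re a).
Proof.
  unfold cexp. rewrite Cmod_mult, Cmod_cis, Rmult_1_r. apply Cmod_RtoC_pos.
  left. apply exp_pos.
Qed.

Lemma cexp_neq_0 (a : C) : cexp a <> 0.
Proof. apply Cmod_gt_0. rewrite Cmod_cexp. apply exp_pos. Qed.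

Lemma cexp_0 : cexp 0 = 1.
Proof. unfold cexp. simpl. rewrite exp_0, cis_0. ring. Qed.

Lemma derivable_pt_lim_estimate (f : R -> R) (x l e : R) :
  derivable_pt_lim f x l -> 0 < e ->
  exists d, 0 < d /\ forall h, Rabs h < d -> Rabs (f (x + h) - f x - l * h) <= e * Rabs h.
Proof.
  intros H He. destruct (H e He) as [[d Hd] Hh]. exists d. split; [easy|]. intros h Hlt.
  destruct (Req_dec h 0) as [->|N].
  - rewrite Rplus_0_r, Rabs_R0. replace (f x - f x - l * 0) with 0 by ring. rewrite Rabs_R0. lra.
  - specialize (Hh h N Hlt).
    replace (f (x + h) - f x - l * h) with (((f (x + h) - f x) / h - l) * h) by (now field).
    rewrite Rabs_mult. apply Rmult_le_compat_r; [apply Rabs_pos|lra].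
Qed.

Lemma cderiv_cexp (a : C) : cderiv cexp a (cexp a).
Proof.
  intros e He. assert (P : 0 < Cmod (cexp a)) by (rewrite Cmod_cexp; apply exp_pos).
  (* Six shares: one from exp, four from cos and sin together, multiplied by |1 + x| <= 2, and one
     from the mixed term x y. *)
  set (e1 := Rmin 1 (e / Cmod (cexp a)) / 6).
  assert (He0 : 0 < Rmin 1 (e / Cmod (cexp a))) by (apply Rmin_glb_lt; [lra|now apply Rdiv_lt_0_compat]).
  assert (He1 : 0 < e1 <= 1) by (unfold e1; generalize (Rmin_l 1 (e / Cmod (cexp a))); lra).
  destruct (derivable_pt_lim_estimate exp 0 1 e1) as (d1 & Hd1 & X1); [|lra|].
  { generalize (derivable_pt_lim_exp 0). now rewrite exp_0. }
  destruct (derivable_pt_lim_estimate sin 0 1 e1) as (d2 & Hd2 & X2); [|lra|].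
  { generalize (derivable_pt_lim_sin 0). now rewrite cos_0. }
  destruct (derivable_pt_lim_estimate cos 0 0 e1) as (d3 & Hd3 & X3); [|lra|].
  { generalize (derivable_pt_lim_cos 0). now rewrite sin_0, Ropp_0. }
  exists (Rmin (Rmin d1 d2) (Rmin d3 e1)). split.
  { repeat apply Rmin_glb_lt; lra. }
  intros z Hz.
  assert (Hz1 : Cmod (z - a) < d1 /\ Cmod (z - a) < d2 /\ Cmod (z - a) < d3 /\ Cmod (z - a) < e1).
  { generalize (Rmin_l (Rmin d1 d2) (Rmin d3 e1)) (Rmin_r (Rmin d1 d2) (Rmin d3 e1))
      (Rmin_l d1 d2) (Rmin_r d1 d2) (Rmin_l d3 e1) (Rmin_r d3 e1). lra. }
  remember (z - a)%C as h eqn:Eh. replace z with (a + h)%C by (subst; ring).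
  rewrite cexp_plus.
  replace (cexp a * cexp h - cexp a - cexp a * h)%C with (cexp a * (cexp h - 1 - h))%C by ring.
  rewrite Cmod_mult. clear Eh.
  assert (A1 := re_le_Cmod h). assert (A2 := im_le_Cmod h).
  destruct h as [x y]. set (m := Cmod (x, y)) in *. simpl in A1, A2.
  specialize (X1 x ltac:(lra)). specialize (X2 y ltac:(lra)). specialize (X3 y ltac:(lra)).
  rewrite Rplus_0_l, exp_0 in X1. rewrite Rplus_0_l, sin_0 in X2. rewrite Rplus_0_l, cos_0 in X3.
  (* The remainder at 0 is expressed through the real remainders of exp, cos and sin at 0, plus the
     second-order term i x y. *)
  replace (cexp (x, y) - 1 - (x, y))%C with
    (RtoC (exp x - 1 - x) * cis y + (RtoC (1 + x) * (RtoC (cos y - 1) + Ci * RtoC (sin y - y)) + Ci * RtoC (x * y)))%C.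
  2:{ unfold cexp, cis, Ci, RtoC, Cminus, Cplus, Copp, Cmult; simpl. f_equal; ring. }
  assert (B : Cmod (RtoC (exp x - 1 - x) * cis y + (RtoC (1 + x) * (RtoC (cos y - 1) + Ci * RtoC (sin y - y)) + Ci * RtoC (x * y)))%C <= 6 * e1 * m).
  { eapply Rle_trans; [apply Cmod_triangle|]. rewrite Cmod_mult, Cmod_cis, Cmod_R.
    eapply Rle_trans. apply Rplus_le_compat_l. apply Cmod_triangle.
    rewrite !Cmod_mult, Cmod_Ci, !Cmod_R.
    assert (T : Cmod (RtoC (cos y - 1) + Ci * RtoC (sin y - y))%C <= Rabs (cos y - 1) + Rabs (sin y - y)).
    { eapply Rle_trans; [apply Cmod_triangle|]. rewrite Cmod_mult, Cmod_Ci, !Cmod_R. lra. }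
    replace (exp x - 1 - 1 * x) with (exp x - 1 - x) in X1 by ring.
    replace (sin y - 0 - 1 * y) with (sin y - y) in X2 by ring.
    replace (cos y - 1 - 0 * y) with (cos y - 1) in X3 by ring.
    assert (U : Rabs (1 + x) <= 2).
    { apply Rabs_le. generalize (Rle_abs x) (Rle_abs (-x)). rewrite Rabs_Ropp. lra. }
    rewrite Rabs_mult.
    assert (Rabs x * Rabs y <= e1 * m) by (apply Rmult_le_compat; try apply Rabs_pos; lra).
    assert (e1 * Rabs x <= e1 * m) by (apply Rmult_le_compat_l; lra).
    assert (e1 * Rabs y <= e1 * m) by (apply Rmult_le_compat_l; lra).
    assert (Rabs (1 + x) * Cmod (RtoC (cos y - 1) + Ci * RtoC (sin y - y))%C <= 2 * (2 * (e1 * m))).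
    { apply Rmult_le_compat; try apply Rabs_pos; try apply Cmod_ge_0; lra. }
    lra. }
  assert (Pm : 0 <= m) by apply Cmod_ge_0.
  apply Rle_trans with (Cmod (cexp a) * (6 * e1 * m)).
  { apply Rmult_le_compat_l; lra. }
  rewrite <- Rmult_assoc. apply Rmult_le_compat_r; [easy|].
  unfold e1. replace (6 * (Rmin 1 (e / Cmod (cexp a)) / 6)) with (Rmin 1 (e / Cmod (cexp a))) by field.
  apply Rle_trans with (Cmod (cexp a) * (e / Cmod (cexp a))).
  - apply Rmult_le_compat_l; [lra|apply Rmin_r].
  - right. field. lra.
Qed.

Lemma cdiff_cexp (a : C) : cdiff cexp a.
Proof. eexists. apply cderiv_cexp. Qed.

Lemma continuous_cis (t : R) : continuous cis t.
Proof.
  apply continuous_Cpair; apply continuity_pt_filterlim.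
  - apply continuity_cos.
  - apply continuity_sin.
Qed.

Definition avg (k : R -> C) : C := (RtoC (/ (2 * PI)) * CInt k 0 (2 * PI))%C.

Lemma TWOPI_pos : 0 < 2 * PI.
Proof. generalize PI_RGT_0; lra. Qed.

Section Avg.
Implicit Types (k g : R -> C).

Lemma is_CInt_avg k : (forall t, continuous k t) -> is_CInt k 0 (2 * PI) (RtoC (2 * PI) * avg k)%C.
Proof.
  intros H. unfold avg. rewrite Cmult_assoc, <- RtoC_mult, Rinv_r, Cmult_1_l
    by (generalize TWOPI_pos; lra).
  apply is_CInt_cont. auto.
Qed.

Lemma avg_is_CInt k (l : C) : is_CInt k 0 (2 * PI) (RtoC (2 * PI) * l)%C -> avg k = l.
Proof.
  intros H. unfold avg. rewrite (is_CInt_unique _ _ _ _ H).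
  rewrite Cmult_assoc, <- RtoC_mult, Rinv_l, Cmult_1_l; [easy|generalize TWOPI_pos; lra].
Qed.

Lemma avg_ext k g : (forall t, 0 <= t <= 2 * PI -> k t = g t) -> avg k = avg g.
Proof.
  intros H. unfold avg. f_equal. apply (RInt_ext (V := C_R_CompleteNormedModule)). intros x Hx.
  apply H. generalize TWOPI_pos; intros. rewrite Rmin_left, Rmax_right in Hx by lra. lra.
Qed.

Lemma avg_plus k g : (forall t, continuous k t) -> (forall t, continuous g t) ->
  avg (fun t => k t + g t)%C = (avg k + avg g)%C.
Proof.
  intros Hk Hg. apply avg_is_CInt. rewrite Cmult_plus_distr_l.
  apply is_CInt_plus; now apply is_CInt_avg.
Qed.

Lemma avg_mult (c : C) k : (forall t, continuous k t) -> avg (fun t => c * k t)%C = (c * avg k)%C.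
Proof.
  intros Hk. apply avg_is_CInt.
  replace (RtoC (2 * PI) * (c * avg k))%C with (c * (RtoC (2 * PI) * avg k))%C by ring.
  apply is_CInt_mult. now apply is_CInt_avg.
Qed.

Lemma avg_minus k g : (forall t, continuous k t) -> (forall t, continuous g t) ->
  avg (fun t => k t - g t)%C = (avg k - avg g)%C.
Proof.
  intros Hk Hg. replace (avg k - avg g)%C with (avg k + - (1) * avg g)%C by ring.
  rewrite <- avg_mult by easy. rewrite <- avg_plus; [apply avg_ext; intros; ring|easy|].
  intros t. apply continuous_Cmult; [apply continuous_const|apply Hg].
Qed.

Lemma avg_const (c : C) : avg (fun _ => c) = c.
Proof.
  apply avg_is_CInt. generalize (is_CInt_const c 0 (2 * PI)). now rewrite Rminus_0_r.
Qed.

Lemma avg_conj k : (forall t, continuous k t) -> avg (fun t => Cconj (k t)) = Cconj (avg k).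
Proof.
  intros Hk. apply avg_is_CInt.
  assert (I := is_CInt_avg k Hk). apply is_CInt_pair in I. destruct I as [I1 I2].
  apply is_CInt_pair. split.
  - replace (Re (RtoC (2 * PI) * Cconj (avg k))) with (Re (RtoC (2 * PI) * avg k)); [exact I1|].
    simpl. ring.
  - replace (Im (RtoC (2 * PI) * Cconj (avg k))) with (- Im (RtoC (2 * PI) * avg k)).
    + exact (is_RInt_opp _ _ _ _ I2).
    + simpl. ring.
Qed.

Lemma avg_re_le k g : (forall t, continuous k t) -> (forall t, continuous g t) ->
  (forall t, Re (k t) <= Re (g t)) -> Re (avg k) <= Re (avg g).
Proof.
  intros Hk Hg H.
  assert (I := is_CInt_avg k Hk). apply is_CInt_pair in I. destruct I as [I1 _].
  assert (J := is_CInt_avg g Hg). apply is_CInt_pair in J. destruct J as [J1 _].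
  assert (P := TWOPI_pos).
  assert (L := is_RInt_le _ _ _ _ _ _ (Rlt_le _ _ P) I1 J1 (fun t _ => H t)).
  rewrite !re_scal_l in L. nra.
Qed.

Lemma avg_norm_le k g : (forall t, continuous k t) -> (forall t, continuous g t) ->
  (forall t, Cmod (k t) <= Re (g t)) -> Cmod (avg k) <= Re (avg g).
Proof.
  intros Hk Hg H.
  assert (I := is_CInt_avg k Hk).
  assert (J := is_CInt_avg g Hg). apply is_CInt_pair in J. destruct J as [J1 _].
  assert (P := TWOPI_pos).
  assert (L := norm_RInt_le (V := C_R_NormedModule) _ _ _ _ _ _ (Rlt_le _ _ P)
     (fun t _ => (Rle_trans _ _ _ (Req_le _ _ (eq_sym (Cmod_norm (k t)))) (H t))) I J1).
  change (@norm R_AbsRing C_R_NormedModule (RtoC (2 * PI) * avg k)%C) with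
    (@norm R_AbsRing (prod_NormedModule R_AbsRing R_NormedModule R_NormedModule) (RtoC (2 * PI) * avg k)%C) in L.
  rewrite <- Cmod_norm, Cmod_mult, Cmod_RtoC_pos, re_scal_l in L by lra. nra.
Qed.

Lemma avg_bound k (M : R) : (forall t, continuous k t) ->
  (forall t, 0 <= t <= 2 * PI -> Cmod (k t) <= M) -> Cmod (avg k) <= M.
Proof.
  intros Hk H. assert (P := TWOPI_pos).
  assert (B := CInt_norm_le k 0 (2 * PI) M _ (Rlt_le _ _ P) H (is_CInt_avg k Hk)).
  rewrite Cmod_mult, Cmod_RtoC_pos in B by lra. nra.
Qed.
End Avg.

Definition circ (f : C -> C) (r : R) : C := avg (fun t => f (RtoC r * cis t)%C).

Lemma Cmod_circle (r t : R) : 0 <= r -> Cmod (RtoC r * cis t)%C = r.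
Proof. intros H. now rewrite Cmod_mult, Cmod_cis, Rmult_1_r, Cmod_RtoC_pos. Qed.

Lemma continuous_circle (r t : R) : continuous (fun t => RtoC r * cis t)%C t.
Proof. apply continuous_Cmult; [apply continuous_const|apply continuous_cis]. Qed.

Lemma continuous_on_circle (f : C -> C) (r : R) : 0 <= r ->
  (forall z, Cmod z = r -> continuous f z) ->
  forall t, continuous (fun t => f (RtoC r * cis t)%C) t.
Proof.
  intros Hr Hf t. apply (continuous_comp (fun t => RtoC r * cis t)%C f); [apply continuous_circle|].
  apply Hf. now apply Cmod_circle.
Qed.

(** Goursat's lemma for f o exp on [ln r1, ln r2] x [0, 2 PI]: the horizontal sides cancel because
    exp has period 2 PI i, and the vertical sides are the two circular means up to a common
    factor. *)
Lemma circ_invariant (f : C -> C) (r1 r2 : R) :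
  0 < r1 <= r2 -> (forall z, r1 <= Cmod z <= r2 -> cdiff f z) -> circ f r1 = circ f r2.
Proof.
  intros [P1 P2] Hf.
  assert (L : ln r1 <= ln r2) by (destruct P2 as [P2| ->]; [left; now apply ln_increasing|lra]).
  assert (D : forall s, in_rect (ln r1) (ln r2) 0 (2 * PI) s -> cdiff (fun s => f (cexp s)) s).
  { intros s [H1 _]. apply cdiff_comp; [apply cdiff_cexp|]. apply Hf. rewrite Cmod_cexp.
    rewrite <- (exp_ln r1), <- (exp_ln r2) by lra. split.
    - destruct (proj1 H1) as [A|A]; [left; now apply exp_increasing|rewrite A; lra].
    - destruct (proj2 H1) as [A|A]; [left; now apply exp_increasing|rewrite A; lra]. }
  assert (Z := goursat_rect _ _ _ _ _ L (Rlt_le _ _ TWOPI_pos) D).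
  unfold rect_int in Z.
  assert (E : CInt (fun x => f (cexp (x, 0))) (ln r1) (ln r2) = CInt (fun x => f (cexp (x, 2 * PI))) (ln r1) (ln r2)).
  { apply (RInt_ext (V := C_R_CompleteNormedModule)). intros x _. f_equal. unfold cexp. simpl.
    now rewrite cis_0, cis_2PI. }
  rewrite E in Z.
  assert (X : forall r, 0 < r -> circ f r = (RtoC (/ (2 * PI)) * CInt (fun y => f (cexp (ln r, y))) 0 (2 * PI))%C).
  { intros r Hr. unfold circ, avg. f_equal. apply (RInt_ext (V := C_R_CompleteNormedModule)).
    intros y _. unfold cexp. simpl. now rewrite exp_ln. }
  rewrite !X by lra. f_equal. 
  assert (W : forall u v w : C, (u - u + Ci * (v - w) = 0 -> w = v)%C).
  { intros u v w Hw. apply Ceq_minus.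
    replace (w - v)%C with (Ci * (u - u + Ci * (v - w)) )%C.
    - rewrite Hw. ring.
    - replace (Ci * (u - u + Ci * (v - w)))%C with ((Ci * Ci) * (v - w))%C by ring.
      replace (Ci * Ci)%C with (- (1))%C; [ring|].
      unfold Ci, Cmult, Copp, RtoC; simpl; f_equal; ring. }
  now apply W in Z.
Qed.

(** Uniformity in t comes from compactness of [0, 2 PI]: the local moduli of continuity form a gauge
    that is bounded below along a finite subcover. *)
Lemma circ_continuous (f : C -> C) (r : R) :
  0 < r -> (forall z, Cmod z = r -> continuous f z) ->
  forall e, 0 < e -> exists d, 0 < d /\ forall t r', 0 <= t <= 2 * PI -> Rabs (r' - r) < d ->
    Cmod (f (RtoC r' * cis t)%C - f (RtoC r * cis t)%C) < e.
Proof.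
  intros Hr Hf e He.
  assert (D : forall t : R, exists d : posreal, forall t' r', Rabs (t' - t) < d -> Rabs (r' - r) < d ->
    Cmod (f (RtoC r' * cis t')%C - f (RtoC r * cis t)%C) < e / 2).
  { intros t.
    destruct (proj1 (continuous_CC_iff f _) (Hf _ (Cmod_circle r t (Rlt_le _ _ Hr))) (e / 2)) as (d & Hd & H); [lra|].
    destruct (proj1 (continuous_RC_iff cis t) (continuous_cis t) (d / (2 * r))) as (d' & Hd' & H').
    { apply Rdiv_lt_0_compat; lra. }
    assert (Hm : 0 < Rmin d' (d / 2)) by (apply Rmin_glb_lt; lra).
    exists (mkposreal _ Hm). simpl. intros t' r' H1 H2. apply H.
    replace (RtoC r' * cis t' - RtoC r * cis t)%C with
      (RtoC (r' - r) * cis t' + RtoC r * (cis t' - cis t))%C by (rewrite RtoC_minus; ring).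
    eapply Rle_lt_trans; [apply Cmod_triangle|]. rewrite !Cmod_mult, Cmod_cis, Cmod_R, Cmod_RtoC_pos by lra.
    specialize (H' t' (Rlt_le_trans _ _ _ H1 (Rmin_l _ _))).
    assert (H3 := Rlt_le_trans _ _ _ H2 (Rmin_r _ _)).
    assert (r * Cmod (cis t' - cis t) < r * (d / (2 * r))) by now apply Rmult_lt_compat_l.
    replace (r * (d / (2 * r))) with (d / 2) in H0 by (field; lra). lra. }
  pose (delta := fun t => proj1_sig (constructive_indefinite_description _ (D t))).
  assert (Hdelta : forall t t' r', Rabs (t' - t) < delta t -> Rabs (r' - r) < delta t ->
    Cmod (f (RtoC r' * cis t')%C - f (RtoC r * cis t)%C) < e / 2).
  { intros t. unfold delta. now destruct (constructive_indefinite_description _ (D t)). }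
  destruct (compactness_value_1d 0 (2 * PI) delta) as [d Hd].
  exists d. split; [apply cond_pos|].
  intros t r' Ht Hr'. apply NNPP. intros N. apply (Hd t Ht). intros (u & Hu & Hu1 & Hu2).
    apply N.
    assert (A := Hdelta u t r' Hu1 ltac:(lra)).
    assert (B := Hdelta u t r Hu1). rewrite Rminus_diag, Rabs_R0 in B. specialize (B (cond_pos _)).
    replace (f (RtoC r' * cis t) - f (RtoC r * cis t))%C with
     ((f (RtoC r' * cis t) - f (RtoC r * cis u)) - (f (RtoC r * cis t) - f (RtoC r * cis u)))%C by ring.
    eapply Rle_lt_trans; [apply Cmod_minus_le|]. lra.
Qed.

(** The means are constant on either side of the circle |z| = r0 and continuous across it, so
    continuity on that circle suffices. This serves a difference quotient, which is only known to be
    continuous at its centre. *)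
Lemma circ_invariant_crossing (f : C -> C) (r0 r1 r2 : R) :
  0 < r0 -> (forall z, 0 < Cmod z <= r2 -> continuous f z) ->
  (forall z, 0 < Cmod z <= r2 -> Cmod z <> r0 -> cdiff f z) ->
  0 < r1 <= r0 -> r0 <= r2 -> circ f r1 = circ f r2.
Proof.
  intros P0 Hc Hd H1 H2.
  assert (Cst : forall r t, 0 < r <= r2 -> continuous (fun t => f (RtoC r * cis t)%C) t).
  { intros r t Hr. apply continuous_on_circle; [lra|]. intros z Hz. apply Hc. lra. }
  assert (A : forall r', 0 < r' <= r2 -> forall e, 0 < e -> exists d, 0 < d /\ forall r, 0 < r <= r2 ->
     Rabs (r - r') < d -> Cmod (circ f r - circ f r') <= e).
  { intros r' Hr' e He. destruct (circ_continuous f r') with (e := e) as (d & Hd' & H); try lra.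
    { intros z Hz. apply Hc. lra. }
    exists d. split; [easy|]. intros r Hr Hrr. unfold circ. rewrite <- avg_minus by auto.
    apply avg_bound.
    - intros t. apply continuous_Cminus; auto.
    - intros t Ht. left. now apply H. }
  assert (B : forall r, 0 < r <= r2 -> circ f r = circ f r0).
  { intros r Hr. apply Ceq_minus, Cmod_eq_0. apply Rle_antisym; [|apply Cmod_ge_0].
    apply le_epsilon. intros e He. rewrite Rplus_0_l.
    destruct (A r0 ltac:(lra) e He) as (d & Hd' & H).
    destruct (Rtotal_order r r0) as [L|[L|L]].
    - set (r' := Rmax r (r0 - d / 2)).
      assert (r <= r' < r0 /\ r0 - d / 2 <= r').
      { unfold r'. generalize (Rmax_l r (r0 - d / 2)) (Rmax_r r (r0 - d / 2)).
        intros. repeat split; try lra. apply Rmax_lub_lt; lra. }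
      rewrite (circ_invariant f r r'); [|lra|].
      + apply H; [lra|]. apply Rabs_def1; lra.
      + intros z Hz. apply Hd; lra.
    - rewrite L. replace (circ f r0 - circ f r0)%C with (RtoC 0) by ring. rewrite Cmod_0. lra.
    - set (r' := Rmin r (r0 + d / 2)).
      assert (r0 < r' <= r /\ r' <= r0 + d / 2).
      { unfold r'. generalize (Rmin_l r (r0 + d / 2)) (Rmin_r r (r0 + d / 2)).
        intros. repeat split; try lra. apply Rmin_glb_lt; lra. }
      rewrite <- (circ_invariant f r' r); [|lra|].
      + apply H; [lra|]. apply Rabs_def1; lra.
      + intros z Hz. apply Hd; lra. }
  rewrite (B r1), (B r2) by lra. reflexivity.
Qed.

(** The Cauchy integral 1 / (2 PI i) times the integral of k dz / (z - a) over |z| = r, written with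
    z = r e^{it} and dz = i z dt. *)
Definition cauchy_int (k : R -> C) (r : R) (a : C) : C :=
  avg (fun t => k t * (RtoC r * cis t / (RtoC r * cis t - a)))%C.

Lemma circle_minus_neq (r t : R) (a : C) : Cmod a < r -> (RtoC r * cis t - a <> 0)%C.
Proof.
  intros H. assert (0 <= Cmod a) by apply Cmod_ge_0.
  apply Cmod_gt_0. generalize (Cmod_triangle_inv (RtoC r * cis t) a). rewrite Cmod_circle; lra.
Qed.

Lemma continuous_cauchy_kernel (r t : R) (a : C) : Cmod a < r ->
  continuous (fun t => RtoC r * cis t / (RtoC r * cis t - a))%C t.
Proof.
  intros H. apply continuous_Cdiv; [apply continuous_circle| |now apply circle_minus_neq].
  apply continuous_Cminus; [apply continuous_circle|apply continuous_const].
Qed.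

Lemma avg_cauchy_kernel (r : R) (a : C) : Cmod a < r ->
  avg (fun t => RtoC r * cis t / (RtoC r * cis t - a))%C = 1.
Proof.
  intros H. assert (P := Cmod_ge_0 a).
  apply Ceq_minus, Cmod_eq_0. apply Rle_antisym; [|apply Cmod_ge_0].
  apply le_epsilon. intros e He. rewrite Rplus_0_l.
  (* The mean does not depend on the radius, and on a circle this large the kernel differs from 1 by
     |a| / |z - a| <= e. *)
  set (r' := r + Cmod a / e + Cmod a).
  assert (P' : 0 <= Cmod a / e) by (apply Rdiv_le_0_compat; lra).
  assert (E := circ_invariant (fun z => z / (z - a))%C r r'). unfold circ in E. rewrite E.
  - rewrite <- (avg_const 1), <- avg_minus.
    + apply avg_bound.
      * intros t. apply continuous_Cminus; [|apply continuous_const].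
        apply continuous_cauchy_kernel. unfold r'; lra.
      * intros t _. assert (N := circle_minus_neq r' t a ltac:(unfold r'; lra)).
        replace (RtoC r' * cis t / (RtoC r' * cis t - a) - 1)%C with (a / (RtoC r' * cis t - a))%C by (field; exact N).
        rewrite Cmod_div by exact N.
        assert (Q : r + Cmod a / e <= Cmod (RtoC r' * cis t - a)).
        { generalize (Cmod_triangle_inv (RtoC r' * cis t) a). rewrite Cmod_circle; unfold r'; lra. }
        apply Rle_div_l; [lra|].
        apply Rle_trans with (e * (Cmod a / e)); [right; field; lra|].
        apply Rmult_le_compat_l; lra.
    + intros t. apply continuous_cauchy_kernel. unfold r'; lra.
    + intros t. apply continuous_const.
  - unfold r'; lra.
  - intros z Hz. apply cdiff_div; [apply cdiff_id|apply cdiff_minus; [apply cdiff_id|apply cdiff_const]|].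
    apply Cmod_gt_0. generalize (Cmod_triangle_inv z a). lra.
Qed.

(** The circular means of z (f z - f a) / (z - a) do not depend on the radius and tend to 0 with it,
    because f is bounded near 0 and the factor z is small. Admitting a bounded singularity at 0 is
    what later yields Riemann's theorem on removable singularities. *)
Lemma cauchy_formula_punctured (f : C -> C) (R0 r : R) (a : C) :
  (forall z, 0 < Cmod z < R0 -> cdiff f z) ->
  (exists M d, 0 < d /\ forall z, 0 < Cmod z < d -> Cmod (f z) <= M) ->
  0 < Cmod a < r -> r < R0 ->
  f a = cauchy_int (fun t => f (RtoC r * cis t)%C) r a.
Proof.
  intros Hf (M & d & Hd & HM) Ha Hr.
  destruct (Hf a ltac:(lra)) as [l Hl].
  (* The value [l * a] is the limit at z = a, so h is continuous there; the factor z is the one in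
     dz = i z dt. *)
  set (h := fun z => if Ceq_dec z a then (l * a)%C else (z * (f z - f a) / (z - a))%C).
  assert (Hz : forall z, z <> a -> (z - a <> 0)%C) by (intros z Hz E; apply Hz; now apply Ceq_minus).
  assert (hd : forall z, 0 < Cmod z <= r -> z <> a -> cdiff h z).
  { intros z H1 H2. apply (cdiff_ext_loc (fun z => z * (f z - f a) / (z - a))%C).
    - exists (Cmod (z - a)). split; [apply Cmod_gt_0; auto|].
      intros w Hw. unfold h. destruct (Ceq_dec w a) as [->|]; [|easy].
      rewrite Cmod_minus_sym in Hw. lra.
    - apply cdiff_div; auto.
      + apply cdiff_mult; [apply cdiff_id|]. apply cdiff_minus; [apply Hf; lra|apply cdiff_const].
      + apply cdiff_minus; [apply cdiff_id|apply cdiff_const]. }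
  assert (hc : forall z, 0 < Cmod z <= r -> continuous h z).
  { intros z H1. destruct (Ceq_dec z a) as [->|N]; [|apply cdiff_continuous; auto].
    assert (Pa := Cmod_ge_0 a). assert (Pl := Cmod_ge_0 l).
    apply continuous_CC_iff. intros e He.
    destruct (Hl (e / 4 / Cmod a)) as (d1 & Hd1 & Q). { repeat apply Rdiv_lt_0_compat; lra. }
    set (d2 := e / 2 / (1 + Cmod l)).
    assert (Hd2 : 0 < d2) by (repeat apply Rdiv_lt_0_compat; lra).
    exists (Rmin (Rmin d1 (Cmod a)) d2). split; [repeat apply Rmin_glb_lt; lra|].
    intros w Hw.
    assert (W1 := Rlt_le_trans _ _ _ Hw (Rmin_r _ _)).
    assert (W2 := Rlt_le_trans _ _ _ Hw (Rmin_l _ _)).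
    assert (W3 := Rlt_le_trans _ _ _ W2 (Rmin_r _ _)).
    assert (W4 := Rlt_le_trans _ _ _ W2 (Rmin_l _ _)).
    unfold h. destruct (Ceq_dec a a) as [_|N]; [|easy].
    destruct (Ceq_dec w a) as [->|N].
    - replace (l * a - l * a)%C with (RtoC 0) by ring. now rewrite Cmod_0.
    - specialize (Q w W4). assert (N' := Hz w N).
      assert (Pw : 0 < Cmod (w - a)) by (apply Cmod_gt_0; exact N').
      replace (w * (f w - f a) / (w - a) - l * a)%C with
        (w * ((f w - f a - l * (w - a)) / (w - a)) + l * (w - a))%C by (field; exact N').
      eapply Rle_lt_trans; [apply Cmod_triangle|]. rewrite !Cmod_mult, Cmod_div by exact N'.
      assert (S1 : Cmod (f w - f a - l * (w - a)) / Cmod (w - a) <= e / 4 / Cmod a).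
      { apply Rle_div_l; lra. }
      assert (S2 : Cmod w <= 2 * Cmod a).
      { generalize (Cmod_triangle_inv w a). lra. }
      assert (S3 : Cmod w * (Cmod (f w - f a - l * (w - a)) / Cmod (w - a)) <= 2 * Cmod a * (e / 4 / Cmod a)).
      { apply Rmult_le_compat; try lra. apply Cmod_ge_0. apply Rdiv_le_0_compat; [apply Cmod_ge_0|lra]. }
      replace (2 * Cmod a * (e / 4 / Cmod a)) with (e / 2) in S3 by (field; lra).
      assert (S4 : Cmod l * Cmod (w - a) < (1 + Cmod l) * d2).
      { apply Rle_lt_trans with ((1 + Cmod l) * Cmod (w - a)); [nra|]. apply Rmult_lt_compat_l; lra. }
      replace ((1 + Cmod l) * d2) with (e / 2) in S4 by (unfold d2; field; lra). lra. }
  assert (C0 : circ h r = 0).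
  { apply Cmod_eq_0. apply Rle_antisym; [|apply Cmod_ge_0].
    apply le_epsilon. intros e He. rewrite Rplus_0_l.
    set (K := (Rabs M + Cmod (f a)) / (Cmod a / 2)).
    assert (PK : 0 <= K).
    { apply Rdiv_le_0_compat; [|lra]. generalize (Rabs_pos M) (Cmod_ge_0 (f a)); lra. }
    set (r' := Rmin (Rmin d (Cmod a)) (e / (K + 1)) / 2).
    assert (He' : 0 < e / (K + 1)) by (apply Rdiv_lt_0_compat; lra).
    assert (R1 : 0 < r' /\ r' < d /\ 2 * r' <= Cmod a /\ r' <= e / (K + 1)).
    { unfold r'. generalize (Rmin_l (Rmin d (Cmod a)) (e / (K + 1))) (Rmin_r (Rmin d (Cmod a)) (e / (K + 1)))
       (Rmin_l d (Cmod a)) (Rmin_r d (Cmod a)).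
      assert (0 < Rmin (Rmin d (Cmod a)) (e / (K + 1))) by (repeat apply Rmin_glb_lt; lra). lra. }
    rewrite <- (circ_invariant_crossing h (Cmod a) r' r); try lra; auto.
    2:{ intros z H1 H2. apply hd; auto. intros ->. lra. }
    unfold circ. apply avg_bound.
    - intros t. apply continuous_on_circle; [lra|]. intros z Hzr. apply hc. lra.
    - intros t _. unfold h. assert (Em := Cmod_circle r' t ltac:(lra)).
      set (z := (RtoC r' * cis t)%C) in *.
      destruct (Ceq_dec z a) as [E|N]; [rewrite E in Em; lra|].
      assert (D : Cmod a / 2 <= Cmod (z - a)).
      { rewrite Cmod_minus_sym. generalize (Cmod_triangle_inv a z). lra. }
      rewrite Cmod_div, Cmod_mult, Em by auto.
      apply Rle_div_l; [lra|].
      assert (F : Cmod (f z - f a) <= Rabs M + Cmod (f a)).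
      { eapply Rle_trans; [apply Cmod_minus_le|].
        generalize (HM z ltac:(lra)) (Rle_abs M). lra. }
      apply Rle_trans with (e / (K + 1) * (Rabs M + Cmod (f a))).
      { apply Rmult_le_compat; try lra. apply Cmod_ge_0. }
      replace (Rabs M + Cmod (f a)) with (K * (Cmod a / 2)) by (unfold K; field; lra).
      rewrite <- Rmult_assoc. apply Rmult_le_compat; try lra.
      { apply Rmult_le_pos; lra. }
      replace (e / (K + 1) * K) with (e * (K / (K + 1))) by (field; lra).
      rewrite <- (Rmult_1_r e) at 2. apply Rmult_le_compat_l; [lra|]. apply Rle_div_l; lra. }
  assert (Cf : forall t, continuous (fun t => f (RtoC r * cis t)%C) t).
  { apply continuous_on_circle; [lra|]. intros z E. apply cdiff_continuous, Hf. lra. }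
  assert (Ck : forall t, continuous (fun t => RtoC r * cis t / (RtoC r * cis t - a))%C t).
  { intros t. apply continuous_cauchy_kernel. lra. }
  assert (E : circ h r = (cauchy_int (fun t => f (RtoC r * cis t)%C) r a - f a * 1)%C).
  { rewrite <- (avg_cauchy_kernel r a) by lra. unfold cauchy_int.
    rewrite <- avg_mult, <- avg_minus; auto.
    - apply avg_ext. intros t _. unfold h.
      assert (N := circle_minus_neq r t a ltac:(lra)).
      destruct (Ceq_dec (RtoC r * cis t) a) as [E|_]; [exfalso; apply N; now apply (proj1 (Ceq_minus _ _))|].
      field. exact N.
    - intros t. apply continuous_Cmult; auto.
    - intros t. apply continuous_Cmult; [apply continuous_const|auto]. }
  rewrite C0 in E. symmetry. apply Ceq_minus. rewrite E. ring.
Qed.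

(** The kernel remainder is exact: 1 / (z - b) - 1 / (z - a) - (b - a) / (z - a)^2 = (b - a)^2 / ((z
    - b) (z - a)^2). Only the bound M on the boundary values enters, so the estimate is uniform over
    bounded families. *)
Lemma cauchy_int_taylor (k : R -> C) (r M : R) (a b : C) :
  (forall t, continuous k t) -> (forall t, 0 <= t <= 2 * PI -> Cmod (k t) <= M) ->
  Cmod a < r -> Cmod b < r ->
  Cmod (cauchy_int k r b - cauchy_int k r a
        - avg (fun t => k t * (RtoC r * cis t / ((RtoC r * cis t - a) * (RtoC r * cis t - a)))) * (b - a))%C
  <= M * r / ((r - Cmod b) * (r - Cmod a) ^ 2) * Cmod (b - a) ^ 2.
Proof.
  intros Hk HM Ha Hb. assert (Pa := Cmod_ge_0 a). assert (Pb := Cmod_ge_0 b).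
  assert (Nz : forall t, ((RtoC r * cis t - a) * (RtoC r * cis t - a))%C <> 0).
  { intros t. apply Cmult_neq_0; now apply circle_minus_neq. }
  assert (C1 : forall c t, Cmod c < r -> continuous (fun t => k t * (RtoC r * cis t / (RtoC r * cis t - c)))%C t).
  { intros c t Hc. apply continuous_Cmult; [apply Hk|]. now apply continuous_cauchy_kernel. }
  assert (C2 : forall t, continuous (fun t => k t * (RtoC r * cis t / ((RtoC r * cis t - a) * (RtoC r * cis t - a))))%C t).
  { intros t. apply continuous_Cmult; [apply Hk|]. apply continuous_Cdiv; [apply continuous_circle| |apply Nz].
    apply continuous_Cmult; (apply continuous_Cminus; [apply continuous_circle|apply continuous_const]). }
  assert (C3 : forall t, continuous (fun t => (b - a) * (k t * (RtoC r * cis t / ((RtoC r * cis t - a) * (RtoC r * cis t - a)))))%C t).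
  { intros t. apply continuous_Cmult; [apply continuous_const|apply C2]. }
  rewrite (Cmult_comm (avg _)), <- avg_mult by apply C2.
  unfold cauchy_int. rewrite <- avg_minus by auto. rewrite <- avg_minus; auto.
  2:{ intros t. apply continuous_Cminus; auto. }
  apply avg_bound.
  { intros t. apply continuous_Cminus; auto. apply continuous_Cminus; auto. }
  intros t Ht.
  assert (Na := circle_minus_neq r t a Ha). assert (Nb := circle_minus_neq r t b Hb).
  match goal with |- Cmod ?x <= _ => replace x with
    (k t * (RtoC r * cis t) * ((b - a) * (b - a)) / ((RtoC r * cis t - b) * ((RtoC r * cis t - a) * (RtoC r * cis t - a))))%C end.
  2:{ field. split; assumption. }
  rewrite Cmod_div by (apply Cmult_neq_0; auto).
  rewrite !Cmod_mult, Cmod_cis, Cmod_RtoC_pos, Rmult_1_r by lra.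
  assert (La : r - Cmod a <= Cmod (RtoC r * cis t - a)).
  { generalize (Cmod_triangle_inv (RtoC r * cis t) a). rewrite Cmod_circle; lra. }
  assert (Lb : r - Cmod b <= Cmod (RtoC r * cis t - b)).
  { generalize (Cmod_triangle_inv (RtoC r * cis t) b). rewrite Cmod_circle; lra. }
  assert (PM : 0 <= M) by (apply Rle_trans with (2 := HM t Ht); apply Cmod_ge_0).
  unfold Rdiv. rewrite (Rmult_assoc (M * r)), (Rmult_comm (/ _) (Cmod (b - a) ^ 2)), <- (Rmult_assoc (M * r)).
  assert (Q : 0 <= Cmod (b - a)) by apply Cmod_ge_0.
  apply Rmult_le_compat.
  - apply Rmult_le_pos; [apply Rmult_le_pos; [apply Cmod_ge_0|lra]|nra].
  - left. apply Rinv_0_lt_compat. apply Rmult_lt_0_compat; [lra|nra].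
  - simpl. rewrite Rmult_1_r. apply Rmult_le_compat_r; [nra|]. apply Rmult_le_compat_r; [lra|auto].
  - apply Rinv_le_contravar.
    + apply Rmult_lt_0_compat; [lra|]. apply pow_lt; lra.
    + simpl. rewrite Rmult_1_r. apply Rmult_le_compat; try lra; [nra|].
      apply Rmult_le_compat; lra.
Qed.

Lemma continuous_bounded_2PI (k : R -> C) :
  (forall t, continuous k t) -> exists M, 0 < M /\ forall t, 0 <= t <= 2 * PI -> Cmod (k t) <= M.
Proof.
  intros Hk. destruct (continuity_ab_maj (fun t => Cmod (k t)) 0 (2 * PI)) as (Mx & H & _).
  - apply Rlt_le, TWOPI_pos.
  - intros c _. apply continuity_pt_filterlim. apply continuous_Cmod, Hk.
  - exists (Cmod (k Mx) + 1). split; [generalize (Cmod_ge_0 (k Mx)); lra|].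
    intros t Ht. specialize (H t Ht). simpl in H. lra.
Qed.

Lemma cauchy_int_cderiv (k : R -> C) (r : R) (a : C) :
  (forall t, continuous k t) -> Cmod a < r ->
  cderiv (cauchy_int k r) a
    (avg (fun t => k t * (RtoC r * cis t / ((RtoC r * cis t - a) * (RtoC r * cis t - a))))%C).
Proof.
  intros Hk Ha e He. destruct (continuous_bounded_2PI k Hk) as (M & PM & HM).
  assert (Pa := Cmod_ge_0 a).
  set (B := M * r / ((r - Cmod a) / 2 * (r - Cmod a) ^ 2)).
  assert (PB : 0 < B).
  { apply Rdiv_lt_0_compat; [nra|]. apply Rmult_lt_0_compat; [lra|apply pow_lt; lra]. }
  exists (Rmin (e / B) ((r - Cmod a) / 2)). split.
  { apply Rmin_glb_lt; [now apply Rdiv_lt_0_compat|lra]. }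
  intros b Hb. assert (H1 := Rlt_le_trans _ _ _ Hb (Rmin_l _ _)).
  assert (H2 := Rlt_le_trans _ _ _ Hb (Rmin_r _ _)).
  assert (Lb : Cmod b < r - (r - Cmod a) / 2) by (generalize (Cmod_triangle_inv b a); lra).
  eapply Rle_trans; [apply (cauchy_int_taylor k r M a b Hk HM); lra|].
  replace (Cmod (b - a) ^ 2) with (Cmod (b - a) * Cmod (b - a)) by ring.
  rewrite <- Rmult_assoc. apply Rmult_le_compat_r; [apply Cmod_ge_0|].
  apply Rle_trans with (B * Cmod (b - a)).
  - apply Rmult_le_compat_r; [apply Cmod_ge_0|]. unfold B, Rdiv. apply Rmult_le_compat_l; [nra|].
    assert (0 < (r - Cmod a) ^ 2) by (apply pow_lt; lra).
    apply Rinv_le_contravar; [apply Rmult_lt_0_compat; lra|]. simpl. rewrite Rmult_1_r.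
    apply Rmult_le_compat_r; [nra|lra].
  - apply Rle_trans with (B * (e / B)); [apply Rmult_le_compat_l; lra|]. right; field; lra.
Qed.

Lemma cauchy_formula (f : C -> C) (R0 r : R) (a : C) :
  (forall z, Cmod z < R0 -> cdiff f z) -> Cmod a < r < R0 ->
  f a = cauchy_int (fun t => f (RtoC r * cis t)%C) r a.
Proof.
  intros Hf Hr. assert (Pa := Cmod_ge_0 a).
  assert (Ck : forall t, continuous (fun t => f (RtoC r * cis t)%C) t).
  { apply continuous_on_circle; [lra|]. intros z E. apply cdiff_continuous, Hf. lra. }
  assert (G : forall b, 0 < Cmod b < r -> f b = cauchy_int (fun t => f (RtoC r * cis t)%C) r b).
  { intros b Hb. apply (cauchy_formula_punctured f R0); try lra.
    - intros z Hz. apply Hf. lra.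
    - assert (C0 := cdiff_continuous f 0 (Hf 0 ltac:(rewrite Cmod_0; lra))).
      destruct (proj1 (continuous_CC_iff f 0) C0 1 Rlt_0_1) as (d & Hd & H).
      exists (1 + Cmod (f 0)), d. split; [easy|]. intros z Hz.
      specialize (H z). replace (z - 0)%C with z in H by ring. specialize (H ltac:(lra)).
      generalize (Cmod_triangle_inv (f z) (f 0)). lra. }
  (* The punctured formula covers a <> 0; at the centre both sides are continuous. *)
  destruct (Req_dec (Cmod a) 0) as [E|N]; [|apply G; lra].
  apply Cmod_eq_0 in E. subst a. rewrite Cmod_0 in *.
  assert (C0 := cdiff_continuous f 0 (Hf 0 ltac:(rewrite Cmod_0; lra))).
  assert (C1 := cderiv_continuous _ _ _ (cauchy_int_cderiv _ r 0 Ck ltac:(rewrite Cmod_0; lra))).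
  apply Ceq_minus, Cmod_eq_0. apply Rle_antisym; [|apply Cmod_ge_0].
  apply le_epsilon. intros e He. rewrite Rplus_0_l.
  destruct (proj1 (continuous_CC_iff _ 0) C0 (e / 2)) as (d & Hd & H); [lra|].
  destruct (proj1 (continuous_CC_iff _ 0) C1 (e / 2)) as (d' & Hd' & H'); [lra|].
  set (x := Rmin (Rmin d d') r / 2).
  assert (X : 0 < x < d /\ x < d' /\ x < r).
  { unfold x. generalize (Rmin_l (Rmin d d') r) (Rmin_r (Rmin d d') r) (Rmin_l d d') (Rmin_r d d').
    assert (0 < Rmin (Rmin d d') r) by (repeat apply Rmin_glb_lt; lra). lra. }
  specialize (H (RtoC x)). specialize (H' (RtoC x)).
  replace (RtoC x - 0)%C with (RtoC x) in H, H' by ring.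
  specialize (G (RtoC x)). rewrite Cmod_RtoC_pos in * by lra.
  specialize (H ltac:(lra)). specialize (H' ltac:(lra)).
  change (Cmod (cauchy_int (fun t : R => f (RtoC r * cis t)%C) r (RtoC x)
                - cauchy_int (fun t : R => f (RtoC r * cis t)%C) r 0)%C < e / 2) in H'.
  rewrite <- G in H' by lra.
  set (A := cauchy_int _ r 0) in *.
  replace (f 0 - A)%C with ((f x - A) - (f x - f 0))%C by ring.
  eapply Rle_trans; [apply Cmod_minus_le|]. lra.
Qed.

(** * Schwarz-Pick estimates and uniform limits *)

Definition Cdisc (c : C) (r : R) (z : C) : Prop := Cmod (z - c) < r.
Definition cdiff_on (P : C -> Prop) (f : C -> C) : Prop := forall z, P z -> cdiff f z.

Lemma cderiv_unique (f : C -> C) (a l m : C) : cderiv f a l -> cderiv f a m -> l = m.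
Proof.
  intros Hl Hm. apply Ceq_minus, Cmod_eq_0. apply Rle_antisym; [|apply Cmod_ge_0].
  apply le_epsilon. intros e He. rewrite Rplus_0_l.
  destruct (Hl (e / 2)) as (d & Hd & H); [lra|]. destruct (Hm (e / 2)) as (d' & Hd' & H'); [lra|].
  set (x := Rmin d d' / 2).
  assert (X : 0 < x < d /\ x < d').
  { unfold x. generalize (Rmin_l d d') (Rmin_r d d') (Rmin_glb_lt d d' 0 Hd Hd'). lra. }
  specialize (H (a + RtoC x)%C). specialize (H' (a + RtoC x)%C).
  replace (a + RtoC x - a)%C with (RtoC x) in H, H' by ring.
  rewrite Cmod_RtoC_pos in H, H' by lra. specialize (H ltac:(lra)). specialize (H' ltac:(lra)).
  assert (E : (RtoC x * (l - m) = (f (a + RtoC x) - f a - m * RtoC x) - (f (a + RtoC x) - f a - l * RtoC x))%C) by ring.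
  apply (f_equal Cmod) in E. rewrite Cmod_mult, Cmod_RtoC_pos in E by lra.
  assert (x * Cmod (l - m) <= x * e); [|nra]. rewrite E.
  eapply Rle_trans; [apply Cmod_minus_le|]. lra.
Qed.

Lemma cdiff_shift (f : C -> C) (c : C) (r : R) :
  cdiff_on (Cdisc c r) f -> forall z, Cmod z < r -> cdiff (fun z => f (c + z)%C) z.
Proof.
  intros H z Hz. apply cdiff_comp.
  - apply cdiff_plus; [apply cdiff_const|apply cdiff_id].
  - apply H. unfold Cdisc. now replace (c + z - c)%C with z by ring.
Qed.

Lemma cderiv_shift (f : C -> C) (c z l : C) :
  cderiv f (c + z)%C l -> cderiv (fun z => f (c + z)%C) z l.
Proof.
  intros H. replace l with (l * (0 + 1))%C by ring.
  apply (cderiv_comp f (fun z => c + z)%C); [|exact H].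
  apply cderiv_plus; [apply cderiv_const|apply cderiv_id].
Qed.

Section Disc.
Variables (f : C -> C) (c : C) (R0 : R).
Hypothesis Hf : cdiff_on (Cdisc c R0) f.

Lemma continuous_disc_circle (r : R) : 0 <= r < R0 -> forall t, continuous (fun t => f (c + RtoC r * cis t)%C) t.
Proof.
  intros Hr. apply (continuous_on_circle (fun z => f (c + z)%C)); [lra|].
  intros z Hz. apply cdiff_continuous, (cdiff_shift f c R0); auto. lra.
Qed.

Lemma mean_value (r : R) : 0 < r < R0 -> avg (fun t => f (c + RtoC r * cis t)%C) = f c.
Proof.
  intros Hr. replace (f c) with (f (c + 0)%C) by (f_equal; ring).
  rewrite (cauchy_formula (fun z => f (c + z)%C) R0 r 0 (cdiff_shift f c R0 Hf)) by (rewrite Cmod_0; lra).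
  apply avg_ext. intros t _. field. 
  assert (N := circle_minus_neq r t 0). rewrite Cmod_0 in N. specialize (N ltac:(lra)).
  split.
  - intros E. apply N. replace (RtoC r * cis t - 0)%C with (RtoC r * cis t)%C by ring. rewrite E. ring.
  - intros E. apply N. rewrite E. ring.
Qed.
End Disc.

Lemma cdiff_on_mult (P : C -> Prop) f g : cdiff_on P f -> cdiff_on P g -> cdiff_on P (fun z => f z * g z)%C.
Proof. intros Hf Hg z Hz. apply cdiff_mult; auto. Qed.

Lemma cdiff_on_const (P : C -> Prop) (c : C) : cdiff_on P (fun _ => c).
Proof. intros z _. apply cdiff_const. Qed.

Lemma cdiff_on_id (P : C -> Prop) : cdiff_on P (fun z => z).
Proof. intros z _. apply cdiff_id. Qed.

Lemma circle_in_disc (c : C) (r t R0 : R) : 0 <= r < R0 -> Cdisc c R0 (c + RtoC r * cis t)%C.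
Proof.
  intros H. unfold Cdisc. replace (c + RtoC r * cis t - c)%C with (RtoC r * cis t)%C by ring.
  rewrite Cmod_circle; lra.
Qed.

Lemma cis_conj_mult t : (cis t * Cconj (cis t))%C = 1.
Proof.
  unfold cis, Cconj, Cmult, RtoC; simpl. f_equal.
  - generalize (sin2_cos2 t). unfold Rsqr. lra.
  - ring.
Qed.

Lemma continuous_Cconj_cis t : continuous (fun t => Cconj (cis t)) t.
Proof. apply continuous_Cconj, continuous_cis. Qed.

Lemma avg_cis : avg cis = 0.
Proof.
  rewrite <- (Cmult_1_l (avg cis)). replace (RtoC 1) with (RtoC 1 * RtoC 1)%C by ring.
  generalize (mean_value (fun z => z) 0 2 (cdiff_on_id _) 1 ltac:(lra)). intros E.
  rewrite Cmult_1_l. transitivity (avg (fun t => 0 + 1 * cis t)%C); [|exact E].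
  rewrite Cmult_1_l. apply avg_ext. intros; ring.
Qed.

Section DiscDeriv.
Variables (f : C -> C) (c : C) (R0 : R).
Hypothesis Hf : cdiff_on (Cdisc c R0) f.

(** The mean value property of (z - c) f z, which vanishes at c. *)
Lemma avg_mult_cis (r : R) : 0 < r < R0 -> avg (fun t => f (c + RtoC r * cis t) * cis t)%C = 0.
Proof.
  intros Hr.
  assert (M := mean_value (fun z => (z - c) * f z)%C c R0
    ltac:(apply cdiff_on_mult; auto; intros z _; apply cdiff_minus; [apply cdiff_id|apply cdiff_const]) r Hr).
  simpl in M. replace ((c - c) * f c)%C with (RtoC 0) in M by ring.
  assert (E : (RtoC r * avg (fun t => f (c + RtoC r * cis t) * cis t))%C = 0).
  { rewrite <- avg_mult.
    - rewrite <- M. apply avg_ext. intros; ring.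
    - intros t. apply continuous_Cmult; [apply (continuous_disc_circle f c R0); auto; lra|apply continuous_cis]. }
  rewrite <- (Cmult_1_l (avg _)), <- (Cinv_l (RtoC r)), <- Cmult_assoc, E; [ring|].
  intros F. apply RtoC_inj in F. lra.
Qed.

(** Near c the function is its own Cauchy integral, whose derivative at the centre is this mean
    divided by r; derivatives are unique. *)
Lemma avg_mult_conj_cis (r : R) (l : C) : 0 < r < R0 -> cderiv f c l ->
  avg (fun t => f (c + RtoC r * cis t) * Cconj (cis t))%C = (RtoC r * l)%C.
Proof.
  intros Hr Hl.
  assert (Ck := continuous_disc_circle f c R0 Hf r ltac:(lra)).
  assert (Hr0 : RtoC r <> 0) by (intros F; apply RtoC_inj in F; lra).
  assert (D := cauchy_int_cderiv (fun t : R => f (c + RtoC r * cis t)%C) r 0 Ck ltac:(rewrite Cmod_0; lra)).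
  assert (D2 : cderiv (fun z => f (c + z)%C) 0 l).
  { apply cderiv_shift. now replace (c + 0)%C with c by ring. }
  assert (X : exists d, 0 < d /\ forall z, Cmod (z - 0) < d ->
    cauchy_int (fun t : R => f (c + RtoC r * cis t)%C) r z = f (c + z)%C).
  { exists r. split; [lra|]. intros z Hz. symmetry.
    apply (cauchy_formula (fun z => f (c + z)%C) R0 r z (cdiff_shift f c R0 Hf)).
    replace (z - 0)%C with z in Hz by ring. lra. }
  assert (E := cderiv_unique _ _ _ _ D2 (cderiv_ext_loc _ _ 0 _ X D)).
  rewrite E, <- avg_mult.
  - apply avg_ext. intros t _. assert (N := cis_neq_0 t).
    replace (Cconj (cis t)) with (/ cis t)%C; [field; now split|].
    rewrite <- (Cmult_1_r (/ cis t)), <- (cis_conj_mult t), Cmult_assoc, Cinv_l, Cmult_1_l; auto.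
  - intros t. apply continuous_Cmult; [apply Ck|].
    apply continuous_Cdiv; [apply continuous_circle| |].
    + apply continuous_Cmult; (apply continuous_Cminus; [apply continuous_circle|apply continuous_const]).
    + apply Cmult_neq_0; apply circle_minus_neq; rewrite Cmod_0; lra.
Qed.

(* The Fejér kernel 1 + cos is nonnegative of mean 1, so averaging f against its rotations stays in the unit disc. *)
Lemma fejer_bound (r : R) (l u : C) : 0 < r < R0 -> cderiv f c l ->
  (forall z, Cdisc c R0 z -> Cmod (f z) <= 1) -> Cmod u = 1 ->
  Cmod (f c + u * (RtoC (r / 2) * l))%C <= 1.
Proof.
  intros Hr Hl HM Hu.
  assert (Ck := continuous_disc_circle f c R0 Hf r ltac:(lra)).
  set (ker := fun t => (1 + / 2 * (u * Cconj (cis t) + Cconj u * cis t))%C).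
  assert (Cker : forall t, continuous ker t).
  { intros t. apply continuous_Cplus; [apply continuous_const|].
    apply continuous_Cmult; [apply continuous_const|].
    apply continuous_Cplus; apply continuous_Cmult; try apply continuous_const.
    - apply continuous_Cconj_cis.
    - apply continuous_cis. }
  assert (RE : forall t, ker t = RtoC (1 + Re (Cconj u * cis t)%C)).
  { intros t. unfold ker. rewrite RtoC_plus, re_alt, Cmult_conj, Cconj_conj. field. }
  assert (Pos : forall t, 0 <= 1 + Re (Cconj u * cis t)%C).
  { intros t. generalize (re_le_Cmod (Cconj u * cis t)%C). rewrite Cmod_mult, Cmod_conj, Cmod_cis, Hu.
    generalize (Rle_abs (- Re (Cconj u * cis t)%C)). rewrite Rabs_Ropp. lra. }
  assert (A : avg (fun t => f (c + RtoC r * cis t) * ker t)%C = (f c + u * (RtoC (r / 2) * l))%C).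
  { transitivity (avg (fun t => f (c + RtoC r * cis t) +
        (/ 2 * u) * (f (c + RtoC r * cis t) * Cconj (cis t)) + (/ 2 * Cconj u) * (f (c + RtoC r * cis t) * cis t))%C).
    { apply avg_ext. intros t _. unfold ker. ring. }
    assert (C1 : forall t, continuous (fun t => f (c + RtoC r * cis t) * Cconj (cis t))%C t).
    { intros t. apply continuous_Cmult; [apply Ck|apply continuous_Cconj_cis]. }
    assert (C2 : forall t, continuous (fun t => f (c + RtoC r * cis t) * cis t)%C t).
    { intros t. apply continuous_Cmult; [apply Ck|apply continuous_cis]. }
    rewrite avg_plus, avg_plus, !avg_mult, (mean_value f c R0 Hf), (avg_mult_conj_cis r l), (avg_mult_cis r); auto.
    - rewrite RtoC_div by lra. field.
    - intros t. apply continuous_Cmult; [apply continuous_const|apply C1].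
    - intros t. apply continuous_Cplus; [apply Ck|]. apply continuous_Cmult; [apply continuous_const|apply C1].
    - intros t. apply continuous_Cmult; [apply continuous_const|apply C2]. }
  rewrite <- A.
  apply Rle_trans with (Re (avg ker)).
  - apply avg_norm_le; auto.
    + intros t. apply continuous_Cmult; auto.
    + intros t. rewrite Cmod_mult, RE, Cmod_RtoC_pos by apply Pos. simpl (Re _).
      rewrite <- (Rmult_1_l (1 + _)) at 2. apply Rmult_le_compat_r; [apply Pos|].
      apply HM, circle_in_disc. lra.
  - right. replace 1 with (Re (RtoC 1)) by reflexivity. f_equal.
    transitivity (avg (fun t => 1 + (/ 2 * Cconj u) * cis t + (/ 2 * u) * Cconj (cis t))%C).
    { apply avg_ext. intros; unfold ker; ring. }
    assert (C1 : forall k t, continuous (fun t => (k * cis t)%C) t).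
    { intros k t. apply continuous_Cmult; [apply continuous_const|apply continuous_cis]. }
    assert (C2 : forall k t, continuous (fun t => (k * Cconj (cis t))%C) t).
    { intros k t. apply continuous_Cmult; [apply continuous_const|apply continuous_Cconj_cis]. }
    rewrite avg_plus, avg_plus, !avg_mult, avg_conj, avg_cis, avg_const; auto using continuous_const, continuous_cis, continuous_Cconj_cis.
    + replace (Cconj 0) with (RtoC 0) by (unfold Cconj, RtoC; simpl; f_equal; ring). ring.
    + intros t. apply continuous_Cplus; [apply continuous_const|apply C1].
Qed.

(** In the Fejér estimate the unimodular u is free: turning the derivative term into the direction
    of f c gives |f c| + (r / 2) |l| <= 1 for every r < R0. What matters later is that the bound is
    linear in the defect 1 - |f c|. *)
Lemma schwarz_pick_weak (l : C) : 0 < R0 -> cderiv f c l ->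
  (forall z, Cdisc c R0 z -> Cmod (f z) <= 1) ->
  R0 * Cmod l <= 2 * (1 - Cmod (f c)).
Proof.
  intros PR Hl HM.
  assert (K : forall r, 0 < r < R0 -> Cmod (f c) + r / 2 * Cmod l <= 1).
  { intros r Hr. assert (F := fun u => fejer_bound r l u Hr Hl HM).
    assert (C2 : Cmod (f c) <= 1).
    { apply HM. unfold Cdisc. replace (c - c)%C with (RtoC 0) by ring. rewrite Cmod_0. lra. }
    destruct (Ceq_dec l 0) as [->|Nl]; [rewrite Cmod_0; lra|].
    assert (Pl : 0 < Cmod l) by (now apply Cmod_gt_0).
    destruct (Ceq_dec (f c) 0) as [E|Nf].
    - specialize (F 1%C (Cmod_1)). rewrite E, Cplus_0_l, Cmult_1_l, Cmod_mult, Cmod_RtoC_pos in F by lra.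
      rewrite E, Cmod_0. lra.
    - assert (Pf : 0 < Cmod (f c)) by (now apply Cmod_gt_0).
      assert (Rl : RtoC (Cmod l) <> 0) by (intros X; apply RtoC_inj in X; lra).
      assert (Rf : RtoC (Cmod (f c)) <> 0) by (intros X; apply RtoC_inj in X; lra).
      set (d := (f c / RtoC (Cmod (f c)))%C).
      assert (Hd : Cmod d = 1).
      { unfold d. rewrite Cmod_div, Cmod_RtoC_pos by (auto; lra). field. lra. }
      set (e := (RtoC (Cmod l) / l)%C).
      assert (He : Cmod e = 1).
      { unfold e. rewrite Cmod_div, Cmod_RtoC_pos by (auto; lra). field. lra. }
      specialize (F (d * e)%C). rewrite Cmod_mult, Hd, He in F. specialize (F ltac:(ring)).
      replace (f c + d * e * (RtoC (r / 2) * l))%C with (d * RtoC (Cmod (f c) + r / 2 * Cmod l))%C in F.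
      + rewrite Cmod_mult, Hd, Cmod_RtoC_pos in F; [lra|]. nra.
      + unfold d, e. rewrite RtoC_plus, RtoC_mult. field. split; auto. }
  apply le_epsilon. intros e He.
  assert (Pl := Cmod_ge_0 l).
  set (r := Rmax (R0 / 2) (R0 - e / (1 + Cmod l))).
  assert (0 < e / (1 + Cmod l)) by (apply Rdiv_lt_0_compat; lra).
  assert (Hr : 0 < r < R0 /\ R0 - e / (1 + Cmod l) <= r).
  { unfold r. generalize (Rmax_l (R0 / 2) (R0 - e / (1 + Cmod l))) (Rmax_r (R0 / 2) (R0 - e / (1 + Cmod l))).
    intros. repeat split; try lra. apply Rmax_lub_lt; lra. }
  specialize (K r (proj1 Hr)).
  assert (R0 * Cmod l <= r * Cmod l + e / (1 + Cmod l) * Cmod l) by nra.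
  assert (e / (1 + Cmod l) * Cmod l <= e).
  { replace (e / (1 + Cmod l) * Cmod l) with (e * (Cmod l / (1 + Cmod l))) by (field; lra).
    rewrite <- (Rmult_1_r e) at 2. apply Rmult_le_compat_l; [lra|]. apply Rle_div_l; lra. }
  lra.
Qed.

(** The constant depends on M and r alone, so difference quotients converge at a rate that is
    uniform in the centre and in parameters. *)
Lemma taylor_bound (r M : R) (l h : C) : 0 < r < R0 -> cderiv f c l ->
  (forall z, Cdisc c R0 z -> Cmod (f z) <= M) -> Cmod h <= r / 2 ->
  Cmod (f (c + h) - f c - l * h)%C <= 2 * M / r ^ 2 * Cmod h ^ 2.
Proof.
  intros Hr Hl HM Hh.
  assert (Ck := continuous_disc_circle f c R0 Hf r ltac:(lra)).
  assert (PM : 0 <= M).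
  { apply Rle_trans with (Cmod (f c)); [apply Cmod_ge_0|]. apply HM.
    unfold Cdisc. replace (c - c)%C with (RtoC 0) by ring. rewrite Cmod_0. lra. }
  assert (CF := fun a Ha => cauchy_formula (fun z => f (c + z)%C) R0 r a (cdiff_shift f c R0 Hf) (conj Ha (proj2 Hr))).
  assert (D := cauchy_int_cderiv (fun t : R => f (c + RtoC r * cis t)%C) r 0 Ck ltac:(rewrite Cmod_0; lra)).
  assert (D2 : cderiv (fun z => f (c + z)%C) 0 l).
  { apply cderiv_shift. now replace (c + 0)%C with c by ring. }
  assert (X : exists d, 0 < d /\ forall z, Cmod (z - 0) < d ->
    cauchy_int (fun t : R => f (c + RtoC r * cis t)%C) r z = f (c + z)%C).
  { exists r. split; [lra|]. intros z Hz. symmetry.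
    apply (cauchy_formula (fun z => f (c + z)%C) R0 r z (cdiff_shift f c R0 Hf)).
    replace (z - 0)%C with z in Hz by ring. lra. }
  assert (E := cderiv_unique _ _ _ _ D2 (cderiv_ext_loc _ _ 0 _ X D)).
  assert (T := cauchy_int_taylor (fun t : R => f (c + RtoC r * cis t)%C) r M 0 h Ck
    ltac:(intros t _; apply HM, circle_in_disc; lra) ltac:(rewrite Cmod_0; lra) ltac:(lra)).
  cbv beta in T, E. rewrite <- E in T.
  rewrite <- !CF in T by (rewrite ?Cmod_0; lra).
  replace (h - 0)%C with h in T by ring. replace (c + 0)%C with c in T by ring.
  eapply Rle_trans; [exact T|]. apply Rmult_le_compat_r; [apply pow2_ge_0|].
  rewrite Cmod_0, Rminus_0_r.
  apply Rle_trans with (M * r / (r / 2 * r ^ 2)).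
  - unfold Rdiv. apply Rmult_le_compat_l; [nra|]. apply Rinv_le_contravar.
    + assert (0 < r ^ 2) by (apply pow_lt; lra). nra.
    + apply Rmult_le_compat_r; [apply pow2_ge_0|lra].
  - right. field. lra.
Qed.
End DiscDeriv.

(** Weierstrass' theorem: the Cauchy formula passes to the uniform limit, and a Cauchy integral of
    continuous data is holomorphic. *)
Lemma cdiff_on_uniform_limit (f : C -> C) (c : C) (R0 : R) :
  (forall e, 0 < e -> exists g, cdiff_on (Cdisc c R0) g /\ forall z, Cdisc c R0 z -> Cmod (f z - g z) <= e) ->
  cdiff_on (Cdisc c R0) f.
Proof.
  intros H.
  assert (Cf : forall z, Cdisc c R0 z -> continuous f z).
  { intros z Hz. apply continuous_CC_iff. intros e He.
    destruct (H (e / 4)) as (g & Hg & HE); [lra|].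
    destruct (proj1 (continuous_CC_iff g z) (cdiff_continuous _ _ (Hg z Hz)) (e / 4)) as (d & Hd & Hw); [lra|].
    unfold Cdisc in *.
    exists (Rmin d (R0 - Cmod (z - c))). split; [apply Rmin_glb_lt; lra|]. intros w Hwz.
    assert (W1 := Rlt_le_trans _ _ _ Hwz (Rmin_l _ _)).
    assert (W2 := Rlt_le_trans _ _ _ Hwz (Rmin_r _ _)).
    assert (Dw : Cmod (w - c) < R0).
    { replace (w - c)%C with ((w - z) + (z - c))%C by ring.
      eapply Rle_lt_trans; [apply Cmod_triangle|]. lra. }
    replace (f w - f z)%C with ((f w - g w) + ((g w - g z) - (f z - g z)))%C by ring.
    eapply Rle_lt_trans; [apply Cmod_triangle|].
    generalize (Cmod_minus_le (g w - g z) (f z - g z)) (HE w Dw) (HE z Hz) (Hw w W1). lra. }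
  intros a Ha. unfold Cdisc in Ha.
  set (r := (Cmod (a - c) + R0) / 2).
  assert (Pa := Cmod_ge_0 (a - c)).
  assert (Hr : Cmod (a - c) < r < R0) by (unfold r; lra).
  assert (Ck : forall t, continuous (fun t => f (c + RtoC r * cis t)%C) t).
  { intros t. apply (continuous_comp (fun t => c + RtoC r * cis t)%C f).
    - apply continuous_Cplus; [apply continuous_const|apply continuous_circle].
    - apply Cf, circle_in_disc. lra. }
  assert (D := cauchy_int_cderiv _ r (a - c)%C Ck ltac:(lra)).
  eexists.
  assert (D' := cderiv_comp _ (fun z => z - c)%C a _ _ (cderiv_plus _ _ _ _ _ (cderiv_id a) (cderiv_const (- c)%C a)) D).
  revert D'. apply cderiv_ext_loc. exists (r - Cmod (a - c)). split; [lra|].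
  intros z Hz. change (cauchy_int (fun t : R => f (c + RtoC r * cis t)%C) r (z - c)%C = f z).
  assert (Dz : Cmod (z - c) < r).
  { replace (z - c)%C with ((z - a) + (a - c))%C by ring.
    eapply Rle_lt_trans; [apply Cmod_triangle|]. lra. }
  apply Ceq_minus, Cmod_eq_0. apply Rle_antisym; [|apply Cmod_ge_0].
  apply le_epsilon. intros e He. rewrite Rplus_0_l.
  (* The error of the approximant is magnified by at most r / (r - |z - c|) in the Cauchy integral
     and enters once more at z itself. *)
  set (B := 1 + r / (r - Cmod (z - c))).
  assert (PB : 1 <= B).
  { unfold B. assert (0 <= r / (r - Cmod (z - c))) by (apply Rdiv_le_0_compat; lra). lra. }
  destruct (H (e / B)) as (g & Hg & HE); [apply Rdiv_lt_0_compat; lra|].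
  assert (Cg := continuous_disc_circle g c R0 Hg r ltac:(lra)).
  assert (G := cauchy_formula (fun z => g (c + z)%C) R0 r (z - c)%C (cdiff_shift g c R0 Hg) ltac:(lra)).
  simpl in G. replace (c + (z - c))%C with z in G by ring.
  replace (cauchy_int (fun t => f (c + RtoC r * cis t)%C) r (z - c) - f z)%C
    with ((cauchy_int (fun t => f (c + RtoC r * cis t)%C) r (z - c) - g z) - (f z - g z))%C by ring.
  eapply Rle_trans; [apply Cmod_minus_le|].
  assert (HEz := HE z ltac:(unfold Cdisc; lra)).
  assert (X : Cmod (cauchy_int (fun t => f (c + RtoC r * cis t)%C) r (z - c) - g z) <= e / B * (r / (r - Cmod (z - c)))).
  { rewrite G. unfold cauchy_int. rewrite <- avg_minus.
    - apply avg_bound.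
      + intros t. apply continuous_Cminus; (apply continuous_Cmult; [auto|apply continuous_cauchy_kernel; lra]).
      + intros t _.
        assert (N := circle_minus_neq r t (z - c)%C ltac:(lra)).
        replace (f (c + RtoC r * cis t) * (RtoC r * cis t / (RtoC r * cis t - (z - c))) -
          g (c + RtoC r * cis t) * (RtoC r * cis t / (RtoC r * cis t - (z - c))))%C with
          ((f (c + RtoC r * cis t) - g (c + RtoC r * cis t)) * (RtoC r * cis t / (RtoC r * cis t - (z - c))))%C by ring.
        rewrite Cmod_mult, Cmod_div, Cmod_circle by (auto; lra).
        apply Rmult_le_compat; [apply Cmod_ge_0| |apply HE, circle_in_disc; lra|].
        * apply Rdiv_le_0_compat; [lra|now apply Cmod_gt_0].
        * unfold Rdiv. apply Rmult_le_compat_l; [lra|]. apply Rinv_le_contravar; [lra|].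
          generalize (Cmod_triangle_inv (RtoC r * cis t) (z - c)). rewrite Cmod_circle; lra.
    - intros t. apply continuous_Cmult; [auto|apply continuous_cauchy_kernel; lra].
    - intros t. apply continuous_Cmult; [auto|apply continuous_cauchy_kernel; lra]. }
  apply Rle_trans with (e / B * (r / (r - Cmod (z - c))) + e / B);
  [apply Rplus_le_compat; [exact X|exact HEz]|].
  right. replace (r / (r - Cmod (z - c))) with (B - 1) by (unfold B; ring). field. lra.
Qed.

(** * Maximum principle and Harnack inequality *)

(** Difference quotients with a fixed step are holomorphic and, f being bounded, converge to f'
    uniformly near a. *)
Lemma cdiff_on_deriv (f f' : C -> C) (c : C) (R0 M : R) :
  (forall z, Cdisc c R0 z -> cderiv f z (f' z)) ->
  (forall z, Cdisc c R0 z -> Cmod (f z) <= M) -> cdiff_on (Cdisc c R0) f'.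
Proof.
  intros Hd HM a Ha. unfold Cdisc in Ha.
  (* A quarter of the distance of a to the boundary: a disc of radius 2 r around any point of the
     disc of radius r about a still fits. *)
  set (r := (R0 - Cmod (a - c)) / 4). assert (Hr : 0 < r) by (unfold r; lra).
  assert (In : forall z w, Cmod (z - a) < r -> Cmod (w - z) < 2 * r -> Cdisc c R0 w).
  { intros z w Hz Hw. unfold Cdisc. replace (w - c)%C with ((w - z) + ((z - a) + (a - c)))%C by ring.
    eapply Rle_lt_trans; [apply Cmod_triangle|]. generalize (Cmod_triangle (z - a) (a - c)). unfold r in *. lra. }
  assert (U : cdiff_on (Cdisc a r) f').
  { apply cdiff_on_uniform_limit. intros e He.
    assert (PM : 0 <= M) by (apply Rle_trans with (2 := HM a Ha); apply Cmod_ge_0).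
    set (K := 2 * M / r ^ 2 + 1).
    assert (PK : 1 <= K).
    { unfold K. assert (0 <= 2 * M / r ^ 2) by (apply Rdiv_le_0_compat; [lra|apply pow_lt; lra]). lra. }
    set (h := Rmin (e / K) (r / 2)).
    assert (Hh : 0 < h) by (apply Rmin_glb_lt; [apply Rdiv_lt_0_compat; lra|lra]).
    assert (Hh1 : h <= e / K) by apply Rmin_l. assert (Hh2 : h <= r / 2) by apply Rmin_r.
    assert (Nh : RtoC h <> 0) by (intros X; apply RtoC_inj in X; lra).
    exists (fun z => (f (z + RtoC h) - f z) / RtoC h)%C. split.
    - intros z Hz. apply cdiff_div; [|apply cdiff_const|exact Nh].
      apply cdiff_minus.
      + apply cdiff_comp; [apply cdiff_plus; [apply cdiff_id|apply cdiff_const]|].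
        eexists. apply Hd. apply (In z); [exact Hz|].
        replace (z + RtoC h - z)%C with (RtoC h) by ring. rewrite Cmod_RtoC_pos; lra.
      + eexists. apply Hd. apply (In z); [exact Hz|].
        replace (z - z)%C with (RtoC 0) by ring. rewrite Cmod_0. lra.
    - intros z Hz.
      assert (T := taylor_bound f z (2 * r)
        ltac:(intros w Hw; eexists; apply Hd; apply (In z); auto) r M (f' z) (RtoC h) ltac:(lra)
        (Hd z (In z z Hz ltac:(replace (z - z)%C with (RtoC 0) by ring; rewrite Cmod_0; lra)))
        ltac:(intros w Hw; apply HM; apply (In z); auto) ltac:(rewrite Cmod_RtoC_pos; lra)).
      rewrite Cmod_RtoC_pos in T by lra.
      replace (f' z - (f (z + RtoC h) - f z) / RtoC h)%C with
        (- ((f (z + RtoC h) - f z - f' z * RtoC h) / RtoC h))%C by (field; exact Nh).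
      rewrite Cmod_opp, Cmod_div, Cmod_RtoC_pos by (auto; lra). apply Rle_div_l; [lra|].
      apply Rle_trans with (1 := T).
      apply Rle_trans with (K * h ^ 2).
      + apply Rmult_le_compat_r; [apply pow2_ge_0|unfold K; lra].
      + replace (K * h ^ 2) with ((K * h) * h) by ring. apply Rmult_le_compat_r; [lra|].
        apply Rle_trans with (K * (e / K)); [apply Rmult_le_compat_l; lra|right; field; lra]. }
  apply U. unfold Cdisc. replace (a - a)%C with (RtoC 0) by ring. rewrite Cmod_0. lra.
Qed.

(** If x > M, then (x / M)^n grows at least linearly by Bernoulli's inequality and exceeds K. *)
Lemma pow_ratio_le (x M K : R) : 0 <= x -> 0 <= M ->
  (forall n, x ^ S n <= K * M ^ S n) -> x <= M.
Proof.
  intros Hx HM H. destruct (Rle_dec x M) as [|N]; [easy|]. exfalso. apply Rnot_le_lt in N.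
  destruct HM as [HM|HM].
  2:{ specialize (H 0%nat). simpl in H. subst M. lra. }
  set (u := x / M - 1).
  assert (Pu : 0 < u).
  { unfold u. assert (1 < x / M); [|lra]. apply Rlt_div_r; lra. }
  destruct (INR_unbounded (Rabs K / u)) as [n Hn].
  specialize (H n).
  assert (PMn : 0 < M ^ S n) by now apply pow_lt.
  assert (E : x ^ S n = (1 + u) ^ S n * M ^ S n).
  { rewrite <- Rpow_mult_distr. f_equal. unfold u. field. lra. }
  rewrite E in H. apply Rmult_le_reg_r in H; [|easy].
  assert (B := poly (S n) u Pu). rewrite S_INR in B.
  assert (Rabs K < INR n * u) by (apply Rlt_div_l in Hn; lra).
  generalize (Rle_abs K). lra.
Qed.

(** Cauchy's formula for the powers of f bounds |f a|^n by (r / (r - |a - c|)) M^n; the constant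
    disappears in the n-th root. *)
Lemma max_principle (f : C -> C) (c a : C) (R0 r M : R) :
  cdiff_on (Cdisc c R0) f -> Cmod (a - c) < r < R0 ->
  (forall t, 0 <= t <= 2 * PI -> Cmod (f (c + RtoC r * cis t)%C) <= M) -> Cmod (f a) <= M.
Proof.
  intros Hf Hr HM. assert (Pa := Cmod_ge_0 (a - c)).
  assert (PM : 0 <= M).
  { apply Rle_trans with (Cmod (f (c + RtoC r * cis 0)%C)); [apply Cmod_ge_0|].
    apply HM. generalize TWOPI_pos; lra. }
  apply pow_ratio_le with (K := r / (r - Cmod (a - c))); [apply Cmod_ge_0|easy|].
  intros n. rewrite <- Cmod_pow.
  set (g := fun z => (f z ^ S n)%C).
  assert (Hg : cdiff_on (Cdisc c R0) g) by (intros z Hz; apply cdiff_pow, Hf, Hz).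
  assert (G := cauchy_formula (fun z => g (c + z)%C) R0 r (a - c)%C (cdiff_shift g c R0 Hg) Hr).
  simpl in G. replace (c + (a - c))%C with a in G by ring.
  change (Cmod (g a) <= r / (r - Cmod (a - c)) * M ^ S n). rewrite G.
  unfold cauchy_int. apply avg_bound.
  - intros t. apply continuous_Cmult; [|apply continuous_cauchy_kernel; lra].
    apply (continuous_disc_circle g c R0 Hg). lra.
  - intros t Ht. assert (N := circle_minus_neq r t (a - c)%C ltac:(lra)).
    rewrite Cmod_mult, Cmod_div, Cmod_circle, Rmult_comm by (auto; lra).
    apply Rmult_le_compat.
    + apply Rdiv_le_0_compat; [lra|now apply Cmod_gt_0].
    + apply Cmod_ge_0.
    + unfold Rdiv. apply Rmult_le_compat_l; [lra|]. apply Rinv_le_contravar; [lra|].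
      generalize (Cmod_triangle_inv (RtoC r * cis t) (a - c)). rewrite Cmod_circle; lra.
    + unfold g. rewrite Cmod_pow. apply pow_incr. split; [apply Cmod_ge_0|now apply HM].
Qed.

(* Poisson: f(a) = avg f P with P = zeta/(zeta-a) + conj(a/(zeta-a)), since f(z) conj(a) z/(r^2-conj(a) z)
   is holomorphic and vanishes at the centre. *)
Lemma harnack (f : C -> C) (R0 r : R) (a : C) :
  cdiff_on (Cdisc 0 R0) f -> Cmod a < r < R0 ->
  (forall z, Cdisc 0 R0 z -> Re (f z) <= 1) ->
  1 - Re (f a) <= (r + Cmod a) / (r - Cmod a) * (1 - Re (f 0)).
Proof.
  intros Hf Hr H1. assert (Pa := Cmod_ge_0 a).
  assert (Sh : forall z, Cmod z < R0 -> Cdisc 0 R0 z).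
  { intros z Hz. unfold Cdisc. now replace (z - 0)%C with z by ring. }
  set (u := fun z => (1 - f z)%C).
  assert (Hu : forall z, Cmod z < R0 -> cdiff u z).
  { intros z Hz. apply cdiff_minus; [apply cdiff_const|apply Hf, Sh, Hz]. }
  assert (Cu : forall t, continuous (fun t => u (RtoC r * cis t)%C) t).
  { apply continuous_on_circle; [lra|]. intros z Hz. apply cdiff_continuous, Hu. lra. }
  set (P := fun t => (RtoC r * cis t / (RtoC r * cis t - a) +
                     Cconj a * (RtoC r * cis t) / (RtoC (r * r) - Cconj a * (RtoC r * cis t)))%C).
  assert (Nz2 : forall z, Cmod z * Cmod a < r * r -> (RtoC (r * r) - Cconj a * z)%C <> 0).
  { intros z Hz. apply Cmod_gt_0.
    generalize (Cmod_triangle_inv (RtoC (r * r)) (Cconj a * z)).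
    rewrite Cmod_mult, Cmod_conj, Cmod_RtoC_pos by nra. lra. }
  assert (Nt2 : forall t, (RtoC (r * r) - Cconj a * (RtoC r * cis t))%C <> 0).
  { intros t. apply Nz2. rewrite Cmod_circle by lra. nra. }
  assert (E0 : avg (fun t => u (RtoC r * cis t) * (Cconj a * (RtoC r * cis t) / (RtoC (r * r) - Cconj a * (RtoC r * cis t))))%C = 0).
  { set (R1 := if Req_EM_T (Cmod a) 0 then R0 else Rmin R0 (r * r / Cmod a)).
    assert (HR1 : r < R1 <= R0 /\ forall x, 0 <= x < R1 -> x * Cmod a < r * r).
    { unfold R1. destruct (Req_EM_T (Cmod a) 0) as [E|E].
      - split; [lra|]. intros x Hx. rewrite E. nra.
      - assert (Cmod a > 0) by lra.
        split; [split; [|apply Rmin_l]|].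
        + apply Rmin_glb_lt; [lra|]. apply Rlt_div_r; nra.
        + intros x Hx. apply Rlt_div_r; [lra|]. apply Rlt_le_trans with (1 := proj2 Hx). apply Rmin_r. }
    assert (M := mean_value (fun z => u z * (Cconj a * z / (RtoC (r * r) - Cconj a * z)))%C 0 R1
      ltac:(intros z Hz; unfold Cdisc in Hz; replace (z - 0)%C with z in Hz by ring;
            apply cdiff_mult; [apply Hu; lra|]; apply cdiff_div;
            [apply cdiff_mult; [apply cdiff_const|apply cdiff_id]
            |apply cdiff_minus; [apply cdiff_const|apply cdiff_mult; [apply cdiff_const|apply cdiff_id]]
            |apply Nz2, HR1; split; [apply Cmod_ge_0|exact Hz]]) r ltac:(lra)).
    simpl in M. rewrite Cmult_0_r in M. unfold Cdiv at 2 in M. rewrite Cmult_0_l, Cmult_0_r in M.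
    rewrite <- M. apply avg_ext. intros t _. now rewrite !Cplus_0_l. }
  assert (CP2 : forall t, continuous (fun t => Cconj a * (RtoC r * cis t) / (RtoC (r * r) - Cconj a * (RtoC r * cis t)))%C t).
  { intros t. apply continuous_Cdiv.
    - apply continuous_Cmult; [apply continuous_const|apply continuous_circle].
    - apply continuous_Cminus; [apply continuous_const|].
      apply continuous_Cmult; [apply continuous_const|apply continuous_circle].
    - apply Nt2. }
  assert (EA : avg (fun t => u (RtoC r * cis t) * P t)%C = u a).
  { rewrite (cauchy_formula u R0 r a Hu Hr). unfold cauchy_int.
    transitivity (avg (fun t => u (RtoC r * cis t) * (RtoC r * cis t / (RtoC r * cis t - a)) +
      u (RtoC r * cis t) * (Cconj a * (RtoC r * cis t) / (RtoC (r * r) - Cconj a * (RtoC r * cis t))))%C).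
    - apply avg_ext. intros t _. unfold P. ring.
    - rewrite avg_plus, E0; [ring|..].
      + intros t. apply continuous_Cmult; [apply Cu|apply continuous_cauchy_kernel; lra].
      + intros t. apply continuous_Cmult; [apply Cu|apply CP2]. }
  (* The kernel is the classical Poisson kernel (r^2 - |a|^2) / |z - a|^2: real, nonnegative, and
     largest where z is closest to a. *)
  assert (PR : forall t, exists x, 0 <= x <= (r + Cmod a) / (r - Cmod a) /\ P t = RtoC x).
  { intros t. set (m := Cmod (RtoC r * cis t - a)).
    assert (Na := circle_minus_neq r t a ltac:(lra)).
    assert (Hm : r - Cmod a <= m).
    { unfold m. generalize (Cmod_triangle_inv (RtoC r * cis t) a). rewrite Cmod_circle; lra. }
    exists ((r * r - Cmod a * Cmod a) / (m * m)). split; [split|].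
    - apply Rdiv_le_0_compat; nra.
    - replace ((r + Cmod a) / (r - Cmod a)) with ((r * r - Cmod a * Cmod a) / ((r - Cmod a) * (r - Cmod a))) by (field; lra).
      unfold Rdiv. apply Rmult_le_compat_l; [nra|]. apply Rinv_le_contravar; [nra|].
      apply Rmult_le_compat; lra.
    - assert (Hc := cis_conj_mult t).
      assert (Em : RtoC (m * m) = ((RtoC r * cis t - a) * (RtoC r * Cconj (cis t) - Cconj a))%C).
      { unfold m. generalize (Cmod2_conj (RtoC r * cis t - a)). rewrite Cminus_conj, Cmult_conj.
        replace (Cconj (RtoC r)) with (RtoC r) by (unfold Cconj, RtoC; simpl; f_equal; ring).
        simpl. rewrite Rmult_1_r. easy. }
      assert (Ea : RtoC (Cmod a * Cmod a) = (a * Cconj a)%C).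
      { generalize (Cmod2_conj a). simpl. rewrite Rmult_1_r. easy. }
      assert (Nm : RtoC (m * m) <> 0) by (intros X; apply RtoC_inj in X; nra).
      rewrite RtoC_div by nra. rewrite RtoC_minus, Ea.
      assert (Q : (RtoC (r * r) - Cconj a * (RtoC r * cis t))%C = (RtoC r * cis t * (RtoC r * Cconj (cis t) - Cconj a))%C).
      { replace (RtoC r * cis t * (RtoC r * Cconj (cis t) - Cconj a))%C with
          (RtoC r * RtoC r * (cis t * Cconj (cis t)) - Cconj a * (RtoC r * cis t))%C by ring.
        rewrite Hc, RtoC_mult. ring. }
      assert (N2 := Nt2 t). rewrite Q in N2.
      unfold P. rewrite Q, Em, RtoC_mult.
      assert (Nb : (RtoC r * Cconj (cis t) - Cconj a)%C <> 0) by (intros X; apply N2; rewrite X; ring).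
      assert (Nr : RtoC r <> 0) by (intros X; apply N2; rewrite X; ring).
      assert (Nc := cis_neq_0 t).
      replace (RtoC r * RtoC r)%C with (RtoC r * RtoC r * (cis t * Cconj (cis t)))%C by (rewrite Hc; ring).
      field. repeat split; auto. }
  assert (L : Re (avg (fun t => u (RtoC r * cis t) * P t)%C) <=
     Re (avg (fun t => RtoC ((r + Cmod a) / (r - Cmod a)) * u (RtoC r * cis t))%C)).
  { apply avg_re_le.
    - intros t. apply continuous_Cmult; [apply Cu|]. apply continuous_Cplus; [apply continuous_cauchy_kernel; lra|apply CP2].
    - intros t. apply continuous_Cmult; [apply continuous_const|apply Cu].
    - intros t. destruct (PR t) as (x & Hx & ->). rewrite re_scal_r, re_scal_l, Rmult_comm.
      apply Rmult_le_compat_r; [|lra]. unfold u.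
      assert (Z := H1 _ (Sh _ (Rle_lt_trans _ _ _ (Req_le _ _ (Cmod_circle r t ltac:(lra))) (proj2 Hr)))).
      unfold Cminus. rewrite re_plus, re_opp. simpl. simpl in Z. lra. }
  rewrite EA, avg_mult, re_scal_l in L by exact Cu.
  assert (M := mean_value u 0 R0 ltac:(intros z Hz; apply Hu; unfold Cdisc in Hz; now replace (z - 0)%C with z in Hz by ring) r ltac:(lra)).
  replace (avg (fun t => u (RtoC r * cis t)%C)) with (u 0) in L.
  - unfold u, Cminus in L. rewrite !re_plus, !re_opp in L. exact L.
  - rewrite <- M. apply avg_ext. intros t _. now rewrite Cplus_0_l.
Qed.

Lemma unit_direction (w : C) : exists u : C, Cmod u = 1 /\ (u * w)%C = RtoC (Cmod w).
Proof.
  destruct (Ceq_dec w 0) as [->|N].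
  - exists 1. rewrite Cmod_1, Cmod_0. split; [easy|ring].
  - assert (P : 0 < Cmod w) by (now apply Cmod_gt_0).
    exists (RtoC (Cmod w) / w)%C. split.
    + rewrite Cmod_div, Cmod_RtoC_pos by (auto; lra). field. lra.
    + field. exact N.
Qed.

(** Rotate f so that f c becomes its modulus m and apply Harnack to the real part: with w the
    rotated value of f a, 1 - Re w is at most a multiple of 1 - m. Since |w| <= 1, closeness of Re w
    to 1 forces closeness of w to 1, at the price of the square. *)
Lemma near_constant (f : C -> C) (c a : C) (R0 r : R) :
  cdiff_on (Cdisc c R0) f -> (forall z, Cdisc c R0 z -> Cmod (f z) <= 1) ->
  Cmod (a - c) < r < R0 ->
  Cmod (f a - f c) ^ 2 <= 8 * r / (r - Cmod (a - c)) * (1 - Cmod (f c)).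
Proof.
  intros Hf H1 Hr. assert (Pa := Cmod_ge_0 (a - c)).
  destruct (unit_direction (f c)) as (u & Hu & Eu).
  assert (Inc : Cdisc c R0 c) by (unfold Cdisc; replace (c - c)%C with (RtoC 0) by ring; rewrite Cmod_0; lra).
  assert (Ina : Cdisc c R0 a) by (unfold Cdisc; lra).
  set (g := fun z => (u * f (c + z))%C).
  assert (G : cdiff_on (Cdisc 0 R0) g).
  { intros z Hz. apply cdiff_mult; [apply cdiff_const|]. apply (cdiff_shift f c R0 Hf).
    unfold Cdisc in Hz. now replace (z - 0)%C with z in Hz by ring. }
  assert (Hn := harnack g R0 r (a - c)%C G Hr).
  assert (G1 : forall z, Cdisc 0 R0 z -> Re (g z) <= 1).
  { intros z Hz. apply Rle_trans with (Cmod (g z)).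
    - eapply Rle_trans; [apply Rle_abs|]. apply re_le_Cmod.
    - unfold g. rewrite Cmod_mult, Hu, Rmult_1_l. apply H1. unfold Cdisc in *.
      replace (c + z - c)%C with (z - 0)%C by ring. exact Hz. }
  specialize (Hn G1). unfold g in Hn.
  replace (c + (a - c))%C with a in Hn by ring. replace (c + 0)%C with c in Hn by ring.
  rewrite Eu in Hn. simpl (Re (RtoC _)) in Hn.
  assert (B : Cmod (f a - f c) ^ 2 = Cmod (u * f a - RtoC (Cmod (f c))) ^ 2).
  { rewrite <- Eu. replace (u * f a - u * f c)%C with (u * (f a - f c))%C by ring. now rewrite Cmod_mult, Hu, Rmult_1_l. }
  rewrite B, Cmod2_alt.
  set (w := (u * f a)%C) in *. assert (Ew : Re w ^ 2 + Im w ^ 2 <= 1).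
  { rewrite <- Cmod2_alt. unfold w. rewrite Cmod_mult, Hu, Rmult_1_l.
    rewrite <- (pow1 2). apply pow_incr. split; [apply Cmod_ge_0|now apply H1]. }
  replace (Re (w - RtoC (Cmod (f c)))) with (Re w - Cmod (f c)) by (unfold Cminus; rewrite re_plus; simpl; ring).
  replace (Im (w - RtoC (Cmod (f c)))) with (Im w) by (unfold Cminus; rewrite im_plus; simpl; ring).
  assert (Q0 := Cmod_ge_0 (f c)). assert (Q1 := H1 c Inc).
  set (K := (r + Cmod (a - c)) / (r - Cmod (a - c))) in *.
  assert (HK : 1 <= K) by (unfold K; apply Rle_div_r; lra).
  apply Rle_trans with (4 * K * (1 - Cmod (f c))).
  - assert (Rw : Re w <= 1) by nra.
    assert (0 <= (1 - Cmod (f c)) * (1 - Re w)) by (apply Rmult_le_pos; lra).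
    (* With m = |f c| and |w| <= 1, the right side exceeds |w - m|^2 by at least 2 (1 - m) (1 - Re
       w) + 1 - m^2. *)
    apply Rle_trans with (2 * (1 - Re w) + 2 * (1 - Cmod (f c))); [nra|].
    assert (1 - Cmod (f c) <= K * (1 - Cmod (f c))) by nra. lra.
  - apply Rmult_le_compat_r; [lra|]. unfold K, Rdiv. rewrite <- Rmult_assoc.
    apply Rmult_le_compat_r; [left; apply Rinv_0_lt_compat; lra|lra].
Qed.

(** Off c the function agrees with its Cauchy integral over a circle around c, and that integral is
    holomorphic at c as well; v is its value there. *)
Lemma removable (f : C -> C) (c : C) (R0 : R) : 0 < R0 ->
  (forall z, Cdisc c R0 z -> z <> c -> cdiff f z) ->
  (exists M d, 0 < d /\ forall z, Cmod (z - c) < d -> z <> c -> Cmod (f z) <= M) ->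
  exists v, cdiff (fun z => if Ceq_dec z c then v else f z) c.
Proof.
  intros PR Hf (M & d & Hd & HM).
  set (r := R0 / 2). assert (Hr : 0 < r < R0) by (unfold r; lra).
  set (g := fun z => f (c + z)%C).
  assert (Hg : forall z, 0 < Cmod z < R0 -> cdiff g z).
  { intros z Hz. apply (cdiff_comp f (fun z => c + z)%C); [apply cdiff_plus; [apply cdiff_const|apply cdiff_id]|].
    apply Hf.
    - unfold Cdisc. replace (c + z - c)%C with z by ring. lra.
    - intros E. assert (z = 0) by (replace z with (c + z - c)%C by ring; rewrite E; ring).
      subst z. rewrite Cmod_0 in Hz. lra. }
  assert (Bg : exists M d, 0 < d /\ forall z, 0 < Cmod z < d -> Cmod (g z) <= M).
  { exists M, d. split; [easy|]. intros z Hz. apply HM.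
    - replace (c + z - c)%C with z by ring. lra.
    - intros E. assert (z = 0) by (replace z with (c + z - c)%C by ring; rewrite E; ring).
      subst z. rewrite Cmod_0 in Hz. lra. }
  assert (Ck : forall t, continuous (fun t : R => g (RtoC r * cis t)%C) t).
  { apply continuous_on_circle; [lra|]. intros z Hz. apply cdiff_continuous, Hg. lra. }
  set (F := cauchy_int (fun t : R => g (RtoC r * cis t)%C) r).
  assert (EF : forall z, 0 < Cmod z < r -> g z = F z).
  { intros z Hz. apply (cauchy_formula_punctured g R0); auto; lra. }
  exists (F 0). apply (cdiff_ext_loc (fun z => F (z - c)%C)).
  - exists r. split; [lra|]. intros z Hz. destruct (Ceq_dec z c) as [->|N].
    + f_equal. ring.
    + rewrite <- EF. unfold g. f_equal. ring. split; [|easy].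
      apply Cmod_gt_0. intros E. apply N. now apply Ceq_minus.
  - apply (cdiff_comp F (fun z => z - c)%C); [apply cdiff_minus; [apply cdiff_id|apply cdiff_const]|].
    eexists. apply (cauchy_int_cderiv (fun t : R => g (RtoC r * cis t)%C)); [exact Ck|].
    replace (c - c)%C with (RtoC 0) by ring. rewrite Cmod_0. lra.
Qed.

(** * Proper maps of the unit disc *)

Lemma Cdisc_0 (r : R) z : Cdisc 0 r z <-> Cmod z < r.
Proof. unfold Cdisc. now replace (z - 0)%C with z by ring. Qed.

Lemma unit_disc_0 : unit_disc (RtoC 0).
Proof. unfold unit_disc. rewrite Cmod_0. lra. Qed.

Lemma cdiff_on_Cdisc (f : C -> C) : cdiff_on unit_disc f -> cdiff_on (Cdisc 0 1) f.
Proof. intros H z Hz. apply H. exact (proj1 (Cdisc_0 1 z) Hz). Qed.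

Lemma max_principle_disc (f : C -> C) (a : C) (r M : R) :
  cdiff_on unit_disc f -> Cmod a < r < 1 -> (forall z, Cmod z = r -> Cmod (f z) <= M) -> Cmod (f a) <= M.
Proof.
  intros Hf Hr HM. apply (max_principle f 0 a 1 r M).
  - now apply cdiff_on_Cdisc.
  - now replace (a - 0)%C with a by ring.
  - intros t _. apply HM. rewrite Cplus_0_l. apply Cmod_circle. generalize (Cmod_ge_0 a); lra.
Qed.

Lemma polar (z : C) : exists t, 0 <= t <= 2 * PI /\ z = (RtoC (Cmod z) * cis t)%C.
Proof.
  destruct (Ceq_dec z 0) as [->|N].
  - exists 0. split; [generalize TWOPI_pos; lra|]. rewrite Cmod_0. ring.
  - assert (P : 0 < Cmod z) by (now apply Cmod_gt_0).
    assert (E := Cmod2_alt z).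
    set (x := Re z / Cmod z). set (y := Im z / Cmod z).
    assert (Exy : x * x + y * y = 1).
    { unfold x, y. replace 1 with (Cmod z ^ 2 / Cmod z ^ 2) by (field; lra). rewrite E at 1. field. lra. }
    assert (Hx : -1 <= x <= 1) by nra.
    assert (Ez : z = (RtoC (Cmod z) * (x, y))%C).
    { unfold x, y. destruct z as [u v]. simpl. unfold RtoC, Cmult; simpl. f_equal; field; lra. }
    assert (B := acos_bound x).
    assert (S : sin (acos x) * sin (acos x) = y * y).
    { generalize (sin2_cos2 (acos x)). rewrite cos_acos by lra. unfold Rsqr. lra. }
    assert (S0 : 0 <= sin (acos x)) by (apply sin_ge_0; lra).
    (* [acos] parametrizes the upper half-circle; below it the angle is reflected. *)
    destruct (Rle_dec 0 y) as [Hy|Hy].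
    + exists (acos x). split; [lra|]. rewrite Ez at 1. f_equal. unfold cis. rewrite cos_acos by lra.
      f_equal. nra.
    + exists (2 * PI - acos x). split; [lra|]. rewrite Ez at 1. f_equal. unfold cis.
      rewrite cos_minus, sin_minus, cos_2PI, sin_2PI, cos_acos by lra. f_equal; nra.
Qed.

Lemma bounded_on_circle (f : C -> C) (r : R) :
  cdiff_on unit_disc f -> 0 <= r < 1 -> exists M, 0 < M /\ forall z, Cmod z = r -> Cmod (f z) <= M.
Proof.
  intros Hf Hr.
  destruct (continuous_bounded_2PI (fun t => f (RtoC r * cis t)%C)) as (M & PM & HM).
  - apply continuous_on_circle; [lra|]. intros z Hz. apply cdiff_continuous, Hf. unfold unit_disc. lra.
  - exists M. split; [easy|]. intros z Hz. destruct (polar z) as (t & Ht & E). rewrite Hz in E.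
    rewrite E. now apply HM.
Qed.

Lemma geometric_zero (x M q : R) : 0 <= x -> 0 <= q < 1 -> (forall n, x <= M * q ^ n) -> x = 0.
Proof.
  intros Hx Hq H. apply Rle_antisym; [|easy]. apply le_epsilon. intros e He. rewrite Rplus_0_l.
  destruct (pow_lt_1_zero q) with (y := e / (Rabs M + 1)) as [N HN].
  - rewrite Rabs_pos_eq; lra.
  - apply Rdiv_lt_0_compat; [lra|]. generalize (Rabs_pos M); lra.
  - specialize (HN N (le_n N)). rewrite Rabs_pos_eq in HN by (apply pow_le; lra).
    assert (PM := Rabs_pos M). assert (P := pow_le q N (proj1 Hq)).
    apply Rle_trans with (1 := H N). apply Rle_trans with ((Rabs M + 1) * (e / (Rabs M + 1))).
    + apply Rle_trans with ((Rabs M + 1) * q ^ N).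
      * apply Rmult_le_compat_r; [easy|]. generalize (Rle_abs M); lra.
      * apply Rmult_le_compat_l; lra.
    + right. field. lra.
Qed.

(** As v vanishes near 0, v / z^n is holomorphic for every n, and the maximum principle on |z| = r
    gives |v a| <= M (|a| / r)^n. Power series are avoided in this way. *)
Lemma identity_at_center (v : C -> C) (d : R) :
  cdiff_on unit_disc v -> 0 < d -> (forall z, Cmod z < d -> v z = 0) -> forall z : C, unit_disc z -> v z = 0.
Proof.
  intros Hv Hd H0 a Ha. unfold unit_disc in Ha.
  destruct (Rlt_dec (Cmod a) d) as [L|L]; [now apply H0|].
  set (r := (1 + Cmod a) / 2). assert (Hr : Cmod a < r < 1) by (unfold r; lra).
  destruct (bounded_on_circle v r Hv) as (M & PM & HM); [lra|].
  apply Cmod_eq_0. apply (geometric_zero _ M (Cmod a / r)); [apply Cmod_ge_0| |].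
  { split; [apply Rdiv_le_0_compat; lra|]. apply Rlt_div_l; lra. }
  intros n.
  assert (B : Cmod (v a / a ^ n)%C <= M / r ^ n).
  { apply (max_principle_disc (fun z => v z / z ^ n)%C a r); auto.
    - intros z Hz. destruct (Rlt_dec (Cmod z) d) as [L'|L'].
      + apply (cdiff_ext_loc (fun _ => 0)); [|apply cdiff_const].
        exists (d - Cmod z). split; [lra|]. intros w Hw. rewrite H0; [unfold Cdiv; ring|].
        generalize (Cmod_triangle_inv w z). lra.
      + apply cdiff_div; [now apply Hv|apply cdiff_pow, cdiff_id|].
        apply Cpow_nz. intros ->. rewrite Cmod_0 in L'. lra.
    - intros z Hz. assert (z <> 0) by (intros ->; rewrite Cmod_0 in Hz; lra).
      rewrite Cmod_div, Cmod_pow, Hz by now apply Cpow_nz.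
      unfold Rdiv. apply Rmult_le_compat_r; [|now apply HM].
      left. apply Rinv_0_lt_compat, pow_lt. lra. }
  assert (Na : a <> 0) by (intros ->; rewrite Cmod_0 in L; lra).
  assert (Pa : 0 < Cmod a) by (now apply Cmod_gt_0).
  rewrite Cmod_div, Cmod_pow in B by now apply Cpow_nz.
  apply (proj1 (Rle_div_l _ _ _ (pow_lt _ n Pa))) in B.
  apply Rle_trans with (1 := B). right. unfold Rdiv. rewrite Rpow_mult_distr, pow_inv. ring.
Qed.

Lemma one_minus_conj_neq (a t : C) : Cmod a < 1 -> Cmod t < 1 -> (1 - Cconj a * t)%C <> 0.
Proof.
  intros Ha Ht. apply Cmod_gt_0. generalize (Cmod_triangle_inv 1 (Cconj a * t)).
  rewrite Cmod_1, Cmod_mult, Cmod_conj. assert (Pa := Cmod_ge_0 a). assert (Pt := Cmod_ge_0 t). nra.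
Qed.

Lemma cdiff_blaschke_factor (a : C) : unit_disc a -> cdiff_on unit_disc (blaschke_factor a).
Proof.
  intros Ha t Ht. apply cdiff_div.
  - apply cdiff_minus; [apply cdiff_id|apply cdiff_const].
  - apply cdiff_minus; [apply cdiff_const|apply cdiff_mult; [apply cdiff_const|apply cdiff_id]].
  - now apply one_minus_conj_neq.
Qed.

Lemma Cmod_sqr_C (z : C) : RtoC (Cmod z ^ 2) = (z * Cconj z)%C.
Proof. apply Cmod2_conj. Qed.

Lemma Cconj_1 : Cconj 1 = 1.
Proof. unfold Cconj, RtoC; simpl; f_equal; ring. Qed.

(** The classical identity behind both the invariance of the disc and the boundary behaviour of the
    factor. *)
Lemma blaschke_factor_defect (a t : C) : Cmod a < 1 -> Cmod t < 1 ->
  1 - Cmod (blaschke_factor a t) ^ 2 = (1 - Cmod a ^ 2) * (1 - Cmod t ^ 2) / Cmod (1 - Cconj a * t) ^ 2.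
Proof.
  intros Ha Ht. assert (N := one_minus_conj_neq a t Ha Ht).
  assert (P : 0 < Cmod (1 - Cconj a * t)) by (now apply Cmod_gt_0).
  unfold blaschke_factor. rewrite Cmod_div by exact N.
  assert (E : Cmod (1 - Cconj a * t) ^ 2 - Cmod (t - a) ^ 2 = (1 - Cmod a ^ 2) * (1 - Cmod t ^ 2)).
  { apply RtoC_inj. rewrite RtoC_mult, !RtoC_minus, !Cmod_sqr_C, !Cminus_conj, !Cmult_conj, Cconj_conj, Cconj_1.
    ring. }
  rewrite <- E. field. lra.
Qed.

Lemma blaschke_factor_disc (a t : C) : unit_disc a -> unit_disc t -> unit_disc (blaschke_factor a t).
Proof.
  unfold unit_disc. intros Ha Ht. assert (D := blaschke_factor_defect a t Ha Ht).
  assert (P : 0 < Cmod (1 - Cconj a * t)) by (apply Cmod_gt_0; now apply one_minus_conj_neq).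
  assert (0 < (1 - Cmod a ^ 2) * (1 - Cmod t ^ 2) / Cmod (1 - Cconj a * t) ^ 2).
  { apply Rdiv_lt_0_compat; [|now apply pow_lt].
    assert (Pa := Cmod_ge_0 a). assert (Pt := Cmod_ge_0 t). apply Rmult_lt_0_compat; nra. }
  assert (Q := Cmod_ge_0 (blaschke_factor a t)). nra.
Qed.

Lemma blaschke_factor_inv (a t : C) : unit_disc a -> unit_disc t ->
  blaschke_factor (- a) (blaschke_factor a t) = t.
Proof.
  unfold unit_disc. intros Ha Ht. unfold blaschke_factor. rewrite Copp_conj.
  assert (N := one_minus_conj_neq a t Ha Ht). assert (N2 := one_minus_conj_neq a a Ha Ha).
  field. split; [exact N|].
  replace (1 - Cconj a * t - - Cconj a * (t - a))%C with (1 - Cconj a * a)%C by ring. exact N2.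
Qed.

Lemma blaschke_factor_opp_0 (a : C) : blaschke_factor (- a) 0 = a.
Proof. unfold blaschke_factor. rewrite Cmult_0_r. field. Qed.

Lemma unit_disc_opp (a : C) : unit_disc a -> unit_disc (- a)%C.
Proof. unfold unit_disc. now rewrite Cmod_opp. Qed.

(** A Moebius map carries 0 to a, which reduces the claim to vanishing near the centre and replaces
    the usual connectedness argument. *)
Lemma identity_theorem (v : C -> C) (a : C) (d : R) : unit_disc a ->
  cdiff_on unit_disc v -> 0 < d -> (forall z, Cmod (z - a) < d -> v z = 0) -> forall z : C, unit_disc z -> v z = 0.
Proof.
  intros Ha Hv Hd H0 z Hz. assert (Ha' := unit_disc_opp a Ha).
  rewrite <- (blaschke_factor_inv a z) by easy.
  assert (C0 : continuous (blaschke_factor (- a)) (RtoC 0)).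
  { apply cdiff_continuous, cdiff_blaschke_factor; [easy|apply unit_disc_0]. }
  destruct (proj1 (continuous_CC_iff _ 0) C0 d Hd) as (d' & Hd' & H).
  apply (identity_at_center (fun t => v (blaschke_factor (- a) t)) d'); [|easy| |now apply blaschke_factor_disc].
  - intros t Ht. apply (cdiff_comp v); [now apply cdiff_blaschke_factor|].
    apply Hv. now apply blaschke_factor_disc.
  - intros t Ht. apply H0. rewrite <- (blaschke_factor_opp_0 a) at 2. apply H.
    now replace (t - 0)%C with t by ring.
Qed.

(** Where u is nonzero at a point it is nonzero nearby, so v vanishes on an open set. *)
Lemma disc_integral_domain (u v : C -> C) :
  cdiff_on unit_disc u -> cdiff_on unit_disc v -> (forall z : C, unit_disc z -> (u z * v z)%C = 0) ->
  (forall z : C, unit_disc z -> u z = 0) \/ (forall z : C, unit_disc z -> v z = 0).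
Proof.
  intros Hu Hv H. destruct (classic (forall z : C, unit_disc z -> u z = 0)) as [|N]; [now left|right].
  apply not_all_ex_not in N. destruct N as [a N]. apply imply_to_and in N. destruct N as [Ha N].
  assert (P : 0 < Cmod (u a)) by (now apply Cmod_gt_0).
  destruct (proj1 (continuous_CC_iff _ a) (cdiff_continuous _ _ (Hu a Ha)) _ P) as (d & Hd & Hc).
  unfold unit_disc in Ha.
  apply (identity_theorem v a (Rmin d (1 - Cmod a))); auto.
  - apply Rmin_glb_lt; lra.
  - intros z Hz. assert (H1 := Rlt_le_trans _ _ _ Hz (Rmin_l _ _)).
    assert (H2 := Rlt_le_trans _ _ _ Hz (Rmin_r _ _)).
    assert (Nz : u z <> 0).
    { intros E. specialize (Hc z H1). rewrite E in Hc. replace (0 - u a)%C with (- u a)%C in Hc by ring.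
      rewrite Cmod_opp in Hc. lra. }
    assert (Dz : unit_disc z) by (unfold unit_disc; generalize (Cmod_triangle_inv z a); lra).
    destruct (Ceq_dec (v z) 0) as [|Nv]; [easy|]. exfalso. now apply (Cmult_neq_0 _ _ Nz Nv), H.
Qed.

(** Connectedness of the circle: |g| cannot pass through 1/2, which separates the two ranges because
    e < 1/2. *)
Lemma circle_dichotomy (g : C -> C) (r e : R) :
  0 <= r -> (forall z, Cmod z = r -> continuous g z) -> e < 1 / 2 ->
  (forall z, Cmod z = r -> Cmod (g z) < e \/ 1 - e < Cmod (g z)) ->
  (forall z, Cmod z = r -> Cmod (g z) < e) \/ (forall z, Cmod z = r -> 1 - e < Cmod (g z)).
Proof.
  intros Hr Hc He H.
  set (h := fun t : R => Cmod (g (RtoC r * cis t)%C)).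
  assert (Ch : continuity h).
  { intros t. apply continuity_pt_filterlim. apply continuous_Cmod.
    now apply (continuous_on_circle g r Hr Hc). }
  assert (Hh : forall t, h t < e \/ 1 - e < h t).
  { intros t. apply H. now apply Cmod_circle. }
  assert (Pol : forall z, Cmod z = r -> exists t, Cmod (g z) = h t).
  { intros z Hz. destruct (polar z) as (t & _ & E). exists t. unfold h. now rewrite <- Hz, <- E. }
  assert (K : forall s t, h s < e -> 1 - e < h t -> False).
  { intros s t Hs Ht. destruct (IVT_gen h s t (1 / 2) Ch) as (x & _ & Hx).
    - generalize (Rmin_l (h s) (h t)) (Rmax_r (h s) (h t)). lra.
    - destruct (Hh x); lra. }
  destruct (Hh 0) as [H0|H0]; [left|right]; intros z Hz; destruct (Pol z Hz) as [t ->];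
    destruct (Hh t) as [Ht|Ht]; auto; exfalso; eauto.
Qed.

(** On a circle near the boundary |g| is either small throughout or near 1 throughout. The maximum
    principle for g, respectively for 1/g, then contradicts 0 < |g 0| < 1. *)
Lemma no_proper_map_to_punctured_disc (g : C -> C) :
  cdiff_on unit_disc g -> (forall z : C, unit_disc z -> 0 < Cmod (g z) < 1) ->
  (forall e, 0 < e -> exists r, r < 1 /\ forall z, r < Cmod z < 1 -> Cmod (g z) < e \/ 1 - e < Cmod (g z)) ->
  False.
Proof.
  intros Hg H01 H.
  assert (D0 := unit_disc_0).
  assert (H0 := H01 0 D0).
  set (e := Rmin (Cmod (g 0)) (1 - Cmod (g 0)) / 2).
  assert (He : 0 < e /\ e < Cmod (g 0) /\ e < 1 - Cmod (g 0) /\ e < 1 / 2).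
  { unfold e. generalize (Rmin_l (Cmod (g 0)) (1 - Cmod (g 0))) (Rmin_r (Cmod (g 0)) (1 - Cmod (g 0)))
     (Rmin_glb_lt (Cmod (g 0)) (1 - Cmod (g 0)) 0 ltac:(lra) ltac:(lra)). lra. }
  destruct (H e) as (r & Hr & Hz); [lra|].
  set (r' := (Rmax r 0 + 1) / 2).
  assert (Hr' : 0 < r' < 1 /\ r < r').
  { unfold r'. generalize (Rmax_l r 0) (Rmax_r r 0) (Rmax_lub_lt r 0 1 Hr ltac:(lra)). lra. }
  destruct (circle_dichotomy g r' e) as [S|S]; try lra.
  - intros z E. apply cdiff_continuous, Hg. unfold unit_disc. lra.
  - intros z E. apply Hz. lra.
  - assert (Cmod (g 0) <= e); [|lra].
    apply (max_principle_disc g 0 r'); [easy|rewrite Cmod_0; lra|]. intros z E. left. now apply S.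
  - assert (B : Cmod (/ g 0)%C <= / (1 - e)).
    { apply (max_principle_disc (fun z => / g z)%C 0 r'); [|rewrite Cmod_0; lra|].
      - intros z Hzd. apply cdiff_inv; [now apply Hg|]. apply Cmod_gt_0. now apply H01.
      - intros z E. assert (Pz := H01 z ltac:(unfold unit_disc; lra)).
        rewrite Cmod_inv by (apply Cmod_gt_0; easy). apply Rinv_le_contravar; [lra|]. left. now apply S. }
    rewrite Cmod_inv in B by (apply Cmod_gt_0; easy).
    apply Rinv_le_contravar in B; [|apply Rinv_0_lt_compat; lra]. rewrite !Rinv_inv in B. lra.
Qed.

(** At a simple zero c of q, |q z| >= (|l| / 2) |z - c| while h z = O(|z - c|), so h / q is bounded
    and extends. The divisors in use, z and the Blaschke factor of t^n at A <> 0, have only simple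
    zeros. *)
Lemma cdiff_quotient (h q : C -> C) :
  cdiff_on unit_disc h -> cdiff_on unit_disc q ->
  (forall z : C, unit_disc z -> q z = 0 -> h z = 0 /\ exists l : C, l <> 0 /\ cderiv q z l) ->
  exists k, cdiff_on unit_disc k /\ forall z : C, unit_disc z -> h z = (q z * k z)%C.
Proof.
  intros Hh Hq H0.
  assert (V : forall c : C, unit_disc c -> q c = 0 -> exists v,
    cdiff (fun z => if Ceq_dec z c then v else h z / q z)%C c /\
    exists d, 0 < d /\ forall z, Cmod (z - c) < d -> z <> c -> unit_disc z /\ q z <> 0).
  { intros c Hc Qc. destruct (H0 c Hc Qc) as (Ec & l & Nl & Hl). destruct (Hh c Hc) as (m & Hm).
    assert (Pl : 0 < Cmod l) by (now apply Cmod_gt_0). unfold unit_disc in Hc.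
    destruct (Hl (Cmod l / 2)) as (d1 & Hd1 & A1); [lra|]. destruct (Hm 1) as (d2 & Hd2 & A2); [lra|].
    set (d := Rmin (Rmin d1 d2) (1 - Cmod c)).
    assert (Hd : 0 < d) by (repeat apply Rmin_glb_lt; lra).
    assert (Dd : d <= d1 /\ d <= d2 /\ d <= 1 - Cmod c).
    { unfold d. generalize (Rmin_l (Rmin d1 d2) (1 - Cmod c)) (Rmin_r (Rmin d1 d2) (1 - Cmod c)) (Rmin_l d1 d2) (Rmin_r d1 d2). lra. }
    assert (Lq : forall z, Cmod (z - c) < d -> Cmod l / 2 * Cmod (z - c) <= Cmod (q z)).
    { intros z Hz. specialize (A1 z ltac:(lra)). rewrite Qc in A1.
      replace (q z - 0 - l * (z - c))%C with (- (l * (z - c) - q z))%C in A1 by ring. rewrite Cmod_opp in A1.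
      generalize (Cmod_triangle_inv (l * (z - c)) (q z)). rewrite Cmod_mult. lra. }
    assert (Nq : forall z, Cmod (z - c) < d -> z <> c -> unit_disc z /\ q z <> 0).
    { intros z Hz N. split; [unfold unit_disc; generalize (Cmod_triangle_inv z c); lra|].
      apply Cmod_gt_0. apply Rlt_le_trans with (2 := Lq z Hz).
      apply Rmult_lt_0_compat; [lra|]. apply Cmod_gt_0. intros E. apply N. now apply Ceq_minus. }
    destruct (removable (fun z => h z / q z)%C c d Hd) as [v Hv].
    - intros z Hz N. destruct (Nq z Hz N). apply cdiff_div; auto.
    - exists ((1 + Cmod m) / (Cmod l / 2)), d. split; [easy|]. intros z Hz N.
      destruct (Nq z Hz N) as [_ Nz]. rewrite Cmod_div by easy.
      assert (Pz : 0 < Cmod (z - c)) by (apply Cmod_gt_0; intros E; apply N; now apply Ceq_minus).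
      assert (Uh : Cmod (h z) <= (1 + Cmod m) * Cmod (z - c)).
      { specialize (A2 z ltac:(lra)). rewrite Ec in A2.
        replace (h z) with ((h z - 0 - m * (z - c)) + m * (z - c))%C by ring.
        eapply Rle_trans; [apply Cmod_triangle|]. rewrite Cmod_mult. lra. }
      specialize (Lq z Hz).
      apply Rle_div_l; [now apply Cmod_gt_0|]. apply Rle_trans with (1 := Uh).
      apply Rle_trans with ((1 + Cmod m) / (Cmod l / 2) * (Cmod l / 2 * Cmod (z - c))).
      + right. field. lra.
      + apply Rmult_le_compat_l; [|easy]. apply Rdiv_le_0_compat; [generalize (Cmod_ge_0 m); lra|lra].
    - exists v. split; [exact Hv|]. now exists d. }
  (* The removable values are picked by choice, one at each zero of q in the disc; 0 is a default
     elsewhere. *)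
  set (val := fun c => match excluded_middle_informative (unit_disc c /\ q c = 0) with
                       | left P => proj1_sig (constructive_indefinite_description _ (V c (proj1 P) (proj2 P)))
                       | right _ => RtoC 0 end).
  exists (fun z => if Ceq_dec (q z) 0 then val z else h z / q z)%C. split.
  - intros c Hc. destruct (Ceq_dec (q c) 0) as [E|N].
    + assert (W : cdiff (fun z => if Ceq_dec z c then val c else h z / q z)%C c /\
        exists d, 0 < d /\ forall z, Cmod (z - c) < d -> z <> c -> unit_disc z /\ q z <> 0).
      { unfold val. destruct (excluded_middle_informative _) as [P|P]; [|now destruct P].
        exact (proj2_sig (constructive_indefinite_description _ (V c (proj1 P) (proj2 P)))). }
      destruct W as [W1 (d & Hd & W2)]. revert W1. apply cdiff_ext_loc.
      exists d. split; [easy|]. intros z Hz. destruct (Ceq_dec z c) as [->|Nz].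
      * destruct (Ceq_dec (q c) 0); easy.
      * destruct (W2 z Hz Nz). destruct (Ceq_dec (q z) 0); easy.
    + apply (cdiff_ext_loc (fun z => h z / q z)%C).
      * assert (P : 0 < Cmod (q c)) by (now apply Cmod_gt_0).
        destruct (proj1 (continuous_CC_iff _ c) (cdiff_continuous _ _ (Hq c Hc)) _ P) as (d & Hd & Hcont).
        exists d. split; [easy|]. intros z Hz. destruct (Ceq_dec (q z) 0) as [E|_]; [|easy].
        specialize (Hcont z Hz). rewrite E in Hcont. replace (0 - q c)%C with (- q c)%C in Hcont by ring.
        rewrite Cmod_opp in Hcont. lra.
      * apply cdiff_div; auto.
  - intros z Hz. destruct (Ceq_dec (q z) 0) as [E|N].
    + destruct (H0 z Hz E) as [-> _]. rewrite E. ring.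
    + field. exact N.
Qed.

(** * Inner functions and Blaschke products *)

(** Narrower than the usual notion: |h| tends to 1 uniformly at the circle, which singles out the
    finite Blaschke products, unimodular constants included. *)
Definition inner (h : C -> C) : Prop :=
  cdiff_on unit_disc h /\ (forall z : C, unit_disc z -> Cmod (h z) <= 1) /\
  (forall e, 0 < e -> exists r, r < 1 /\ forall z : C, r < Cmod z < 1 -> 1 - e < Cmod (h z)).

Lemma inner_quotient (h q : C -> C) : inner h -> inner q ->
  (forall z : C, unit_disc z -> q z = 0 -> h z = 0 /\ exists l : C, l <> 0 /\ cderiv q z l) ->
  exists k, inner k /\ forall z : C, unit_disc z -> h z = (q z * k z)%C.
Proof.
  intros (Hh & Hh1 & Hhb) (Hq & Hq1 & Hqb) Z.
  destruct (cdiff_quotient h q Hh Hq Z) as (k & Hk & E).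
  exists k. split; [|exact E]. repeat split; [exact Hk| |].
  - intros a Ha. unfold unit_disc in Ha. apply le_epsilon. intros e He.
    (* Since 1 - e / (1 + e) = 1 / (1 + e), on a circle where |q| exceeds this value |k| is at most
       1 + e. *)
    destruct (Hqb (e / (1 + e))) as (r & Hr & Hz); [apply Rdiv_lt_0_compat; lra|].
    set (r' := (Rmax r (Cmod a) + 1) / 2).
    assert (Hr' : r < r' < 1 /\ Cmod a < r').
    { unfold r'. generalize (Rmax_l r (Cmod a)) (Rmax_r r (Cmod a)) (Rmax_lub_lt r (Cmod a) 1 Hr Ha). lra. }
    apply (max_principle_disc k a r'); [easy|lra|]. intros z Ez.
    specialize (Hz z ltac:(lra)). assert (Dz : unit_disc z) by (unfold unit_disc; lra).
    specialize (Hh1 z Dz). rewrite (E z Dz), Cmod_mult in Hh1.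
    replace (1 - e / (1 + e)) with (/ (1 + e)) in Hz by (field; lra).
    assert (Pk := Cmod_ge_0 (k z)).
    assert (/ (1 + e) * Cmod (k z) <= 1) by nra.
    apply Rmult_le_reg_l with (/ (1 + e)); [apply Rinv_0_lt_compat; lra|].
    rewrite Rinv_l by lra. lra.
  - intros e He. destruct (Hhb e He) as (r & Hr & Hz). exists r. split; [easy|]. intros z Hzr.
    specialize (Hz z Hzr). assert (Dz : unit_disc z) by (unfold unit_disc; lra).
    specialize (Hq1 z Dz). rewrite (E z Dz), Cmod_mult in Hz.
    assert (Pk := Cmod_ge_0 (k z)). nra.
Qed.

Lemma inner_id : inner (fun z => z).
Proof.
  repeat split.
  - intros z _. apply cdiff_id.
  - intros z Hz. unfold unit_disc in Hz. lra.
  - intros e He. exists (1 - e). split; [lra|]. intros z Hz. lra.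
Qed.

Lemma pow_le_1 (x : R) (n : nat) : 0 <= x <= 1 -> x ^ n <= 1.
Proof. intros H. rewrite <- (pow1 n). now apply pow_incr. Qed.

Lemma one_minus_pow_le (x : R) (n : nat) : 0 <= x <= 1 -> 1 - x ^ n <= INR n * (1 - x).
Proof.
  intros Hx. induction n.
  - simpl. lra.
  - rewrite S_INR. simpl. assert (0 <= x ^ n) by (apply pow_le; lra).
    assert (x ^ n <= 1) by (apply pow_le_1; lra). nra.
Qed.

Lemma unit_disc_pow (t : C) (n : nat) : (0 < n)%nat -> unit_disc t -> unit_disc (t ^ n)%C.
Proof.
  unfold unit_disc. intros Hn Ht. rewrite Cmod_pow. destruct n; [lia|]. simpl.
  assert (P := Cmod_ge_0 t).
  assert (Cmod t ^ n <= 1) by (apply pow_le_1; lra).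
  assert (0 <= Cmod t ^ n) by now apply pow_le. nra.
Qed.

Lemma inner_blaschke_pow (A : C) (n : nat) : unit_disc A -> (0 < n)%nat ->
  inner (fun t => blaschke_factor A (t ^ n)%C).
Proof.
  intros HA Hn. repeat split.
  - intros z Hz. apply (cdiff_comp (blaschke_factor A)); [apply cdiff_pow, cdiff_id|].
    apply cdiff_blaschke_factor; [easy|now apply unit_disc_pow].
  - intros z Hz. left. apply blaschke_factor_disc; [easy|now apply unit_disc_pow].
  - intros e He. unfold unit_disc in HA. assert (PA := Cmod_ge_0 A).
    assert (Pn : 1 <= INR n) by (rewrite <- INR_1; apply le_INR; lia).
    (* With |1 - conj(A) s| >= 1 - |A| and 1 - |s| <= n d, this d makes the defect of the Blaschke
       factor at most e / 2. *)
    set (d := e * (1 - Cmod A) / (8 * INR n)).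
    assert (Hd : 0 < d) by (apply Rdiv_lt_0_compat; [apply Rmult_lt_0_compat; lra|lra]).
    exists (1 - d). split; [lra|]. intros z Hz.
    set (s := (z ^ n)%C). assert (Ds : Cmod s < 1) by (apply unit_disc_pow; [easy|unfold unit_disc; lra]).
    assert (Ps := Cmod_ge_0 s).
    assert (S1 : 1 - Cmod s <= INR n * d).
    { unfold s. rewrite Cmod_pow. apply Rle_trans with (INR n * (1 - Cmod z)).
      - apply one_minus_pow_le. generalize (Cmod_ge_0 z). lra.
      - apply Rmult_le_compat_l; lra. }
    assert (Df := blaschke_factor_defect A s HA Ds).
    assert (N : 1 - Cmod A <= Cmod (1 - Cconj A * s)).
    { generalize (Cmod_triangle_inv 1 (Cconj A * s)). rewrite Cmod_1, Cmod_mult, Cmod_conj. nra. }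
    assert (Db : Cmod (blaschke_factor A s) < 1) by now apply blaschke_factor_disc.
    assert (Pb := Cmod_ge_0 (blaschke_factor A s)).
    assert (B : (1 - Cmod A ^ 2) * (1 - Cmod s ^ 2) / Cmod (1 - Cconj A * s) ^ 2 < e).
    { apply Rlt_div_l; [apply pow_lt; lra|].
      apply Rle_lt_trans with (2 * (1 - Cmod A) * (2 * (INR n * d))).
      - apply Rmult_le_compat; nra.
      - replace (2 * (1 - Cmod A) * (2 * (INR n * d))) with (e / 2 * (1 - Cmod A) ^ 2) by (unfold d; field; lra).
        apply Rlt_le_trans with (e * (1 - Cmod A) ^ 2).
        + apply Rmult_lt_compat_r; [apply pow_lt|]; lra.
        + apply Rmult_le_compat_l; [lra|]. apply pow_incr. lra. }
    nra.
Qed.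

(** The maximum principle for 1/h gives |h| = 1 everywhere; then the near-constancy estimate has
    right side 0. *)
Lemma inner_nonvanishing (h : C -> C) : inner h -> (forall z : C, unit_disc z -> h z <> 0) ->
  exists zeta, Cmod zeta = 1 /\ forall z : C, unit_disc z -> h z = zeta.
Proof.
  intros (Hh & Hh1 & Hhb) N.
  assert (H1 : forall a : C, unit_disc a -> Cmod (h a) = 1).
  { intros a Ha. apply Rle_antisym; [now apply Hh1|]. apply le_epsilon. intros e He.
    destruct (Rle_dec 1 e) as [L|L]; [generalize (Cmod_ge_0 (h a)); lra|].
    destruct (Hhb e He) as (r & Hr & Hz). unfold unit_disc in Ha.
    set (r' := (Rmax r (Cmod a) + 1) / 2).
    assert (Hr' : r < r' < 1 /\ Cmod a < r').
    { unfold r'. generalize (Rmax_l r (Cmod a)) (Rmax_r r (Cmod a)) (Rmax_lub_lt r (Cmod a) 1 Hr Ha). lra. }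
    assert (B : Cmod (/ h a)%C <= / (1 - e)).
    { apply (max_principle_disc (fun z => / h z)%C a r'); [|lra|].
      - intros z Hzd. apply cdiff_inv; auto.
      - intros z E. rewrite Cmod_inv by (apply N; unfold unit_disc; lra).
        apply Rinv_le_contravar; [lra|]. left. apply Hz. lra. }
    assert (P : 0 < Cmod (h a)) by (apply Cmod_gt_0; now apply N).
    rewrite Cmod_inv in B by now apply N.
    apply Rinv_le_contravar in B; [|now apply Rinv_0_lt_compat]. rewrite !Rinv_inv in B. lra. }
  exists (h 0). split; [apply H1, unit_disc_0|]. intros z Hz. unfold unit_disc in Hz.
  assert (Q := near_constant h 0 z 1 ((1 + Cmod z) / 2) (cdiff_on_Cdisc h Hh)
    (fun w Hw => Hh1 w (proj1 (Cdisc_0 1 w) Hw))).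
  replace (z - 0)%C with z in Q by ring. specialize (Q ltac:(lra)).
  rewrite (H1 0 unit_disc_0) in Q. replace (1 - 1) with 0 in Q by ring. rewrite Rmult_0_r in Q.
  apply Ceq_minus, Cmod_eq_0. generalize (Cmod_ge_0 (h z - h 0)). nra.
Qed.

Lemma pow_below (q x : R) : 0 <= q < 1 -> 0 < x -> exists n : nat, q ^ n < x.
Proof.
  intros Hq Hx. destruct (pow_lt_1_zero q) with (y := x) as [n Hn]; [rewrite Rabs_pos_eq; lra|easy|].
  exists n. specialize (Hn n (le_n n)). rewrite Rabs_pos_eq in Hn; [easy|]. apply pow_le; lra.
Qed.

(** Each division by z keeps the function inner and multiplies its modulus at a fixed point t by 1 /
    |t|, yet that modulus stays at most 1. Hence any n with |t|^n < |h t| bounds the number of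
    divisions. *)
Lemma inner_order_at_0 (h : C -> C) : inner h ->
  exists (k : nat) (h0 : C -> C), inner h0 /\ h0 0 <> 0 /\
    forall z : C, unit_disc z -> h z = (z ^ k * h0 z)%C.
Proof.
  intros Hh.
  assert (exists t : C, unit_disc t /\ h t <> 0) as (t & Ht & Nt).
  { destruct Hh as (_ & _ & Hb). destruct (Hb 1 Rlt_0_1) as (r & Hr & Hz).
    set (r' := (Rmax r 0 + 1) / 2).
    assert (Hr' : r < r' < 1 /\ 0 < r').
    { unfold r'. generalize (Rmax_l r 0) (Rmax_r r 0) (Rmax_lub_lt r 0 1 Hr ltac:(lra)). lra. }
    assert (E : Cmod (RtoC r') = r') by (apply Cmod_RtoC_pos; lra).
    exists (RtoC r'). split; [unfold unit_disc; lra|]. apply Cmod_gt_0.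
    specialize (Hz (RtoC r')). lra. }
  assert (Ht' := Ht). unfold unit_disc in Ht'. assert (P := Cmod_ge_0 t).
  assert (Pt : 0 < Cmod (h t)) by (now apply Cmod_gt_0).
  destruct (pow_below (Cmod t) (Cmod (h t)) ltac:(lra) Pt) as [n Hn].
  clear Nt Pt. revert h Hh Hn. induction n as [|n IH]; intros h Hh Hn.
  - exfalso. destruct Hh as (_ & H1 & _). specialize (H1 t Ht). simpl in Hn. lra.
  - destruct (Ceq_dec (h 0) 0) as [E|N].
    + destruct (inner_quotient h (fun z => z) Hh inner_id) as (k & Hk & Ek).
      { intros z _ ->. split; [easy|]. exists 1. split; [apply C1_nz|apply cderiv_id]. }
      destruct (IH k Hk) as (m & h0 & A & B & D).
      { rewrite (Ek t Ht), Cmod_mult in Hn. simpl in Hn.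
        destruct P as [P|P]; [|rewrite <- P in Hn; lra].
        now apply Rmult_lt_reg_l in Hn. }
      exists (S m), h0. repeat split; try apply A; auto. intros z Hz. simpl.
      rewrite (Ek z Hz), (D z Hz). ring.
    + exists 0%nat, h. repeat split; try apply Hh; auto. intros; simpl; ring.
Qed.

Lemma cderiv_pow (n : nat) (a : C) : cderiv (fun z => z ^ n)%C a (RtoC (INR n) * a ^ (n - 1))%C.
Proof.
  induction n as [|n IH].
  - simpl. rewrite Cmult_0_l. apply cderiv_const.
  - assert (M := cderiv_mult _ _ _ _ _ (cderiv_id a) IH). simpl in M.
    replace (RtoC (INR (S n)) * a ^ (S n - 1))%C with (1 * a ^ n + a * (RtoC (INR n) * a ^ (n - 1)))%C.
    + exact M.
    + rewrite S_INR, RtoC_plus. replace (S n - 1)%nat with n by lia.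
      destruct n; [simpl; ring|]. replace (S n - 1)%nat with n by lia. simpl (a ^ S n)%C. ring.
Qed.

(** A <> 0 keeps the roots of t^n = A away from the critical point 0 of t -> t^n, so they are simple
    zeros. *)
Lemma cderiv_blaschke_pow_zero (n : nat) (A b : C) : unit_disc A -> (0 < n)%nat -> A <> 0 -> (b ^ n)%C = A ->
  exists l : C, l <> 0 /\ cderiv (fun t => blaschke_factor A (t ^ n)%C) b l.
Proof.
  intros HA Hn NA Eb. unfold unit_disc in HA.
  assert (N1 := one_minus_conj_neq A A HA HA).
  destruct (cdiff_inv (fun t => 1 - Cconj A * t)%C A
     ltac:(apply cdiff_minus; [apply cdiff_const|apply cdiff_mult; [apply cdiff_const|apply cdiff_id]]) N1) as [m Hm].
  assert (D1 : cderiv (blaschke_factor A) A (/ (1 - Cconj A * A))%C).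
  { assert (D := cderiv_mult _ _ _ _ _ (cderiv_plus _ _ _ _ _ (cderiv_id A) (cderiv_const (- A)%C A)) Hm).
    cbv beta in D. replace ((1 + 0) * / (1 - Cconj A * A) + (A + - A) * m)%C with (/ (1 - Cconj A * A))%C in D by (field; exact N1).
    exact D. }
  rewrite <- Eb in D1 at 2.
  assert (D := cderiv_comp _ _ _ _ _ (cderiv_pow n b) D1).
  eexists. split; [|exact D].
  assert (Nb : b <> 0).
  { intros ->. apply NA. rewrite <- Eb. destruct n; [lia|simpl; ring]. }
  apply Cmult_neq_0.
  - intros E. apply C1_nz. rewrite <- (Cinv_l (1 - Cconj A * A)%C), E by exact N1. ring.
  - apply Cmult_neq_0; [|now apply Cpow_nz].
    intros E. apply RtoC_inj in E. apply (not_0_INR n); [lia|exact E].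
Qed.

Lemma blaschke_factor_eq_0 (a t : C) : unit_disc a -> unit_disc t -> blaschke_factor a t = 0 -> t = a.
Proof.
  intros Ha Ht E. rewrite <- (blaschke_factor_inv a t Ha Ht), E. apply blaschke_factor_opp_0.
Qed.

Lemma blaschke_factor_self (a : C) : blaschke_factor a a = 0.
Proof. unfold blaschke_factor. unfold Cdiv. ring. Qed.

Definition blaschke_list (l : list C) (t : C) : C :=
  fold_right (fun a b => (blaschke_factor a t * b)%C) (RtoC 1) l.

(** By the symmetry a zero a comes with all roots of t^n = a^n, so the single factor at A = a^n,
    evaluated at t^n, divides h. The quotient k has |k 0| = |h 0| / |A| with |A| <= q, where q < 1
    bounds all zeros of h; as |k 0| <= 1, the process stops. *)
Theorem inner_is_blaschke (n : nat) (h : C -> C) : (0 < n)%nat -> inner h -> h 0 <> 0 ->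
  (forall a b : C, unit_disc a -> unit_disc b -> (a ^ n)%C = (b ^ n)%C -> h a = h b) ->
  exists (zeta : C) (l : list C), Cmod zeta = 1 /\ (forall a, In a l -> unit_disc a) /\
    forall t : C, unit_disc t -> h t = (zeta * blaschke_list l (t ^ n)%C)%C.
Proof.
  intros Hn Hh N0 Sym.
  assert (exists q, 0 <= q < 1 /\ forall a : C, unit_disc a -> h a = 0 -> Cmod a <= q) as (q & Hq & Zq).
  { destruct Hh as (_ & _ & Hb). destruct (Hb 1 Rlt_0_1) as (r & Hr & Hz).
    exists (Rmax r 0). split; [split; [apply Rmax_r|apply Rmax_lub_lt; lra]|].
    intros a Ha Ea. unfold unit_disc in Ha. apply Rnot_lt_le. intros L.
    specialize (Hz a). rewrite Ea, Cmod_0 in Hz. generalize (Rmax_l r 0). lra. }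
  assert (P0 : 0 < Cmod (h 0)) by (now apply Cmod_gt_0).
  destruct (pow_below q (Cmod (h 0)) Hq P0) as [N HN]. clear P0.
  revert h Hh N0 Sym Zq HN. induction N as [|N IH]; intros h Hh N0 Sym Zq HN.
  { exfalso. destruct Hh as (_ & H1 & _). specialize (H1 0 unit_disc_0). simpl in HN. lra. }
  destruct (classic (forall z : C, unit_disc z -> h z <> 0)) as [NV|V].
  { destruct (inner_nonvanishing h Hh NV) as (zeta & Hz & E). exists zeta, nil.
    split; [easy|]. split; [intros a []|]. intros t Ht. simpl. rewrite E by easy. ring. }
  apply not_all_ex_not in V. destruct V as [a V]. apply imply_to_and in V. destruct V as [Ha Va].
  apply NNPP in Va.
  assert (Na : a <> 0) by (intros ->; now apply N0).
  set (A := (a ^ n)%C). assert (HA : unit_disc A) by now apply unit_disc_pow.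
  assert (NA : A <> 0) by now apply Cpow_nz.
  assert (ZA : forall z : C, unit_disc z -> blaschke_factor A (z ^ n)%C = 0 -> (z ^ n)%C = A).
  { intros z Hz. apply blaschke_factor_eq_0; [easy|now apply unit_disc_pow]. }
  assert (I := inner_blaschke_pow A n HA Hn).
  destruct (inner_quotient h (fun t => blaschke_factor A (t ^ n)%C) Hh I) as (k & Hk & Ek).
  { intros z Hz Ez. apply ZA in Ez; [|easy]. split.
    - rewrite <- Va. now apply Sym.
    - now apply cderiv_blaschke_pow_zero. }
  assert (Bk : forall z : C, unit_disc z -> k z = 0 -> h z = 0).
  { intros z Hz E. rewrite Ek, E by easy. ring. }
  destruct (IH k Hk) as (zeta & l & Hz & Hl & E).
  - intros E. apply N0. apply Bk; [apply unit_disc_0|easy].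
  - intros b c Hb Hc Ebc.
    assert (Gen : forall b c : C, unit_disc b -> unit_disc c -> (b ^ n)%C = (c ^ n)%C -> (b ^ n)%C <> A -> k b = k c).
    { intros b' c' Hb' Hc' Ebc' Nb'. assert (S := Sym b' c' Hb' Hc' Ebc').
      rewrite (Ek b' Hb'), (Ek c' Hc'), Ebc' in S.
      assert (Nz : blaschke_factor A (c' ^ n)%C <> 0).
      { intros X. apply Nb'. rewrite Ebc'. now apply ZA. }
      rewrite <- (Cmult_1_l (k b')), <- (Cinv_l _ Nz), <- Cmult_assoc, S, Cmult_assoc, Cinv_l by exact Nz. ring. }
    (* Where the divisor vanishes, the symmetry of k cannot be read off from that of h. It follows
       by continuity along (1 - x) b and (1 - x) c, which avoid t^n = A because A <> 0. *)
    destruct (Ceq_dec (b ^ n)%C A) as [EA|NEA]; [|now apply Gen].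
    apply Ceq_minus, Cmod_eq_0. apply Rle_antisym; [|apply Cmod_ge_0].
    apply le_epsilon. intros e He. rewrite Rplus_0_l.
    destruct (proj1 (continuous_CC_iff k b) (cdiff_continuous _ _ (proj1 Hk b Hb)) (e / 2)) as (d & Hd & Xd); [lra|].
    destruct (proj1 (continuous_CC_iff k c) (cdiff_continuous _ _ (proj1 Hk c Hc)) (e / 2)) as (d' & Hd' & Xd'); [lra|].
    set (x := Rmin (Rmin d d') 1 / 2).
    assert (Hx : 0 < x <= 1 / 2 /\ x < d /\ x < d').
    { unfold x. generalize (Rmin_l (Rmin d d') 1) (Rmin_r (Rmin d d') 1) (Rmin_l d d') (Rmin_r d d').
      assert (0 < Rmin (Rmin d d') 1) by (repeat apply Rmin_glb_lt; lra). lra. }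
    set (s := RtoC (1 - x)). assert (Es : Cmod s = 1 - x) by (apply Cmod_RtoC_pos; lra).
    assert (Dsc : forall w : C, unit_disc w -> unit_disc (s * w)%C /\ Cmod (s * w - w) < d /\ Cmod (s * w - w) < d').
    { intros w Hw. unfold unit_disc in *. rewrite Cmod_mult, Es. assert (Pw := Cmod_ge_0 w).
      replace (s * w - w)%C with (- (RtoC x * w))%C by (unfold s; rewrite RtoC_minus; ring).
      rewrite Cmod_opp, Cmod_mult, Cmod_RtoC_pos by lra. repeat split; nra. }
    destruct (Dsc b Hb) as (B1 & B2 & _). destruct (Dsc c Hc) as (C1 & _ & C2).
    assert (G : k (s * b)%C = k (s * c)%C).
    { apply Gen; auto.
      - now rewrite !Cpow_mult_l, Ebc.
      - rewrite Cpow_mult_l, EA. intros X. apply (f_equal Cmod) in X.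
        rewrite Cmod_mult, Cmod_pow, Es in X.
        assert (PA : 0 < Cmod A) by (now apply Cmod_gt_0).
        assert ((1 - x) ^ n < 1); [|nra].
        destruct n as [|n']; [lia|]. simpl.
        assert ((1 - x) ^ n' <= 1) by (apply pow_le_1; lra).
        assert (0 <= (1 - x) ^ n') by (apply pow_le; lra). nra. }
    replace (k b - k c)%C with ((k (s * c)%C - k c) - (k (s * b)%C - k b))%C by (rewrite G; ring).
    eapply Rle_trans; [apply Cmod_minus_le|]. specialize (Xd _ B2). specialize (Xd' _ C2). lra.
  - intros z Hz E. apply Zq; auto.
  - rewrite (Ek 0 unit_disc_0), Cmod_mult in HN.
    replace (0 ^ n)%C with (RtoC 0) in HN by (destruct n; [lia|simpl; ring]).
    replace (blaschke_factor A 0) with (- A)%C in HN by (unfold blaschke_factor; rewrite Cmult_0_r; field).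
    rewrite Cmod_opp in HN.
    assert (LA : Cmod A <= q).
    { unfold A. rewrite Cmod_pow. apply Rle_trans with (2 := Zq a Ha Va). destruct n as [|n']; [lia|]. simpl.
      unfold unit_disc in Ha. assert (Pa := Cmod_ge_0 a).
      assert (Cmod a ^ n' <= 1) by (apply pow_le_1; lra). nra. }
    assert (Pk := Cmod_ge_0 (k 0)). simpl in HN.
    destruct (proj1 Hq) as [Pq|Pq].
    + apply Rmult_lt_reg_l with q; [easy|]. apply Rlt_le_trans with (1 := HN). now apply Rmult_le_compat_r.
    + exfalso. rewrite <- Pq in HN, LA. nra.
  - exists zeta, (A :: l). split; [easy|]. split.
    + intros b [<-|Hb]; auto.
    + intros t Ht. rewrite (Ek t Ht), (E t Ht). unfold blaschke_list. simpl. ring.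
Qed.

(** * Properness on Hartogs domains *)

Lemma locally_C2_iff (P : C2 -> Prop) (a b : C) :
  locally ((a, b) : C2) P <->
  exists d, 0 < d /\ forall z w : C, Cmod (z - a) < d -> Cmod (w - b) < d -> P (z, w).
Proof.
  split.
  - intros [[d Hd] H]. exists d. split; [easy|]. intros z w Hz Hw. apply H.
    split; apply Cmod_C_ball; assumption.
  - intros (d & Hd & H). assert (Hd2 : 0 < d / 2) by lra. exists (mkposreal _ Hd2).
    intros [z w] [Hz Hw]. apply C_ball_Cmod in Hz. apply C_ball_Cmod in Hw. simpl in *. apply H; lra.
Qed.

(** Finitely many members of an increasing family lie in one of them, so compactness yields a single
    index. *)
Lemma compact_directed {T : UniformSpace} (K : T -> Prop) (V : nat -> T -> Prop) :
  compact_set K -> (forall n, open (V n)) -> (forall n m, (n <= m)%nat -> forall x, V n x -> V m x) ->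
  (forall x, K x -> exists n, V n x) -> exists n, forall x, K x -> V n x.
Proof.
  intros HK HO HM HC.
  destruct (HK (fun W => exists n, W = V n)) as (l & Hl & Hc).
  - intros W [n ->]. apply HO.
  - intros x Hx. destruct (HC x Hx) as [n Hn]. exists (V n). split; [now exists n|easy].
  - assert (exists N, forall W, In W l -> forall x, W x -> V N x) as [N HN].
    { clear Hc. induction l as [|W l IH].
      - exists 0%nat. intros W [].
      - destruct IH as [N HN]; [intros; apply Hl; now right|].
        destruct (Hl W (or_introl eq_refl)) as [n ->].
        exists (max n N). intros W' [<-|HW'] x Hx.
        + apply (HM n); [lia|easy].
        + apply (HM N); [lia|]. now apply (HN W'). }
    exists N. intros x Hx. destruct (Hc x Hx) as (W & HW & HWx). now apply (HN W).
Qed.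

Lemma small_inv_nat (e : R) : 0 < e -> exists n : nat, / (INR n + 2) < e.
Proof.
  intros He. destruct (INR_unbounded (/ e)) as [n Hn]. exists n.
  rewrite <- (Rinv_inv e). apply Rinv_lt_contravar; [|lra].
  assert (0 < / e) by now apply Rinv_0_lt_compat. apply Rmult_lt_0_compat; lra.
Qed.

Lemma inv_nat_range (n : nat) : 0 < / (INR n + 2) <= / 2.
Proof.
  assert (P := pos_INR n). split; [apply Rinv_0_lt_compat; lra|apply Rinv_le_contravar; lra].
Qed.

Lemma inv_nat_decr (n m : nat) : (n <= m)%nat -> / (INR m + 2) <= / (INR n + 2).
Proof.
  intros H. assert (P := pos_INR n). apply le_INR in H. apply Rinv_le_contravar; lra.
Qed.

Lemma continuous_fst_C2 (x : C2) : continuous (fun x : C2 => fst x : C) x.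
Proof. destruct x as [a b]. exact (continuous_fst (U := C_UniformSpace) (V := C_UniformSpace) a b). Qed.

Lemma continuous_snd_C2 (x : C2) : continuous (fun x : C2 => snd x : C) x.
Proof. destruct x as [a b]. exact (continuous_snd (U := C_UniformSpace) (V := C_UniformSpace) a b). Qed.

Lemma locally_lt {T : UniformSpace} (f g : T -> R) (x : T) :
  continuous f x -> continuous g x -> f x < g x -> locally x (fun y => f y < g y).
Proof.
  intros Hf Hg H.
  assert (D : continuous (fun y => g y - f y) x) by now apply (continuous_minus (V := R_NormedModule)).
  assert (P : 0 < g x - f x) by lra.
  apply filterlim_locally with (eps := mkposreal _ P) in D. revert D. apply filter_imp.
  intros y Hy. change (Rabs ((g y - f y) - (g x - f x)) < g x - f x) in Hy.
  apply Rabs_def2 in Hy. lra.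
Qed.

Lemma compact_complement_open (K : C2 -> Prop) (y : C2) :
  compact_set K -> ~ K y -> locally y (fun x => ~ K x).
Proof.
  intros HK Hy. destruct y as [a b].
  set (dist := fun x : C2 => Cmod (fst x - a) + Cmod (snd x - b)).
  assert (Cd : forall x, continuous dist x).
  { intros x. apply (continuous_plus (V := R_NormedModule)); apply continuous_Cmod;
    (apply continuous_Cminus; [|apply continuous_const]).
    - apply continuous_fst_C2.
    - apply continuous_snd_C2. }
  destruct (compact_directed K (fun n x => / (INR n + 2) < dist x) HK) as [n Hn].
  - intros n x Hx. apply (locally_lt (fun _ => / (INR n + 2)) dist); [apply continuous_const|apply Cd|easy].
  - intros n m H x Hx. generalize (inv_nat_decr n m H). lra.
  - intros [z w] Hx. apply small_inv_nat. unfold dist; simpl.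
    assert (P1 := Cmod_ge_0 (z - a)). assert (P2 := Cmod_ge_0 (w - b)).
    destruct P1 as [P1|P1]; [lra|]. destruct P2 as [P2|P2]; [lra|]. exfalso. apply Hy.
    symmetry in P1, P2. apply Cmod_eq_0, Ceq_minus in P1. apply Cmod_eq_0, Ceq_minus in P2. now subst.
  - apply locally_C2_iff. assert (P := inv_nat_range n). exists (/ (INR n + 2) / 2). split; [lra|].
    intros z w Hz Hw HKx. specialize (Hn _ HKx). unfold dist in Hn; simpl in Hn. lra.
Qed.

(** Points of C^2 are read as 4-tuples of reals, where gauge compactness of a box applies. A point
    outside K receives a ball missing K, and such balls are dropped from the finite list. *)
Lemma heine_borel_C2 (K : C2 -> Prop) (M : R) :
  (forall x, K x -> Cmod (fst x) <= M /\ Cmod (snd x) <= M) ->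
  (forall x, ~ K x -> locally x (fun y => ~ K y)) -> compact_set K.
Proof.
  intros HM HC cov HO Hcov.
  set (T4 := Compactness.Tn 4 R).
  set (pt := fun t : T4 => let '(a, (b, (c, (d, _)))) := t in (((a, b) : C), ((c, d) : C)) : C2).
  assert (D : forall t : T4, exists d : posreal,
     (~ K (pt t) /\ forall y, ball (pt t) d y -> ~ K y) \/
     (exists V, cov V /\ forall y, ball (pt t) d y -> V y)).
  { intros t. destruct (classic (K (pt t))) as [Hk|Hk].
    - destruct (Hcov _ Hk) as (V & HV & HVx). destruct (HO V HV _ HVx) as [d Hd].
      exists d. right. now exists V.
    - destruct (HC _ Hk) as [d Hd]. exists d. now left. }
  set (delta := fun t => proj1_sig (constructive_indefinite_description _ (D t))).
  assert (Hdelta : forall t, (~ K (pt t) /\ forall y, ball (pt t) (delta t) y -> ~ K y) \/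
     (exists V, cov V /\ forall y, ball (pt t) (delta t) y -> V y)).
  { intros t. exact (proj2_sig (constructive_indefinite_description _ (D t))). }
  set (lo := (- M, (- M, (- M, (- M, tt)))) : T4). set (hi := (M, (M, (M, (M, tt)))) : T4).
  apply NNPP. intros N. apply (compactness_list 4 lo hi delta). intros [l Hl]. apply N. clear N.
  assert (exists lV : list (C2 -> Prop), (forall V, In V lV -> cov V) /\
    forall t, In t l -> (forall y, ball (pt t) (delta t) y -> ~ K y) \/
      exists V, In V lV /\ forall y, ball (pt t) (delta t) y -> V y) as (lV & H1 & H2).
  { clear Hl. induction l as [|t l IH].
    - exists nil. split; [intros V []|intros t []].
    - destruct IH as (lV & H1 & H2). destruct (Hdelta t) as [[_ A]|(V & HV & A)].
      + exists lV. split; [easy|]. intros s [<-|Hs]; [now left|now apply H2].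
      + exists (V :: lV). split; [intros W [<-|HW]; auto|].
        intros s [<-|Hs].
        * right. exists V. split; [now left|easy].
        * destruct (H2 s Hs) as [A'|(W & HW & A')]; [now left|right]. exists W. split; [now right|easy]. }
  exists lV. split; [easy|]. intros [[a b] [c d]] HK.
  destruct (HM _ HK) as [M1 M2]. simpl in M1, M2.
  assert (A1 := re_le_Cmod (a, b)). assert (A2 := im_le_Cmod (a, b)).
  assert (A3 := re_le_Cmod (c, d)). assert (A4 := im_le_Cmod (c, d)). simpl in A1, A2, A3, A4.
  apply Rabs_le_between in A1, A2, A3, A4.
  destruct (Hl (a, (b, (c, (d, tt))))) as ((a' & b' & c' & d' & u) & Ht & _ & B1 & B2 & B3 & B4 & _).
  { unfold lo, hi. simpl. repeat split; lra. }
  assert (B : ball (pt (a', (b', (c', (d', u))))) (delta (a', (b', (c', (d', u))))) (((a, b) : C), ((c, d) : C))).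
  { split; split; assumption. }
  destruct (H2 _ Ht) as [A|(V & HV & A)].
  - exfalso. exact (A _ B HK).
  - exists V. split; [easy|]. exact (A _ B).
Qed.

(** * Exhaustion of the Hartogs triangle and properness as an escape condition *)

(** The Hartogs triangle depends on p and q only through r = q / p. With w <> 0 built in, real
    powers are taken of positive numbers only. *)
Definition hdom (r : R) (x : C2) : Prop :=
  0 < Cmod (snd x) < 1 /\ Cmod (fst x) < Rpower (Cmod (snd x)) r.

Lemma Rpower_pos (x y : R) : 0 < Rpower x y.
Proof. apply exp_pos. Qed.

Lemma Rpower_lt_iff (x y c : R) : 0 < x -> 0 < y -> 0 < c -> (Rpower x c < Rpower y c <-> x < y).
Proof.
  intros Hx Hy Hc. split; intros H.
  - apply Rnot_le_lt. intros L.
    assert (Rpower y c <= Rpower x c) by (apply Rle_Rpower_l; lra). lra.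
  - apply Rlt_Rpower_l; lra.
Qed.

Lemma Rpower_1_base (c : R) : Rpower 1 c = 1.
Proof. unfold Rpower. rewrite ln_1, Rmult_0_r. apply exp_0. Qed.

Lemma hartogs_hdom (p q : R) (x : C2) : 0 < p -> 0 < q -> hartogs p q x <-> hdom (q / p) x.
Proof.
  intros Hp Hq. destruct x as [z w]. unfold hartogs, hdom, rpow; simpl.
  assert (Pz := Cmod_ge_0 z). assert (Pw := Cmod_ge_0 w).
  destruct (Req_EM_T (Cmod w) 0) as [Ew|Nw].
  { rewrite Ew. split; intros H; [|lra]. destruct H as [H _]. exfalso.
    destruct (Req_EM_T (Cmod z) 0); [lra|]. generalize (Rpower_pos (Cmod z) (2 * p)). lra. }
  assert (W1 : Rpower (Cmod w) (2 * q) < 1 <-> Cmod w < 1).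
  { rewrite <- (Rpower_1_base (2 * q)) at 1. apply Rpower_lt_iff; lra. }
  rewrite W1.
  assert (E : Rpower (Cmod w) (2 * q) = Rpower (Rpower (Cmod w) (q / p)) (2 * p)).
  { rewrite Rpower_mult. f_equal. field. lra. }
  destruct (Req_EM_T (Cmod z) 0) as [Ez|Nz].
  - rewrite Ez. generalize (Rpower_pos (Cmod w) (2 * q)) (Rpower_pos (Cmod w) (q / p)). intros. split; lra.
  - rewrite E, Rpower_lt_iff; try lra. apply Rpower_pos.
Qed.

(** An exhaustion: the open sets absorb every compact subset, and the closed ones are compact for r,
    d > 0. The bound on |z| is relative to |w|^r, so that in the covering coordinate t it becomes a
    bound of |t| by 1 - d. *)
Definition hopen (r d : R) (x : C2) : Prop :=
  d < Cmod (snd x) < 1 - d /\ Cmod (fst x) < (1 - d) * Rpower (Cmod (snd x)) r.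
Definition hclosed (r d : R) (x : C2) : Prop :=
  d <= Cmod (snd x) <= 1 - d /\ Cmod (fst x) <= (1 - d) * Rpower (Cmod (snd x)) r.

Lemma continuous_Rpower_base (r x : R) : 0 < x -> continuous (fun x => Rpower x r) x.
Proof.
  intros Hx. apply continuity_pt_filterlim. apply derivable_continuous_pt.
  exists (r * Rpower x (r - 1)). now apply derivable_pt_lim_power.
Qed.

Lemma continuous_modfst (x : C2) : continuous (fun x : C2 => Cmod (fst x)) x.
Proof. apply continuous_Cmod, continuous_fst_C2. Qed.
Lemma continuous_modsnd (x : C2) : continuous (fun x : C2 => Cmod (snd x)) x.
Proof. apply continuous_Cmod, continuous_snd_C2. Qed.
Lemma continuous_hbound (r k : R) (x : C2) : 0 < Cmod (snd x) ->
  continuous (fun x : C2 => k * Rpower (Cmod (snd x)) r) x.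
Proof.
  intros H. apply (continuous_mult (K := R_AbsRing)); [apply continuous_const|].
  apply (continuous_comp (fun x : C2 => Cmod (snd x)) (fun y => Rpower y r));
   [apply continuous_modsnd|now apply continuous_Rpower_base].
Qed.

Lemma open_hopen (r d : R) : 0 <= d -> open (hopen r d).
Proof.
  intros Hd x ([H1 H2] & H3). repeat apply filter_and.
  - apply (locally_lt (fun _ => d)); [apply continuous_const|apply continuous_modsnd|easy].
  - apply (locally_lt _ (fun _ => 1 - d)); [apply continuous_modsnd|apply continuous_const|easy].
  - apply locally_lt; [apply continuous_modfst|apply continuous_hbound; lra|easy].
Qed.

Lemma hopen_0 (r : R) (x : C2) : hopen r 0 x <-> hdom r x.
Proof. unfold hopen, hdom. rewrite Rminus_0_r, Rmult_1_l. reflexivity. Qed.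

Lemma open_hdom (r : R) (x : C2) : hdom r x -> locally x (hdom r).
Proof.
  intros H. apply hopen_0 in H. apply (open_hopen r 0 (Rle_refl 0)) in H. revert H.
  apply filter_imp. intros y. apply hopen_0.
Qed.

Lemma hopen_mono (r d d' : R) (x : C2) : d' <= d -> hopen r d x -> hopen r d' x.
Proof.
  intros H (H1 & H2). split; [lra|]. apply Rlt_le_trans with (1 := H2).
  apply Rmult_le_compat_r; [left; apply Rpower_pos|lra].
Qed.

Lemma hopen_hclosed (r d : R) (x : C2) : hopen r d x -> hclosed r d x.
Proof. unfold hopen, hclosed. lra. Qed.

Lemma hclosed_hdom (r d : R) (x : C2) : 0 < d -> hclosed r d x -> hdom r x.
Proof.
  intros Hd (H1 & H2). split; [lra|]. apply Rle_lt_trans with (1 := H2).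
  assert (P := Rpower_pos (Cmod (snd x)) r). nra.
Qed.

Lemma hdom_exhaust (r : R) (x : C2) : hdom r x -> exists n : nat, hopen r (/ (INR n + 2)) x.
Proof.
  intros (H1 & H2). assert (P := Rpower_pos (Cmod (snd x)) r).
  set (Q := Cmod (fst x) / Rpower (Cmod (snd x)) r).
  assert (HQ : Q < 1) by (unfold Q; apply Rlt_div_l; lra).
  destruct (small_inv_nat (Rmin (Rmin (Cmod (snd x)) (1 - Cmod (snd x))) (1 - Q))) as [n Hn].
  { repeat apply Rmin_glb_lt; lra. }
  exists n. assert (A1 := Rmin_r (Rmin (Cmod (snd x)) (1 - Cmod (snd x))) (1 - Q)).
  assert (A2 := Rmin_l (Rmin (Cmod (snd x)) (1 - Cmod (snd x))) (1 - Q)).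
  assert (A3 := Rmin_l (Cmod (snd x)) (1 - Cmod (snd x))). assert (A4 := Rmin_r (Cmod (snd x)) (1 - Cmod (snd x))).
  split; [lra|]. apply Rlt_div_l; [easy|]. fold Q. lra.
Qed.

Lemma compact_in_hopen (r : R) (K : C2 -> Prop) : compact_set K -> (forall x, K x -> hdom r x) ->
  exists d, 0 < d /\ forall x, K x -> hopen r d x.
Proof.
  intros HK HD.
  destruct (compact_directed K (fun n => hopen r (/ (INR n + 2))) HK) as [n Hn].
  - intros n. apply open_hopen. generalize (inv_nat_range n). lra.
  - intros n m H x. apply hopen_mono. now apply inv_nat_decr.
  - intros x Hx. apply hdom_exhaust. auto.
  - exists (/ (INR n + 2)). split; [apply inv_nat_range|easy].
Qed.

Lemma hclosed_complement_open (r d : R) (x : C2) : 0 < d -> ~ hclosed r d x -> locally x (fun y => ~ hclosed r d y).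
Proof.
  intros Hd H. unfold hclosed in H.
  destruct (Rlt_dec (Cmod (snd x)) d) as [L|L].
  { generalize (locally_lt _ (fun _ => d) x (continuous_modsnd x) (continuous_const _ _) L).
    apply filter_imp. unfold hclosed. intros y Hy. lra. }
  destruct (Rlt_dec (1 - d) (Cmod (snd x))) as [L'|L'].
  { generalize (locally_lt (fun _ => 1 - d) _ x (continuous_const _ _) (continuous_modsnd x) L').
    apply filter_imp. unfold hclosed. intros y Hy. lra. }
  assert (L3 : (1 - d) * Rpower (Cmod (snd x)) r < Cmod (fst x)).
  { apply Rnot_le_lt. intros L3. apply H. lra. }
  generalize (locally_lt _ _ x (continuous_hbound r (1 - d) x ltac:(lra)) (continuous_modfst x) L3).
  apply filter_imp. unfold hclosed. intros y Hy. lra.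
Qed.

Lemma Rpower_le_1 (x r : R) : 0 < x <= 1 -> 0 < r -> Rpower x r <= 1.
Proof.
  intros Hx Hr. rewrite <- (Rpower_1_base r). apply Rle_Rpower_l; lra.
Qed.

Lemma compact_hclosed (r d : R) : 0 < r -> 0 < d -> compact_set (hclosed r d).
Proof.
  intros Hr Hd. apply (heine_borel_C2 _ 1).
  - intros x (H1 & H2). split; [|lra]. apply Rle_trans with (1 := H2).
    assert (P := Rpower_pos (Cmod (snd x)) r). assert (B := Rpower_le_1 (Cmod (snd x)) r ltac:(lra) Hr). nra.
  - intros x Hx. now apply hclosed_complement_open.
Qed.

(** The preimage of a compact [hclosed r' e] is compact, hence absorbed by some [hopen r d]. This is
    all that properness contributes to the lifted problem. *)
Lemma proper_escape (r r' : R) (F : C2 -> C2) : 0 < r' -> proper_map (hdom r) (hdom r') F ->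
  forall e, 0 < e -> exists d, 0 < d /\ forall x, hdom r x -> hclosed r' e (F x) -> hopen r d x.
Proof.
  intros Hr HF e He.
  assert (C := HF (hclosed r' e) (fun y => hclosed_hdom r' e y He) (compact_hclosed r' e Hr He)).
  destruct (compact_in_hopen r _ C) as (d & Hd & H); [now intros x [Hx _]|].
  exists d. split; [easy|]. intros x H1 H2. now apply H.
Qed.

(** The preimage of a compact set lies in some [hclosed r d], hence is bounded. Its complement is
    open: at points of [hclosed r d] by continuity of F, elsewhere because [hclosed r d] is
    closed. *)
Lemma escape_proper (r r' : R) (F : C2 -> C2) : 0 < r ->
  (forall x, hdom r x -> continuous F x) ->
  (forall e, 0 < e -> exists d, 0 < d /\ forall x, hdom r x -> hclosed r' e (F x) -> hclosed r d x) ->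
  proper_map (hdom r) (hdom r') F.
Proof.
  intros Hr HC H K HK CK.
  destruct (compact_in_hopen r' K CK HK) as (e & He & HKe).
  destruct (H e He) as (d & Hd & HF).
  assert (Sub : forall x, hdom r x /\ K (F x) -> hclosed r d x).
  { intros x [Hx Hk]. apply HF; [easy|]. apply hopen_hclosed. auto. }
  apply (heine_borel_C2 _ 1).
  - intros x Hx. apply Sub in Hx. destruct Hx as (H1 & H2). split; [|lra]. apply Rle_trans with (1 := H2).
    assert (P := Rpower_pos (Cmod (snd x)) r). assert (B := Rpower_le_1 (Cmod (snd x)) r ltac:(lra) Hr). nra.
  - intros x Hx. destruct (classic (hclosed r d x)) as [Y|N].
    + assert (Hd' := hclosed_hdom r d x Hd Y).
      assert (NK : ~ K (F x)) by (intros Y'; apply Hx; now split).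
      assert (L := compact_complement_open K (F x) CK NK). apply (HC x Hd') in L.
      unfold filtermap in L. revert L. apply filter_imp. intros y Hy [_ Hy']. now apply Hy.
    + generalize (hclosed_complement_open r d x Hd N). apply filter_imp.
      intros y Hy Hy'. apply Hy. now apply Sub.
Qed.

(** * Holomorphy in two variables *)

(** The sum of the two moduli serves as norm on C^2; it is comparable to the norm of [C2] and easier
    to estimate with. *)
Definition c2diff (u : C2 -> C) (a b : C) : Prop :=
  exists A B : C, forall e, 0 < e -> exists d, 0 < d /\ forall z w : C, Cmod (z - a) < d -> Cmod (w - b) < d ->
    Cmod (u (z, w) - u (a, b) - (A * (z - a) + B * (w - b)))%C <= e * (Cmod (z - a) + Cmod (w - b)).

Lemma norm_C2_le (z w : C) : @norm C_AbsRing C2 (z, w) <= Cmod z + Cmod w.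
Proof.
  change (sqrt (Cmod z ^ 2 + Cmod w ^ 2) <= Cmod z + Cmod w).
  assert (Pz := Cmod_ge_0 z). assert (Pw := Cmod_ge_0 w).
  rewrite <- (sqrt_pow2 (Cmod z + Cmod w)) by lra. apply sqrt_le_1_alt. nra.
Qed.

Lemma norm_C2_ge (z w : C) : Cmod z <= @norm C_AbsRing C2 (z, w) /\ Cmod w <= @norm C_AbsRing C2 (z, w).
Proof.
  change (Cmod z <= sqrt (Cmod z ^ 2 + Cmod w ^ 2) /\ Cmod w <= sqrt (Cmod z ^ 2 + Cmod w ^ 2)).
  assert (Pz := Cmod_ge_0 z). assert (Pw := Cmod_ge_0 w).
  split; [rewrite <- (sqrt_pow2 (Cmod z)) at 1 by lra|rewrite <- (sqrt_pow2 (Cmod w)) at 1 by lra];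
  apply sqrt_le_1_alt; nra.
Qed.

(** A C-linear map is determined by its values at (1, 0) and (0, 1), which supply the coefficients
    A, B of both components; the change of norm costs only constants. *)
Lemma ex_filterdiff_C2_iff (F : C2 -> C2) (a b : C) :
  ex_filterdiff F (locally ((a, b) : C2)) <->
  c2diff (fun x => fst (F x)) a b /\ c2diff (fun x => snd (F x)) a b.
Proof.
  split.
  - intros [L [HL HD]].
    specialize (HD (a, b) (fun P H => H)).
    assert (Lin : forall z w : C, L (z, w) = plus (scal (z : C_AbsRing) (L (RtoC 1, RtoC 0))) (scal (w : C_AbsRing) (L (RtoC 0, RtoC 1)))).
    { intros z w. rewrite <- !(linear_scal L HL), <- (linear_plus L HL). f_equal.
      apply (f_equal2 pair); [change (z = z * 1 + w * 0)%C|change (w = z * 0 + w * 1)%C]; ring. }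
    assert (E : forall e, 0 < e -> exists d, 0 < d /\ forall z w : C, Cmod (z - a) < d -> Cmod (w - b) < d ->
       @norm C_AbsRing C2 (minus (minus (F (z, w)) (F (a, b))) (L (z - a, w - b)%C)) <= e * (Cmod (z - a) + Cmod (w - b))).
    { intros e He. specialize (HD (mkposreal e He)). apply locally_C2_iff in HD. destruct HD as (d & Hd & H).
      exists d. split; [easy|]. intros z w Hz Hw. specialize (H z w Hz Hw). simpl in H.
      apply Rle_trans with (1 := H). apply Rmult_le_compat_l; [lra|]. apply norm_C2_le. }
    destruct (L (RtoC 1, RtoC 0)) as [A A']. destruct (L (RtoC 0, RtoC 1)) as [B B'].
    split; [exists A, B|exists A', B']; intros e He; destruct (E e He) as (d & Hd & H); exists d; (split; [easy|]);
    intros z w Hz Hw; specialize (H z w Hz Hw); rewrite Lin in H; apply Rle_trans with (2 := H);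
    destruct (F (z, w)) as [f1 g1]; destruct (F (a, b)) as [f0 g0]; simpl fst; simpl snd.
    + eapply Rle_trans; [|apply (proj1 (norm_C2_ge _ _))]. right. f_equal.
      change ((f1 - f0 - (A * (z - a) + B * (w - b)))%C = (f1 - f0 - ((z - a) * A + (w - b) * B))%C). ring.
    + eapply Rle_trans; [|apply (proj2 (norm_C2_ge _ _))]. right. f_equal.
      change ((g1 - g0 - (A' * (z - a) + B' * (w - b)))%C = (g1 - g0 - ((z - a) * A' + (w - b) * B'))%C). ring.
  - intros [(A & B & H1) (A' & B' & H2)].
    set (L := fun x : C2 => ((A * fst x + B * snd x)%C, (A' * fst x + B' * snd x)%C) : C2).
    exists L. split.
    + split.
      * intros [z w] [z' w']. apply (f_equal2 pair);
        [change (A * (z + z') + B * (w + w') = (A * z + B * w) + (A * z' + B * w'))%C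
        |change (A' * (z + z') + B' * (w + w') = (A' * z + B' * w) + (A' * z' + B' * w'))%C]; ring.
      * intros k [z w]. apply (f_equal2 pair);
        [change (A * (k * z) + B * (k * w) = k * (A * z + B * w))%C
        |change (A' * (k * z) + B' * (k * w) = k * (A' * z + B' * w))%C]; ring.
      * exists (Cmod A + Cmod B + Cmod A' + Cmod B' + 1).
        assert (PA := Cmod_ge_0 A). assert (PB := Cmod_ge_0 B). assert (PA' := Cmod_ge_0 A'). assert (PB' := Cmod_ge_0 B').
        split; [lra|]. intros [z w]. destruct (norm_C2_ge z w) as [N1 N2].
        set (n := @norm C_AbsRing C2 (z, w)) in *.
        assert (Pn : 0 <= n) by apply norm_ge_0.
        eapply Rle_trans; [apply norm_C2_le|]. simpl.
        eapply Rle_trans; [apply Rplus_le_compat; apply Cmod_triangle|]. rewrite !Cmod_mult.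
        change (@norm C_AbsRing (prod_NormedModule C_AbsRing C_NormedModule C_NormedModule) (z, w)) with n.
        assert (X : forall A : C, Cmod A * Cmod z <= Cmod A * n /\ Cmod A * Cmod w <= Cmod A * n).
        { intros A0. split; (apply Rmult_le_compat_l; [apply Cmod_ge_0|easy]). }
        generalize (proj1 (X A)) (proj2 (X B)) (proj1 (X A')) (proj2 (X B')). lra.
    + intros x Hx. apply is_filter_lim_locally_unique in Hx. subst x. intros [e He].
      destruct (H1 (e / 4)) as (d1 & Hd1 & X1); [lra|]. destruct (H2 (e / 4)) as (d2 & Hd2 & X2); [lra|].
      apply locally_C2_iff. exists (Rmin d1 d2). split; [now apply Rmin_glb_lt|].
      intros z w Hz Hw.
      specialize (X1 z w (Rlt_le_trans _ _ _ Hz (Rmin_l _ _)) (Rlt_le_trans _ _ _ Hw (Rmin_l _ _))).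
      specialize (X2 z w (Rlt_le_trans _ _ _ Hz (Rmin_r _ _)) (Rlt_le_trans _ _ _ Hw (Rmin_r _ _))).
      change (@norm C_AbsRing C2 ((fst (F (z, w)) - fst (F (a, b)) - (A * (z - a) + B * (w - b)))%C,
         (snd (F (z, w)) - snd (F (a, b)) - (A' * (z - a) + B' * (w - b)))%C) <= e * @norm C_AbsRing C2 ((z - a)%C, (w - b)%C)).
      eapply Rle_trans; [apply norm_C2_le|]. destruct (norm_C2_ge (z - a)%C (w - b)%C) as [N1 N2].
      nra.
Qed.

Lemma ex_filterdiff_C_iff (f : C_NormedModule -> C_NormedModule) (a : C_NormedModule) :
  ex_filterdiff f (locally a) <-> cdiff f a.
Proof.
  split.
  - intros [L [HL HD]]. specialize (HD a (fun P H => H)).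
    exists (L (RtoC 1)). intros e He. specialize (HD (mkposreal e He)).
    apply locally_C_iff in HD. destruct HD as (d & Hd & H). exists d. split; [easy|]. intros z Hz.
    specialize (H z Hz). simpl in H. apply Rle_trans with (2 := H). right.
    change (Cmod (f z - f a - L (RtoC 1) * (z - a))%C = Cmod (f z - f a - L (z - a)%C)%C). f_equal. f_equal. f_equal.
    rewrite Cmult_comm. change ((scal ((z - a)%C : C_AbsRing) (L (RtoC 1))) = L (z - a)%C).
    rewrite <- (linear_scal L HL). f_equal. change (((z - a) * 1)%C = (z - a)%C). ring.
  - intros [l Hl]. exists (fun z : C_NormedModule => (z * l)%C). split.
    + split.
      * intros z w. change ((z + w) * l = z * l + w * l)%C. ring.
      * intros k z. change (k * z * l = k * (z * l))%C. ring.
      * exists (Cmod l + 1). assert (Pl := Cmod_ge_0 l). split; [lra|]. intros z.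
        change (Cmod (z * l)%C <= (Cmod l + 1) * Cmod z). rewrite Cmod_mult.
        assert (Pz := Cmod_ge_0 z). nra.
    + intros x Hx. apply is_filter_lim_locally_unique in Hx. subst x. intros [e He].
      destruct (Hl e He) as (d & Hd & H). apply locally_C_iff. exists d. split; [easy|]. intros z Hz.
      specialize (H z Hz). change (Cmod (f z - f a - (z - a) * l)%C <= e * Cmod (z - a)%C).
      now rewrite (Cmult_comm (z - a)).
Qed.

Lemma c2diff_locally_ext (u v : C2 -> C) (a b : C) :
  locally ((a, b) : C2) (fun x => u x = v x) -> c2diff u a b -> c2diff v a b.
Proof.
  intros HE (A & B & H). apply locally_C2_iff in HE. destruct HE as (d0 & Hd0 & E).
  exists A, B. intros e He. destruct (H e He) as (d & Hd & X).
  exists (Rmin d d0). split; [now apply Rmin_glb_lt|]. intros z w Hz Hw.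
  rewrite <- !E.
  - apply X; eapply Rlt_le_trans; try eassumption; apply Rmin_l.
  - replace (a - a)%C with (RtoC 0) by ring. now rewrite Cmod_0.
  - replace (b - b)%C with (RtoC 0) by ring. now rewrite Cmod_0.
  - eapply Rlt_le_trans; [exact Hz|apply Rmin_r].
  - eapply Rlt_le_trans; [exact Hw|apply Rmin_r].
Qed.

Lemma c2diff_lipschitz (u : C2 -> C) (a b : C) : c2diff u a b ->
  exists M d, 0 < M /\ 0 < d /\ forall z w : C, Cmod (z - a) < d -> Cmod (w - b) < d ->
    Cmod (u (z, w) - u (a, b))%C <= M * (Cmod (z - a) + Cmod (w - b)).
Proof.
  intros (A & B & H). destruct (H 1 Rlt_0_1) as (d & Hd & X).
  assert (PA := Cmod_ge_0 A). assert (PB := Cmod_ge_0 B).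
  exists (1 + Cmod A + Cmod B), d. split; [lra|]. split; [easy|]. intros z w Hz Hw. specialize (X z w Hz Hw).
  replace (u (z, w) - u (a, b))%C with ((u (z, w) - u (a, b) - (A * (z - a) + B * (w - b))) + (A * (z - a) + B * (w - b)))%C by ring.
  eapply Rle_trans; [apply Cmod_triangle|].
  assert (T := Cmod_triangle (A * (z - a)) (B * (w - b))). rewrite !Cmod_mult in T.
  assert (Pz := Cmod_ge_0 (z - a)). assert (Pw := Cmod_ge_0 (w - b)). nra.
Qed.

Lemma c2diff_continuous (u : C2 -> C) (a b : C) : c2diff u a b -> continuous u ((a, b) : C2).
Proof.
  intros H. destruct (c2diff_lipschitz u a b H) as (M & d & PM & Hd & X).
  apply continuous_C_iff. intros e He. apply locally_C2_iff.
  exists (Rmin d (e / (4 * M))). split; [apply Rmin_glb_lt; [easy|apply Rdiv_lt_0_compat; lra]|].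
  intros z w Hz Hw.
  assert (Hz1 := Rlt_le_trans _ _ _ Hz (Rmin_r _ _)). assert (Hw1 := Rlt_le_trans _ _ _ Hw (Rmin_r _ _)).
  specialize (X z w (Rlt_le_trans _ _ _ Hz (Rmin_l _ _)) (Rlt_le_trans _ _ _ Hw (Rmin_l _ _))).
  apply Rle_lt_trans with (1 := X).
  apply Rle_lt_trans with (M * (e / (4 * M) + e / (4 * M))).
  - apply Rmult_le_compat_l; lra.
  - replace (M * (e / (4 * M) + e / (4 * M))) with (e / 2) by (field; lra). lra.
Qed.

Lemma c2diff_const (c : C) (a b : C) : c2diff (fun _ => c) a b.
Proof.
  exists 0, 0. intros e He. exists 1. split; [lra|]. intros z w _ _.
  replace (c - c - (0 * (z - a) + 0 * (w - b)))%C with (RtoC 0) by ring. rewrite Cmod_0.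
  generalize (Cmod_ge_0 (z - a)) (Cmod_ge_0 (w - b)). nra.
Qed.

Lemma c2diff_fst (a b : C) : c2diff (fun x => fst x) a b.
Proof.
  exists 1, 0. intros e He. exists 1. split; [lra|]. intros z w _ _. simpl.
  replace (z - a - (1 * (z - a) + 0 * (w - b)))%C with (RtoC 0) by ring. rewrite Cmod_0.
  generalize (Cmod_ge_0 (z - a)) (Cmod_ge_0 (w - b)). nra.
Qed.

Lemma c2diff_snd (a b : C) : c2diff (fun x => snd x) a b.
Proof.
  exists 0, 1. intros e He. exists 1. split; [lra|]. intros z w _ _. simpl.
  replace (w - b - (0 * (z - a) + 1 * (w - b)))%C with (RtoC 0) by ring. rewrite Cmod_0.
  generalize (Cmod_ge_0 (z - a)) (Cmod_ge_0 (w - b)). nra.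
Qed.

Lemma c2diff_plus (u v : C2 -> C) (a b : C) : c2diff u a b -> c2diff v a b -> c2diff (fun x => u x + v x)%C a b.
Proof.
  intros (A & B & H1) (A' & B' & H2). exists (A + A')%C, (B + B')%C. intros e He.
  destruct (H1 (e / 2)) as (d1 & Hd1 & X1); [lra|]. destruct (H2 (e / 2)) as (d2 & Hd2 & X2); [lra|].
  exists (Rmin d1 d2). split; [now apply Rmin_glb_lt|]. intros z w Hz Hw.
  specialize (X1 z w (Rlt_le_trans _ _ _ Hz (Rmin_l _ _)) (Rlt_le_trans _ _ _ Hw (Rmin_l _ _))).
  specialize (X2 z w (Rlt_le_trans _ _ _ Hz (Rmin_r _ _)) (Rlt_le_trans _ _ _ Hw (Rmin_r _ _))).
  replace (u (z, w) + v (z, w) - (u (a, b) + v (a, b)) - ((A + A') * (z - a) + (B + B') * (w - b)))%C with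
   ((u (z, w) - u (a, b) - (A * (z - a) + B * (w - b))) + (v (z, w) - v (a, b) - (A' * (z - a) + B' * (w - b))))%C by ring.
  eapply Rle_trans; [apply Cmod_triangle|]. lra.
Qed.

Lemma c2diff_comp (h : C -> C) (u : C2 -> C) (a b : C) :
  c2diff u a b -> cdiff h (u (a, b)) -> c2diff (fun x => h (u x)) a b.
Proof.
  intros Hu (l & Hl). assert (Lp := c2diff_lipschitz u a b Hu). assert (Cu := c2diff_continuous u a b Hu).
  destruct Hu as (A & B & H). destruct Lp as (M & d0 & PM & Hd0 & LM).
  assert (Pl := Cmod_ge_0 l).
  exists (l * A)%C, (l * B)%C. intros e He.
  destruct (H (e / 2 / (1 + Cmod l))) as (d1 & Hd1 & X1); [repeat apply Rdiv_lt_0_compat; lra|].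
  destruct (Hl (e / 2 / M)) as (d2 & Hd2 & X2); [repeat apply Rdiv_lt_0_compat; lra|].
  apply continuous_C_iff with (e := d2) in Cu; [|easy]. apply locally_C2_iff in Cu. destruct Cu as (d3 & Hd3 & X3).
  exists (Rmin (Rmin d0 d1) d3). split; [repeat apply Rmin_glb_lt; easy|]. intros z w Hz Hw.
  assert (Z : Cmod (z - a) < d0 /\ Cmod (z - a) < d1 /\ Cmod (z - a) < d3 /\ Cmod (w - b) < d0 /\ Cmod (w - b) < d1 /\ Cmod (w - b) < d3).
  { generalize (Rmin_l (Rmin d0 d1) d3) (Rmin_r (Rmin d0 d1) d3) (Rmin_l d0 d1) (Rmin_r d0 d1). lra. }
  destruct Z as (Z1 & Z2 & Z3 & W1 & W2 & W3).
  specialize (LM z w Z1 W1). specialize (X1 z w Z2 W2). specialize (X3 z w Z3 W3). specialize (X2 _ X3).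
  replace (h (u (z, w)) - h (u (a, b)) - (l * A * (z - a) + l * B * (w - b)))%C with
    ((h (u (z, w)) - h (u (a, b)) - l * (u (z, w) - u (a, b))) + l * (u (z, w) - u (a, b) - (A * (z - a) + B * (w - b))))%C by ring.
  eapply Rle_trans; [apply Cmod_triangle|]. rewrite Cmod_mult.
  set (n := Cmod (z - a) + Cmod (w - b)) in *.
  assert (Pn : 0 <= n) by (unfold n; generalize (Cmod_ge_0 (z - a)) (Cmod_ge_0 (w - b)); lra).
  assert (T1 : e / 2 / M * Cmod (u (z, w) - u (a, b))%C <= e / 2 * n).
  { apply Rle_trans with (e / 2 / M * (M * n)); [|right; field; lra].
    apply Rmult_le_compat_l; [|easy]. left. repeat apply Rdiv_lt_0_compat; lra. }
  assert (T2 : Cmod l * Cmod (u (z, w) - u (a, b) - (A * (z - a) + B * (w - b)))%C <= e / 2 * n).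
  { apply Rle_trans with ((1 + Cmod l) * (e / 2 / (1 + Cmod l) * n)); [|right; field; lra].
    apply Rmult_le_compat; try lra. apply Cmod_ge_0. }
  lra.
Qed.

(** Polarization again: products follow from sums and from composition with squares. *)
Lemma c2diff_mult (u v : C2 -> C) (a b : C) : c2diff u a b -> c2diff v a b -> c2diff (fun x => u x * v x)%C a b.
Proof.
  intros Hu Hv.
  assert (Sq : forall w, c2diff w a b -> forall k : C, c2diff (fun x => k * (w x * w x))%C a b).
  { intros w Hw k. apply (c2diff_comp (fun z => k * (z * z))%C); [easy|].
    apply cdiff_mult; [apply cdiff_const|apply cdiff_mult; apply cdiff_id]. }
  apply (c2diff_locally_ext (fun x => / 4 * ((u x + v x) * (u x + v x)) + - / 4 * ((u x + - (1) * v x) * (u x + - (1) * v x)))%C).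
  - apply filter_forall. intros x. field.
  - apply c2diff_plus; apply Sq.
    + now apply c2diff_plus.
    + apply c2diff_plus; [easy|]. apply (c2diff_comp (fun z => - (1) * z)%C); [easy|].
      apply cdiff_mult; [apply cdiff_const|apply cdiff_id].
Qed.

(** The chain rule along a holomorphic curve; the curves in question are the slices of the covering
    and the axis z = 0. *)
Lemma c2diff_curve (u : C2 -> C) (g1 g2 : C -> C) (s : C) :
  c2diff u (g1 s) (g2 s) -> cdiff g1 s -> cdiff g2 s -> cdiff (fun t => u (g1 t, g2 t)) s.
Proof.
  intros (A & B & H) (l1 & H1) (l2 & H2).
  assert (P1 := Cmod_ge_0 l1). assert (P2 := Cmod_ge_0 l2). assert (PA := Cmod_ge_0 A). assert (PB := Cmod_ge_0 B).
  exists (A * l1 + B * l2)%C. intros e He.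
  set (M := 2 + Cmod l1 + Cmod l2). set (M' := 1 + Cmod A + Cmod B).
  destruct (H (e / 2 / M)) as (d & Hd & X); [unfold M; repeat apply Rdiv_lt_0_compat; lra|].
  assert (He' : 0 < Rmin 1 (e / 2 / M')).
  { unfold M'. apply Rmin_glb_lt; [lra|repeat apply Rdiv_lt_0_compat; lra]. }
  destruct (H1 _ He') as (d1 & Hd1 & X1). destruct (H2 _ He') as (d2 & Hd2 & X2).
  destruct (proj1 (continuous_CC_iff g1 s) (cderiv_continuous _ _ _ H1) d Hd) as (d3 & Hd3 & X3).
  destruct (proj1 (continuous_CC_iff g2 s) (cderiv_continuous _ _ _ H2) d Hd) as (d4 & Hd4 & X4).
  exists (Rmin (Rmin d1 d2) (Rmin d3 d4)). split; [repeat apply Rmin_glb_lt; easy|]. intros t Ht.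
  assert (Z : Cmod (t - s) < d1 /\ Cmod (t - s) < d2 /\ Cmod (t - s) < d3 /\ Cmod (t - s) < d4).
  { generalize (Rmin_l (Rmin d1 d2) (Rmin d3 d4)) (Rmin_r (Rmin d1 d2) (Rmin d3 d4)) (Rmin_l d1 d2) (Rmin_r d1 d2) (Rmin_l d3 d4) (Rmin_r d3 d4). lra. }
  destruct Z as (Z1 & Z2 & Z3 & Z4).
  specialize (X1 t Z1). specialize (X2 t Z2). specialize (X _ _ (X3 t Z3) (X4 t Z4)).
  set (n := Cmod (t - s)) in *. assert (Pn : 0 <= n) by apply Cmod_ge_0.
  assert (R1 := Rmin_l 1 (e / 2 / M')). assert (R2 := Rmin_r 1 (e / 2 / M')). set (e' := Rmin 1 (e / 2 / M')) in *.
  assert (Y1 : Cmod (g1 t - g1 s) <= (1 + Cmod l1) * n).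
  { replace (g1 t - g1 s)%C with ((g1 t - g1 s - l1 * (t - s)) + l1 * (t - s))%C by ring.
    eapply Rle_trans; [apply Cmod_triangle|]. rewrite Cmod_mult. fold n. nra. }
  assert (Y2 : Cmod (g2 t - g2 s) <= (1 + Cmod l2) * n).
  { replace (g2 t - g2 s)%C with ((g2 t - g2 s - l2 * (t - s)) + l2 * (t - s))%C by ring.
    eapply Rle_trans; [apply Cmod_triangle|]. rewrite Cmod_mult. fold n. nra. }
  replace (u (g1 t, g2 t) - u (g1 s, g2 s) - (A * l1 + B * l2) * (t - s))%C with
    ((u (g1 t, g2 t) - u (g1 s, g2 s) - (A * (g1 t - g1 s) + B * (g2 t - g2 s))) +
     (A * (g1 t - g1 s - l1 * (t - s)) + B * (g2 t - g2 s - l2 * (t - s))))%C by ring.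
  eapply Rle_trans; [apply Cmod_triangle|].
  assert (T1 : e / 2 / M * (Cmod (g1 t - g1 s) + Cmod (g2 t - g2 s)) <= e / 2 * n).
  { apply Rle_trans with (e / 2 / M * (M * n)); [|right; field; unfold M; lra].
    apply Rmult_le_compat_l; [|unfold M; lra]. left. unfold M; repeat apply Rdiv_lt_0_compat; lra. }
  assert (T2 : Cmod (A * (g1 t - g1 s - l1 * (t - s)) + B * (g2 t - g2 s - l2 * (t - s)))%C <= e / 2 * n).
  { eapply Rle_trans; [apply Cmod_triangle|]. rewrite !Cmod_mult.
    apply Rle_trans with (M' * (e / 2 / M' * n)); [|right; field; unfold M'; lra].
    assert (e' * n <= e / 2 / M' * n) by now apply Rmult_le_compat_r.
    set (k := e / 2 / M' * n) in *. unfold M'.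
    assert (0 <= k) by (apply Rle_trans with (2 := H0); apply Rmult_le_pos; lra).
    assert (Cmod A * Cmod (g1 t - g1 s - l1 * (t - s)) <= Cmod A * k) by (apply Rmult_le_compat_l; lra).
    assert (Cmod B * Cmod (g2 t - g2 s - l2 * (t - s)) <= Cmod B * k) by (apply Rmult_le_compat_l; lra).
    lra. }
  lra.
Qed.

(** * Vanishing on the left half-plane *)

Definition left_half (s : C) : Prop := Re s < 0.

Lemma Cdisc_left_half (c : C) (z : C) : Cdisc c (- Re c) z -> left_half z.
Proof.
  unfold Cdisc, left_half. intros H. assert (A := re_le_Cmod (z - c)).
  unfold Cminus in A. rewrite re_plus, re_opp in A. generalize (Rle_abs (Re z + - Re c)).
  unfold Cminus in H. lra.
Qed.

Lemma exp_le_exp (x y : R) : x <= y -> exp x <= exp y.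
Proof. intros [H| ->]; [left; now apply exp_increasing|lra]. Qed.

(* By Harnack's inequality a near-maximal value of |u| would propagate along a horizontal segment to the boundary. *)
Lemma left_half_vanish (u : C -> C) (M : R) :
  cdiff_on left_half u -> (forall s, left_half s -> Cmod (u s) <= M) ->
  (forall e, 0 < e -> exists d, 0 < d /\ forall s, left_half s ->
     exp (Re s) <= d \/ 1 - d <= exp (Re s) -> Cmod (u s) <= e) ->
  forall s, left_half s -> u s = 0.
Proof.
  intros Hu HM Hs s0 Hs0. apply NNPP. intros N0.
  assert (P0 : 0 < Cmod (u s0)) by (now apply Cmod_gt_0).
  destruct (completeness (fun x => exists s, left_half s /\ x = Cmod (u s))) as [S [S1 S2]].
  { exists M. intros x (s & Hl & ->). auto. }
  { exists (Cmod (u s0)), s0. now split. }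
  assert (PS : 0 < S) by (apply Rlt_le_trans with (1 := P0); apply S1; now exists s0).
  destruct (Hs (S / 4)) as (d0 & Hd0 & D0); [lra|].
  set (d := Rmin d0 (1 / 4)).
  assert (Hd : 0 < d <= 1 / 4 /\ d <= d0).
  { unfold d. generalize (Rmin_l d0 (1 / 4)) (Rmin_r d0 (1 / 4)) (Rmin_glb_lt d0 (1 / 4) 0 Hd0 ltac:(lra)). lra. }
  assert (D : forall s, left_half s -> exp (Re s) <= d \/ 1 - d <= exp (Re s) -> Cmod (u s) <= S / 4).
  { intros s Hl [A|A]; apply D0; auto; lra. }
  (* Values of modulus above S / 4 occur only in the strip -L < Re s < -dl. *)
  set (L := - ln d). set (dl := - ln (1 - d)).
  assert (Hdl : 0 < dl).
  { unfold dl. assert (ln (1 - d) < ln 1) by (apply ln_increasing; lra). rewrite ln_1 in H. lra. }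
  assert (HL : dl < L).
  { unfold dl, L. assert (ln d < ln (1 - d)) by (apply ln_increasing; lra). lra. }
  (* Chosen so that the near-constancy bound (8 L / (dl / 2)) eta is at most 1 / 16. A near-maximal
     value is used because the supremum S need not be attained. *)
  set (eta := Rmin (1 / 4) (dl / (256 * L))).
  assert (Heta : 0 < eta <= 1 / 4 /\ eta <= dl / (256 * L)).
  { unfold eta. assert (0 < dl / (256 * L)) by (apply Rdiv_lt_0_compat; lra).
    generalize (Rmin_l (1 / 4) (dl / (256 * L))) (Rmin_r (1 / 4) (dl / (256 * L))) (Rmin_glb_lt (1 / 4) (dl / (256 * L)) 0 ltac:(lra) H). lra. }
  assert (exists s, left_half s /\ S * (1 - eta) < Cmod (u s)) as (s & Hl & Hsup).
  { apply NNPP. intros N. assert (S <= S * (1 - eta)); [|nra]. apply S2. intros x (s & Hl & ->).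
    apply Rnot_lt_le. intros A. apply N. now exists s. }
  assert (Big : S / 4 < Cmod (u s)) by nra.
  assert (X1 : - L < Re s).
  { apply Rnot_le_lt. intros A. assert (exp (Re s) <= d); [|generalize (D s Hl (or_introl H)); lra].
    rewrite <- (exp_ln d) by lra. apply exp_le_exp. unfold L in A. lra. }
  assert (X2 : Re s < - dl).
  { apply Rnot_le_lt. intros A. assert (1 - d <= exp (Re s)); [|generalize (D s Hl (or_intror H)); lra].
    rewrite <- (exp_ln (1 - d)) by lra. apply exp_le_exp. unfold dl in A. lra. }
  set (v := fun z => (/ RtoC S * u z)%C).
  assert (NS : RtoC S <> 0) by (intros E; apply RtoC_inj in E; lra).
  assert (Mv : forall z, Cmod (v z) = Cmod (u z) / S).
  { intros z. unfold v. rewrite Cmod_mult, Cmod_inv, Cmod_RtoC_pos by (auto; lra). field. lra. }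
  (* The point of the line Re = -dl at the height of s. It lies in the disc about s that touches the
     imaginary axis, and |u| <= S / 4 there. *)
  set (a := (s + RtoC (- dl - Re s))%C).
  assert (Ra : Re a = - dl) by (unfold a; rewrite re_plus; simpl; ring).
  assert (Da : Cmod (a - s) = - dl - Re s).
  { unfold a. replace (s + RtoC (- dl - Re s) - s)%C with (RtoC (- dl - Re s)) by ring. apply Cmod_RtoC_pos. lra. }
  assert (NC := near_constant v s a (- Re s) (- Re s - dl / 2)
    ltac:(intros z Hz; apply cdiff_mult; [apply cdiff_const|apply Hu; now apply (Cdisc_left_half s)])
    ltac:(intros z Hz; rewrite Mv; apply Rle_div_l; [lra|]; rewrite Rmult_1_l; apply S1; exists z; split;
           [now apply (Cdisc_left_half s)|reflexivity]) ltac:(lra)).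
  rewrite Da, !Mv in NC.
  replace (- Re s - dl / 2 - (- dl - Re s)) with (dl / 2) in NC by lra.
  assert (V1 : 1 - Cmod (u s) / S <= eta).
  { assert (1 - eta < Cmod (u s) / S); [|lra]. apply Rlt_div_r; nra. }
  assert (Bound : Cmod (v a - v s) ^ 2 <= 1 / 16).
  { apply Rle_trans with (1 := NC). apply Rle_trans with (8 * L / (dl / 2) * eta).
    - apply Rmult_le_compat.
      + apply Rdiv_le_0_compat; lra.
      + assert (Cmod (u s) <= S) by (apply S1; exists s; split; easy).
        assert (Cmod (u s) / S <= 1) by (apply Rle_div_l; lra). lra.
      + unfold Rdiv. apply Rmult_le_compat_r; [left; apply Rinv_0_lt_compat; lra|lra].
      + exact V1.
    - apply Rle_trans with (8 * L / (dl / 2) * (dl / (256 * L))).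
      + apply Rmult_le_compat_l; [|lra]. apply Rdiv_le_0_compat; lra.
      + right. field. lra. }
  assert (Close : Cmod (v a - v s) <= 1 / 4).
  { generalize (Cmod_ge_0 (v a - v s)). intros. nra. }
  assert (Small : Cmod (v a) <= 1 / 4).
  { rewrite Mv. apply Rle_div_l; [lra|]. replace (1 / 4 * S) with (S / 4) by field. apply D.
    - unfold left_half. lra.
    - right. rewrite Ra. unfold dl. rewrite Ropp_involutive, exp_ln; lra. }
  assert (T := Cmod_triangle_inv (v s) (v a)). rewrite Cmod_minus_sym in T.
  rewrite (Mv s) in T. lra.
Qed.

(** * Derivatives in t of functions of (t, s), and differentiation along rays *)

Definition Cder (h : C -> C) (a : C) : C := epsilon (inhabits (RtoC 0)) (cderiv h a).

Lemma Cder_correct (h : C -> C) (a : C) : cdiff h a -> cderiv h a (Cder h a).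
Proof. intros H. unfold Cder. apply epsilon_spec. exact H. Qed.

Section ParamDeriv.
Variable phi : C -> C -> C.
Hypothesis Ht : forall s, left_half s -> cdiff_on unit_disc (fun t => phi t s).
Hypothesis Hs : forall t : C, unit_disc t -> cdiff_on left_half (fun s => phi t s).
Hypothesis H1 : forall (t : C) s, unit_disc t -> left_half s -> Cmod (phi t s) <= 1.

Definition Dt (t s : C) : C := Cder (fun t => phi t s) t.

Lemma Dt_correct (t s : C) : unit_disc t -> left_half s -> cderiv (fun t => phi t s) t (Dt t s).
Proof. intros A B. apply Cder_correct. now apply Ht. Qed.

Lemma Cdisc_unit_disc (t z : C) : Cdisc t (1 - Cmod t) z -> unit_disc z.
Proof. unfold Cdisc, unit_disc. intros H. generalize (Cmod_triangle_inv z t). lra. Qed.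

(** The source of decay: the t-derivative becomes small wherever |phi| approaches 1. *)
Lemma Dt_bound (t s : C) : unit_disc t -> left_half s ->
  (1 - Cmod t) * Cmod (Dt t s) <= 2 * (1 - Cmod (phi t s)).
Proof.
  intros A B. apply (schwarz_pick_weak (fun t => phi t s) t).
  - intros z Hz. apply Ht; [easy|]. now apply (Cdisc_unit_disc t).
  - unfold unit_disc in A. lra.
  - now apply Dt_correct.
  - intros z Hz. apply H1; [|easy]. now apply (Cdisc_unit_disc t).
Qed.

Lemma Dt_holomorphic_t (s : C) : left_half s -> cdiff_on unit_disc (fun t => Dt t s).
Proof.
  intros B z Hz. apply (cdiff_on_deriv (fun t => phi t s) (fun t => Dt t s) 0 1 1).
  - intros w Hw. apply Dt_correct; [|easy]. exact (proj1 (Cdisc_0 1 w) Hw).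
  - intros w Hw. apply H1; [|easy]. exact (proj1 (Cdisc_0 1 w) Hw).
  - apply Cdisc_0. exact Hz.
Qed.

(** The Taylor estimate in t is uniform in s. So the difference quotients in t with a fixed step,
    which are holomorphic in s, converge uniformly. *)
Lemma Dt_holomorphic_s (t : C) : unit_disc t -> cdiff_on left_half (fun s => Dt t s).
Proof.
  intros A s0 Hs0.
  assert (U : cdiff_on (Cdisc s0 (- Re s0)) (fun s => Dt t s)).
  { apply cdiff_on_uniform_limit. intros e He. assert (A' := A). unfold unit_disc in A'.
    set (r := (1 - Cmod t) / 2). assert (Hr : 0 < r < 1 - Cmod t) by (unfold r; lra).
    set (K := 2 * 1 / r ^ 2).
    assert (PK : 0 < K) by (apply Rdiv_lt_0_compat; [lra|apply pow_lt; lra]).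
    set (h := Rmin (e / K) (r / 2)).
    assert (Hh : 0 < h) by (apply Rmin_glb_lt; [apply Rdiv_lt_0_compat; lra|lra]).
    assert (Hh1 : h <= e / K) by apply Rmin_l. assert (Hh2 : h <= r / 2) by apply Rmin_r.
    assert (Nh : RtoC h <> 0) by (intros X; apply RtoC_inj in X; lra).
    assert (Mh : Cmod (RtoC h) = h) by (apply Cmod_RtoC_pos; lra).
    assert (Dh : unit_disc (t + RtoC h)%C).
    { unfold unit_disc. eapply Rle_lt_trans; [apply Cmod_triangle|]. rewrite Mh. lra. }
    exists (fun s => (phi (t + RtoC h)%C s - phi t s) / RtoC h)%C. split.
    - intros s Hd. apply Cdisc_left_half in Hd. apply cdiff_div; [|apply cdiff_const|exact Nh].
      apply cdiff_minus; apply Hs; auto.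
    - intros s Hd. apply Cdisc_left_half in Hd.
      assert (T := taylor_bound (fun t => phi t s) t (1 - Cmod t)
        ltac:(intros z Hz; apply Ht; [easy|now apply (Cdisc_unit_disc t)]) r 1 (Dt t s) (RtoC h) Hr
        (Dt_correct t s A Hd) ltac:(intros z Hz; apply H1; [now apply (Cdisc_unit_disc t)|easy]) ltac:(lra)).
      cbv beta in T. rewrite Mh in T. fold K in T.
      replace (Dt t s - (phi (t + RtoC h) s - phi t s) / RtoC h)%C with
        (- ((phi (t + RtoC h)%C s - phi t s - Dt t s * RtoC h) / RtoC h))%C by (field; exact Nh).
      rewrite Cmod_opp, Cmod_div, Mh by auto. apply Rle_div_l; [lra|].
      apply Rle_trans with (1 := T). replace (K * h ^ 2) with ((K * h) * h) by ring.
      apply Rmult_le_compat_r; [lra|].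
      apply Rle_trans with (K * (e / K)); [apply Rmult_le_compat_l; lra|right; field; lra]. }
  apply U. unfold Cdisc. replace (s0 - s0)%C with (RtoC 0) by ring. rewrite Cmod_0. unfold left_half in Hs0. lra.
Qed.
End ParamDeriv.

Lemma is_derive_fst_C (k : R -> C) (x : R) (l : C) :
  is_derive (V := C_R_NormedModule) k x l -> is_derive (fun x => fst (k x)) x (fst l).
Proof.
  intros D. unfold is_derive in *.
  assert (X := filterdiff_comp' k fst x _ fst D
    (filterdiff_linear (K := R_AbsRing) (U := C_R_NormedModule) (V := R_NormedModule) fst is_linear_fst)).
  eapply filterdiff_ext_lin; [exact X|]. intros y. reflexivity.
Qed.

Lemma is_derive_snd_C (k : R -> C) (x : R) (l : C) :
  is_derive (V := C_R_NormedModule) k x l -> is_derive (fun x => snd (k x)) x (snd l).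
Proof.
  intros D. unfold is_derive in *.
  assert (X := filterdiff_comp' k snd x _ snd D
    (filterdiff_linear (K := R_AbsRing) (U := C_R_NormedModule) (V := R_NormedModule) snd is_linear_snd)).
  eapply filterdiff_ext_lin; [exact X|]. intros y. reflexivity.
Qed.

Lemma is_derive_ray (h : C -> C) (al l : C) (x : R) : cderiv h (RtoC x * al)%C l ->
  is_derive (fun x : R => Re (h (RtoC x * al)%C)) x (Re (l * al)) /\
  is_derive (fun x : R => Im (h (RtoC x * al)%C)) x (Im (l * al)).
Proof.
  intros H.
  assert (D : is_derive (V := C_R_NormedModule) (fun x : R => h (RtoC x * al)%C) x (l * al)%C).
  { apply is_derive_RC. intros e He. assert (Pa := Cmod_ge_0 al).
    destruct (H (e / (1 + Cmod al))) as (d & Hd & X); [apply Rdiv_lt_0_compat; lra|].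
    exists (d / (1 + Cmod al)). split; [apply Rdiv_lt_0_compat; lra|]. intros y Hy.
    specialize (X (RtoC y * al)%C).
    replace (RtoC y * al - RtoC x * al)%C with (RtoC (y - x) * al)%C in X by (rewrite RtoC_minus; ring).
    rewrite Cmod_mult, Cmod_R in X.
    replace (l * al * RtoC (y - x))%C with (l * (RtoC (y - x) * al))%C by ring.
    assert (Py := Rabs_pos (y - x)).
    apply (Rlt_div_r _ _ (1 + Cmod al)) in Hy; [|lra].
    eapply Rle_trans; [apply X; nra|].
    apply Rle_trans with (e / (1 + Cmod al) * (Rabs (y - x) * (1 + Cmod al))).
    - apply Rmult_le_compat_l; [apply Rdiv_le_0_compat; lra|]. nra.
    - right. field. lra. }
  split; [exact (is_derive_fst_C _ _ _ D)|exact (is_derive_snd_C _ _ _ D)].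
Qed.

Lemma unit_disc_ray (t : C) (x : R) : 0 <= x <= 1 -> unit_disc t -> unit_disc (RtoC x * t)%C.
Proof.
  unfold unit_disc. intros Hx Ht. rewrite Cmod_mult, Cmod_RtoC_pos by lra.
  assert (P := Cmod_ge_0 t). nra.
Qed.

Lemma zero_derivative_constant (h : C -> C) :
  (forall t : C, unit_disc t -> cderiv h t 0) -> forall t : C, unit_disc t -> h t = h 0.
Proof.
  intros H t Ht.
  assert (D := fun x (Hx : 0 <= x <= 1) => is_derive_ray h t 0 x (H _ (unit_disc_ray t x Hx Ht))).
  assert (E1 : Re (h (RtoC 0 * t)%C) = Re (h (RtoC 1 * t)%C)).
  { apply (eq_is_derive (V := R_NormedModule) (fun x => Re (h (RtoC x * t)%C)) 0 1); [|lra].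
    intros x Hx. generalize (proj1 (D x Hx)). rewrite Cmult_0_l. easy. }
  assert (E2 : Im (h (RtoC 0 * t)%C) = Im (h (RtoC 1 * t)%C)).
  { apply (eq_is_derive (V := R_NormedModule) (fun x => Im (h (RtoC x * t)%C)) 0 1); [|lra].
    intros x Hx. generalize (proj2 (D x Hx)). rewrite Cmult_0_l. easy. }
  rewrite Cmult_0_l, Cmult_1_l in E1, E2.
  destruct (h t), (h 0). simpl in E1, E2. now subst.
Qed.

Lemma is_derive_Cmod2_ray (h : C -> C) (al l : C) (x : R) : cderiv h (RtoC x * al)%C l ->
  is_derive (fun x : R => Cmod (h (RtoC x * al)%C) ^ 2) x (2 * Re (Cconj (h (RtoC x * al)%C) * (l * al))).
Proof.
  intros H. destruct (is_derive_ray h al l x H) as [D1 D2].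
  apply (is_derive_ext (fun x => Re (h (RtoC x * al)%C) * Re (h (RtoC x * al)%C) + Im (h (RtoC x * al)%C) * Im (h (RtoC x * al)%C))).
  { intros y. rewrite Cmod2_alt. simpl. ring. }
  assert (D := is_derive_plus (V := R_NormedModule) _ _ _ _ _
     (is_derive_mult (K := R_AbsRing) _ _ _ _ _ D1 D1 Rmult_comm) (is_derive_mult (K := R_AbsRing) _ _ _ _ _ D2 D2 Rmult_comm)).
  match type of D with is_derive _ _ ?v => replace (2 * Re (Cconj (h (RtoC x * al)%C) * (l * al))) with v end.
  - exact D.
  - set (hz := h (RtoC x * al)%C). set (m := (l * al)%C). rewrite re_mult, re_conj, im_conj.
    change (Re m * Re hz + Re hz * Re m + (Im m * Im hz + Im hz * Im m) = 2 * (Re hz * Re m - - Im hz * Im m)).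
    ring.
Qed.

(* The hypothesis says that f / g^c has zero logarithmic derivative, wherever that makes sense. *)
Lemma modulus_power_relation (f g f' g' : C -> C) (c : R) :
  (forall t : C, unit_disc t -> cderiv f t (f' t)) -> (forall t : C, unit_disc t -> cderiv g t (g' t)) ->
  (forall t : C, unit_disc t -> g t <> 0) ->
  (forall t : C, unit_disc t -> (g t * f' t - RtoC c * (f t * g' t))%C = 0) ->
  forall t : C, unit_disc t ->
    Cmod (f t) / Rpower (Cmod (g t)) c = Cmod (f 0) / Rpower (Cmod (g 0)) c.
Proof.
  intros Hf Hg Ng W t Ht.
  assert (Pg : forall x, 0 <= x <= 1 -> 0 < Cmod (g (RtoC x * t)%C) ^ 2).
  { intros x Hx. apply pow_lt. apply Cmod_gt_0. apply Ng. now apply unit_disc_ray. }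
  (* The square |f|^2 |g|^{-2c} along the ray from 0 to t: unlike |f|, it is differentiable at zeros
     of f. *)
  set (q := fun x => Cmod (f (RtoC x * t)%C) ^ 2 * exp (- c * ln (Cmod (g (RtoC x * t)%C) ^ 2))).
  assert (Q : q 0 = q 1).
  { apply (eq_is_derive (V := R_NormedModule) q 0 1); [|lra]. intros x Hx. unfold q.
    assert (Dx := unit_disc_ray t x Hx Ht).
    assert (Df := is_derive_Cmod2_ray f t _ x (Hf _ Dx)). assert (Dg := is_derive_Cmod2_ray g t _ x (Hg _ Dx)).
    assert (Dl := is_derive_comp (V := R_NormedModule) ln _ x _ _ (is_derive_ln _ (Pg x Hx)) Dg).
    assert (Ds := is_derive_scal _ x (- c) _ Dl).
    assert (De := is_derive_comp (V := R_NormedModule) exp _ x _ _ (is_derive_exp _) Ds).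
    assert (D := is_derive_mult (K := R_AbsRing) _ _ x _ _ Df De Rmult_comm).
    match type of D with is_derive _ _ ?v => replace (@zero R_NormedModule) with v end; [exact D|].
    specialize (W _ Dx). specialize (Pg x Hx).
    set (z := (RtoC x * t)%C) in *. set (E := exp _).
    set (G2 := Cmod (g z) ^ 2) in *. set (F2 := Cmod (f z) ^ 2).
    (* The numerator of the derivative is twice the real part of conj(f) conj(g) t times the
       expression that vanishes by hypothesis. *)
    assert (K : 2 * Re (Cconj (f z) * (f' z * t)) * G2 - c * (F2 * (2 * Re (Cconj (g z) * (g' z * t)))) = 0).
    { transitivity (2 * Re (Cconj (f z) * Cconj (g z) * t * (g z * f' z - RtoC c * (f z * g' z)))).
      - unfold G2, F2. rewrite !Cmod2_alt. destruct (f z), (g z), (f' z), (g' z), t. simpl. ring.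
      - rewrite W, Cmult_0_r. simpl. ring. }
    change (2 * Re (Cconj (f z) * (f' z * t)) * E + F2 * ((- c * (2 * Re (Cconj (g z) * (g' z * t)) * / G2)) * E) = 0).
    replace (2 * Re (Cconj (f z) * (f' z * t))) with (c * (F2 * (2 * Re (Cconj (g z) * (g' z * t)))) / G2)
      by (apply Rmult_eq_reg_r with G2; [|lra]; unfold Rdiv; rewrite Rmult_assoc, Rinv_l by lra; lra).
    field. lra. }
  unfold q in Q. rewrite Cmult_0_l, Cmult_1_l in Q.
  assert (Sq : forall u : C, unit_disc u -> Cmod (f u) ^ 2 * exp (- c * ln (Cmod (g u) ^ 2)) = (Cmod (f u) / Rpower (Cmod (g u)) c) ^ 2).
  { intros u Hu. assert (P : 0 < Cmod (g u)) by (apply Cmod_gt_0; now apply Ng).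
    unfold Rdiv. rewrite Rpow_mult_distr. f_equal. unfold Rpower. rewrite <- exp_Ropp.
    simpl. rewrite !Rmult_1_r, ln_mult, <- exp_plus by lra. f_equal. ring. }
  rewrite !Sq in Q by (easy || apply unit_disc_0).
  assert (Pos : forall u : C, 0 <= Cmod (f u) / Rpower (Cmod (g u)) c).
  { intros u. apply Rdiv_le_0_compat; [apply Cmod_ge_0|apply exp_pos]. }
  assert (P1 := Pos t). assert (P2 := Pos 0). rewrite <- !Rsqr_pow2 in Q. symmetry. now apply Rsqr_inj.
Qed.

(** * Lifts of proper maps *)

(* The covering of the Hartogs triangle by the bidisc (disc x half-plane). *)
Definition cover (r : R) (t s : C) : C2 := ((t * cexp (RtoC r * s))%C, cexp s).

Lemma Rpower_exp (x y : R) : Rpower (exp x) y = exp (y * x).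
Proof. unfold Rpower. now rewrite ln_exp. Qed.

Lemma cexp_scal (k : R) (s : C) : cexp (RtoC k * s)%C = (RtoC (exp (k * Re s)) * cis (k * Im s))%C.
Proof. unfold cexp. now rewrite re_scal_l, im_scal_l. Qed.

Lemma cover_hdom (r : R) (t s : C) : unit_disc t -> left_half s -> hdom r (cover r t s).
Proof.
  unfold unit_disc, left_half, hdom, cover; simpl fst; simpl snd. intros Ht Hs.
  rewrite Cmod_mult, !Cmod_cexp, Rpower_exp, re_scal_l. split.
  - split; [apply exp_pos|]. rewrite <- exp_0. now apply exp_increasing.
  - assert (P := exp_pos (r * Re s)). nra.
Qed.

Lemma cexp_surj (w : C) : w <> 0 -> exists s, cexp s = w /\ Re s = ln (Cmod w).
Proof.
  intros Hw. assert (P : 0 < Cmod w) by (now apply Cmod_gt_0).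
  destruct (polar w) as (th & _ & E). exists (ln (Cmod w), th). split; [|reflexivity].
  unfold cexp. simpl. rewrite exp_ln by easy. now symmetry.
Qed.

Lemma cover_surj (r : R) (z w : C) : hdom r (z, w) ->
  exists t s : C, unit_disc t /\ left_half s /\ cover r t s = (z, w).
Proof.
  intros [[H1 H2] H3]. simpl in H1, H2, H3.
  destruct (cexp_surj w) as (s & Es & Rs); [now apply Cmod_gt_0|].
  assert (N := cexp_neq_0 (RtoC r * s)%C).
  exists (z / cexp (RtoC r * s))%C, s. repeat split.
  - unfold unit_disc. rewrite Cmod_div, Cmod_cexp, re_scal_l, Rs by exact N.
    apply Rlt_div_l; [apply exp_pos|]. rewrite Rmult_1_l. exact H3.
  - unfold left_half. rewrite Rs, <- ln_1. now apply ln_increasing.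
  - unfold cover. f_equal; [|exact Es]. field. exact N.
Qed.

Lemma pow_Rpower (x : R) (n : nat) : 0 < x -> x ^ n = Rpower x (INR n).
Proof. intros H. symmetry. now apply Rpower_pow. Qed.

Lemma circle_max (h : C -> C) (rho : R) : 0 <= rho -> (forall z, Cmod z = rho -> continuous h z) ->
  exists z0, Cmod z0 = rho /\ forall z, Cmod z = rho -> Cmod (h z) <= Cmod (h z0).
Proof.
  intros Hrho Hc.
  destruct (continuity_ab_maj (fun t => Cmod (h (RtoC rho * cis t)%C)) 0 (2 * PI)) as (Mx & H & _).
  - apply Rlt_le, TWOPI_pos.
  - intros c _. apply continuity_pt_filterlim. apply (continuous_Cmod (fun t : R => h (RtoC rho * cis t)%C)). exact (continuous_on_circle h rho Hrho Hc c).
  - exists (RtoC rho * cis Mx)%C. split; [now apply Cmod_circle|]. intros z Hz.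
    destruct (polar z) as (t & Ht & E). rewrite Hz in E. rewrite E. now apply H.
Qed.

(** G is bounded, hence extends to 0 with some value v. The behaviour as w -> 0 leaves only |v| = 0
    or |v| >= 1, and |v| < 1 by the maximum principle, so v = 0. The extension is inner with no zero
    except 0, that is, xi w^l with l > 0. *)
Lemma punctured_disc_proper (G : C -> C) :
  (forall w, 0 < Cmod w < 1 -> cdiff G w) -> (forall w, 0 < Cmod w < 1 -> 0 < Cmod (G w) < 1) ->
  (forall e, 0 < e -> exists d, 0 < d /\ forall w : C, 0 < Cmod w < 1 ->
     Cmod w <= d \/ 1 - d <= Cmod w -> Cmod (G w) < e \/ 1 - e < Cmod (G w)) ->
  exists (xi : C) (l : nat), Cmod xi = 1 /\ (0 < l)%nat /\ forall w, 0 < Cmod w < 1 -> G w = (xi * w ^ l)%C.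
Proof.
  intros HG HR HB.
  assert (Nz : forall z : C, unit_disc z -> z <> 0 -> 0 < Cmod z < 1).
  { intros z Hz N. split; [now apply Cmod_gt_0|exact Hz]. }
  destruct (removable G 0 1 Rlt_0_1) as [v Hv].
  { intros z Hz N. apply HG, Nz; [exact (proj1 (Cdisc_0 1 z) Hz)|easy]. }
  { exists 1, 1. split; [lra|]. intros z Hz N. left. apply HR, Nz; [|easy]. exact (proj1 (Cdisc_0 1 z) Hz). }
  set (H := fun z => if Ceq_dec z 0 then v else G z).
  assert (H0 : H 0 = v) by (unfold H; now destruct (Ceq_dec 0 0)).
  assert (HN : forall z : C, z <> 0 -> H z = G z) by (intros z N; unfold H; now destruct (Ceq_dec z 0)).
  assert (DH : cdiff_on unit_disc H).
  { intros z Hz. destruct (Ceq_dec z 0) as [->|N]; [exact Hv|].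
    apply (cdiff_ext_loc G); [|now apply HG, Nz].
    exists (Cmod z). split; [now apply Cmod_gt_0|]. intros w Hw. symmetry. apply HN. intros ->.
    replace (0 - z)%C with (- z)%C in Hw by ring. rewrite Cmod_opp in Hw. lra. }
  assert (Nh : forall x, 0 < x -> RtoC x <> 0) by (intros x Hx E; apply RtoC_inj in E; lra).
  assert (V1 : Cmod v < 1).
  { destruct (circle_max H (1 / 2)) as (z0 & Hz0 & Hm); [lra| |].
    { intros z Hz. apply cdiff_continuous, DH. unfold unit_disc. lra. }
    rewrite <- H0. apply Rle_lt_trans with (Cmod (H z0)).
    - apply (max_principle_disc H 0 (1 / 2)); [easy|rewrite Cmod_0; lra|exact Hm].
    - rewrite HN by (intros ->; rewrite Cmod_0 in Hz0; lra). apply HR. lra. }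
  assert (V0 : v = 0).
  { apply NNPP. intros N. assert (Pv : 0 < Cmod v) by (now apply Cmod_gt_0).
    set (e := Rmin (Cmod v) (1 - Cmod v) / 2).
    assert (He : 0 < e /\ 2 * e <= Cmod v /\ 2 * e <= 1 - Cmod v).
    { unfold e. generalize (Rmin_l (Cmod v) (1 - Cmod v)) (Rmin_r (Cmod v) (1 - Cmod v)) (Rmin_glb_lt (Cmod v) (1 - Cmod v) 0 Pv ltac:(lra)). lra. }
    destruct (HB e) as (d & Hd & Hb); [lra|].
    destruct (proj1 (continuous_CC_iff H 0) (cdiff_continuous _ _ (DH 0 unit_disc_0)) e) as (d' & Hd' & Hc); [lra|].
    set (x := Rmin (Rmin d d') 1 / 2).
    assert (Hx : 0 < x <= 1 / 2 /\ x < d /\ x < d').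
    { unfold x. generalize (Rmin_l (Rmin d d') 1) (Rmin_r (Rmin d d') 1) (Rmin_l d d') (Rmin_r d d').
      assert (0 < Rmin (Rmin d d') 1) by (repeat apply Rmin_glb_lt; lra). lra. }
    assert (Ex : Cmod (RtoC x) = x) by (apply Cmod_RtoC_pos; lra).
    specialize (Hc (RtoC x)). replace (RtoC x - 0)%C with (RtoC x) in Hc by ring.
    rewrite Ex, H0, HN in Hc by (apply Nh; lra). specialize (Hc ltac:(lra)).
    assert (T1 := Cmod_triangle_inv (G (RtoC x)) v). assert (T2 := Cmod_triangle_inv v (G (RtoC x))).
    rewrite Cmod_minus_sym in T2.
    destruct (Hb (RtoC x)) as [A|A]; lra. }
  assert (IH : inner H).
  { split; [exact DH|]. split.
    - intros z Hz. destruct (Ceq_dec z 0) as [->|N]; [rewrite H0; lra|]. rewrite HN by easy. left. now apply HR, Nz.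
    - intros e He. set (c := Cmod (G (RtoC (1 / 2)))).
      assert (E2 : Cmod (RtoC (1 / 2)) = 1 / 2) by (apply Cmod_RtoC_pos; lra).
      assert (Hc : 0 < c < 1) by (apply HR; lra).
      (* As e' < |G (1/2)|, the maximum principle excludes that |G| is below e' on a whole circle of
         radius above 1/2. *)
      set (e' := Rmin (Rmin e (c / 2)) (1 / 4)).
      assert (He' : 0 < e' /\ e' <= e /\ e' <= c / 2 /\ e' <= 1 / 4).
      { unfold e'. generalize (Rmin_l (Rmin e (c / 2)) (1 / 4)) (Rmin_r (Rmin e (c / 2)) (1 / 4)) (Rmin_l e (c / 2)) (Rmin_r e (c / 2)).
        assert (0 < Rmin (Rmin e (c / 2)) (1 / 4)) by (repeat apply Rmin_glb_lt; lra). lra. }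
      destruct (HB e') as (d & Hd & Hb); [lra|].
      exists (Rmax (1 / 2) (1 - d)). split; [apply Rmax_lub_lt; lra|]. intros z Hz.
      assert (M1 := Rmax_l (1 / 2) (1 - d)). assert (M2 := Rmax_r (1 / 2) (1 - d)).
      assert (Ez : forall w, Cmod w = Cmod z -> H w = G w).
      { intros w Hw. apply HN. intros ->. rewrite Cmod_0 in Hw. lra. }
      destruct (circle_dichotomy H (Cmod z) e') as [S|S]; try lra.
      + intros w Hw. apply cdiff_continuous, DH. unfold unit_disc. lra.
      + intros w Hw. rewrite Ez by easy. apply Hb; [lra|]. right. lra.
      + exfalso. assert (Cmod (H (RtoC (1 / 2))) <= e'); [|rewrite HN in H1 by (apply Nh; lra); fold c in H1; lra].
        apply (max_principle_disc H _ (Cmod z)); [easy|lra|]. intros w Hw. left. now apply S.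
      + specialize (S z eq_refl). lra. }
  destruct (inner_order_at_0 H IH) as (l & h0 & Ih0 & N0 & E).
  destruct (inner_nonvanishing h0 Ih0) as (xi & Hxi & Exi).
  { intros z Hz Ez. destruct (Ceq_dec z 0) as [->|N]; [easy|].
    assert (P := HR z (Nz z Hz N)). rewrite <- HN, (E z Hz), Ez, Cmult_0_r, Cmod_0 in P by easy. lra. }
  exists xi, l. split; [easy|]. split.
  - destruct l; [|lia]. exfalso. apply N0. specialize (E 0 unit_disc_0). rewrite H0, V0 in E. simpl in E.
    rewrite Cmult_1_l in E. now symmetry.
  - intros w Hw. assert (Dw : unit_disc w) by (unfold unit_disc; lra).
    rewrite <- HN, (E w Dw), (Exi w Dw) by (apply Cmod_gt_0; lra). ring.
Qed.

(** * The lifted pair (f, g) of a proper map *)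

Section Forward.
Variables (r r' : R) (F : C2 -> C2).
Hypotheses (Hr : 0 < r) (Hr' : 0 < r').
Hypothesis Hmap : forall x, hdom r x -> hdom r' (F x).
Hypothesis Hf : forall z w : C, hdom r (z, w) -> c2diff (fun x => fst (F x)) z w.
Hypothesis Hg : forall z w : C, hdom r (z, w) -> c2diff (fun x => snd (F x)) z w.
Hypothesis Hesc : forall e, 0 < e -> exists d, 0 < d /\ forall x, hdom r x -> hclosed r' e (F x) -> hopen r d x.

Let f (t s : C) : C := fst (F (cover r t s)).
Let g (t s : C) : C := snd (F (cover r t s)).

Lemma fg_bounds (t s : C) : unit_disc t -> left_half s ->
  0 < Cmod (g t s) < 1 /\ Cmod (f t s) < Rpower (Cmod (g t s)) r' /\ Cmod (f t s) < 1.
Proof.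
  intros Ht Hs. destruct (Hmap _ (cover_hdom r t s Ht Hs)) as [H1 H2]. fold (f t s) (g t s) in H1, H2.
  repeat split; try apply H1; [exact H2|]. apply Rlt_le_trans with (1 := H2). apply Rpower_le_1; lra.
Qed.

Lemma cover_cdiff_t (s t : C) : cdiff (fun t => (t * cexp (RtoC r * s))%C) t /\ cdiff (fun _ : C => cexp s) t.
Proof. split; [apply cdiff_mult; [apply cdiff_id|apply cdiff_const]|apply cdiff_const]. Qed.

Lemma cover_cdiff_s (t s : C) : cdiff (fun s => (t * cexp (RtoC r * s))%C) s /\ cdiff cexp s.
Proof.
  split; [|apply cdiff_cexp]. apply cdiff_mult; [apply cdiff_const|].
  apply (cdiff_comp cexp (fun s => RtoC r * s)%C); [apply cdiff_mult; [apply cdiff_const|apply cdiff_id]|apply cdiff_cexp].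
Qed.

Lemma f_t (s : C) : left_half s -> cdiff_on unit_disc (fun t => f t s).
Proof.
  intros Hs t Ht. destruct (cover_cdiff_t s t).
  apply (c2diff_curve (fun x => fst (F x)) (fun t => (t * cexp (RtoC r * s))%C) (fun _ => cexp s)); auto.
  apply Hf. now apply cover_hdom.
Qed.
Lemma g_t (s : C) : left_half s -> cdiff_on unit_disc (fun t => g t s).
Proof.
  intros Hs t Ht. destruct (cover_cdiff_t s t).
  apply (c2diff_curve (fun x => snd (F x)) (fun t => (t * cexp (RtoC r * s))%C) (fun _ => cexp s)); auto.
  apply Hg. now apply cover_hdom.
Qed.
Lemma f_s (t : C) : unit_disc t -> cdiff_on left_half (fun s => f t s).
Proof.
  intros Ht s Hs. destruct (cover_cdiff_s t s).
  apply (c2diff_curve (fun x => fst (F x)) (fun s => (t * cexp (RtoC r * s))%C) cexp); auto.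
  apply Hf. now apply cover_hdom.
Qed.
Lemma g_s (t : C) : unit_disc t -> cdiff_on left_half (fun s => g t s).
Proof.
  intros Ht s Hs. destruct (cover_cdiff_s t s).
  apply (c2diff_curve (fun x => snd (F x)) (fun s => (t * cexp (RtoC r * s))%C) cexp); auto.
  apply Hg. now apply cover_hdom.
Qed.

(** The condition on (t, s) negates [hopen r d] in covering coordinates, and the conclusion negates
    [hclosed r' e] for the image (f, g). *)
Lemma escape (e : R) : 0 < e -> exists d, 0 < d /\ forall t s : C, unit_disc t -> left_half s ->
  1 - d <= Cmod t \/ exp (Re s) <= d \/ 1 - d <= exp (Re s) ->
  Cmod (g t s) < e \/ 1 - e < Cmod (g t s) \/ (1 - e) * Rpower (Cmod (g t s)) r' < Cmod (f t s).
Proof.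
  intros He. destruct (Hesc e He) as (d & Hd & H). exists d. split; [easy|]. intros t s Ht Hs Hb.
  assert (X := H (cover r t s) (cover_hdom r t s Ht Hs)).
  unfold hclosed, hopen in X. fold (f t s) (g t s) in X.
  unfold cover in X; simpl fst in X; simpl snd in X.
  rewrite Cmod_mult, !Cmod_cexp, Rpower_exp, re_scal_l in X.
  destruct (Rlt_dec (Cmod (g t s)) e) as [|N1]; [now left|]. right.
  destruct (Rlt_dec (1 - e) (Cmod (g t s))) as [|N2]; [now left|]. right.
  apply Rnot_le_lt. intros N3.
  destruct (X ltac:(lra)) as (X1 & X2). destruct Hb as [Hb|[Hb|Hb]]; try lra.
  assert (P := exp_pos (r * Re s)). apply Rmult_lt_reg_r in X2; lra.
Qed.

Let ft := Dt f.
Let gt := Dt g.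
(** Formally g^{1 + r'} times the t-derivative of f g^{-r'}; multiplied out, it requires no branch
    of the power. *)
Let W (t s : C) : C := (g t s * ft t s - RtoC r' * (f t s * gt t s))%C.
Let U (t s : C) : C := (W t s * gt t s)%C.

Lemma f_le_1 (t s : C) : unit_disc t -> left_half s -> Cmod (f t s) <= 1.
Proof. intros Ht Hs. left. now apply fg_bounds. Qed.
Lemma g_le_1 (t s : C) : unit_disc t -> left_half s -> Cmod (g t s) <= 1.
Proof. intros Ht Hs. left. now apply fg_bounds. Qed.

Lemma ft_bound (t s : C) : unit_disc t -> left_half s -> Cmod (ft t s) <= 2 / (1 - Cmod t).
Proof.
  intros Ht Hs. assert (B := Dt_bound f f_t f_le_1 t s Ht Hs). fold ft in B.
  unfold unit_disc in Ht. apply Rle_div_r; [lra|]. generalize (Cmod_ge_0 (f t s)). lra.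
Qed.

Lemma gt_bound (t s : C) : unit_disc t -> left_half s -> Cmod (gt t s) <= 2 / (1 - Cmod t) * (1 - Cmod (g t s)).
Proof.
  intros Ht Hs. assert (B := Dt_bound g g_t g_le_1 t s Ht Hs). fold gt in B.
  unfold unit_disc in Ht. apply Rmult_le_reg_l with (1 - Cmod t); [lra|].
  replace ((1 - Cmod t) * (2 / (1 - Cmod t) * (1 - Cmod (g t s)))) with (2 * (1 - Cmod (g t s))) by (field; lra). exact B.
Qed.

(* Apply the derivative bound to f^b/g^a, which maps into the disc because a <= b r'. *)
Lemma W_bound (t s : C) (b : nat) (e : R) : unit_disc t -> left_half s -> (0 < b)%nat -> 0 < e -> INR b * e <= 1 / 2 ->
  (1 - e) * Rpower (Cmod (g t s)) r' < Cmod (f t s) -> Cmod (W t s) <= 3 / INR b * (2 / (1 - Cmod t)).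
Proof.
  intros Ht Hs Hb He Hbe Hc.
  assert (Pb : 1 <= INR b) by (rewrite <- INR_1; apply le_INR; lia).
  assert (He1 : e <= 1 / 2) by nra.
  destruct (fg_bounds t s Ht Hs) as ((G0 & G1) & FG & F1).
  assert (PF : 0 < Cmod (f t s)).
  { apply Rle_lt_trans with (2 := Hc). apply Rmult_le_pos; [lra|left; apply Rpower_pos]. }
  (* With a = floor(b r') and |g| < 1, |g|^{b r'} <= |g|^a, which puts f^b / g^a into the disc;
     moreover |a / b - r'| <= 1 / b. *)
  assert (exists a : nat, INR a <= INR b * r' < INR a + 1) as [a Ha].
  { assert (P : 0 <= INR b * r') by (apply Rmult_le_pos; lra).
    destruct (nfloor_ex _ P) as [a Ha]. now exists a. }
  set (h := fun t => (f t s ^ b / g t s ^ a)%C).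
  assert (Ng : forall z : C, unit_disc z -> (g z s ^ a)%C <> 0).
  { intros z Hz. apply Cpow_nz, Cmod_gt_0. now apply fg_bounds. }
  assert (Dh : cdiff_on unit_disc h).
  { intros z Hz. apply cdiff_div; [apply cdiff_pow, f_t; auto|apply cdiff_pow, g_t; auto|now apply Ng]. }
  assert (Bh : forall z : C, unit_disc z -> Cmod (h z) <= 1).
  { intros z Hz. destruct (fg_bounds z s Hz Hs) as ((g0 & g1) & fg & _).
    unfold h. rewrite Cmod_div, !Cmod_pow by now apply Ng. apply Rle_div_l; [now apply pow_lt|].
    rewrite Rmult_1_l. apply Rle_trans with ((Rpower (Cmod (g z s)) r') ^ b).
    - apply pow_incr. split; [apply Cmod_ge_0|lra].
    - rewrite !pow_Rpower, Rpower_mult by (easy || apply Rpower_pos).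
      unfold Rpower. apply exp_le_exp. assert (ln (Cmod (g z s)) < 0) by (rewrite <- ln_1; apply ln_increasing; lra). nra. }
  assert (D1 := cderiv_comp _ _ _ _ _ (Dt_correct f f_t t s Ht Hs) (cderiv_pow b (f t s))).
  assert (D2 := cderiv_comp _ _ _ _ _ (Dt_correct g g_t t s Ht Hs) (cderiv_pow a (g t s))).
  assert (D3 := cderiv_comp Cinv _ _ _ _ D2 (cderiv_inv_id _ (Ng t Ht))).
  assert (D4 := cderiv_mult _ _ _ _ _ D1 D3). cbv beta in D4. fold ft gt in D4.
  set (l := (RtoC (INR b) * f t s ^ (b - 1) * ft t s * / g t s ^ a +
        f t s ^ b * (- / (g t s ^ a * g t s ^ a) * (RtoC (INR a) * g t s ^ (a - 1) * gt t s)))%C) in *.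
  assert (Bl : Cmod l <= 2 / (1 - Cmod t)).
  { assert (S := schwarz_pick_weak h t (1 - Cmod t) ltac:(intros z Hz; apply Dh; now apply (Cdisc_unit_disc t))
      l ltac:(unfold unit_disc in Ht; lra) D4 ltac:(intros z Hz; apply Bh; now apply (Cdisc_unit_disc t))).
    unfold unit_disc in Ht. apply Rle_div_r; [lra|]. generalize (Cmod_ge_0 (h t)). lra. }
  assert (Nf0 : f t s <> 0) by (now apply Cmod_gt_0). assert (Ng0 : g t s <> 0) by (now apply Cmod_gt_0).
  (* Clearing denominators in the derivative l of f^b / g^a isolates b times the analogue of W with
     a / b in place of r'. *)
  assert (Id : (f t s ^ b * (RtoC (INR b) * g t s * ft t s - RtoC (INR a) * f t s * gt t s))%C = (l * (g t s ^ a * g t s * f t s))%C).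
  { unfold l. destruct b as [|b']; [lia|]. replace (S b' - 1)%nat with b' by lia.
    rewrite !Cpow_S. destruct a as [|a'].
    - simpl. field. 
    - replace (S a' - 1)%nat with a' by lia. rewrite !Cpow_S. field. split; [now apply Cpow_nz|easy]. }
  apply (f_equal Cmod) in Id. rewrite !Cmod_mult, !Cmod_pow in Id.
  set (Q := Cmod (RtoC (INR b) * g t s * ft t s - RtoC (INR a) * f t s * gt t s)%C) in *.
  assert (BQ : Q <= 2 * (2 / (1 - Cmod t))).
  { assert (B1 : (1 - e) ^ b * Rpower (Cmod (g t s)) (INR b * r') <= Cmod (f t s) ^ b).
    { rewrite (Rmult_comm (INR b)), <- Rpower_mult, <- pow_Rpower, <- Rpow_mult_distr by apply Rpower_pos.
      apply pow_incr. split; [|lra]. apply Rmult_le_pos; [lra|left; apply Rpower_pos]. }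
    (* Bernoulli with b e <= 1/2; the loss of one half becomes the factor 2 in [BQ]. *)
    assert (B2 : 1 / 2 <= (1 - e) ^ b).
    { generalize (one_minus_pow_le (1 - e) b ltac:(lra)). lra. }
    assert (B3 : Cmod (g t s) ^ a * Cmod (g t s) <= Rpower (Cmod (g t s)) (INR b * r')).
    { replace (Cmod (g t s) ^ a * Cmod (g t s)) with (Cmod (g t s) ^ S a) by (simpl; ring).
      rewrite pow_Rpower, S_INR by easy. unfold Rpower. apply exp_le_exp.
      assert (ln (Cmod (g t s)) < 0) by (rewrite <- ln_1; apply ln_increasing; lra). nra. }
    set (X := Rpower (Cmod (g t s)) (INR b * r')) in *.
    assert (PX : 0 < X) by apply Rpower_pos.
    assert (PQ : 0 <= Q) by apply Cmod_ge_0. assert (Pl := Cmod_ge_0 l).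
    assert (Pt : 0 < 2 / (1 - Cmod t)) by (unfold unit_disc in Ht; apply Rdiv_lt_0_compat; lra).
    assert (B4 : 1 / 2 * X <= Cmod (f t s) ^ b) by nra.
    assert (B5 : 1 / 2 * X * Q <= 2 / (1 - Cmod t) * X).
    { apply Rle_trans with (Cmod (f t s) ^ b * Q); [now apply Rmult_le_compat_r|]. rewrite Id.
      apply Rmult_le_compat; try easy.
      - repeat apply Rmult_le_pos; try apply Cmod_ge_0. apply pow_le, Cmod_ge_0.
      - rewrite <- (Rmult_1_r X). apply Rmult_le_compat; try lra.
        apply Rmult_le_pos; [apply pow_le|]; lra. }
    apply Rmult_le_reg_l with (1 / 2 * X); lra. }
  (* The first summand contributes 2 / b and the replacement of r' by a / b contributes 1 / b, both
     times 2 / (1 - |t|): hence the constant 3. *)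
  assert (E : W t s = (/ RtoC (INR b) * (RtoC (INR b) * g t s * ft t s - RtoC (INR a) * f t s * gt t s)
     + RtoC (INR a / INR b - r') * (f t s * gt t s))%C).
  { unfold W. rewrite RtoC_minus, RtoC_div by lra. field. intros X; apply RtoC_inj in X; lra. }
  rewrite E. eapply Rle_trans; [apply Cmod_triangle|].
  rewrite !Cmod_mult, Cmod_inv, Cmod_RtoC_pos, Cmod_R by (try (intros X; apply RtoC_inj in X); lra).
  fold Q.
  assert (Bg := gt_bound t s Ht Hs).
  assert (Pt : 0 < 2 / (1 - Cmod t)) by (unfold unit_disc in Ht; apply Rdiv_lt_0_compat; lra).
  assert (Bd : Rabs (INR a / INR b - r') <= / INR b).
  { replace (INR a / INR b - r') with (- ((INR b * r' - INR a) / INR b)) by (field; lra).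
    rewrite Rabs_Ropp, Rabs_pos_eq.
    - unfold Rdiv. rewrite <- (Rmult_1_l (/ INR b)) at 2. apply Rmult_le_compat_r; [left; apply Rinv_0_lt_compat|]; lra.
    - apply Rdiv_le_0_compat; lra. }
  assert (Pib : 0 < / INR b) by (apply Rinv_0_lt_compat; lra).
  assert (T1 : / INR b * Q <= / INR b * (2 * (2 / (1 - Cmod t)))) by (apply Rmult_le_compat_l; lra).
  assert (T2 : Rabs (INR a / INR b - r') * (Cmod (f t s) * Cmod (gt t s)) <= / INR b * (2 / (1 - Cmod t))).
  { apply Rmult_le_compat; [apply Rabs_pos| |easy|].
    - apply Rmult_le_pos; [lra|apply Cmod_ge_0].
    - assert (Pg := Cmod_ge_0 (gt t s)). nra. }
  unfold Rdiv at 1. lra.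
Qed.

Lemma U_small (t : C) : unit_disc t -> forall eps, 0 < eps -> exists d, 0 < d /\ forall s, left_half s ->
  exp (Re s) <= d \/ 1 - d <= exp (Re s) -> Cmod (U t s) <= eps.
Proof.
  intros Ht eps Heps.
  set (k := 2 / (1 - Cmod t)).
  assert (Pk : 0 < k) by (unfold unit_disc in Ht; unfold k; apply Rdiv_lt_0_compat; lra).
  destruct (INR_unbounded (3 * k * k / eps)) as [b0 Hb0]. set (b := S b0).
  assert (Hb : 3 * k * k / eps < INR b) by (unfold b; rewrite S_INR; lra).
  assert (Pb : 1 <= INR b) by (unfold b; rewrite S_INR; generalize (pos_INR b0); lra).
  (* k bounds f_t and g_t at the given t. If |f| and |g| are at most m, or if |g_t| is at most k m,
     then |U| <= k^2 (1 + r') m = eps. The remaining case |f| close to |g|^{r'} is paid for by the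
     size of b. *)
  set (m := eps / (k * k * (1 + r'))).
  assert (Pm : 0 < m) by (apply Rdiv_lt_0_compat; [easy|]; apply Rmult_lt_0_compat; [now apply Rmult_lt_0_compat|lra]).
  (* The bound 1 / (2 b) is the condition b e <= 1/2 of [W_bound]; m^{1 / r'} turns |g| < e into |f|
     <= m. *)
  set (e1 := Rmin (1 / (2 * INR b)) (Rmin m (Rpower m (/ r')))).
  set (e := Rmin e1 (m / 2)).
  assert (He : 0 < e /\ e <= 1 / (2 * INR b) /\ e <= m / 2 /\ e <= Rpower m (/ r')).
  { unfold e, e1. assert (A := Rpower_pos m (/ r')).
    assert (0 < 1 / (2 * INR b)) by (apply Rdiv_lt_0_compat; lra).
    generalize (Rmin_l (1 / (2 * INR b)) (Rmin m (Rpower m (/ r')))) (Rmin_r (1 / (2 * INR b)) (Rmin m (Rpower m (/ r'))))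
      (Rmin_l m (Rpower m (/ r'))) (Rmin_r m (Rpower m (/ r')))
      (Rmin_l (Rmin (1 / (2 * INR b)) (Rmin m (Rpower m (/ r')))) (m / 2)) (Rmin_r (Rmin (1 / (2 * INR b)) (Rmin m (Rpower m (/ r')))) (m / 2)).
    intros. split; [repeat apply Rmin_glb_lt; lra|]. lra. }
  destruct He as (He & He1 & He2 & He3).
  destruct (escape e He) as (d & Hd & Hesc'). exists d. split; [easy|]. intros s Hs Hb'.
  assert (Bg := gt_bound t s Ht Hs). assert (Bf := ft_bound t s Ht Hs). fold k in Bg, Bf.
  destruct (fg_bounds t s Ht Hs) as ((G0 & G1) & FG & F1).
  assert (Pf := Cmod_ge_0 (f t s)). assert (Pft := Cmod_ge_0 (ft t s)). assert (Pgt := Cmod_ge_0 (gt t s)).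
  assert (Bg1 : Cmod (gt t s) <= k) by nra.
  unfold U. rewrite Cmod_mult.
  assert (WT : Cmod (W t s) <= Cmod (g t s) * Cmod (ft t s) + r' * (Cmod (f t s) * Cmod (gt t s))).
  { unfold W. eapply Rle_trans; [apply Cmod_minus_le|]. rewrite !Cmod_mult, Cmod_RtoC_pos; lra. }
  assert (Em : k * k * (1 + r') * m = eps) by (unfold m; field; lra).
  assert (PW := Cmod_ge_0 (W t s)).
  destruct (Hesc' t s Ht Hs (or_intror Hb')) as [C1|[C2|C3]].
  - assert (Ff : Cmod (f t s) <= m).
    { left. apply Rlt_le_trans with (1 := FG). apply Rle_trans with (Rpower (Rpower m (/ r')) r').
      - apply Rle_Rpower_l; lra.
      - rewrite Rpower_mult, Rinv_l, Rpower_1; lra. }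
    assert (T1 : Cmod (g t s) * Cmod (ft t s) <= m * k) by (apply Rmult_le_compat; lra).
    assert (T2 : Cmod (f t s) * Cmod (gt t s) <= m * k) by (apply Rmult_le_compat; lra).
    assert (T3 : r' * (Cmod (f t s) * Cmod (gt t s)) <= r' * (m * k)) by (apply Rmult_le_compat_l; lra).
    apply Rle_trans with ((m * k + r' * (m * k)) * k); [apply Rmult_le_compat; lra|]. lra.
  - assert (T1 : Cmod (g t s) * Cmod (ft t s) <= 1 * k) by (apply Rmult_le_compat; lra).
    assert (T2 : Cmod (f t s) * Cmod (gt t s) <= 1 * k) by (apply Rmult_le_compat; lra).
    assert (T3 : r' * (Cmod (f t s) * Cmod (gt t s)) <= r' * (1 * k)) by (apply Rmult_le_compat_l; lra).
    assert (T4 : Cmod (gt t s) <= k * m).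
    { apply Rle_trans with (1 := Bg). apply Rmult_le_compat_l; lra. }
    apply Rle_trans with ((1 * k + r' * (1 * k)) * (k * m)); [apply Rmult_le_compat; lra|]. lra.
  - assert (He1' : INR b * e <= 1 / 2).
    { apply Rle_trans with (INR b * (1 / (2 * INR b))); [apply Rmult_le_compat_l; lra|right; field; lra]. }
    assert (B := W_bound t s b e Ht Hs ltac:(unfold b; lia) He He1' C3). fold k in B.
    apply Rle_trans with (3 / INR b * k * k); [apply Rmult_le_compat; lra|].
    replace (3 / INR b * k * k) with (3 * k * k / eps / INR b * eps) by (field; lra).
    rewrite <- (Rmult_1_l eps) at 3. apply Rmult_le_compat_r; [lra|]. apply Rle_div_l; lra.
Qed.

Lemma W_cdiff_t (s : C) : left_half s -> cdiff_on unit_disc (fun t => W t s).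
Proof.
  intros Hs t Ht. apply cdiff_minus.
  - apply cdiff_mult; [now apply g_t|]. now apply (Dt_holomorphic_t f f_t f_le_1).
  - apply cdiff_mult; [apply cdiff_const|]. apply cdiff_mult; [now apply f_t|].
    now apply (Dt_holomorphic_t g g_t g_le_1).
Qed.

Lemma U_zero (t s : C) : unit_disc t -> left_half s -> U t s = 0.
Proof.
  intros Ht. revert s.
  set (k := 2 / (1 - Cmod t)).
  assert (Pk : 0 < k) by (unfold unit_disc in Ht; unfold k; apply Rdiv_lt_0_compat; lra).
  apply (left_half_vanish (fun s => U t s) ((k + r' * k) * k)).
  - intros s Hs. assert (Ds := Dt_holomorphic_s f f_t f_s f_le_1 t Ht s Hs).
    assert (Es := Dt_holomorphic_s g g_t g_s g_le_1 t Ht s Hs).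
    apply cdiff_mult; [|exact Es]. apply cdiff_minus.
    + apply cdiff_mult; [now apply g_s|exact Ds].
    + apply cdiff_mult; [apply cdiff_const|]. apply cdiff_mult; [now apply f_s|exact Es].
  - intros s Hs. assert (Bg := gt_bound t s Ht Hs). assert (Bf := ft_bound t s Ht Hs). fold k in Bg, Bf.
    destruct (fg_bounds t s Ht Hs) as ((G0 & G1) & FG & F1).
    assert (Pf := Cmod_ge_0 (f t s)). assert (Pft := Cmod_ge_0 (ft t s)). assert (Pgt := Cmod_ge_0 (gt t s)).
    assert (Bg1 : Cmod (gt t s) <= k) by nra.
    unfold U. rewrite Cmod_mult. apply Rmult_le_compat; try apply Cmod_ge_0; [|easy].
    unfold W. eapply Rle_trans; [apply Cmod_minus_le|]. rewrite !Cmod_mult, Cmod_RtoC_pos by lra.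
    assert (Cmod (f t s) * Cmod (gt t s) <= 1 * k) by (apply Rmult_le_compat; lra).
    assert (Cmod (g t s) * Cmod (ft t s) <= 1 * k) by (apply Rmult_le_compat; lra).
    assert (r' * (Cmod (f t s) * Cmod (gt t s)) <= r' * (1 * k)) by (apply Rmult_le_compat_l; lra). lra.
  - exact (U_small t Ht).
Qed.

(** For fixed s one of W and g_t vanishes identically in t. If W does, |f| / |g|^{r'} is constant in
    t and below 1, so the alternative |f| close to |g|^{r'} is excluded as |t| -> 1; then g(., s)
    would be a proper map from the disc to the punctured disc. *)
Lemma g_const_t (t s : C) : unit_disc t -> left_half s -> g t s = g 0 s.
Proof.
  intros Ht Hs.
  assert (GT : cdiff_on unit_disc (fun t => gt t s)) by (now apply (Dt_holomorphic_t g g_t g_le_1)).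
  destruct (disc_integral_domain _ _ (W_cdiff_t s Hs) GT (fun z Hz => U_zero z s Hz Hs)) as [W0|G0].
  - exfalso.
    assert (Rel := modulus_power_relation (fun t => f t s) (fun t => g t s) (fun t => ft t s) (fun t => gt t s) r'
      (fun z Hz => Dt_correct f f_t z s Hz Hs) (fun z Hz => Dt_correct g g_t z s Hz Hs)
      (fun z Hz => proj2 (Cmod_gt_0 _) (proj1 (proj1 (fg_bounds z s Hz Hs)))) W0).
    cbv beta in Rel. set (kap := Cmod (f 0 s) / Rpower (Cmod (g 0 s)) r') in *.
    assert (Hk : kap < 1).
    { unfold kap. apply Rlt_div_l; [apply Rpower_pos|]. rewrite Rmult_1_l. apply fg_bounds; [apply unit_disc_0|easy]. }
    apply (no_proper_map_to_punctured_disc (fun t => g t s)).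
    + now apply g_t.
    + intros z Hz. now apply fg_bounds.
    (* With e' <= 1 - kap, the alternative |f| > (1 - e') |g|^{r'} contradicts |f| = kap
       |g|^{r'}. *)
    + intros e He. set (e' := Rmin e (1 - kap)).
      assert (He' : 0 < e' /\ e' <= e /\ e' <= 1 - kap).
      { unfold e'. generalize (Rmin_l e (1 - kap)) (Rmin_r e (1 - kap)) (Rmin_glb_lt e (1 - kap) 0 He ltac:(lra)). lra. }
      destruct (escape e') as (d & Hd & H); [lra|]. exists (1 - d). split; [lra|]. intros z Hz.
      assert (Dz : unit_disc z) by (unfold unit_disc; lra).
      destruct (H z s Dz Hs) as [A|[A|A]]; [left; lra|left; lra|right; lra|exfalso].
      specialize (Rel z Dz). assert (P := Rpower_pos (Cmod (g z s)) r').
      apply (Rlt_div_r _ _ _ P) in A. lra.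
  - apply (zero_derivative_constant (fun t => g t s)); [|easy].
    intros z Hz. rewrite <- (G0 z Hz). now apply (Dt_correct g g_t).
Qed.

Let G (w : C) : C := snd (F (RtoC 0, w)).

Lemma cover_0 (s : C) : cover r 0 s = (RtoC 0, cexp s).
Proof. unfold cover. now rewrite Cmult_0_l. Qed.

Lemma hdom_0 (w : C) : 0 < Cmod w < 1 -> hdom r (RtoC 0, w).
Proof. intros H. split; [exact H|]. simpl. rewrite Cmod_0. apply Rpower_pos. Qed.

Lemma G_g (t s : C) : unit_disc t -> left_half s -> g t s = G (cexp s).
Proof. intros Ht Hs. rewrite g_const_t by easy. unfold g, G. now rewrite cover_0. Qed.

Lemma G_cdiff (w : C) : 0 < Cmod w < 1 -> cdiff G w.
Proof.
  intros Hw. apply (c2diff_curve (fun x => snd (F x)) (fun _ => RtoC 0) (fun w => w)).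
  - apply Hg. now apply hdom_0.
  - apply cdiff_const.
  - apply cdiff_id.
Qed.

Lemma G_range (w : C) : 0 < Cmod w < 1 -> 0 < Cmod (G w) < 1.
Proof. intros Hw. exact (proj1 (Hmap _ (hdom_0 w Hw))). Qed.

(* On each disc f has a zero, since otherwise 1/f violates the maximum principle. *)
Lemma f_has_zero (s : C) : left_half s -> exists t : C, unit_disc t /\ f t s = 0.
Proof.
  intros Hs. apply NNPP. intros N.
  assert (Nz : forall t : C, unit_disc t -> f t s <> 0) by (intros t Ht E; apply N; now exists t).
  set (c := Cmod (g 0 s)). assert (Hc : 0 < c < 1) by (apply fg_bounds; [apply unit_disc_0|easy]).
  destruct (fg_bounds 0 s unit_disc_0 Hs) as (_ & H0 & _). fold c in H0. set (B := Rpower c r') in *.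
  assert (PB : 0 < B) by apply Rpower_pos.
  assert (Pf0 : 0 < Cmod (f 0 s)) by (apply Cmod_gt_0, Nz, unit_disc_0).
  set (e := Rmin (Rmin c (1 - c)) (1 - Cmod (f 0 s) / B) / 2).
  assert (Q : Cmod (f 0 s) / B < 1) by (apply Rlt_div_l; lra).
  assert (He : 0 < e /\ e < c /\ e < 1 - c /\ e < 1 - Cmod (f 0 s) / B).
  { unfold e. generalize (Rmin_l (Rmin c (1 - c)) (1 - Cmod (f 0 s) / B)) (Rmin_r (Rmin c (1 - c)) (1 - Cmod (f 0 s) / B))
     (Rmin_l c (1 - c)) (Rmin_r c (1 - c)).
    assert (0 < Rmin (Rmin c (1 - c)) (1 - Cmod (f 0 s) / B)) by (repeat apply Rmin_glb_lt; lra). lra. }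
  destruct (escape e) as (d & Hd & H); [lra|].
  set (rho := Rmax (1 / 2) (1 - d / 2)).
  assert (Hrho : 0 < rho < 1 /\ 1 - d <= rho).
  { unfold rho. generalize (Rmax_l (1 / 2) (1 - d / 2)) (Rmax_r (1 / 2) (1 - d / 2)) (Rmax_lub_lt (1 / 2) (1 - d / 2) 1 ltac:(lra) ltac:(lra)). lra. }
  assert (M : Cmod (/ f 0 s)%C <= / ((1 - e) * B)).
  { apply (max_principle_disc (fun t => / f t s)%C 0 rho).
    - intros z Hz. apply cdiff_inv; [now apply f_t|now apply Nz].
    - rewrite Cmod_0. lra.
    - intros z Ez. assert (Dz : unit_disc z) by (unfold unit_disc; lra).
      rewrite Cmod_inv by now apply Nz. apply Rinv_le_contravar; [apply Rmult_lt_0_compat; lra|].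
      destruct (H z s Dz Hs ltac:(lra)) as [A|[A|A]]; rewrite g_const_t in A by easy; fold c in A; try lra. fold B in A. lra. }
  rewrite Cmod_inv in M by (apply Nz, unit_disc_0).
  apply Rinv_le_contravar in M; [|now apply Rinv_0_lt_compat]. rewrite !Rinv_inv in M.
  apply Rmult_lt_compat_r with (r := B) in Q; [|easy].
  assert (Cmod (f 0 s) / B * B = Cmod (f 0 s)) by (field; lra). nra.
Qed.

(** Over a zero of f the alternative |f| close to |g|^{r'} fails, and g does not depend on t, so |G
    w| itself is near 0 or near 1. *)
Lemma G_boundary (e : R) : 0 < e -> exists d, 0 < d /\ forall w : C, 0 < Cmod w < 1 ->
  Cmod w <= d \/ 1 - d <= Cmod w -> Cmod (G w) < e \/ 1 - e < Cmod (G w).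
Proof.
  intros He. destruct (escape (Rmin e 1)) as (d & Hd & H); [apply Rmin_glb_lt; lra|].
  exists d. split; [easy|]. intros w Hw Hb.
  destruct (cexp_surj w) as (s & Es & Rs); [now apply Cmod_gt_0|].
  assert (Hs : left_half s) by (unfold left_half; rewrite Rs, <- ln_1; apply ln_increasing; lra).
  destruct (f_has_zero s Hs) as (t & Ht & Zt).
  assert (Em : exp (Re s) = Cmod w) by (rewrite <- Es; symmetry; apply Cmod_cexp).
  assert (M1 := Rmin_l e 1). assert (M2 := Rmin_r e 1).
  destruct (H t s Ht Hs) as [A|[A|A]]; [right; lra|..]; rewrite ?G_g, ?Es in A by easy.
  - left. lra.
  - right. lra.
  - exfalso. rewrite Zt, Cmod_0 in A. assert (P := Rpower_pos (Cmod (G w)) r').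
    assert (0 <= (1 - Rmin e 1) * Rpower (Cmod (G w)) r') by (apply Rmult_le_pos; lra). lra.
Qed.

Section Step3.
Variables (xi : C) (l : nat).
Hypotheses (Hxi : Cmod xi = 1) (Hl : (0 < l)%nat).
Hypothesis HG : forall w, 0 < Cmod w < 1 -> G w = (xi * w ^ l)%C.

(** Up to a unimodular constant a branch of f g^{-r'}, single-valued on the half-plane because g =
    xi e^{l s}. *)
Let phi (t s : C) : C := (f t s * cexp (- RtoC (INR l * r') * s))%C.

Lemma Cmod_g_cover (t s : C) : unit_disc t -> left_half s -> Cmod (g t s) = exp (INR l * Re s).
Proof.
  intros Ht Hs. rewrite G_g, HG by (easy || (rewrite Cmod_cexp; split; [apply exp_pos|rewrite <- exp_0; now apply exp_increasing])).
  rewrite Cmod_mult, Hxi, Cmod_pow, Cmod_cexp, Rmult_1_l, pow_Rpower, Rpower_exp by apply exp_pos. reflexivity.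
Qed.

Lemma Cmod_phi (t s : C) : unit_disc t -> left_half s ->
  Cmod (phi t s) = Cmod (f t s) / Rpower (Cmod (g t s)) r'.
Proof.
  intros Ht Hs. unfold phi. rewrite Cmod_mult, Cmod_cexp, Cmod_g_cover, Rpower_exp by easy.
  unfold Rdiv. rewrite <- exp_Ropp. f_equal. f_equal. rewrite <- RtoC_opp, re_scal_l. ring.
Qed.

Lemma phi_lt_1 (t s : C) : unit_disc t -> left_half s -> Cmod (phi t s) < 1.
Proof.
  intros Ht Hs. rewrite Cmod_phi by easy. apply Rlt_div_l; [apply Rpower_pos|]. rewrite Rmult_1_l.
  now apply fg_bounds.
Qed.

Lemma phi_t (s : C) : left_half s -> cdiff_on unit_disc (fun t => phi t s).
Proof. intros Hs t Ht. apply cdiff_mult; [now apply f_t|apply cdiff_const]. Qed.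

Lemma phi_s (t : C) : unit_disc t -> cdiff_on left_half (fun s => phi t s).
Proof.
  intros Ht s Hs. apply cdiff_mult; [now apply f_s|].
  apply (cdiff_comp cexp (fun s => - RtoC (INR l * r') * s)%C); [apply cdiff_mult; [apply cdiff_const|apply cdiff_id]|apply cdiff_cexp].
Qed.

(** With s fixed, |g| is a constant strictly between 0 and 1, so as |t| -> 1 only the alternative
    |f| close to |g|^{r'} survives. *)
Lemma phi_inner (s : C) : left_half s -> inner (fun t => phi t s).
Proof.
  intros Hs. repeat split.
  - now apply phi_t.
  - intros t Ht. left. now apply phi_lt_1.
  - intros e He. set (c := exp (INR l * Re s)).
    assert (Hc : 0 < c < 1).
    { split; [apply exp_pos|]. unfold c. rewrite <- exp_0. apply exp_increasing. unfold left_half in Hs.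
      assert (1 <= INR l) by (rewrite <- INR_1; apply le_INR; lia). nra. }
    set (e' := Rmin e (Rmin c (1 - c))).
    assert (He' : 0 < e' /\ e' <= e /\ e' <= c /\ e' <= 1 - c).
    { unfold e'. generalize (Rmin_l e (Rmin c (1 - c))) (Rmin_r e (Rmin c (1 - c))) (Rmin_l c (1 - c)) (Rmin_r c (1 - c)).
      assert (0 < Rmin e (Rmin c (1 - c))) by (repeat apply Rmin_glb_lt; lra). lra. }
    destruct (escape e') as (d & Hd & H); [lra|]. exists (1 - d). split; [lra|]. intros t Ht.
    assert (Dt : unit_disc t) by (unfold unit_disc; lra).
    rewrite Cmod_phi by easy. assert (P := Rpower_pos (Cmod (g t s)) r').
    destruct (H t s Dt Hs ltac:(lra)) as [A|[A|A]]; try (rewrite Cmod_g_cover in A by easy; fold c in A; lra).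
    apply Rlt_div_r; [easy|]. apply Rle_lt_trans with (2 := A). apply Rmult_le_compat_r; lra.
Qed.

(* For fixed centre c, near-constancy makes phi(., s) - phi(., c) vanish on the unit circle. *)
Lemma phi_const_near (s c t : C) : left_half c -> Cmod (s - c) < - Re c -> unit_disc t -> phi t s = phi t c.
Proof.
  intros Hc Hsc Ht. assert (Hs : left_half s) by (now apply (Cdisc_left_half c)).
  unfold unit_disc in Ht.
  apply Ceq_minus, Cmod_eq_0. apply Rle_antisym; [|apply Cmod_ge_0].
  apply le_epsilon. intros e He. rewrite Rplus_0_l.
  set (q := (Cmod (s - c) + - Re c) / 2). assert (Pq := Cmod_ge_0 (s - c)).
  assert (Hq : Cmod (s - c) < q < - Re c) by (unfold q; lra).
  set (K := 8 * q / (q - Cmod (s - c))).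
  assert (PK : 0 < K) by (apply Rdiv_lt_0_compat; lra).
  assert (NC : forall t : C, unit_disc t -> Cmod (phi t s - phi t c) ^ 2 <= K * (1 - Cmod (phi t c))).
  { intros z Hz. apply (near_constant (fun s => phi z s) c s (- Re c) q); [| |exact Hq].
    - intros w Hw. apply phi_s; [easy|]. now apply (Cdisc_left_half c).
    - intros w Hw. left. apply phi_lt_1; [easy|]. now apply (Cdisc_left_half c). }
  destruct (phi_inner c Hc) as (_ & _ & Hb).
  (* The near-constancy estimate controls the square of the difference, hence a defect of at most
     e^2 / K on the circle. *)
  destruct (Hb (e * e / K)) as (rho0 & Hrho0 & B); [apply Rdiv_lt_0_compat; nra|].
  set (rho := (Rmax rho0 (Cmod t) + 1) / 2).
  assert (Hrho : rho0 < rho < 1 /\ Cmod t < rho).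
  { unfold rho. generalize (Rmax_l rho0 (Cmod t)) (Rmax_r rho0 (Cmod t)) (Rmax_lub_lt rho0 (Cmod t) 1 Hrho0 Ht). lra. }
  apply (max_principle_disc (fun t => phi t s - phi t c)%C t rho); [|lra|].
  - intros z Hz. apply cdiff_minus; now apply phi_t.
  - intros z Ez. assert (Dz : unit_disc z) by (unfold unit_disc; lra).
    specialize (B z ltac:(lra)). specialize (NC z Dz). cbv beta in B.
    assert (K * (1 - Cmod (phi z c)) <= e * e).
    { apply Rle_trans with (K * (e * e / K)); [apply Rmult_le_compat_l; lra|right; field; lra]. }
    assert (P := Cmod_ge_0 (phi z s - phi z c)). nra.
Qed.

Lemma phi_const (s s' t : C) : left_half s -> left_half s' -> unit_disc t -> phi t s = phi t s'.
Proof.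
  intros Hs Hs' Ht. unfold left_half in Hs, Hs'.
  (* The discs centred at -L that touch the imaginary axis exhaust the left half-plane, so one far
     centre serves both s and s'. *)
  assert (Far : forall s, Re s < 0 -> exists L0, forall L, L0 < L -> Cmod (s - RtoC (- L)) < L).
  { intros z Hz. set (q := Cmod z ^ 2 / (- 2 * Re z)).
    assert (Pq : 0 <= q) by (apply Rdiv_le_0_compat; [apply pow2_ge_0|lra]).
    exists q. intros L HL.
    assert (E : Cmod (z - RtoC (- L)) ^ 2 = Cmod z ^ 2 + 2 * L * Re z + L ^ 2).
    { rewrite !Cmod2_alt. destruct z as [x y]. simpl. ring. }
    assert (Eq : Cmod z ^ 2 = q * (- 2 * Re z)) by (unfold q; field; lra).
    assert (P := Cmod_ge_0 (z - RtoC (- L))). nra. }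
  destruct (Far s Hs) as [L1 H1]. destruct (Far s' Hs') as [L2 H2].
  set (L := Rmax (Rmax L1 L2) 0 + 1).
  assert (HL : L1 < L /\ L2 < L /\ 0 < L).
  { unfold L. generalize (Rmax_l (Rmax L1 L2) 0) (Rmax_r (Rmax L1 L2) 0) (Rmax_l L1 L2) (Rmax_r L1 L2). lra. }
  assert (RL : Re (RtoC (- L)) = - L) by reflexivity.
  rewrite (phi_const_near s (RtoC (- L)) t), (phi_const_near s' (RtoC (- L)) t); try easy;
    rewrite ?RL; unfold left_half; rewrite ?RL; rewrite ?Ropp_involutive; try lra.
  - apply H2. lra.
  - apply H1. lra.
Qed.

Lemma first_component : exists h : C -> C, inner h /\ (forall t : C, unit_disc t -> Cmod (h t) < 1) /\
  (forall t s : C, unit_disc t -> left_half s -> fst (F (cover r t s)) = (cexp (RtoC (INR l * r') * s) * h t)%C) /\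
  (forall t : C, unit_disc t -> h (t * cis (2 * PI * r))%C = (cis (2 * PI * (INR l * r')) * h t)%C).
Proof.
  assert (L1 : left_half (RtoC (-1))) by (unfold left_half; simpl; lra).
  exists (fun t => phi t (RtoC (-1))). split; [now apply phi_inner|]. split; [intros; now apply phi_lt_1|].
  assert (Cancel : forall s, (cexp (RtoC (INR l * r') * s) * cexp (- RtoC (INR l * r') * s))%C = 1).
  { intros s. rewrite <- cexp_plus. replace (RtoC (INR l * r') * s + - RtoC (INR l * r') * s)%C with (RtoC 0) by ring.
    apply cexp_0. }
  assert (Main : forall t s : C, unit_disc t -> left_half s -> f t s = (cexp (RtoC (INR l * r') * s) * phi t (RtoC (-1)))%C).
  { intros t s Ht Hs. rewrite (phi_const (RtoC (-1)) s t) by easy. unfold phi.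
    rewrite Cmult_comm, <- Cmult_assoc, (Cmult_comm (cexp (- _ * _))), Cancel. ring. }
  split; [exact Main|]. intros t Ht.
  assert (Ht' : unit_disc (t * cis (2 * PI * r))%C).
  { unfold unit_disc in *. rewrite Cmod_mult, Cmod_cis. lra. }
  (* One turn of w around 0: (t, -1 + 2 PI i) and (t e^{2 PI i r}, -1) cover the same point of the
     domain. *)
  set (s := (-1, 2 * PI) : C).
  assert (Hs : left_half s) by (unfold left_half; simpl; lra).
  assert (E : f t s = f (t * cis (2 * PI * r))%C (RtoC (-1))).
  { unfold f. f_equal. f_equal. unfold cover, s. f_equal.
    - rewrite !cexp_scal. simpl. rewrite Rmult_0_r, cis_0, (Rmult_comm r (2 * PI)). ring.
    - unfold cexp. simpl. rewrite cis_0, cis_2PI. ring. }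
  rewrite (Main t s Ht Hs), (Main _ _ Ht' L1) in E.
  assert (X : cexp (RtoC (INR l * r') * s)%C = (cexp (RtoC (INR l * r') * RtoC (-1)) * cis (2 * PI * (INR l * r')))%C).
  { rewrite !cexp_scal. simpl. rewrite Rmult_0_r, cis_0, (Rmult_comm (INR l * r') (2 * PI)). ring. }
  rewrite X, <- Cmult_assoc in E.
  assert (N := cexp_neq_0 (RtoC (INR l * r') * RtoC (-1))%C).
  rewrite <- (Cmult_1_l (phi (t * _)%C _)), <- (Cinv_l _ N), <- Cmult_assoc, <- E, Cmult_assoc, Cinv_l, Cmult_1_l by exact N.
  reflexivity.
Qed.
End Step3.
End Forward.

(** * Rotation symmetry of inner functions *)

Lemma cis_2PI_Z (m : Z) : cis (2 * PI * IZR m) = 1.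
Proof.
  assert (S : sin (IZR m * PI) = 0) by (apply sin_eq_0_1; now exists m).
  replace (2 * PI * IZR m) with (2 * (IZR m * PI)) by ring.
  unfold cis. rewrite cos_2a_sin, sin_2a, S. unfold RtoC. f_equal; ring.
Qed.

Lemma cis_2PI_eq_1 (x : R) : cis (2 * PI * x) = 1 -> exists m : Z, x = IZR m.
Proof.
  intros E. unfold cis, RtoC in E. apply (f_equal fst) in E. simpl in E.
  replace (2 * PI * x) with (2 * (PI * x)) in E by ring. rewrite cos_2a_sin in E.
  assert (S : sin (PI * x) = 0) by nra.
  destruct (sin_eq_0_0 _ S) as [m Hm]. exists m. assert (P := PI_RGT_0).
  apply Rmult_eq_reg_l with PI; lra.
Qed.

Lemma cis_pow (x : R) (n : nat) : (cis x ^ n)%C = cis (INR n * x).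
Proof.
  induction n.
  - simpl. now rewrite Rmult_0_l, cis_0.
  - rewrite Cpow_S, IHn, <- cis_plus, S_INR. f_equal. ring.
Qed.

Lemma cis_neg (x : R) : (/ cis x)%C = cis (- x).
Proof.
  rewrite <- (Cmult_1_r (/ cis x)), <- cis_0. replace 0 with (x + - x) by ring.
  rewrite cis_plus, Cmult_assoc, Cinv_l by apply cis_neq_0. ring.
Qed.

Lemma cexp_pow (s : C) (n : nat) : (cexp s ^ n)%C = cexp (RtoC (INR n) * s).
Proof.
  induction n.
  - simpl. now rewrite Cmult_0_l, cexp_0.
  - rewrite Cpow_S, IHn, <- cexp_plus, S_INR, RtoC_plus. f_equal. ring.
Qed.

Lemma cexp_opp (s : C) : cexp (- s)%C = (/ cexp s)%C.
Proof.
  assert (N := cexp_neq_0 s). rewrite <- (Cmult_1_r (/ cexp s)), <- cexp_0.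
  replace (RtoC 0) with (s + - s)%C by ring. rewrite cexp_plus, Cmult_assoc, Cinv_l by exact N. ring.
Qed.

Lemma Cpowz_cexp (s : C) (m : Z) : Cpowz (cexp s) m = cexp (RtoC (IZR m) * s).
Proof.
  destruct m as [|n|n]; simpl.
  - rewrite Cmult_0_l. now rewrite cexp_0.
  - now rewrite cexp_pow, INR_IZR_INZ, positive_nat_Z.
  - rewrite cexp_pow, <- cexp_opp, INR_IZR_INZ, positive_nat_Z. f_equal.
    change (Zneg n) with (- Zpos n)%Z. rewrite opp_IZR, RtoC_opp. ring.
Qed.

(** Cancelling t^k in the relation and evaluating at 0, where h0 <> 0, gives e^{2 PI i k r} = e^{2
    PI i x}. So x - k r is an integer, and the remaining factor is invariant. *)
Lemma inner_rotation (h : C -> C) (r x : R) : inner h ->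
  (forall t : C, unit_disc t -> h (t * cis (2 * PI * r))%C = (cis (2 * PI * x) * h t)%C) ->
  exists (k : nat) (h0 : C -> C) (m : Z), inner h0 /\ h0 0 <> 0 /\
    (forall t : C, unit_disc t -> h t = (t ^ k * h0 t)%C) /\
    x - INR k * r = IZR m /\
    (forall t : C, unit_disc t -> h0 (t * cis (2 * PI * r))%C = h0 t).
Proof.
  intros Ih Rot. destruct (inner_order_at_0 h Ih) as (k & h0 & Ih0 & N0 & E).
  set (om := cis (2 * PI * r)) in *. set (c := cis (2 * PI * x)) in *.
  assert (Dom : forall t : C, unit_disc t -> unit_disc (t * om)%C).
  { intros t Ht. unfold unit_disc in *. unfold om. rewrite Cmod_mult, Cmod_cis. lra. }
  set (u := fun t => (om ^ k * h0 (t * om)%C - c * h0 t)%C).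
  assert (Du : cdiff_on unit_disc u).
  { intros t Ht. apply cdiff_minus; (apply cdiff_mult; [apply cdiff_const|]).
    - apply (cdiff_comp h0 (fun t => t * om)%C); [apply cdiff_mult; [apply cdiff_id|apply cdiff_const]|].
      apply Ih0. now apply Dom.
    - now apply Ih0. }
  assert (U0 : forall t : C, unit_disc t -> u t = 0).
  { destruct (disc_integral_domain (fun t => t ^ k)%C u) as [Z|Z]; [|easy| |exfalso|exact Z].
    - intros t _. apply cdiff_pow, cdiff_id.
    - intros t Ht. assert (R := Rot t Ht). rewrite (E _ (Dom t Ht)), (E t Ht), Cpow_mult_l in R.
      unfold u. replace (t ^ k * (om ^ k * h0 (t * om) - c * h0 t))%C with
        (t ^ k * om ^ k * h0 (t * om) - c * (t ^ k * h0 t))%C by ring. rewrite R. ring.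
    - specialize (Z (RtoC (1 / 2))). apply (Cpow_nz (RtoC (1 / 2)) k).
      + intros X. apply RtoC_inj in X. lra.
      + apply Z. unfold unit_disc. rewrite Cmod_RtoC_pos; lra. }
  assert (Ec : (om ^ k)%C = c).
  { assert (V := U0 0 unit_disc_0). unfold u in V. rewrite Cmult_0_l in V.
    apply Ceq_minus. rewrite <- (Cmult_1_r (om ^ k - c)), <- (Cinv_r _ N0), Cmult_assoc.
    replace ((om ^ k - c) * h0 0)%C with (om ^ k * h0 0 - c * h0 0)%C by ring. rewrite V. ring. }
  destruct (cis_2PI_eq_1 (x - INR k * r)) as [m Hm].
  { replace (2 * PI * (x - INR k * r)) with (2 * PI * x + - (INR k * (2 * PI * r))) by ring.
    rewrite cis_plus, <- cis_neg, <- cis_pow. fold om c. rewrite Ec. apply Cinv_r. apply cis_neq_0. }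
  exists k, h0, m. repeat split; try apply Ih0; auto.
  intros t Ht. specialize (U0 t Ht). unfold u in U0. rewrite Ec in U0.
  apply Ceq_minus. assert (Nc : c <> 0) by apply cis_neq_0.
  rewrite <- (Cmult_1_l (h0 _ - h0 t)), <- (Cinv_l _ Nc), <- Cmult_assoc.
  replace (c * (h0 (t * om) - h0 t))%C with (c * h0 (t * om) - c * h0 t)%C by ring. rewrite U0. ring.
Qed.

Lemma rotation_iterate (h0 : C -> C) (r : R) :
  (forall t : C, unit_disc t -> h0 (t * cis (2 * PI * r))%C = h0 t) ->
  forall (j : nat) (t : C), unit_disc t -> h0 (t * cis (2 * PI * (INR j * r)))%C = h0 t.
Proof.
  intros Inv j. induction j; intros t Ht.
  - simpl. rewrite Rmult_0_l, Rmult_0_r, cis_0, Cmult_1_r. reflexivity.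
  - rewrite S_INR. replace (2 * PI * ((INR j + 1) * r)) with (2 * PI * (INR j * r) + 2 * PI * r) by ring.
    rewrite cis_plus, Cmult_assoc, Inv; [now apply IHj|].
    unfold unit_disc in *. rewrite Cmod_mult, Cmod_cis. lra.
Qed.

Lemma blaschke_list_zero (l : list C) (t : C) : (forall a, In a l -> unit_disc a) -> unit_disc t ->
  blaschke_list l t = 0 -> In t l.
Proof.
  intros Hl Ht. induction l as [|a l IH]; simpl.
  - intros E. exfalso. now apply C1_nz.
  - intros E. destruct (Ceq_dec (blaschke_factor a t) 0) as [Z|N].
    + left. symmetry. apply blaschke_factor_eq_0; auto. apply Hl. now left.
    + right. apply IH; [intros; apply Hl; now right|].
      destruct (Ceq_dec (blaschke_list l t) 0) as [|N']; [easy|]. exfalso. now apply (Cmult_neq_0 _ _ N N').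
Qed.

Lemma blaschke_list_root (l : list C) (a : C) : In a l -> blaschke_list l a = 0.
Proof.
  induction l as [|b l IH]; [easy|]. intros [->|H]; simpl.
  - rewrite blaschke_factor_self. ring.
  - change (blaschke_factor b a * blaschke_list l a = 0)%C. rewrite IH by easy. ring.
Qed.

Lemma is_rational_div (a b : Z) : (0 < b)%Z -> is_rational (IZR a / IZR b).
Proof.
  intros Hb. exists (Qmake a (Z.to_pos b)). unfold Q2R. simpl. now rewrite Z2Pos.id.
Qed.

(* An irrational rotation moves a nonzero point to infinitely many others. *)
Lemma inner_irrational_rotation (h0 : C -> C) (r : R) : ~ is_rational r -> inner h0 -> h0 0 <> 0 ->
  (forall t : C, unit_disc t -> h0 (t * cis (2 * PI * r))%C = h0 t) ->
  exists zeta, Cmod zeta = 1 /\ forall t : C, unit_disc t -> h0 t = zeta.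
Proof.
  intros Nr Ih N0 Inv.
  destruct (inner_is_blaschke 1 h0) as (zeta & l & Hz & Hl & E); auto.
  { intros a b _ _ Eab. rewrite !Cpow_1_r in Eab. now rewrite Eab. }
  destruct l as [|a l0].
  { exists zeta. split; [easy|]. intros t Ht. rewrite E by easy. unfold blaschke_list. simpl. ring. }
  exfalso. set (l := a :: l0) in *.
  assert (Ha : unit_disc a) by (apply Hl; now left).
  assert (Za : h0 a = 0).
  { rewrite E, Cpow_1_r, blaschke_list_root by (easy || now left). ring. }
  assert (Na : a <> 0) by (intros ->; now apply N0).
  set (orb := fun j : nat => (a * cis (2 * PI * (INR j * r)))%C).
  assert (Horb : forall j, In (orb j) l).
  { intros j. assert (Do : unit_disc (orb j)).
    { unfold unit_disc in *. unfold orb. rewrite Cmod_mult, Cmod_cis. lra. }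
    assert (Zj : h0 (orb j) = 0) by (unfold orb; rewrite (rotation_iterate h0 r Inv); easy).
    rewrite E, Cpow_1_r in Zj by easy. apply blaschke_list_zero; auto.
    destruct (Ceq_dec (blaschke_list l (orb j)) 0) as [|N]; [easy|]. exfalso.
    assert (zeta <> 0) by (intros ->; rewrite Cmod_0 in Hz; lra).
    now apply (Cmult_neq_0 _ _ H N). }
  assert (Ninj : forall i j : nat, (i < j)%nat -> orb i <> orb j).
  { intros i j Hij Eij. unfold orb in Eij.
    assert (C1 : cis (2 * PI * (INR (j - i) * r)) = 1).
    { rewrite minus_INR by lia.
      replace (2 * PI * ((INR j - INR i) * r)) with (2 * PI * (INR j * r) + - (2 * PI * (INR i * r))) by ring.
      rewrite cis_plus, <- cis_neg.
      assert (Eq : cis (2 * PI * (INR i * r)) = cis (2 * PI * (INR j * r))).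
      { rewrite <- (Cmult_1_l (cis (2 * PI * (INR i * r)))), <- (Cinv_l _ Na), <- Cmult_assoc, Eij, Cmult_assoc, Cinv_l by exact Na. ring. }
      rewrite Eq. apply Cinv_r, cis_neq_0. }
    destruct (cis_2PI_eq_1 _ C1) as [m Hm]. apply Nr.
    assert (P : 0 < INR (j - i)) by (apply lt_0_INR; lia).
    replace r with (IZR m / IZR (Z.of_nat (j - i))).
    - apply is_rational_div. lia.
    - rewrite <- INR_IZR_INZ, <- Hm. field. lra. }
  assert (Inj : Injective orb).
  { intros i j Eij. destruct (Nat.lt_total i j) as [L|[L|L]]; [exfalso|easy|exfalso].
    - now apply (Ninj i j).
    - now apply (Ninj j i). }
  (* Pigeonhole: the first [S (length l)] points of the orbit are distinct and all belong to l. *)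
  assert (Len := NoDup_incl_length (Injective_map_NoDup Inj (seq_NoDup (S (length l)) 0))
    (l' := l) ltac:(intros x Hx; apply in_map_iff in Hx; destruct Hx as (j & <- & _); apply Horb)).
  rewrite length_map, length_seq in Len. lia.
Qed.

(** Since gcd(n, q) = 1, e^{2 PI i q / n} is a primitive n-th root of unity and its powers exhaust
    the n-th roots of unity. *)
Lemma root_of_unity_power (u : C) (n q : nat) : (0 < n)%nat -> Nat.gcd n q = 1%nat -> (u ^ n)%C = 1 ->
  exists j : nat, u = cis (2 * PI * (INR j * (INR q / INR n))).
Proof.
  intros Hn Hgcd Hu.
  assert (Pn : 0 < INR n) by (now apply lt_0_INR).
  assert (Mu : Cmod u = 1).
  { apply (f_equal Cmod) in Hu. rewrite Cmod_pow, Cmod_1 in Hu. assert (P := Cmod_ge_0 u).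
    destruct (Rtotal_order (Cmod u) 1) as [L|[L|L]]; [exfalso|easy|exfalso].
    - destruct n; [lia|]. simpl in Hu. assert (Cmod u ^ n <= 1) by (apply pow_le_1; lra).
      assert (0 <= Cmod u ^ n) by now apply pow_le. nra.
    - assert (1 < Cmod u ^ n) by (apply Rlt_pow_R1; [easy|lia]). lra. }
  destruct (polar u) as (th & _ & E). rewrite Mu, Cmult_1_l in E.
  assert (C1 : cis (2 * PI * (INR n * th / (2 * PI))) = 1).
  { replace (2 * PI * (INR n * th / (2 * PI))) with (INR n * th) by (field; apply PI_neq0).
    rewrite <- cis_pow, <- E. exact Hu. }
  destruct (cis_2PI_eq_1 _ C1) as [m Hm].
  assert (exists x y : Z, (x * Z.of_nat n + y * Z.of_nat q = 1)%Z) as (x & y & Bez).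
  { destruct (Nat.gcd_bezout_pos n q Hn) as (x & y & B). rewrite Hgcd in B.
    exists (Z.of_nat x), (- Z.of_nat y)%Z. lia. }
  set (N := Z.of_nat n) in *. assert (HN : (0 < N)%Z) by (unfold N; lia).
  (* u = e^{2 PI i m / n}, so q j = m modulo n is wanted: multiply the Bezout identity by m. *)
  set (j := ((m * y) mod N)%Z). set (c := ((m * y) / N)%Z).
  assert (Hj : (0 <= j < N)%Z) by (apply Z.mod_pos_bound; lia).
  assert (Dj : (m * y = N * c + j)%Z) by (apply Z.div_mod; lia).
  assert (Em : (m = Z.of_nat q * j + N * (c * Z.of_nat q + m * x))%Z).
  { transitivity (m * (x * N + y * Z.of_nat q))%Z; [rewrite Bez; ring|].
    transitivity (m * x * N + (m * y) * Z.of_nat q)%Z; [ring|]. rewrite Dj. ring. }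
  exists (Z.to_nat j). rewrite E.
  replace th with (2 * PI * (INR (Z.to_nat j) * (INR q / INR n)) + 2 * PI * IZR (c * Z.of_nat q + m * x)).
  - rewrite cis_plus, cis_2PI_Z. ring.
  - assert (Eth : th = 2 * PI * IZR m / INR n) by (rewrite <- Hm; field; split; [apply PI_neq0|lra]).
    assert (Em' := f_equal IZR Em). rewrite !plus_IZR, !mult_IZR, plus_IZR, !mult_IZR in Em'.
    rewrite plus_IZR, !mult_IZR, (INR_IZR_INZ (Z.to_nat j)), Z2Nat.id, (INR_IZR_INZ q) by lia.
    rewrite Eth. rewrite INR_IZR_INZ in Pn |- *. fold N in Pn |- *.
    transitivity (2 * PI * (IZR (Z.of_nat q) * IZR j + IZR N * (IZR c * IZR (Z.of_nat q) + IZR m * IZR x)) / IZR N).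
    + field. lra.
    + rewrite <- Em'. reflexivity.
Qed.

Lemma rational_fraction (x : R) : 0 < x -> is_rational x ->
  exists n d : nat, (0 < n)%nat /\ (0 < d)%nat /\ Nat.gcd d n = 1%nat /\ x = INR n / INR d.
Proof.
  intros Hx [[a b] E]. unfold Q2R in E. simpl in E.
  assert (Pb : 0 < IZR (Zpos b)) by (apply IZR_lt; lia).
  assert (Ha : (0 < a)%Z).
  { apply lt_IZR. apply Rmult_lt_reg_r with (/ IZR (Zpos b)); [now apply Rinv_0_lt_compat|]. lra. }
  set (n := Z.to_nat a). set (d := Pos.to_nat b).
  assert (Hn : (0 < n)%nat) by (unfold n; lia). assert (Hd : (0 < d)%nat) by (unfold d; lia).
  set (g := Nat.gcd d n). assert (Hg : g <> 0%nat) by (unfold g; intros Z; apply Nat.gcd_eq_0_l in Z; lia).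
  destruct (Nat.gcd_divide_l d n) as [d' Ed]. destruct (Nat.gcd_divide_r d n) as [n' En]. fold g in Ed, En.
  exists n', d'. repeat split.
  - destruct n'; lia.
  - destruct d'; lia.
  - assert (G := Nat.gcd_div_gcd d n g Hg eq_refl). rewrite Ed, En, !Nat.div_mul in G by easy. exact G.
  - rewrite E. replace (IZR a) with (INR n) by (unfold n; rewrite INR_IZR_INZ, Z2Nat.id; [easy|lia]).
    replace (IZR (Zpos b)) with (INR d) by (unfold d; rewrite INR_IZR_INZ, positive_nat_Z; easy).
    rewrite En, Ed, !mult_INR. field.
    split; apply not_0_INR; [intros ->; lia|exact Hg].
Qed.

(** * Normal forms *)

Lemma hartogs_eq_hdom (p q : R) : 0 < p -> 0 < q -> hartogs p q = hdom (q / p).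
Proof.
  intros Hp Hq. apply functional_extensionality. intros x. apply propositional_extensionality.
  now apply hartogs_hdom.
Qed.

Lemma holomorphic_on_C2_iff (D : C2 -> Prop) (F : C2 -> C2) :
  holomorphic_on D F <-> forall z w : C, D (z, w) -> c2diff (fun x => fst (F x)) z w /\ c2diff (fun x => snd (F x)) z w.
Proof.
  split.
  - intros H z w Hd. apply ex_filterdiff_C2_iff. exact (H _ Hd).
  - intros H [z w] Hd. apply ex_filterdiff_C2_iff. now apply H.
Qed.

(** Common to rational and irrational r: the arithmetic of r enters only through the invariance of
    h0 under the rotation by 2 PI r. *)
Lemma proper_holomorphic_form (r r' : R) (F : C2 -> C2) : 0 < r -> 0 < r' ->
  proper_holomorphic (hdom r) (hdom r') F ->
  exists (xi : C) (l k : nat) (m : Z) (h0 : C -> C),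
    Cmod xi = 1 /\ (0 < l)%nat /\ inner h0 /\ h0 0 <> 0 /\ INR l * r' - INR k * r = IZR m /\
    (forall t : C, unit_disc t -> h0 (t * cis (2 * PI * r))%C = h0 t) /\
    (forall t : C, unit_disc t -> Cmod (t ^ k * h0 t)%C < 1) /\
    forall t s : C, unit_disc t -> left_half s ->
      F (cover r t s) = ((cexp (RtoC (INR l * r') * s) * (t ^ k * h0 t))%C, (xi * cexp s ^ l)%C).
Proof.
  intros Hr Hr' (Hmap & Hhol & Hprop). assert (Hcd := proj1 (holomorphic_on_C2_iff (hdom r) F) Hhol).
  assert (Hf := fun z w H => proj1 (Hcd z w H)). assert (Hg := fun z w H => proj2 (Hcd z w H)).
  assert (Hesc := proper_escape r r' F Hr' Hprop).
  destruct (punctured_disc_proper (fun w => snd (F (RtoC 0, w)))) as (xi & l & Hxi & Hl & EG).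
  - exact (G_cdiff r F Hg).
  - exact (G_range r r' F Hmap).
  - exact (G_boundary r r' F Hr' Hmap Hf Hg Hesc).
  - destruct (first_component r r' F Hr' Hmap Hf Hg Hesc xi l Hxi Hl EG) as (h & Ih & H1 & Eh & Rot).
    destruct (inner_rotation h r (INR l * r') Ih Rot) as (k & h0 & m & Ih0 & N0 & Ek & Em & Inv).
    exists xi, l, k, m, h0. do 6 (split; [easy|]). split.
    { intros t Ht. rewrite <- Ek by easy. now apply H1. }
    intros t s Ht Hs.
    assert (A1 : @eq C (fst (F (cover r t s))) (cexp (RtoC (INR l * r') * s) * (t ^ k * h0 t))%C)
      by now rewrite (Eh t s Ht Hs), (Ek t Ht).
    assert (A2 : @eq C (snd (F (cover r t s))) (xi * cexp s ^ l)%C).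
    { assert (Gs := G_g r r' F Hr' Hmap Hf Hg Hesc t s Ht Hs). cbv beta in Gs.
      rewrite Gs. apply EG. rewrite Cmod_cexp. split; [apply exp_pos|]. rewrite <- exp_0. now apply exp_increasing. }
    rewrite (surjective_pairing (F _)). exact (f_equal2 pair A1 A2).
Qed.

Lemma monomial_cover (r r' : R) (k l : nat) (m : Z) (t s : C) : INR l * r' - INR k * r = IZR m ->
  ((t * cexp (RtoC r * s)) ^ k * Cpowz (cexp s) m)%C = (t ^ k * cexp (RtoC (INR l * r') * s))%C.
Proof.
  intros Em. rewrite Cpow_mult_l, cexp_pow, Cpowz_cexp, <- Cmult_assoc, <- cexp_plus.
  f_equal. f_equal. rewrite <- Em, RtoC_minus, (RtoC_mult (INR k)). ring.
Qed.

(** The exponentials cancel as n r = q, so z^n w^{-q} is a single-valued function on the domain that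
    depends on t alone. *)
Lemma cover_power (r : R) (n q : nat) (t s : C) : r = INR q / INR n -> (0 < n)%nat ->
  ((t * cexp (RtoC r * s)) ^ n * Cpowz (cexp s) (- Z.of_nat q))%C = (t ^ n)%C.
Proof.
  intros Er Hn. rewrite Cpow_mult_l, cexp_pow, Cpowz_cexp, <- Cmult_assoc, <- cexp_plus.
  replace (RtoC (INR n) * (RtoC r * s) + RtoC (IZR (- Z.of_nat q)) * s)%C with (RtoC 0).
  - rewrite cexp_0. ring.
  - rewrite opp_IZR, <- INR_IZR_INZ, RtoC_opp, Cmult_assoc, <- RtoC_mult, Er.
    replace (INR n * (INR q / INR n)) with (INR q) by (field; apply not_0_INR; lia). ring.
Qed.

(** The monomial shape. Such maps are proper for every r, rational or not, which also gives the
    existence statement and the proper map that is not an automorphism. *)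
Definition irrational_form (r r' : R) (F : C2 -> C2) : Prop :=
  exists (zeta xi : C) (k l : nat) (m : Z),
    unit_circle zeta /\ unit_circle xi /\ (0 < k)%nat /\ (0 < l)%nat /\
    INR l * r' - INR k * r = IZR m /\
    forall z w : C, hdom r (z, w) ->
      F (z, w) = ((zeta * Cpow z k * Cpowz w m)%C, (xi * Cpow w l)%C).

Definition rational_form (r r' : R) (F : C2 -> C2) : Prop :=
  exists (zeta xi : C) (k' l p' q' : nat) (m : Z) (B : C -> C),
    unit_circle zeta /\ unit_circle xi /\ (0 < l)%nat /\
    INR l * r' - INR k' * r = IZR m /\
    (0 < p')%nat /\ (0 < q')%nat /\ Nat.gcd p' q' = 1%nat /\
    r = INR q' / INR p' /\
    finite_blaschke B /\ B (RtoC 0) <> RtoC 0 /\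
    ((forall t : C, unit_disc t -> B t = RtoC 1) -> (0 < k')%nat) /\
    forall z w : C, hdom r (z, w) ->
      F (z, w) =
        ((zeta * Cpow z k' * Cpowz w m
            * B (Cpow z p' * Cpowz w (- Z.of_nat q')%Z)%C)%C,
         (xi * Cpow w l)%C).

Lemma proper_holomorphic_irrational (r r' : R) (F : C2 -> C2) : 0 < r -> 0 < r' -> ~ is_rational r ->
  proper_holomorphic (hdom r) (hdom r') F -> irrational_form r r' F.
Proof.
  intros Hr Hr' Nr HF.
  destruct (proper_holomorphic_form r r' F Hr Hr' HF) as (xi & l & k & m & h0 & Hxi & Hl & Ih & N0 & Em & Inv & H1 & E).
  destruct (inner_irrational_rotation h0 r Nr Ih N0 Inv) as (zeta & Hz & Ez).
  exists zeta, xi, k, l, m. do 2 (split; [easy|]). split.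
  (* With k = 0 the fibre factor t^k h0 would be a unimodular constant, against the strict bound. *)
  { destruct k; [|lia]. exfalso. specialize (H1 0 unit_disc_0). rewrite Ez in H1 by apply unit_disc_0.
    simpl in H1. rewrite Cmult_1_l in H1. lra. }
  do 2 (split; [easy|]). intros z w Hzw. destruct (cover_surj r z w Hzw) as (t & s & Ht & Hs & Ec).
  rewrite <- Ec, E, Ez by easy. injection Ec as <- <-.
  rewrite <- (Cmult_assoc zeta), (monomial_cover r r' k l m t s Em). f_equal. ring.
Qed.

Lemma proper_holomorphic_rational (r r' : R) (F : C2 -> C2) : 0 < r -> 0 < r' -> is_rational r ->
  proper_holomorphic (hdom r) (hdom r') F -> rational_form r r' F.
Proof.
  intros Hr Hr' Rr HF.
  destruct (proper_holomorphic_form r r' F Hr Hr' HF) as (xi & l & k & m & h0 & Hxi & Hl & Ih & N0 & Em & Inv & H1 & E).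
  destruct (rational_fraction r Hr Rr) as (q' & p' & Hq' & Hp' & Hgcd & Er).
  destruct (inner_is_blaschke p' h0) as (zeta & L & Hz & HL & EB); auto.
  (* Nonzero points with equal p'-th powers differ by a power of e^{2 PI i r}, under which h0 is
     invariant. *)
  { intros a b Ha Hb Eab. destruct (Ceq_dec b 0) as [->|Nb].
    - destruct (Ceq_dec a 0) as [->|Na]; [easy|]. exfalso. apply (Cpow_nz a p' Na). rewrite Eab.
      destruct p'; [lia|simpl; ring].
    - destruct (root_of_unity_power (a / b)%C p' q' Hp' Hgcd) as [j Hj].
      { unfold Cdiv. rewrite Cpow_mult_l, Cpow_inv, Eab by exact Nb. apply Cinv_r. now apply Cpow_nz. }
      replace a with (b * (a / b))%C by (field; exact Nb). rewrite Hj, <- Er. now apply rotation_iterate. }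
  exists zeta, xi, k, l, p', q', m, (blaschke_list L).
  do 8 (split; [easy|]). split; [now exists L|]. split.
  { intros B0. apply N0. rewrite (EB 0 unit_disc_0).
    replace (0 ^ p')%C with (RtoC 0) by (destruct p'; [lia|simpl; ring]). rewrite B0. ring. }
  split.
  (* With k = 0 and B = 1 the first component would have modulus |w|^{l r'} and the image would lie
     on the boundary of the target. *)
  { intros B1. destruct k; [|lia]. exfalso. specialize (H1 0 unit_disc_0).
    rewrite (EB 0 unit_disc_0), B1 in H1 by (apply unit_disc_pow; [easy|apply unit_disc_0]).
    simpl in H1. rewrite Cmult_1_l, Cmult_1_r in H1. lra. }
  intros z w Hzw. destruct (cover_surj r z w Hzw) as (t & s & Ht & Hs & Ec).
  rewrite <- Ec, E, EB by easy. injection Ec as <- <-.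
  rewrite (cover_power r p' q' t s Er Hp'), <- (Cmult_assoc zeta), (monomial_cover r r' k l m t s Em).
  f_equal. ring.
Qed.

(** * Sufficiency of the normal forms *)

Lemma inner_mult (h k : C -> C) : inner h -> inner k -> inner (fun t => h t * k t)%C.
Proof.
  intros (H1 & H2 & H3) (K1 & K2 & K3). repeat split.
  - now apply cdiff_on_mult.
  - intros z Hz. rewrite Cmod_mult, <- (Rmult_1_r 1).
    apply Rmult_le_compat; try apply Cmod_ge_0; auto.
  - intros e He. set (e' := Rmin (e / 2) 1).
    assert (He' : 0 < e' <= 1 /\ 2 * e' <= e).
    { unfold e'. generalize (Rmin_l (e / 2) 1) (Rmin_r (e / 2) 1) (Rmin_glb_lt (e / 2) 1 0 ltac:(lra) ltac:(lra)). lra. }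
    destruct (H3 e') as (r1 & Hr1 & A1); [lra|]. destruct (K3 e') as (r2 & Hr2 & A2); [lra|].
    exists (Rmax r1 r2). split; [now apply Rmax_lub_lt|]. intros z Hz.
    assert (M1 := Rmax_l r1 r2). assert (M2 := Rmax_r r1 r2).
    specialize (A1 z ltac:(lra)). specialize (A2 z ltac:(lra)). rewrite Cmod_mult. nra.
Qed.

Lemma inner_const (c : C) : Cmod c = 1 -> inner (fun _ => c).
Proof.
  intros Hc. repeat split.
  - apply cdiff_on_const.
  - intros; lra.
  - intros e He. exists 0. split; [lra|]. intros z _. lra.
Qed.

Lemma inner_pow (k : nat) : inner (fun t => t ^ k)%C.
Proof.
  induction k; simpl.
  - apply inner_const, Cmod_1.
  - apply (inner_mult (fun t => t)); [apply inner_id|exact IHk].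
Qed.

Lemma inner_blaschke_list (l : list C) (n : nat) : (0 < n)%nat -> (forall a, In a l -> unit_disc a) ->
  inner (fun t => blaschke_list l (t ^ n)%C).
Proof.
  intros Hn. induction l as [|a l IH]; intros Hl.
  - exact (inner_const 1 Cmod_1).
  - apply (inner_mult (fun t => blaschke_factor a (t ^ n)%C)).
    + apply inner_blaschke_pow; [apply Hl; now left|easy].
    + apply IH. intros b Hb. apply Hl. now right.
Qed.

Lemma cdiff_Cpowz (w : C) (m : Z) : w <> 0 -> cdiff (fun w => Cpowz w m) w.
Proof.
  intros N. destruct m as [|n|n]; simpl.
  - apply cdiff_const.
  - apply cdiff_pow, cdiff_id.
  - apply cdiff_inv; [apply cdiff_pow, cdiff_id|now apply Cpow_nz].
Qed.

Lemma c2diff_Cpow_fst (k : nat) (z w : C) : c2diff (fun x => fst x ^ k)%C z w.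
Proof. apply (c2diff_comp (fun z => z ^ k)%C); [apply c2diff_fst|apply cdiff_pow, cdiff_id]. Qed.

Lemma c2diff_Cpowz_snd (m : Z) (z w : C) : w <> 0 -> c2diff (fun x => Cpowz (snd x) m) z w.
Proof. intros N. apply (c2diff_comp (fun w => Cpowz w m)); [apply c2diff_snd|now apply cdiff_Cpowz]. Qed.

Lemma c2diff_Cpow_snd (c : C) (l : nat) (z w : C) : c2diff (fun x => c * snd x ^ l)%C z w.
Proof.
  apply c2diff_mult; [apply c2diff_const|].
  apply (c2diff_comp (fun w => w ^ l)%C); [apply c2diff_snd|apply cdiff_pow, cdiff_id].
Qed.

Lemma hdom_snd_neq_0 (r : R) (z w : C) : hdom r (z, w) -> w <> 0.
Proof. intros [[H _] _]. now apply Cmod_gt_0. Qed.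

Lemma c2diff_on_hdom_ext (r : R) (u v : C2 -> C) (z w : C) : hdom r (z, w) ->
  (forall x, hdom r x -> u x = v x) -> c2diff u z w -> c2diff v z w.
Proof.
  intros Hzw E. apply c2diff_locally_ext. generalize (open_hdom r (z, w) Hzw). apply filter_imp. exact E.
Qed.

Lemma continuous_C2_pair (F : C2 -> C2) (z w : C) :
  c2diff (fun x => fst (F x)) z w -> c2diff (fun x => snd (F x)) z w -> continuous F ((z, w) : C2).
Proof.
  intros H1 H2. apply c2diff_continuous in H1. apply c2diff_continuous in H2.
  apply filterlim_locally. intros e.
  apply filterlim_locally with (eps := e) in H1. apply filterlim_locally with (eps := e) in H2.
  generalize (filter_and _ _ H1 H2). apply filter_imp. intros y [A B]. now split.
Qed.

Lemma hdom_cover (r : R) (x : C2) : hdom r x ->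
  exists t s : C, unit_disc t /\ left_half s /\ x = cover r t s.
Proof.
  destruct x as [z w]. intros Hx. destruct (cover_surj r z w Hx) as (t & s & Ht & Hs & Ec).
  exists t, s. now rewrite Ec.
Qed.

(** Properness sees only the moduli of the components in covering coordinates. With the given ones,
    source and target are left in the same ways: Re s -> 0, Re s -> -oo or |t| -> 1. *)
Lemma proper_holomorphic_of_inner (r r' : R) (F : C2 -> C2) (l : nat) (h : C -> C) :
  0 < r -> 0 < r' -> (0 < l)%nat -> inner h -> (forall t : C, unit_disc t -> Cmod (h t) < 1) ->
  (forall z w : C, hdom r (z, w) -> c2diff (fun x => fst (F x)) z w /\ c2diff (fun x => snd (F x)) z w) ->
  (forall t s : C, unit_disc t -> left_half s ->
     Cmod (fst (F (cover r t s))) = exp (INR l * r' * Re s) * Cmod (h t) /\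
     Cmod (snd (F (cover r t s))) = exp (INR l * Re s)) ->
  proper_holomorphic (hdom r) (hdom r') F.
Proof.
  intros Hr Hr' Hl (Ih1 & Ih2 & Ih3) H1 Hd HF.
  assert (Pl : 1 <= INR l) by (rewrite <- INR_1; apply le_INR; lia).
  split; [|split].
  - intros x Hx. destruct (hdom_cover r x Hx) as (t & s & Ht & Hs & ->).
    destruct (HF t s Ht Hs) as [E1 E2]. unfold hdom. rewrite E1, E2, Rpower_exp. split.
    + split; [apply exp_pos|]. rewrite <- exp_0. apply exp_increasing. unfold left_half in Hs. nra.
    + replace (r' * (INR l * Re s)) with (INR l * r' * Re s) by ring.
      assert (P := exp_pos (INR l * r' * Re s)). specialize (H1 t Ht). nra.
  - apply holomorphic_on_C2_iff. exact Hd.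
  - apply escape_proper; [easy| |].
    + intros [z w] Hx. apply continuous_C2_pair; now apply Hd.
    + intros e He. destruct (Ih3 e He) as (rho & Hrho & Hb).
      assert (Pe : 0 < e / INR l) by (apply Rdiv_lt_0_compat; lra).
      (* e^{l Re s} >= e gives e^{Re s} >= e as l >= 1; e^{l Re s} <= 1 - e gives e^{Re s} <= 1 - e
         / l by Bernoulli; |h t| <= 1 - e gives |t| <= rho. *)
      set (d := Rmin (Rmin e (e / INR l)) (1 - rho)).
      assert (Hd' : 0 < d /\ d <= e /\ d <= e / INR l /\ d <= 1 - rho).
      { unfold d. generalize (Rmin_l (Rmin e (e / INR l)) (1 - rho)) (Rmin_r (Rmin e (e / INR l)) (1 - rho)) (Rmin_l e (e / INR l)) (Rmin_r e (e / INR l)).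
        assert (0 < Rmin (Rmin e (e / INR l)) (1 - rho)) by (repeat apply Rmin_glb_lt; lra). lra. }
      exists d. split; [easy|]. intros x Hx. destruct (hdom_cover r x Hx) as (t & s & Ht & Hs & ->).
      destruct (HF t s Ht Hs) as [E1 E2]. unfold hclosed. rewrite E1, E2, Rpower_exp.
      replace (r' * (INR l * Re s)) with (INR l * r' * Re s) by ring.
      intros ((K1 & K2) & K3). unfold cover; simpl fst; simpl snd. rewrite Cmod_mult, !Cmod_cexp, Rpower_exp, re_scal_l.
      unfold left_half in Hs. unfold unit_disc in Ht.
      assert (PX : 0 < exp (Re s) <= 1).
      { split; [apply exp_pos|]. rewrite <- exp_0. apply exp_le_exp. lra. }
      assert (EP : exp (INR l * Re s) = exp (Re s) ^ l) by (rewrite pow_Rpower, Rpower_exp; [easy|apply exp_pos]).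
      split; [split|].
      * apply Rle_trans with e; [lra|]. apply Rle_trans with (1 := K1). apply exp_le_exp. nra.
      * rewrite EP in K2. assert (A := one_minus_pow_le (exp (Re s)) l ltac:(lra)).
        assert (e / INR l <= 1 - exp (Re s)); [|lra]. apply Rle_div_l; lra.
      * apply Rmult_le_compat_r; [left; apply exp_pos|].
        apply Rnot_lt_le. intros N. specialize (Hb t ltac:(lra)).
        assert (P := exp_pos (INR l * r' * Re s)). nra.
Qed.

Lemma irrational_form_proper (r r' : R) (F : C2 -> C2) : 0 < r -> 0 < r' ->
  irrational_form r r' F -> proper_holomorphic (hdom r) (hdom r') F.
Proof.
  intros Hr Hr' (zeta & xi & k & l & m & Hz & Hxi & Hk & Hl & Em & E). unfold unit_circle in Hz, Hxi.
  apply (proper_holomorphic_of_inner r r' F l (fun t => zeta * t ^ k)%C Hr Hr' Hl).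
  - apply inner_mult; [now apply inner_const|apply inner_pow].
  - intros t Ht. rewrite Cmod_mult, Hz, Rmult_1_l. now apply unit_disc_pow.
  - intros z w Hzw. assert (Nw := hdom_snd_neq_0 r z w Hzw). split.
    + apply (c2diff_on_hdom_ext r (fun x => zeta * fst x ^ k * Cpowz (snd x) m)%C); [easy| |].
      * intros [a b] Hab. now rewrite E.
      * apply c2diff_mult; [|now apply c2diff_Cpowz_snd].
        apply c2diff_mult; [apply c2diff_const|apply c2diff_Cpow_fst].
    + apply (c2diff_on_hdom_ext r (fun x => xi * snd x ^ l)%C); [easy| |apply c2diff_Cpow_snd].
      intros [a b] Hab. now rewrite E.
  - intros t s Ht Hs. assert (X := cover_hdom r t s Ht Hs). unfold cover in X |- *.
    rewrite E by exact X. simpl fst; simpl snd. rewrite <- Cmult_assoc, (monomial_cover r r' k l m t s Em).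
    rewrite !Cmod_mult, Hz, Hxi, !Cmod_pow, !Cmod_cexp, re_scal_l, (pow_Rpower (exp _)), Rpower_exp by apply exp_pos.
    split; ring.
Qed.

Lemma rational_form_proper (r r' : R) (F : C2 -> C2) : 0 < r -> 0 < r' ->
  rational_form r r' F -> proper_holomorphic (hdom r) (hdom r') F.
Proof.
  intros Hr Hr' (zeta & xi & k & l & p' & q' & m & B & Hz & Hxi & Hl & Em & Hp' & Hq' & _ & Er & (L & HL & EB) & B0 & BN & E).
  unfold unit_circle in Hz, Hxi. fold (blaschke_list L) in EB.
  assert (IB := inner_blaschke_list L p' Hp' HL).
  assert (I : inner (fun t => t ^ k * blaschke_list L (t ^ p'))%C) by (apply inner_mult; [apply inner_pow|exact IB]).
  assert (H1 : forall t : C, unit_disc t -> Cmod (t ^ k * blaschke_list L (t ^ p')%C)%C < 1).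
  { intros t Ht. rewrite Cmod_mult.
    assert (A1 : Cmod (t ^ k)%C <= 1) by now apply (inner_pow k).
    assert (A2 : Cmod (blaschke_list L (t ^ p')%C) <= 1) by now apply IB.
    assert (A3 := Cmod_ge_0 (t ^ k)%C). assert (A4 := Cmod_ge_0 (blaschke_list L (t ^ p')%C)).
    (* Strictness needs one factor of modulus below 1: t^k when the product is empty, where k > 0 is
       imposed, and the first Blaschke factor otherwise. *)
    destruct L as [|a L'].
    - assert (Hk : (0 < k)%nat) by (apply BN; intros u Hu; now rewrite EB).
      assert (Cmod (t ^ k)%C < 1) by now apply unit_disc_pow. nra.
    - assert (C1 : Cmod (blaschke_factor a (t ^ p')%C) < 1).
      { apply blaschke_factor_disc; [apply HL; now left|now apply unit_disc_pow]. }
      assert (C2' : Cmod (blaschke_list L' (t ^ p')%C) <= 1).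
      { apply (inner_blaschke_list L' p' Hp'); [intros b Hb; apply HL; now right|exact Ht]. }
      change (blaschke_list (a :: L') (t ^ p')%C) with (blaschke_factor a (t ^ p') * blaschke_list L' (t ^ p'))%C in *.
      rewrite Cmod_mult in *. assert (C3 := Cmod_ge_0 (blaschke_factor a (t ^ p')%C)).
      assert (C4 := Cmod_ge_0 (blaschke_list L' (t ^ p')%C)). nra. }
  apply (proper_holomorphic_of_inner r r' F l (fun t => t ^ k * blaschke_list L (t ^ p'))%C Hr Hr' Hl I H1).
  - intros z w Hzw. assert (Nw := hdom_snd_neq_0 r z w Hzw). split.
    (* B is prescribed on the disc only; its argument stays there, so it may be replaced by the
       product itself. *)
    + apply (c2diff_on_hdom_ext r (fun x => zeta * fst x ^ k * Cpowz (snd x) m * blaschke_list L (fst x ^ p' * Cpowz (snd x) (- Z.of_nat q')))%C); [easy| |].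
      * intros [a b] Hab. rewrite E by exact Hab. simpl fst; simpl snd.
        destruct (cover_surj r a b Hab) as (t & s & Ht & Hs & Ec). unfold cover in Ec. injection Ec as <- <-.
        rewrite (cover_power r p' q' t s Er Hp'), EB; [reflexivity|now apply unit_disc_pow].
      * apply c2diff_mult; [apply c2diff_mult; [apply c2diff_mult; [apply c2diff_const|apply c2diff_Cpow_fst]|now apply c2diff_Cpowz_snd]|].
        apply (c2diff_comp (blaschke_list L)).
        { apply c2diff_mult; [apply c2diff_Cpow_fst|now apply c2diff_Cpowz_snd]. }
        simpl fst; simpl snd.
        destruct (cover_surj r z w Hzw) as (t & s & Ht & Hs & Ec). unfold cover in Ec. injection Ec as <- <-.
        rewrite (cover_power r p' q' t s Er Hp').
        assert (I1 := inner_blaschke_list L 1 (le_n 1) HL).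
        apply (cdiff_ext_loc (fun t => blaschke_list L (t ^ 1)%C)).
        { exists 1. split; [lra|]. intros u _. now rewrite Cpow_1_r. }
        apply I1. now apply unit_disc_pow.
    + apply (c2diff_on_hdom_ext r (fun x => xi * snd x ^ l)%C); [easy| |apply c2diff_Cpow_snd].
      intros [a b] Hab. now rewrite E.
  - intros t s Ht Hs. assert (X := cover_hdom r t s Ht Hs). unfold cover in X |- *.
    rewrite E by exact X. simpl fst; simpl snd.
    rewrite (cover_power r p' q' t s Er Hp'), EB by now apply unit_disc_pow.
    change (fold_right (fun a b => blaschke_factor a (t ^ p') * b)%C 1 L) with (blaschke_list L (t ^ p')%C).
    rewrite <- (Cmult_assoc zeta), (monomial_cover r r' k l m t s Em).
    rewrite !Cmod_mult, Hz, Hxi, !Cmod_pow, !Cmod_cexp, re_scal_l, (pow_Rpower (exp _)), Rpower_exp by apply exp_pos.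
    split; ring.
Qed.

(** * Automorphisms *)

Lemma blaschke_factor_inv' (a t : C) : unit_disc a -> unit_disc t ->
  blaschke_factor a (blaschke_factor (- a) t) = t.
Proof.
  intros Ha Ht. rewrite <- (blaschke_factor_inv (- a) t (unit_disc_opp a Ha) Ht) at 2.
  now replace (- - a)%C with a by ring.
Qed.

Lemma rotation_neq_1 (d : nat) : (2 <= d)%nat -> cis (2 * PI * (/ INR d)) <> 1.
Proof.
  intros Hd E. destruct (cis_2PI_eq_1 _ E) as [m Hm].
  assert (P : 2 <= INR d) by (apply (le_INR 2); lia).
  assert (B : 0 < / INR d < 1).
  { split; [apply Rinv_0_lt_compat; lra|]. rewrite <- Rinv_1. apply Rinv_lt_contravar; lra. }
  rewrite Hm in B. destruct B as [B1 B2]. apply (lt_IZR 0) in B1. apply (lt_IZR m 1) in B2. lia.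
Qed.

Lemma rotation_pow (d : nat) : (0 < d)%nat -> (cis (2 * PI * (/ INR d)) ^ d)%C = 1.
Proof.
  intros Hd. rewrite cis_pow. replace (INR d * (2 * PI * / INR d)) with (2 * PI) by (field; apply not_0_INR; lia).
  apply cis_2PI.
Qed.

Lemma inner_zero (h : C -> C) : inner h -> (forall t : C, unit_disc t -> Cmod (h t) < 1) ->
  exists a : C, unit_disc a /\ h a = 0.
Proof.
  intros Ih H1. apply NNPP. intros N.
  destruct (inner_nonvanishing h Ih) as (zeta & Hz & E).
  - intros z Hz Ez. apply N. now exists z.
  - specialize (H1 0 unit_disc_0). rewrite E in H1 by apply unit_disc_0. lra.
Qed.

(** Moving a zero a of h to 0 leaves an inner function whose only zero is 0 by injectivity, hence
    eta t^d. A constant is excluded, and for d >= 2 the rotation by a d-th root of unity breaks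
    injectivity. *)
Lemma inner_injective (h : C -> C) : inner h -> (forall t : C, unit_disc t -> Cmod (h t) < 1) ->
  (forall t u : C, unit_disc t -> unit_disc u -> h t = h u -> t = u) ->
  exists eta a : C, Cmod eta = 1 /\ unit_disc a /\ forall t : C, unit_disc t -> h t = (eta * blaschke_factor a t)%C.
Proof.
  intros Ih H1 Inj. destruct (inner_zero h Ih H1) as (a & Ha & Za).
  assert (Ha' := unit_disc_opp a Ha).
  assert (Ib := inner_blaschke_pow (- a)%C 1 Ha' (le_n 1)).
  set (k := fun t => h (blaschke_factor (- a) t)).
  assert (Ik : inner k).
  { repeat split.
    - intros t Ht. apply (cdiff_comp h); [now apply cdiff_blaschke_factor|]. apply Ih. now apply blaschke_factor_disc.
    - intros t Ht. left. apply H1. now apply blaschke_factor_disc.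
    - intros e He. destruct (proj2 (proj2 Ih) e He) as (r & Hr & B).
      destruct (proj2 (proj2 Ib) (1 - r)) as (r' & Hr' & B'); [lra|].
      exists r'. split; [easy|]. intros z Hz. specialize (B' z Hz). rewrite Cpow_1_r in B'.
      apply B. split; [lra|]. apply blaschke_factor_disc; [easy|]. unfold unit_disc; lra. }
  destruct (inner_order_at_0 k Ik) as (d & k1 & Ik1 & N1 & E1).
  assert (Z0 : forall z : C, unit_disc z -> k z = 0 -> z = 0).
  { intros z Hz Ez. unfold k in Ez. rewrite <- Za in Ez. apply Inj in Ez; [|now apply blaschke_factor_disc|easy].
    rewrite <- (blaschke_factor_inv' a z Ha Hz), Ez. apply blaschke_factor_self. }
  destruct (inner_nonvanishing k1 Ik1) as (eta & He & Ek1).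
  { intros z Hz Ez. assert (z = 0); [|subst z; now apply N1].
    apply Z0; [easy|]. rewrite (E1 z Hz), Ez. ring. }
  assert (Ek : forall t : C, unit_disc t -> k t = (t ^ d * eta)%C).
  { intros t Ht. now rewrite (E1 t Ht), (Ek1 t Ht). }
  assert (Hd : d = 1%nat).
  { assert (D2 : unit_disc (RtoC (1 / 2))) by (unfold unit_disc; rewrite Cmod_RtoC_pos; lra).
    assert (Injk : forall t u : C, unit_disc t -> unit_disc u -> k t = k u -> t = u).
    { intros t u Ht Hu E. apply Inj in E; try now apply blaschke_factor_disc.
      rewrite <- (blaschke_factor_inv' a t Ha Ht), E. now apply blaschke_factor_inv'. }
    destruct d as [|[|d]]; [exfalso|easy|exfalso].
    - assert (X : RtoC (1 / 2) = RtoC 0) by (apply Injk; [easy|apply unit_disc_0|now rewrite !Ek by (easy || apply unit_disc_0)]).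
      apply RtoC_inj in X. lra.
    - set (u := cis (2 * PI * (/ INR (S (S d))))).
      assert (Du : unit_disc (RtoC (1 / 2) * u)%C) by (unfold unit_disc, u in *; rewrite Cmod_mult, Cmod_cis; lra).
      assert (X : (RtoC (1 / 2) * u)%C = RtoC (1 / 2)).
      { apply Injk; auto. rewrite !Ek by easy. rewrite Cpow_mult_l. unfold u. rewrite rotation_pow by lia. ring. }
      apply (rotation_neq_1 (S (S d))); [lia|]. fold u.
      assert (N2 : RtoC (1 / 2) <> 0) by (intros Y; apply RtoC_inj in Y; lra).
      rewrite <- (Cmult_1_l u), <- (Cinv_l _ N2), <- Cmult_assoc, X. now rewrite !Cinv_l. }
  exists eta, a. split; [easy|]. split; [easy|]. intros t Ht.
  rewrite <- (blaschke_factor_inv a t Ha Ht) at 1.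
  change (k (blaschke_factor a t) = (eta * blaschke_factor a t)%C).
  rewrite Ek, Hd by now apply blaschke_factor_disc. rewrite Cpow_1_r. ring.
Qed.

Lemma Cmod_inv_1 (c : C) : Cmod c = 1 -> Cmod (/ c)%C = 1.
Proof. intros H. rewrite Cmod_inv; [rewrite H; field|]. intros ->. rewrite Cmod_0 in H. lra. Qed.

Lemma Cmod_1_neq_0 (c : C) : Cmod c = 1 -> c <> 0.
Proof. intros H ->. rewrite Cmod_0 in H. lra. Qed.

Lemma moebius_automorphism (phi : C_NormedModule -> C_NormedModule) (eta a : C) : Cmod eta = 1 -> unit_disc a ->
  (forall t : C, unit_disc t -> phi t = (eta * blaschke_factor a t)%C) -> automorphism unit_disc phi.
Proof.
  intros He Ha E. assert (He' := Cmod_inv_1 eta He). assert (Ne := Cmod_1_neq_0 eta He).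
  assert (Ha' := unit_disc_opp a Ha).
  assert (Rot : forall c t : C, Cmod c = 1 -> unit_disc t -> unit_disc (c * t)%C).
  { intros c t Hc Ht. unfold unit_disc in *. now rewrite Cmod_mult, Hc, Rmult_1_l. }
  split; [|split].
  - intros t Ht. rewrite E by easy. apply Rot; [easy|now apply blaschke_factor_disc].
  - intros t Ht. apply ex_filterdiff_C_iff. apply (cdiff_ext_loc (fun t => eta * blaschke_factor a t)%C).
    + unfold unit_disc in Ht. exists (1 - Cmod t). split; [lra|]. intros z Hz. symmetry. apply E.
      unfold unit_disc. generalize (Cmod_triangle_inv z t). lra.
    + apply cdiff_mult; [apply cdiff_const|now apply cdiff_blaschke_factor].
  - exists (fun t : C_NormedModule => blaschke_factor (- a) (/ eta * t)%C). split; [|split; [|split]].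
    + intros t Ht. apply blaschke_factor_disc; auto.
    + intros t Ht. apply ex_filterdiff_C_iff. apply (cdiff_comp (blaschke_factor (- a)) (fun t => / eta * t)%C).
      * apply cdiff_mult; [apply cdiff_const|apply cdiff_id].
      * apply cdiff_blaschke_factor; auto.
    + intros t Ht. rewrite E by easy. rewrite Cmult_assoc, Cinv_l, Cmult_1_l by exact Ne. now apply blaschke_factor_inv.
    + intros t Ht. rewrite E, blaschke_factor_inv' by (try apply blaschke_factor_disc; auto).
      rewrite Cmult_assoc, Cinv_r by exact Ne. apply Cmult_1_l.
Qed.

(** The preimage of K under F is the image of K under the continuous inverse G; a cover of it is
    pulled back through G to a cover of K. *)
Lemma automorphism_proper (r : R) (F : C2 -> C2) : automorphism (hdom r) F ->
  proper_holomorphic (hdom r) (hdom r) F /\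
  (forall x y, hdom r x -> hdom r y -> F x = F y -> x = y).
Proof.
  intros (HM & HH & G & GM & GH & GF & FG). split.
  - split; [exact HM|]. split; [exact HH|]. intros K HK CK cov Hopen Hcov.
    set (pull := fun (V : C2 -> Prop) (y : C2) => hdom r y /\ V (G y)).
    destruct (CK (fun W => exists V, cov V /\ W = pull V)) as (lW & HlW & HcW).
    + intros W (V & HV & ->) y [Hy HVy]. apply filter_and; [now apply open_hdom|].
      assert (D := proj1 (holomorphic_on_C2_iff (hdom r) G) GH). destruct y as [z w]. destruct (D z w Hy) as [D1 D2].
      apply (continuous_C2_pair G z w D1 D2). now apply Hopen.
    + intros y Hy. destruct (Hcov (G y)) as (V & HV & HVy).
      * split; [apply GM; auto|]. rewrite FG; auto.
      * exists (pull V). split; [now exists V|]. split; auto.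
    + assert (exists lV : list (C2 -> Prop), (forall V, In V lV -> cov V) /\
        forall W, In W lW -> exists V, In V lV /\ W = pull V) as (lV & H1 & H2).
      { clear HcW. induction lW as [|W lW IH].
        - exists nil. split; [intros V []|intros W []].
        - destruct IH as (lV & H1 & H2); [intros; apply HlW; now right|].
          destruct (HlW W (or_introl eq_refl)) as (V & HV & EV). exists (V :: lV). split.
          + intros V' [<-|HV']; auto.
          + intros W' [<-|HW']; [exists V; split; [now left|easy]|].
            destruct (H2 W' HW') as (V' & HV' & E'). exists V'. split; [now right|easy]. }
      exists lV. split; [easy|]. intros x [Hx HKx]. destruct (HcW _ HKx) as (W & HW & HWx).
      destruct (H2 W HW) as (V & HV & ->). exists V. split; [easy|]. destruct HWx as [_ HVx]. now rewrite GF in HVx.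
  - intros x y Hx Hy E. rewrite <- (GF x Hx), <- (GF y Hy). now rewrite E.
Qed.

Lemma cover_inj (r : R) (t u s : C) : cover r t s = cover r u s -> t = u.
Proof.
  intros E. unfold cover in E. assert (E1 := f_equal fst E). simpl in E1.
  assert (N := cexp_neq_0 (RtoC r * s)%C).
  rewrite <- (Cmult_1_r t), <- (Cmult_1_r u), <- (Cinv_r _ N), !Cmult_assoc. f_equal. exact E1.
Qed.

(** The normal form with r' = r applies. Injectivity forces l = 1 and makes h injective, hence a
    Moebius map with zero a. If a <> 0, then h 0 <> 0, so k = 0 and r = m is an integer. *)
Lemma automorphism_form (r : R) (F : C2 -> C2) : 0 < r -> automorphism (hdom r) F ->
  exists xi eta a : C, Cmod xi = 1 /\ Cmod eta = 1 /\ unit_disc a /\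
    (a = 0 \/ exists N : nat, (0 < N)%nat /\ r = INR N) /\
    forall t s : C, unit_disc t -> left_half s ->
      F (cover r t s) = ((cexp (RtoC r * s) * (eta * blaschke_factor a t))%C, (xi * cexp s)%C).
Proof.
  intros Hr HA. destruct (automorphism_proper r F HA) as [HP Inj].
  destruct (proper_holomorphic_form r r F Hr Hr HP) as (xi & l & k & m & h0 & Hxi & Hl & Ih & N0 & Em & _ & H1 & E).
  set (h := fun t => (t ^ k * h0 t)%C).
  assert (I : inner h) by (apply inner_mult; [apply inner_pow|easy]).
  assert (L1 : left_half (RtoC (-1))) by (unfold left_half; simpl; lra).
  assert (El : l = 1%nat).
  { apply NNPP. intros Nl. destruct (inner_zero h I H1) as (a & Ha & Za).
    assert (Pl : 0 < INR l) by now apply lt_0_INR.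
    (* Over a zero of h the first component vanishes, and the l-th power in the second does not
       separate -1 from -1 + 2 PI i / l. *)
    set (s := (-1, 2 * PI * / INR l) : C).
    assert (Ls : left_half s) by (unfold left_half; simpl; lra).
    assert (X : cover r a s = cover r a (RtoC (-1))).
    { apply Inj; try now apply cover_hdom. rewrite !E by easy. fold (h a). rewrite Za, !Cmult_0_r. f_equal.
      rewrite !cexp_pow, !cexp_scal. simpl. rewrite Rmult_0_r, cis_0.
      replace (INR l * (2 * PI * / INR l)) with (2 * PI) by (field; lra). now rewrite cis_2PI. }
    apply (f_equal snd) in X. unfold cover, cexp, s in X. simpl in X. rewrite cis_0 in X.
    apply (rotation_neq_1 l); [lia|].
    assert (NE : RtoC (exp (-1)) <> 0) by (intros Y; apply RtoC_inj in Y; generalize (exp_pos (-1)); lra).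
    rewrite <- (Cmult_1_l (cis _)), <- (Cinv_l _ NE), <- Cmult_assoc, X. ring. }
  subst l. rewrite INR_1, Rmult_1_l in *.
  destruct (inner_injective h I H1) as (eta & a & He & Ha & Eh).
  { intros t u Ht Hu Etu. apply (cover_inj r t u (RtoC (-1))). apply Inj; try now apply cover_hdom.
    rewrite !E by easy. fold (h t) (h u). now rewrite Etu. }
  exists xi, eta, a. do 3 (split; [easy|]). split.
  - destruct (Ceq_dec a 0) as [|Na]; [now left|right]. destruct k as [|k'].
    + simpl in Em. rewrite Rmult_0_l, Rminus_0_r in Em. exists (Z.to_nat m).
      assert (Pm : (0 < m)%Z) by (apply lt_IZR; lra).
      split; [lia|]. now rewrite INR_IZR_INZ, Z2Nat.id by lia.
    + exfalso. assert (Z := Eh 0 unit_disc_0). unfold h in Z. simpl in Z. rewrite !Cmult_0_l in Z.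
      apply (Cmult_neq_0 eta (blaschke_factor a 0)); [now apply Cmod_1_neq_0| |now symmetry].
      intros B. apply blaschke_factor_eq_0 in B; [now apply Na|easy|apply unit_disc_0].
  - intros t s Ht Hs. rewrite E by easy. fold (h t). rewrite Eh, Cpow_1_r by easy. reflexivity.
Qed.

Lemma Cpowz_opp_nat (w : C) (N : nat) : Cpowz w (- Z.of_nat N) = (/ w ^ N)%C.
Proof.
  destruct N; simpl.
  - field.
  - now rewrite SuccNat2Pos.id_succ.
Qed.

Definition linear_rotation (z0 w0 : C) (x : C2) : C2 := ((z0 * fst x)%C, (w0 * snd x)%C).
(** The action of phi on the fibre coordinate t = z w^{-N}, which is single-valued because the
    exponent is an integer. *)
Definition fibre_map (N : nat) (phi : C -> C) (x : C2) : C2 :=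
  ((snd x ^ N * phi (fst x * Cpowz (snd x) (- Z.of_nat N)))%C, snd x).

Lemma holomorphic_on_comp (D E : C2 -> Prop) (F G : C2 -> C2) :
  maps_to D E F -> holomorphic_on D F -> holomorphic_on E G -> holomorphic_on D (fun x => G (F x)).
Proof.
  intros HM HF HG x Hx. destruct (HF x Hx) as [lF HlF]. destruct (HG _ (HM x Hx)) as [lG HlG].
  exists (fun y => lG (lF y)). now apply filterdiff_comp'.
Qed.

Lemma holomorphic_on_ext (r : R) (F G : C2 -> C2) : (forall x, hdom r x -> F x = G x) ->
  holomorphic_on (hdom r) F -> holomorphic_on (hdom r) G.
Proof.
  intros E H x Hx. destruct (H x Hx) as [l Hl]. exists l. apply (filterdiff_ext_locally F); [|easy].
  generalize (open_hdom r x Hx). apply filter_imp. exact E.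
Qed.

Lemma linear_rotation_maps (r : R) (z0 w0 : C) : Cmod z0 = 1 -> Cmod w0 = 1 ->
  maps_to (hdom r) (hdom r) (linear_rotation z0 w0).
Proof.
  intros Hz Hw x Hx. unfold hdom, linear_rotation in *. simpl. now rewrite !Cmod_mult, Hz, Hw, !Rmult_1_l.
Qed.

Lemma linear_rotation_holomorphic (r : R) (z0 w0 : C) : holomorphic_on (hdom r) (linear_rotation z0 w0).
Proof.
  apply holomorphic_on_C2_iff. intros z w _. split.
  - apply c2diff_mult; [apply c2diff_const|apply c2diff_fst].
  - apply c2diff_mult; [apply c2diff_const|apply c2diff_snd].
Qed.

Lemma linear_rotation_inv (z0 w0 : C) (x : C2) : z0 <> 0 -> w0 <> 0 ->
  linear_rotation (/ z0) (/ w0) (linear_rotation z0 w0 x) = x.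
Proof.
  intros Nz Nw. destruct x as [z w]. unfold linear_rotation. simpl. f_equal; rewrite Cmult_assoc, Cinv_l by easy; apply Cmult_1_l.
Qed.

Lemma fibre_coordinate (N : nat) (x : C2) : hdom (INR N) x ->
  unit_disc (fst x * Cpowz (snd x) (- Z.of_nat N))%C /\ snd x <> RtoC 0.
Proof.
  intros [[H1 _] H2]. assert (Nw : snd x <> RtoC 0) by (now apply Cmod_gt_0). split; [|easy].
  unfold unit_disc. rewrite Cpowz_opp_nat, Cmod_mult, Cmod_inv, Cmod_pow, pow_Rpower by (easy || now apply Cpow_nz).
  apply Rlt_div_l; [apply Rpower_pos|]. lra.
Qed.

Lemma fibre_map_maps (N : nat) (phi : C -> C) : maps_to unit_disc unit_disc phi ->
  maps_to (hdom (INR N)) (hdom (INR N)) (fibre_map N phi).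
Proof.
  intros Hp x Hx. destruct (fibre_coordinate N x Hx) as [Ht Nw]. split; [apply Hx|]. simpl.
  rewrite Cmod_mult, Cmod_pow, pow_Rpower by apply Hx.
  assert (P := Rpower_pos (Cmod (snd x)) (INR N)).
  assert (L : Cmod (phi (fst x * Cpowz (snd x) (- Z.of_nat N))%C) < 1) by exact (Hp _ Ht).
  set (p := Rpower _ _) in *. set (q := Cmod (phi _)) in *. nra.
Qed.

Lemma fibre_map_holomorphic (N : nat) (phi : C -> C) : cdiff_on unit_disc phi ->
  holomorphic_on (hdom (INR N)) (fibre_map N phi).
Proof.
  intros Hp. apply holomorphic_on_C2_iff. intros z w Hx.
  destruct (fibre_coordinate N (z, w) Hx) as [Ht Nw]. split; [|apply c2diff_snd].
  apply c2diff_mult.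
  - apply (c2diff_comp (fun w => w ^ N)%C); [apply c2diff_snd|apply cdiff_pow, cdiff_id].
  - apply (c2diff_comp phi); [|now apply Hp].
    apply c2diff_mult; [apply c2diff_fst|now apply c2diff_Cpowz_snd].
Qed.

Lemma fibre_map_inv (N : nat) (phi psi : C -> C) (x : C2) : hdom (INR N) x ->
  (forall t : C, unit_disc t -> psi (phi t) = t) -> fibre_map N psi (fibre_map N phi x) = x.
Proof.
  intros Hx H. destruct (fibre_coordinate N x Hx) as [Ht Nw]. destruct x as [z w]. unfold fibre_map. simpl in *.
  rewrite Cpowz_opp_nat in *. assert (NN : (w ^ N)%C <> 0) by now apply Cpow_nz. f_equal.
  replace (w ^ N * phi (z * / w ^ N) * / w ^ N)%C with (phi (z * / w ^ N)%C) by (field; exact NN).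
  rewrite H by exact Ht. field. exact NN.
Qed.

Lemma automorphism_unit_disc_parts (phi : C_NormedModule -> C_NormedModule) : automorphism unit_disc phi ->
  maps_to unit_disc unit_disc phi /\ cdiff_on unit_disc phi /\ exists psi : C -> C,
    maps_to unit_disc unit_disc psi /\ cdiff_on unit_disc psi /\
    (forall t : C, unit_disc t -> psi (phi t) = t) /\ (forall t : C, unit_disc t -> phi (psi t) = t).
Proof.
  intros (HM & HH & psi & PM & PH & E1 & E2). split; [easy|]. split.
  - intros t Ht. apply ex_filterdiff_C_iff. now apply HH.
  - exists psi. repeat split; auto. intros t Ht. apply ex_filterdiff_C_iff. now apply PH.
Qed.

(** F is a rotation of w after [fibre_map N phi]; the inverse composes the two inverses in reverse
    order. *)
Lemma fibre_automorphism (N : nat) (xi : C) (phi : C_NormedModule -> C_NormedModule) (F : C2 -> C2) :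
  Cmod xi = 1 -> automorphism unit_disc phi ->
  (forall z w : C, hdom (INR N) (z, w) ->
     F (z, w) = ((Cpow w N * phi (z * Cpowz w (- Z.of_nat N)%Z)%C)%C, (xi * w)%C)) ->
  automorphism (hdom (INR N)) F.
Proof.
  intros Hxi HA E. destruct (automorphism_unit_disc_parts phi HA) as (M & D & psi & M' & D' & I1 & I2).
  assert (EF : forall x, hdom (INR N) x -> linear_rotation 1 xi (fibre_map N phi x) = F x).
  { intros [z w] Hx. rewrite E by exact Hx. unfold linear_rotation, fibre_map. simpl. now rewrite Cmult_1_l. }
  assert (M1 := linear_rotation_maps (INR N) 1 xi Cmod_1 Hxi).
  assert (M2 := fibre_map_maps N phi M). assert (M3 := fibre_map_maps N psi M').
  assert (Nxi := Cmod_1_neq_0 xi Hxi).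
  assert (M4 := linear_rotation_maps (INR N) (/ 1) (/ xi) (Cmod_inv_1 1 Cmod_1) (Cmod_inv_1 xi Hxi)).
  split; [|split].
  - intros x Hx. rewrite <- EF by easy. now apply M1, M2.
  - apply (holomorphic_on_ext _ _ _ EF).
    apply (holomorphic_on_comp _ (hdom (INR N))); [easy|now apply fibre_map_holomorphic|apply linear_rotation_holomorphic].
  - exists (fun x => fibre_map N psi (linear_rotation (/ 1) (/ xi) x)). split; [|split; [|split]].
    + intros x Hx. now apply M3, M4.
    + apply (holomorphic_on_comp _ (hdom (INR N))); [easy|apply linear_rotation_holomorphic|now apply fibre_map_holomorphic].
    + intros x Hx. rewrite <- EF, linear_rotation_inv by (easy || apply C1_nz). now apply fibre_map_inv.
    + intros x Hx. rewrite <- EF by (apply M3; now apply M4).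
      rewrite (fibre_map_inv N psi phi) by (easy || now apply M4).
      replace (RtoC 1) with (/ / RtoC 1)%C at 1 by (field; apply C1_nz).
      replace xi with (/ / xi)%C at 1 by (field; exact Nxi).
      apply linear_rotation_inv; [rewrite <- RtoC_inv by lra; intros X; apply RtoC_inj in X; lra|].
      apply Cmod_1_neq_0. now apply Cmod_inv_1.
Qed.

Lemma rotation_automorphism (r : R) (zeta xi : C) (F : C2 -> C2) : Cmod zeta = 1 -> Cmod xi = 1 ->
  (forall z w : C, hdom r (z, w) -> F (z, w) = ((zeta * z)%C, (xi * w)%C)) -> automorphism (hdom r) F.
Proof.
  intros Hz Hxi E.
  assert (EF : forall x, hdom r x -> linear_rotation zeta xi x = F x).
  { intros [z w] Hx. now rewrite E. }
  assert (M1 := linear_rotation_maps r zeta xi Hz Hxi).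
  assert (Nz := Cmod_1_neq_0 zeta Hz). assert (Nxi := Cmod_1_neq_0 xi Hxi).
  assert (M2 := linear_rotation_maps r _ _ (Cmod_inv_1 zeta Hz) (Cmod_inv_1 xi Hxi)).
  split; [|split].
  - intros x Hx. rewrite <- EF by easy. now apply M1.
  - apply (holomorphic_on_ext _ _ _ EF). apply linear_rotation_holomorphic.
  - exists (linear_rotation (/ zeta) (/ xi)). split; [easy|]. split; [apply linear_rotation_holomorphic|]. split.
    + intros x Hx. rewrite <- EF by easy. now apply linear_rotation_inv.
    + intros x Hx. rewrite <- EF by now apply M2.
      destruct x as [z w]. unfold linear_rotation. simpl. f_equal; rewrite Cmult_assoc, Cinv_r by easy; apply Cmult_1_l.
Qed.

Lemma automorphism_iff (r : R) (F : C2 -> C2) : 0 < r ->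
  automorphism (hdom r) F <->
   ((exists (N : nat) (xi : C) (phi : C_NormedModule -> C_NormedModule),
       (0 < N)%nat /\ r = INR N /\
       unit_circle xi /\ automorphism unit_disc phi /\
       forall z w : C, hdom r (z, w) ->
         F (z, w) =
           ((Cpow w N * phi (z * Cpowz w (- Z.of_nat N)%Z)%C)%C, (xi * w)%C))
    \/
    (~ is_positive_integer r /\
     exists (xi zeta : C) (phi : C_NormedModule -> C_NormedModule),
       unit_circle xi /\ unit_circle zeta /\ automorphism unit_disc phi /\
       phi (RtoC 0) = RtoC 0 /\
       (forall t : C, unit_disc t -> phi t = (zeta * t)%C) /\
       forall z w : C, hdom r (z, w) ->
         F (z, w) = ((zeta * z)%C, (xi * w)%C))).
Proof.
  intros Hr. split.
  - intros HA. destruct (automorphism_form r F Hr HA) as (xi & eta & a & Hxi & He & Ha & Hcase & E).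
    destruct (classic (is_positive_integer r)) as [(N & HN & Er)|NI].
    + left. exists N, xi, (fun t => eta * blaschke_factor a t)%C. do 3 (split; [easy|]). split.
      { now apply (moebius_automorphism _ eta a). }
      intros z w Hzw. destruct (cover_surj r z w Hzw) as (t & s & Ht & Hs & Ec).
      rewrite <- Ec, E by easy. injection Ec as <- <-.
      replace (t * cexp (RtoC r * s) * Cpowz (cexp s) (- Z.of_nat N))%C with t.
      * now rewrite Er, cexp_pow.
      * rewrite Cpowz_opp_nat, cexp_pow, <- Er. field. apply cexp_neq_0.
    + right. split; [easy|]. destruct Hcase as [-> |(N & HN & Er)]; [|exfalso; apply NI; now exists N].
      assert (B0 : forall t, blaschke_factor 0 t = t).
      { intros t. unfold blaschke_factor. replace (Cconj 0) with (RtoC 0) by (unfold Cconj, RtoC; simpl; f_equal; ring).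
        field. }
      exists xi, eta, (fun t => eta * t)%C. do 2 (split; [easy|]). split.
      { apply (moebius_automorphism _ eta 0); [easy|apply unit_disc_0|]. intros t _. now rewrite B0. }
      split; [apply Cmult_0_r|]. split; [easy|].
      intros z w Hzw. destruct (cover_surj r z w Hzw) as (t & s & Ht & Hs & Ec).
      rewrite <- Ec, E, B0 by easy. injection Ec as <- <-. f_equal. ring.
  - intros [(N & xi & phi & HN & -> & Hxi & HA & E)|(_ & xi & zeta & phi & Hxi & Hz & _ & _ & _ & E)].
    + now apply (fibre_automorphism N xi phi).
    + now apply (rotation_automorphism r zeta xi).
Qed.

Lemma proper_holomorphic_iff (r r' : R) (F : C2 -> C2) : 0 < r -> 0 < r' ->
  proper_holomorphic (hdom r) (hdom r') F <->
  (~ is_rational r /\ irrational_form r r' F) \/ (is_rational r /\ rational_form r r' F).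
Proof.
  intros Hr Hr'. split.
  - intros H. destruct (classic (is_rational r)) as [Q|N]; [right|left]; split; auto.
    + now apply proper_holomorphic_rational.
    + now apply proper_holomorphic_irrational.
  - intros [[_ H]|[_ H]]; [now apply irrational_form_proper|now apply rational_form_proper].
Qed.

Lemma proper_holomorphic_exists_iff (r r' : R) : 0 < r -> 0 < r' ->
  (exists F : C2 -> C2, proper_holomorphic (hdom r) (hdom r') F) <->
  (exists (k l : nat) (m : Z), (0 < k)%nat /\ (0 < l)%nat /\ INR l * r' - INR k * r = IZR m).
Proof.
  intros Hr Hr'. split.
  - intros [F HF]. apply proper_holomorphic_iff in HF; [|easy|easy].
    destruct HF as [(_ & zeta & xi & k & l & m & _ & _ & Hk & Hl & E & _)|
      (_ & zeta & xi & k & l & p' & q' & m & B & _ & _ & Hl & E & Hp & _ & _ & Er & _)].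
    + now exists k, l, m.
    (* k may be 0 here. Adding p' makes it positive and changes l r' - k r by the integer q', since
       p' r = q'. *)
    + exists (k + p')%nat, l, (m - Z.of_nat q')%Z. split; [lia|]. split; [easy|].
      rewrite plus_INR, minus_IZR, <- E, <- INR_IZR_INZ.
      assert (INR p' * r = INR q') by (rewrite Er; field; apply not_0_INR; lia). lra.
  - intros (k & l & m & Hk & Hl & E).
    exists (fun x => ((1 * fst x ^ k * Cpowz (snd x) m)%C, (1 * snd x ^ l)%C)).
    apply irrational_form_proper; [easy|easy|].
    exists 1, 1, k, l, m. do 2 (split; [apply Cmod_1|]). do 3 (split; [easy|]). reflexivity.
Qed.

Lemma proper_not_automorphism (r : R) : 0 < r -> exists F : C2 -> C2,
  proper_holomorphic (hdom r) (hdom r) F /\ ~ automorphism (hdom r) F.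
Proof.
  (* (z^2, w^2) identifies (0, w) with (0, -w). *)
  intros Hr. set (F := fun x : C2 => ((1 * fst x ^ 2 * Cpowz (snd x) 0)%C, (1 * snd x ^ 2)%C) : C2).
  exists F. split.
  - apply irrational_form_proper; [easy|easy|].
    exists 1, 1, 2%nat, 2%nat, 0%Z. do 2 (split; [apply Cmod_1|]). do 2 (split; [lia|]).
    split; [simpl; ring|]. reflexivity.
  - intros HA. destruct (automorphism_proper r F HA) as [_ Inj].
    assert (D : forall y : R, Rabs y = 1 / 2 -> hdom r (RtoC 0, RtoC y)).
    { intros y Hy. unfold hdom; simpl. rewrite Cmod_0, Cmod_R, Hy. split; [lra|apply Rpower_pos]. }
    assert (X : (RtoC 0, RtoC (1 / 2)) = (RtoC 0, RtoC (- (1 / 2)))).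
    { apply Inj; [apply D; apply Rabs_pos_eq; lra|apply D; rewrite Rabs_Ropp; apply Rabs_pos_eq; lra|].
      unfold F. simpl. rewrite RtoC_opp. f_equal. ring. }
    apply (f_equal snd) in X. simpl in X. apply RtoC_inj in X. lra.
Qed.

Theorem theorem1 (p q pt qt : R)
    (hp : (0 < p)%R) (hq : (0 < q)%R) (hpt : (0 < pt)%R) (hqt : (0 < qt)%R) :
  (* (a) *)
  ((exists F : C2 -> C2, proper_holomorphic (hartogs p q) (hartogs pt qt) F) <->
   (exists (k l : nat) (m : Z), (0 < k)%nat /\ (0 < l)%nat /\
      (INR l * qt / pt - INR k * q / p)%R = IZR m)) /\
  (* (b) *)
  (forall F : C2 -> C2,
     proper_holomorphic (hartogs p q) (hartogs pt qt) F <->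
     ((~ is_rational (q / p)%R /\
       exists (zeta xi : C) (k l : nat) (m : Z),
         unit_circle zeta /\ unit_circle xi /\ (0 < k)%nat /\ (0 < l)%nat /\
         (INR l * qt / pt - INR k * q / p)%R = IZR m /\
         forall z w : C, hartogs p q (z, w) ->
           F (z, w) = ((zeta * Cpow z k * Cpowz w m)%C, (xi * Cpow w l)%C))
      \/
      (is_rational (q / p)%R /\
       exists (zeta xi : C) (k' l p' q' : nat) (m : Z) (B : C -> C),
         unit_circle zeta /\ unit_circle xi /\ (0 < l)%nat /\
         (INR l * qt / pt - INR k' * q / p)%R = IZR m /\
         (0 < p')%nat /\ (0 < q')%nat /\ Nat.gcd p' q' = 1%nat /\
         (p / q)%R = (INR p' / INR q')%R /\
         finite_blaschke B /\ B (RtoC 0) <> RtoC 0 /\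
         ((forall t : C, unit_disc t -> B t = RtoC 1) -> (0 < k')%nat) /\
         forall z w : C, hartogs p q (z, w) ->
           F (z, w) =
             ((zeta * Cpow z k' * Cpowz w m
                 * B (Cpow z p' * Cpowz w (- Z.of_nat q')%Z)%C)%C,
              (xi * Cpow w l)%C)))) /\
  (* (b), in particular *)
  (exists F : C2 -> C2,
     proper_holomorphic (hartogs p q) (hartogs p q) F /\
     ~ automorphism (hartogs p q) F) /\
  (* (c) *)
  (forall F : C2 -> C2,
     automorphism (hartogs p q) F <->
     ((exists (N : nat) (xi : C) (phi : C_NormedModule -> C_NormedModule),
         (0 < N)%nat /\ (q / p)%R = INR N /\
         unit_circle xi /\ automorphism unit_disc phi /\
         forall z w : C, hartogs p q (z, w) ->
           F (z, w) =
             ((Cpow w N * phi (z * Cpowz w (- Z.of_nat N)%Z)%C)%C, (xi * w)%C))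
      \/
      (~ is_positive_integer (q / p)%R /\
       exists (xi zeta : C) (phi : C_NormedModule -> C_NormedModule),
         unit_circle xi /\ unit_circle zeta /\ automorphism unit_disc phi /\
         phi (RtoC 0) = RtoC 0 /\
         (forall t : C, unit_disc t -> phi t = (zeta * t)%C) /\
         forall z w : C, hartogs p q (z, w) ->
           F (z, w) = ((zeta * z)%C, (xi * w)%C)))).
Proof.
  assert (Hr : 0 < q / p) by now apply Rdiv_lt_0_compat.
  assert (Hr' : 0 < qt / pt) by now apply Rdiv_lt_0_compat.
  (* From here on only the ratios q / p and qt / pt occur; what remains is to match the arithmetic
     of the statement. *)
  rewrite !hartogs_eq_hdom by easy.
  assert (Ex : forall k l : nat, INR l * qt / pt - INR k * q / p = INR l * (qt / pt) - INR k * (q / p)).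
  { intros. unfold Rdiv. ring. }
  assert (Inv : forall a b : nat, (0 < a)%nat -> (0 < b)%nat -> p / q = INR a / INR b <-> q / p = INR b / INR a).
  { intros a b Ha Hb. apply lt_0_INR in Ha, Hb.
    split; intros E; [rewrite <- (Rinv_div p q), E|rewrite <- (Rinv_div q p), E]; field; lra. }
  split; [|split; [|split]].
  - rewrite proper_holomorphic_exists_iff by easy.
    split; intros (k & l & m & Hk & Hl & E); exists k, l, m; rewrite Ex in *; auto.
  - intros F. rewrite proper_holomorphic_iff by easy. split.
    + intros [[N (zeta & xi & k & l & m & H)]|[Q (zeta & xi & k & l & p' & q' & m & B & H)]]; [left|right]; (split; [easy|]).
      * exists zeta, xi, k, l, m. now rewrite Ex.
      * exists zeta, xi, k, l, p', q', m, B. rewrite Ex. destruct H as (H1 & H2 & H3 & H4 & H5 & H6 & H7 & H8 & H9).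
        do 7 (split; [easy|]). split; [now apply Inv|easy].
    + intros [[N (zeta & xi & k & l & m & H)]|[Q (zeta & xi & k & l & p' & q' & m & B & H)]]; [left|right]; (split; [easy|]).
      * exists zeta, xi, k, l, m. now rewrite Ex in H.
      * exists zeta, xi, k, l, p', q', m, B. rewrite Ex in H. destruct H as (H1 & H2 & H3 & H4 & H5 & H6 & H7 & H8 & H9).
        do 7 (split; [easy|]). split; [now apply Inv|easy].
  - now apply proper_not_automorphism.
  - intros F. now apply automorphism_iff.
Qed.
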